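(* Let $A=(a_1,\dots,a_n)\in\mathbb{Z}^n$ be of the type $\{j_1,\dots,j_{s_1}\}$ and let $\{i_1,\dots,i_s\}$ be a type with $i_1+\dots+i_s=n$. Then the line bundle $\mathcal{O}(A)$ exists on $\mathrm{sh}_{\{i_1,\dots,i_s\}}$ if and only if $\{j_1,\dots,j_{s_1}\}\le\{i_1,\dots,i_s\}$.
   Context: Everything is over $\mathbb{C}$. Fusion product: for positive integers $A=(a_1,\dots,a_n)$ choose pairwise distinct $z_1,\dots,z_n\in\mathbb{C}$ and let $\mathbb{C}^{a_i}(z_i)$ be the evaluation module of $\mathfrak{sl}_2\otimes\mathbb{C}[t]$, i.e. the irreducible $a_i$-dimensional $\mathfrak{sl}_2$-module on which $x_k:=x\otimes t^k$ acts as $z_i^k x$. The tensor product $V=\bigotimes_i\mathbb{C}^{a_i}(z_i)$ is cyclic, generated by the tensor product $v$ of lowest weight vectors. Filter $V$ by the subspaces $V^{(m)}$ spanned by $x^{(1)}_{k_1}\cdots x^{(r)}_{k_r}v$ with $x^{(l)}\in\mathfrak{sl}_2$ and $k_1+\dots+k_r\le m$. The fusion product $M^A$ is the associated graded $\mathfrak{sl}_2\otimes\mathbb{C}[t]$-module; it is (known to be) independent of the $z_i$ and is an $\mathfrak{sl}_2\otimes(\mathbb{C}[t]/t^n)$-module. Let $v_A\in M^A$ be the image of $v$. $G=\mathrm{SL}_2(\mathbb{C}[t]/t^n)$ acts on $\mathbb{P}(M^A)$; for $2\le a_1\le\dots\le a_n$ put $\mathrm{sh}_A=\overline{G\cdot[v_A]}\subset\mathbb{P}(M^A)$,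 $[v_A]=\mathbb{C}v_A$. Types: a type is an ordered tuple $\{i_1,\dots,i_s\}$ of positive integers with sum $n$. An $n$-tuple $A\in\mathbb{Z}^n$ is of this type if $a_1=\dots=a_{i_1}\ne a_{i_1+1}=\dots=a_{i_1+i_2}\ne\dots\ne a_{n-i_s+1}=\dots=a_n$ (only consecutive entries are compared). For types of the same size, $\{i_1,\dots,i_s\}\ge\{j_1,\dots,j_{s_1}\}$ if for any $A,B$ of these types respectively $a_l=a_{l+1}\Rightarrow b_l=b_{l+1}$ for all $l$; i.e. the second is obtained from the first by summing consecutive entries. Put $\mathrm{sh}_{\{i_1,\dots,i_s\}}=\mathrm{sh}_A$ and $[v_{\{i_1,\dots,i_s\}}]=[v_A]$ for $A=(2^{i_1}3^{i_2}\cdots(s+1)^{i_s})$ (exponents denote multiplicities of entries). Line bundles: let $e\in\mathfrak{sl}_2$ be the standard raising element and $e_j=e\otimes t^j$. For $j=0,\dots,n-1$ put $C_j=\overline{\{\exp(ze_j)\cdot[v_{\{i_1,\dots,i_s\}}]:z\in\mathbb{C}\}}\simeq\mathbb{P}^1$ in $\mathrm{sh}_{\{i_1,\dots,i_s\}}$. A line bundle $\mathcal{E}$ on $\mathrm{sh}_{\{i_1,\dots,i_s\}}$ is denoted $\mathcal{O}(a_1,\dots,a_n)=\mathcal{O}(A)$, $a_i\in\mathbb{Z}$, if $\mathcal{E}|_{C_j}\simeq\mathcal{O}_{\mathbb{P}^1}(a_1+\dots+a_{n-j})$ for all $j=0,\dots,n-1$ (a line bundle on $\mathrm{sh}_{\{i_1,\dots,i_s\}}$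 is determined by these numbers). *)

(* Defs.v *)
From mathcomp Require Export all_boot all_order all_algebra.
From mathcomp Require Export boolp classical_sets reals.
From mathcomp Require Export complex qpoly mpoly.

Set Implicit Arguments.
Unset Strict Implicit.
Unset Printing Implicit Defensive.

Import GRing.Theory.
Local Open Scope classical_set_scope.
Local Open Scope ring_scope.

(** * Linear algebra *)

Section LinearAlgebra.
Variables (K : fieldType) (V : vectType K).

Lemma ex_set_span (S : set V) : exists U : {vspace V},
  (forall u, S u -> u \in U) /\
  (forall W : {vspace V}, (forall u, S u -> u \in W) -> (U <= W)%VS).
Proof.
pose ok (U : {vspace V}) :=
  forall W : {vspace V}, (forall u, S u -> u \in W) -> (U <= W)%VS.
suff main k : forall U, ok U -> (\dim {:V} - \dim U <= k)%N ->
    exists U' : {vspace V}, (forall u, S u -> u \in U') /\ ok U'.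
  by apply: (main _ 0%VS) (leqnn _) => W _; exact: sub0v.
elim: k => [|k IHk] U okU dimU.
  exists U; split=> // u _; suff ->: U = {:V}%VS by exact: memvf.
  by apply/eqP; rewrite eqEdim subvf -subn_eq0 -leqn0.
have [SU|] := pselect (forall u, S u -> u \in U); first by exists U.
move=> /existsNP[u /not_implyP[Su /negP uU]].
apply: (IHk (U + <[u]>)%VS) => [W SW|].
  by rewrite subv_add okU //= -memvE SW.
have ltU : (\dim U < \dim (U + <[u]>))%N.
  rewrite ltnNge; apply: contra uU => leU.
  have /eqP-> : U == (U + <[u]>)%VS by rewrite eqEdim addvSl.
  by rewrite memvE addvSr.
rewrite leq_subLR (leq_trans (n := (k.+1 + \dim U)%N)) //.
  by rewrite addnC -leq_subLR.
by rewrite addSn -addnS addnC leq_add2r.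
Qed.

(* The linear span of an arbitrary, possibly infinite, set of vectors. *)
Definition set_span (S : set V) : {vspace V} := sval (cid (ex_set_span S)).

Lemma set_span_ub (S : set V) u : S u -> u \in set_span S.
Proof. exact: (svalP (cid (ex_set_span S))).1. Qed.

Lemma set_span_least (S : set V) (W : {vspace V}) :
  (forall u, S u -> u \in W) -> (set_span S <= W)%VS.
Proof. exact: (svalP (cid (ex_set_span S))).2. Qed.

(* The exponential of a nilpotent endomorphism N: since N ^ \dim V = 0, the
   series stops before the exponent \dim V. *)
Definition nilp_exp (N : 'End(V)) : 'End(V) :=
  \sum_(k < (\dim {:V}).+1) (k`!%:R)^-1 *: iter k (comp_lfun N) \1%VF.

End LinearAlgebra.

(** * Quasi-projective varieties over an algebraically closed field, described
    by their sets of closed points in the projective space of a vector space *)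

Section ProjectiveSpace.
Variables (K : fieldType) (M : vectType K).

Definition proj : Type := {L : {vspace M} | \dim L == 1%N}.

(* The value of a polynomial in the coordinates of M at a fixed nonzero vector
   of the line x.  Only the vanishing of homogeneous P, and quotients of P, Q
   homogeneous of the same degree, are used: these do not depend on the chosen
   vector (nor, up to a linear change of variables, on the basis). *)
Definition peval (P : {mpoly K[\dim {:M}]}) (x : proj) : K :=
  P.@[fun i => coord (vbasis {:M}) i (vpick (val x))].

Definition zclosed (Z : set proj) : Prop :=
  exists S : set {mpoly K[\dim {:M}]},
    (forall P, S P -> exists d : nat, P \is d.-homog) /\
    Z = [set x | forall P, S P -> peval P x = 0].

Definition zopen (U : set proj) : Prop := zclosed (~` U).

Definition zclosure (X : set proj) : set proj :=
  \bigcap_(Z in [set Z | zclosed Z /\ X `<=` Z]) Z.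

(* f restricts to a regular function on the locally closed set X. *)
Definition regular_on (X : set proj) (f : proj -> K) : Prop :=
  forall x, X x -> exists (U : set proj) (d : nat) (P Q : {mpoly K[\dim {:M}]}),
    [/\ zopen U, U x, P \is d.-homog, Q \is d.-homog &
        forall y, X y -> U y -> peval Q y != 0 /\ f y = peval P y / peval Q y].

(* A line bundle is given by a trivialising open cover (lb_open i) and
   transition functions; lb_trans i j is the function g_ij such that the
   coordinates of a section satisfy s_i = g_ij s_j.  The opens are opens of the
   projective space, to be intersected with the variety carrying the bundle. *)
Record cocycle := Cocycle {
  lb_index : Type;
  lb_open : lb_index -> set proj;
  lb_trans : lb_index -> lb_index -> proj -> K }.

Definition is_line_bundle (X : set proj) (E : cocycle) : Prop :=
  [/\ forall i, zopen (lb_open (c := E) i),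
      forall x, X x -> exists i, lb_open (c := E) i x,
      forall i j, regular_on (X `&` lb_open i `&` lb_open j)
                             (lb_trans (c := E) i j),
      forall i j x, X x -> lb_open i x -> lb_open j x ->
        lb_trans (c := E) i j x != 0 &
      forall i j k x, X x -> lb_open i x -> lb_open j x -> lb_open k x ->
        lb_trans (c := E) i k x = lb_trans i j x * lb_trans j k x].

(* Isomorphism of the restrictions to X of two line bundles: h i' i is the
   expression s'_i' = h_i'i s_i of the isomorphism in the trivialisations i of E
   and i' of E'. *)
Definition lb_iso (X : set proj) (E E' : cocycle) : Prop :=
  exists h : lb_index E' -> lb_index E -> proj -> K,
    [/\ forall i' i, regular_on (X `&` lb_open i' `&` lb_open i) (h i' i),
        forall i' i x, X x -> lb_open i' x -> lb_open i x -> h i' i x != 0 &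
        forall i' j' i j x, X x ->
          lb_open i' x -> lb_open j' x -> lb_open i x -> lb_open j x ->
          h i' i x * lb_trans i j x = lb_trans i' j' x * h j' j x].

End ProjectiveSpace.

Definition regular_map (K : fieldType) (M N : vectType K)
    (Y : set (proj N)) (X : set (proj M)) (phi : proj N -> proj M) : Prop :=
  [/\ forall y, Y y -> X (phi y),
      forall U, zopen U -> exists2 U' : set (proj N), zopen U' &
        forall y, Y y -> (U' y <-> U (phi y)) &
      forall U f, zopen U -> regular_on (X `&` U) f ->
        regular_on (Y `&` (phi @^-1` U)) (f \o phi)].

Definition variety_iso (K : fieldType) (M N : vectType K)
    (Y : set (proj N)) (X : set (proj M)) (phi : proj N -> proj M) : Prop :=
  regular_map Y X phi /\
  exists psi : proj M -> proj N,
    [/\ regular_map X Y psi, forall y, Y y -> psi (phi y) = y &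
        forall x, X x -> phi (psi x) = x].

Definition lb_pullback (K : fieldType) (M N : vectType K)
    (phi : proj N -> proj M) (E : cocycle M) : cocycle N :=
  Cocycle (fun i : lb_index E => phi @^-1` lb_open i)
          (fun i j => lb_trans i j \o phi).

(* O(d) on P^1: a section F, homogeneous of degree d, has the coordinate
   F / x_i ^ d on the open set x_i != 0. *)
Definition O_P1 (K : fieldType) (d : int) : cocycle 'rV[K]_2 :=
  Cocycle
    (fun i : 'I_2 => [set x : proj 'rV[K]_2 | vpick (val x) 0 i != 0])
    (fun (i j : 'I_2) (x : proj 'rV[K]_2) =>
       (vpick (val x) 0 j / vpick (val x) 0 i) ^ d).

(* X is isomorphic to P^1 and E restricts to O(d) on it. *)
Definition restricts_to_O (K : fieldType) (M : vectType K)
    (X : set (proj M)) (E : cocycle M) (d : int) : Prop :=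
  exists phi : proj 'rV[K]_2 -> proj M,
    variety_iso [set: proj 'rV[K]_2] X phi /\
    lb_iso [set: proj 'rV[K]_2] (lb_pullback phi E) (O_P1 K d).

(** * Fusion products *)

Section Fusion.
Variables (R : realType) (n : nat) (a : 'I_n -> nat) (z : 'I_n -> R[i]).
Notation C := R[i].

Definition sl2_e : 'M[C]_2 := delta_mx 0 1.
Definition sl2_f : 'M[C]_2 := delta_mx 1 0.

(* The irreducible sl2-module of dimension d (matrices acting on columns), in a
   basis u_0, ..., u_(d-1) with u_0 a lowest weight vector, e u_k = u_(k+1),
   h u_k = (2k - (d - 1)) u_k and f u_k = k (d - k) u_(k-1). *)
Definition irr_e d : 'M[C]_d := \matrix_(k, l) (k == l.+1 :> nat)%:R.
Definition irr_h d : 'M[C]_d :=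
  \matrix_(k, l) ((k == l)%:R * (k.*2%:R - d.-1%:R)).
Definition irr_f d : 'M[C]_d :=
  \matrix_(k, l) ((l == k.+1 :> nat)%:R * (l * (d - l))%:R).
Definition sl2_irr d (x : 'M[C]_2) : 'M[C]_d :=
  x 0 1 *: irr_e d + x 0 0 *: irr_h d + x 1 0 *: irr_f d.

(* V = C^(a_1) (x) ... (x) C^(a_n), in coordinates with respect to the tensors
   of basis vectors. *)
Definition multi_index : finType := {dffun forall i : 'I_n, 'I_(a i)}.
Definition tensor : vectType C := {ffun multi_index -> C^o}.

(* The action of x (x) t^k on the tensor product of the evaluation modules:
   the sum over i of z_i ^ k times x acting on the i-th factor. *)
Definition tensor_act (x : 'M[C]_2) (k : nat) (u : tensor) : tensor :=
  [ffun J : multi_index => \sum_(i < n) z i ^+ k *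
     \sum_(J' : multi_index | [forall j, (j != i) ==> (J' j == J j)])
        sl2_irr (a i) x (J i) (J' i) * u J'].

Definition tensor_low : tensor :=
  [ffun J : multi_index => [forall i, J i == 0%N :> nat]%:R].

Definition word_act (w : seq ('M[C]_2 * nat)) : tensor :=
  foldr (fun xk u => tensor_act xk.1 xk.2 u) tensor_low w.

Definition fil (m : nat) : {vspace tensor} :=
  set_span [set u | exists w : seq ('M[C]_2 * nat),
    [/\ forall xk, xk \in w -> \tr xk.1 = 0,
        (sumn [seq xk.2 | xk <- w] <= m)%N & u = word_act w]].

(* The quotient map of V by V^(m-1) (by 0 if m = 0), the quotient being realised
   on a complement of V^(m-1): the kernel of symbol m is V^(m-1). *)
Definition symbol (m : nat) : 'End(tensor) :=
  (\1 - projv (if m is m'.+1 then fil m' else 0))%VF.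

(* The associated graded space: the component of degree m is the image
   V^(m) / V^(m-1) of V^(m) under symbol m.  Degrees m <= \dim V suffice: the
   action of sl2 (x) C[t] is generated in t-degrees 0 and 1, so the filtration
   is strictly increasing until it is constant. *)
Definition graded : vectType C := {ffun 'I_(\dim {:tensor}).+1 -> tensor}.
Definition gr : {vspace graded} :=
  set_span [set u : graded | forall m, u m \in (symbol m @: fil m)%VS].

Definition fusion : vectType C := subvs_of gr.

(* x (x) t^k maps the class of u in V^(m) / V^(m-1) to the class of
   (x (x) t^k) u in V^(m+k) / V^(m+k-1). *)
Definition fusion_act (x : 'M[C]_2) (k : nat) : 'End(fusion) :=
  linfun (fun u : fusion => vsproj gr
    [ffun m : 'I_(\dim {:tensor}).+1 => if (k <= m)%N
       then symbol m (tensor_act x k (vsval u (inord (m - k)))) else 0]).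

Definition fusion_low : fusion :=
  vsproj gr [ffun m : 'I_(\dim {:tensor}).+1 =>
               if m == 0%N :> nat then tensor_low else 0].

Notation Rn := {poly %/ ('X^n : {poly C})}.

(* The representation of SL_2(C[t]/t^n) on the fusion product obtained by
   integrating the action of sl2 (x) C[t]/t^n.  As C[t]/t^n is local, SL_2 is
   generated by its elementary matrices 1 + p E_01 = exp(e (x) p) and
   1 + p E_10 = exp(f (x) p), so these conditions determine rho on SL_2. *)
Definition integrates (rho : 'M[Rn]_2 -> 'End(fusion)) : Prop :=
  [/\ forall g h, \det g = 1 -> \det h = 1 ->
        rho (g *m h) = (rho g \o rho h)%VF,
      forall p : Rn, rho (1%:M + p *: delta_mx 0 1) =
        nilp_exp (\sum_(k < n) (p : {poly C})`_k *: fusion_act sl2_e k) &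
      forall p : Rn, rho (1%:M + p *: delta_mx 1 0) =
        nilp_exp (\sum_(k < n) (p : {poly C})`_k *: fusion_act sl2_f k)].

(* The orbit of [v_A] under SL_2(C[t]/t^n), and its closure sh_A. *)
Definition orbit_low : set (proj fusion) :=
  [set x | exists (rho : 'M[Rn]_2 -> 'End(fusion)) (g : 'M[Rn]_2),
     [/\ integrates rho, \det g = 1 & val x = <[rho g fusion_low]>%VS]].

Definition sh : set (proj fusion) := zclosure orbit_low.

Definition sh_curve (k : nat) : set (proj fusion) :=
  zclosure [set x | exists c : C,
    val x = <[nilp_exp (c *: fusion_act sl2_e k) fusion_low]>%VS].

(* The line bundle E on sh is O(A); the indices of A start from 0. *)
Definition is_O (E : cocycle fusion) (A : n.-tuple int) : Prop :=
  forall k : 'I_n, restricts_to_O (sh_curve k) E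
                     (\sum_(l < n | (l < n - k)%N) tnth A l).

End Fusion.

Arguments sh {R n} a z.

(** * Types *)

Definition is_type (n : nat) (t : seq nat) : bool :=
  all (fun i => 0 < i)%N t && (sumn t == n).

(* The concatenation of blocks of t_1, t_2, ... entries, with values b_1, b_2,
   ... respectively *)
Definition blocks (T : Type) (t : seq nat) (b : seq T) : seq T :=
  flatten [seq nseq p.1 p.2 | p <- zip t b].

Definition has_type (t : seq nat) (A : seq int) : Prop :=
  exists b : seq int,
    [/\ size b = size t, sorted (fun x y => x != y) b & A = blocks t b].

Definition type_ge (n : nat) (t u : seq nat) : Prop :=
  forall A B : n.-tuple int, has_type t A -> has_type u B ->
    forall l, (l.+1 < n)%N ->
      nth 0 A l = nth 0 A l.+1 -> nth 0 B l = nth 0 B l.+1.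

(* (2^(t_1) 3^(t_2) ... (s+1)^(t_s)) *)
Definition type_dims (n : nat) (t : seq nat) (i : 'I_n) : nat :=
  nth 0%N (blocks t (iota 2 (size t))) i.

Arguments type_dims n t : clear implicits.

(* Main.v *)
(* Write st b for the start of the block b of equal entries of the type, so that
   a_i = 1 + #{b | st b <= i}.  The fusion product embeds in a tensor product of
   exterior powers, one n-th exterior power of C^2 (x) C[t]/t^n for each b, in such
   a way that g [v] is the tensor product of the lines spanned by the wedge product
   of t^i g f for i >= st b and of t^i f for i < st b.  Hence sh carries a
   tautological bundle for each b, and the products of their powers are the O(A)
   with A constant on the blocks.

   Conversely, suppose that no block starts at j, with 0 < j < n, and let k be
   n - 1 - j.  Line bundles on open subsets of affine spaces are trivial, so the
   pullback of a line bundle to a polynomial family in sh, over triples (F, G, z)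
   with F, G independent and z nonzero, has a nowhere vanishing section S.  The
   family contains the curve C_k at z = (1, 0), C_(k+1) at (F, G) the standard
   basis, and a similar family containing C_(k+2) at z = (0, 1).  Being a unit on
   every line, the quotient of S by a section along the curves is invariant under
   elementary operations on (F, G), hence under (F, G) -> (2 F, G / 2), which
   amounts to z -> (2 z_0, z_1 / 2).  Comparing the powers of 2 shows that the
   degrees on C_k, C_(k+1) and C_(k+2) are in arithmetic progression, that is, the
   entries of A at j - 1 and j agree. *)
From HB Require Import structures.
Require Import Defs.
From mathcomp Require Import all_fingroup.
From mathcomp Require Import ring lra zify.
Set Implicit Arguments.
Unset Strict Implicit.
Unset Printing Implicit Defensive.
Import GRing.Theory Num.Theory.
Local Open Scope ring_scope.

(** * Line bundles on open subsets of affine spaces *)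

(** The associated graded space comes without a basis, so the embedding is built from functionals on
    the tensor product. A functional is encoded by its generating polynomial, its value at the
    tensor product of the exp(y_i e) u_0. Minors of matrices with columns f + y_i e at the nodes z_i
    give the functionals [minor_form I], on which sl2 (x) t^k acts by row operations. The weight of
    [I], the sum of its exponents of t, matches the filtration: minors of weight [wt0 + m] vanish on
    V^(m-1), hence descend to degree m, and taking leading terms turns multiplication by t, with
    eigenvalues z_i, into a nilpotent shift. The resulting [ell I] separate points by a dimension
    count: the graded space has dimension at most the product of the a_i, and as many independent
    minors are exhibited. From then on a vector is known by its minors, and the geometry becomes
    identities between minors. Degrees enter through one fact: a nowhere vanishing section S of the
    pullback of O(d) to the plane minus the origin satisfies S(l z) = l^-d S(z). The number 2 serves
    only because its integral powers are distinct. *)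

Section Divisibility.
Variable A : idomainType.
Implicit Types a b p u x y : A.

Definition rdvd a b := exists c, b = c * a.
Definition rprime p :=
  [/\ p != 0, ~ rdvd p 1 & forall a b, rdvd p (a * b) -> rdvd p a \/ rdvd p b].
(** The number of prime factors is recorded because it is the measure of the later inductions, no
    norm or degree being available in a general ring. *)
Definition factors n a := exists u (s : seq A),
  [/\ rdvd u 1, forall p, p \in s -> rprime p, size s = n & a = u * \prod_(p <- s) p].

Lemma rdvd_refl a : rdvd a a.
Proof. by exists 1; rewrite mul1r. Qed.

Lemma rdvd_mull a b c : rdvd a b -> rdvd a (c * b).
Proof. by case=> d ->; exists (c * d); rewrite mulrA. Qed.

Lemma rdvd_trans b a c : rdvd a b -> rdvd b c -> rdvd a c.
Proof. by move=> ab [d ->]; exact: rdvd_mull. Qed.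

Lemma rdvd_unit a b : rdvd a 1 -> rdvd b 1 -> rdvd (a * b) 1.
Proof. by case=> c ac [d bd]; exists (c * d); rewrite mulrACA -ac -bd mul1r. Qed.

Lemma rprime_prod p (s : seq A) :
  rprime p -> rdvd p (\prod_(q <- s) q) -> exists2 q, q \in s & rdvd p q.
Proof.
move=> [_ p1 pM]; elim: s => [|q s IH]; first by rewrite big_nil.
rewrite big_cons => /pM[pq|/IH[q' qs pq']]; first by exists q; rewrite ?mem_head.
by exists q' => //; rewrite in_cons qs orbT.
Qed.

Lemma rprime_expM p e a : rprime p -> rdvd p a -> forall b, rdvd p (b ^+ e) -> rdvd p b.
Proof.
move=> [_ p1 pM] _ b; elim: e => [|e IH]; first by rewrite expr0.
by rewrite exprS => /pM[].
Qed.

Lemma rprime_assoc p q : rprime p -> rprime q -> rdvd p q -> exists2 w, rdvd w 1 & q = w * p.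
Proof.
move=> [p0 p1 pM] [q0 q1 qM] [w qE]; exists w => //.
have /qM[] : rdvd q (w * p) by rewrite -qE; exact: rdvd_refl.
  case=> d wE; case: p1; exists d.
  by apply: (mulfI q0); rewrite mulr1 {1}qE wE; ring.
case=> d pE; exists d; apply: (mulIf p0).
by rewrite mul1r {1}pE qE mulrA.
Qed.

(** A prime dividing the product is associate to one of the listed primes; deleting that one and
    absorbing the unit leaves a factorization of [b]. The count drops by exactly one, so repeated
    division by primes stops. *)
Lemma factors_div n p b : rprime p -> p * b != 0 -> factors n (p * b) ->
  exists2 m, n = m.+1 & factors m b.
Proof.
move=> pP pb0 [u [s [u1 sP sz E]]].
have [p0 p1 pM] := pP.
have : rdvd p (u * \prod_(q <- s) q) by rewrite -E; exists b; rewrite mulrC.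
case/pM => [[d uE]|].
  by case: p1; apply: rdvd_trans u1; exists d.
move/(rprime_prod pP)=> [q qs pq].
have [w w1 qE] := rprime_assoc pP (sP _ qs) pq.
exists (size s).-1; first by rewrite -sz prednK //; case: (s) qs.
exists (u * w), (rem q s); split.
- exact: rdvd_unit.
- by move=> r /mem_rem; exact: sP.
- by rewrite size_rem.
apply: (mulfI p0); rewrite E (perm_big _ (perm_to_rem qs)) big_cons /= qE.
by rewrite !mulrA [p * u]mulrC -!mulrA; congr (_ * _); rewrite mulrCA.
Qed.

Definition factorial_ring := forall a, a != 0 -> exists n, factors n a.

Lemma factors_mul n m a b : factors n a -> factors m b -> factors (n + m) (a * b).
Proof.
case=> u [s [u1 sP <- ->]] [v [t [v1 tP <- ->]]].
exists (u * v), (s ++ t); split.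
- exact: rdvd_unit.
- by move=> p; rewrite mem_cat => /orP[/sP|/tP].
- by rewrite size_cat.
by rewrite big_cat /= mulrACA.
Qed.

Lemma factors_prime p : rprime p -> factors 1 p.
Proof.
move=> pP; exists 1, [:: p]; split=> //; last by rewrite big_seq1 mul1r.
  exact: rdvd_refl.
by move=> q; rewrite inE => /eqP->.
Qed.

Lemma valuation p a : factorial_ring -> rprime p -> a != 0 ->
  exists e x, a = p ^+ e * x /\ ~ rdvd p x.
Proof.
move=> UF pP a0; have [n] := UF _ a0.
elim: n a a0 => [|n IH] a a0 fa.
  exists 0%N, a; rewrite expr0 mul1r; split=> // -[d aE].
  by rewrite aE mulrC in fa a0; have [] := factors_div pP a0 fa.
have [[d aE]|] := pselect (rdvd p a); last first.
  by exists 0%N, a; rewrite expr0 mul1r.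
rewrite aE mulrC in fa a0; have [m [<-] fd] := factors_div pP a0 fa.
have d0 : d != 0 by apply: contraNneq a0 => ->; rewrite mulr0.
have [e [x [dE px]]] := IH _ d0 fd.
by exists e.+1, x; split=> //; rewrite aE exprS dE; ring.
Qed.

End Divisibility.

(** * Factoriality and a weak Nullstellensatz for polynomial rings *)

Section Geometric.
Variable K : closedFieldType.

(* R is a ring of polynomial functions on the set of points T for which the
   zero function is detected by points, R is factorial, and (a weak
   Nullstellensatz) a prime hypersurface is only contained in the zero sets of
   its multiples. *)
Definition geometric (A : idomainType) (T : Type) (ev : T -> {rmorphism A -> K}) :=
  [/\ forall a, a != 0 -> exists q, ev q a != 0,
      factorial_ring A &
      forall p c, rprime p -> ~ rdvd p c -> exists q, ev q p = 0 /\ ev q c != 0].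

Lemma geometric_base : geometric (fun _ : unit => idfun : {rmorphism K -> K}).
Proof.
split=> [a a0|a a0|p c [p0 p1 _]]; first by exists tt.
  exists 0%N, a, [::]; split=> //; last by rewrite big_nil mulr1.
  by exists a^-1; rewrite mulVf.
by case: p1; exists p^-1; rewrite mulVf.
Qed.

Section Step.
Variables (A : idomainType) (T : Type) (ev : T -> {rmorphism A -> K}).
Hypothesis geoA : geometric ev.

Definition evX (q : T * K) : {rmorphism {poly A} -> K} :=
  (horner_eval q.2 \o map_poly (ev q.1)).

Lemma evXE q (p : {poly A}) : evX q p = (map_poly (ev q.1) p).[q.2].
Proof. by []. Qed.

Lemma map_ev_neq0 q (p : {poly A}) i : ev q p`_i != 0 -> map_poly (ev q) p != 0.
Proof. by apply: contraNneq => E; rewrite -coef_map E coef0. Qed.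

Lemma ex_nonroot (p : {poly K}) : p != 0 -> exists x, p.[x] != 0.
Proof. by case/closed_nonrootP=> x px; exists x. Qed.

Lemma rdvd_polyC (c : A) (p : {poly A}) : (forall i, rdvd c p`_i) -> rdvd c%:P p.
Proof.
move=> H; have [f fE] := choice H.
exists (\poly_(i < size p) f i); apply/polyP => i.
rewrite coefMC coef_poly; case: ltnP => // ip.
by rewrite mul0r nth_default.
Qed.

Lemma rdvd_polyC_coef (c : A) (p : {poly A}) i : rdvd c%:P p -> rdvd c p`_i.
Proof. by case=> d ->; rewrite coefMC; exists d`_i. Qed.

Lemma nrdvd_polyC (c : A) (p : {poly A}) : ~ rdvd c%:P p -> exists i, ~ rdvd c p`_i.
Proof. by move=> H; apply/existsNP => H'; apply: H; exact: rdvd_polyC. Qed.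

(** Gauss's lemma by specialization: if [c] divides neither factor, it misses a coefficient of each.
    At a point where [c] vanishes and these two coefficients do not, a product of two nonzero
    polynomials over a field would be zero. *)
Lemma rprime_polyC (c : A) : rprime c%:P <-> rprime c.
Proof.
have [pit UF nss] := geoA.
split=> [[c0 c1 cM]|cP].
  split; first by rewrite polyC_eq0 in c0.
    by move=> [d /(congr1 polyC) E]; apply: c1; exists d%:P; rewrite -polyCM -E.
  move=> a b ab.
  have : rdvd c%:P (a%:P * b%:P).
    by case: ab => d E; exists d%:P; rewrite -!polyCM E.
  by case/cM => /(@rdvd_polyC_coef _ _ 0%N); rewrite coefC; [left|right].
have [c0 c1 cM] := cP.
split; first by rewrite polyC_eq0.
  by move/(@rdvd_polyC_coef _ _ 0%N); rewrite coef1.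
move=> a b [d E]; have [|na] := pselect (rdvd c%:P a); first by left.
right; apply: contrapT => nb.
have [i ia] := nrdvd_polyC na; have [j jb] := nrdvd_polyC nb.
have [|q [qc]] := nss c (a`_i * b`_j) cP; first by move/cM => [].
rewrite rmorphM mulf_eq0 negb_or => /andP[qa qb].
have := congr1 (map_poly (ev q)) E; rewrite !rmorphM /= map_polyC /= qc mulr0.
by move/eqP; rewrite mulf_eq0 (negPf (map_ev_neq0 qa)) (negPf (map_ev_neq0 qb)).
Qed.

Import Pdiv.Idomain.

Lemma rprime_dvd_scale (p a : {poly A}) k : rprime p -> (1 < size p)%N -> k != 0 ->
  rdvd p (k *: a) -> rdvd p a.
Proof.
move=> [p0 p1 pM] sp k0; rewrite -mul_polyC => /pM[] // [d kE].
have d0 : d != 0 by apply: contraNneq k0 => d0; rewrite d0 mul0r in kE; rewrite -polyC_eq0 kE.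
move: (congr1 (fun t : {poly A} => size t) kE); rewrite size_polyC k0 size_mul //= => E.
suff : (1 < 1)%N by [].
rewrite [X in (_ < X)%N]E; move: d0; rewrite -size_poly_gt0; case: (size d) => // m _.
by rewrite addSn /= (leq_trans sp) // leq_addl.
Qed.

(** Passes from primality in the ring to coprimality over the fraction field, where Bezout relations
    exist. If the gcd had positive degree, [p] would divide it up to a constant, hence divide [c];
    the alternative, that [p] divides the cofactor, would make the gcd a constant. *)
Lemma rprime_coprimep (p c : {poly A}) : rprime p -> (1 < size p)%N ->
  ~ rdvd p c -> coprimep p c.
Proof.
move=> pP sp pc; apply/negPn/negP; rewrite coprimep_def => sg.
have [p0 p1 pM] := pP.
set g := gcdp p c in sg.
have g0 : g != 0 by rewrite gcdp_eq0 negb_and p0.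
have sg1 : (1 < size g)%N by move: sg g0; rewrite -size_poly_gt0; case: (size g) => [|[]].
have /dvdpP[[k e] /= k0 E] := dvdp_gcdl p c.
have : rdvd p (e * g) by rewrite -E -mul_polyC; apply: rdvd_mull; exact: rdvd_refl.
case/pM => [[f fE]|pg].
  have : f * g = k%:P.
    by apply: (mulIf p0); rewrite mul_polyC E fE mulrAC.
  have f0 : f != 0.
    apply: contraNneq k0 => f0; move: E; rewrite fE f0 !mul0r => E.
    by move/eqP: E; rewrite -mul_polyC mulf_eq0 (negPf p0) orbF polyC_eq0.
  move/(congr1 (fun t : {poly A} => size t)); rewrite size_mul // size_polyC k0 => E'.
  move: f0 sg1 E'; rewrite -size_poly_gt0; case: (size f) => // m _.
  by rewrite addSn /=; case: (size g) => [|[|l]] // _; rewrite addnC.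
have /dvdpP[[l e'] /= l0 E'] := dvdp_gcdr p c.
apply: pc; apply: (rprime_dvd_scale pP sp l0); rewrite E'.
exact: rdvd_mull.
Qed.

Definition primitive_poly (p : {poly A}) := forall c, rprime c -> ~ rdvd c%:P p.

(** The primes of [k] are cancelled one at a time: a prime constant dividing [e * d] cannot divide
    the primitive [d], so it divides [e]. *)
Lemma primitive_dvd (d a : {poly A}) k : primitive_poly d -> k != 0 ->
  rdvd d (k *: a) -> rdvd d a.
Proof.
have [pit UF nss] := geoA.
move=> dP k0; have [n] := UF _ k0.
elim: n k k0 => [|n IH] k k0 [u [s [u1 sP sz kE]]].
  case: s sz kE {sP} => // _; rewrite big_nil mulr1 => ->.
  case: u1 => v E [e Ee]; exists (v *: e).
  by rewrite -scalerAl -Ee scalerA -E scale1r.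
case: s sz sP kE => // p s [sz] sP kE [e Ee].
have pP : rprime p by apply: sP; rewrite mem_head.
have pP' := (rprime_polyC p).2 pP; have [p0 _ pM] := pP'.
pose k' := u * \prod_(q <- s) q.
have kE' : k = p * k' by rewrite kE big_cons mulrCA.
have k'0 : k' != 0 by apply: contraNneq k0 => E; rewrite kE' E mulr0.
apply: (IH k' k'0).
  by exists u, s; split=> // q qs; apply: sP; rewrite in_cons qs orbT.
have : rdvd p%:P (e * d).
  by exists (k' *: a); rewrite -Ee kE' -scalerA mulrC mul_polyC.
case/pM => [[e' e'E]|/(dP _ pP)//].
exists e'; apply: (mulfI p0).
by rewrite mul_polyC scalerA -kE' Ee e'E; ring.
Qed.

(** A prime constant dividing [a] also divides its leading coefficient, whose number of prime
    factors therefore decreases when that constant is extracted. *)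
Lemma primitive_part (a : {poly A}) : a != 0 ->
  exists c a', [/\ c != 0, a = c *: a' & primitive_poly a'].
Proof.
have [pit UF nss] := geoA.
move=> a0; have la0 : lead_coef a != 0 by rewrite lead_coef_eq0.
have [n] := UF _ la0; elim: n a a0 la0 => [|n IH] a a0 la0 fa;
  (have [|] := pselect (primitive_poly a);
    first by (exists 1, a; rewrite scale1r oner_neq0));
  move/existsNP => [p /not_implyP[pP /contrapT [b bE]]];
  have lE : lead_coef a = p * lead_coef b by rewrite bE lead_coefM lead_coefC mulrC.
  by rewrite lE in fa la0; have [] := factors_div pP la0 fa.
have fa' := fa; have la0' := la0; rewrite lE in fa' la0'.
have [m [<-] fb] := factors_div pP la0' fa'.
have lb0 : lead_coef b != 0 by apply: contraNneq la0' => ->; rewrite mulr0.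
have [|c [a' [c0 E P]]] := IH b _ lb0 fb; first by rewrite -lead_coef_eq0.
exists (p * c), a'; split=> //; first by rewrite mulf_neq0 //; case: pP.
by rewrite -scalerA -E bE mulrC mul_polyC.
Qed.

(** Induction on the degree. A nonconstant polynomial has a divisor of least positive degree over
    the fraction field; its primitive part is prime in the ring and can be split off. *)
Lemma factorial_poly : factorial_ring {poly A}.
Proof.
have [pit UF nss] := geoA.
move=> a; have [N] := ubnP (size a); elim: N a => // N IH a; rewrite ltnS => saN a0.
have [sa|sa] := leqP (size a) 1.
  have /size1_polyC aE := sa; have a00 : a`_0 != 0 by rewrite -polyC_eq0 -aE.
  have [n [u [s [[v uv] sP _ E]]]] := UF _ a00; exists (size s), u%:P, [seq p%:P | p <- s].
  split.
  - by exists v%:P; rewrite -polyCM -uv.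
  - by move=> p /mapP[q /sP qP ->]; apply/rprime_polyC.
  - by rewrite size_map.
  by rewrite {1}aE E polyCM big_map rmorph_prod.
(* Here [%|] is divisibility up to nonzero constants, that is, over the fraction field. By
   minimality of the degree, a gcd with such a divisor is constant or the whole divisor. *)
pose ok k := `[< exists d : {poly A}, [/\ size d = k, (1 < k)%N & d %| a] >].
have ex : exists k, ok k by exists (size a); apply/asboolP; exists a.
case: (ex_minnP ex) => k /asboolP[d0 [sd0 k1 d0a]] kmin.
have d00 : d0 != 0 by rewrite -size_poly_gt0 sd0 (leq_trans _ k1).
have [c [d [c0 dE dP]]] := primitive_part d00.
have sd : size d = k by rewrite -sd0 dE size_scale.
have da : d %| a by rewrite dE dvdpZl in d0a.
have dn0 : d != 0 by rewrite -size_poly_gt0 sd (leq_trans _ k1).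
have tdvd x : d %| x -> rdvd d x.
  move=> /dvdpP[[l e] /= l0 E]; apply: (primitive_dvd dP l0).
  by rewrite E; exists e.
have dprime : rprime d.
  split=> //.
    case=> e /(congr1 (fun t : {poly A} => size t)); rewrite size_poly1.
    have [->|e0] := eqVneq e 0; first by rewrite mul0r size_poly0.
    rewrite size_mul // sd; move: e0 k1; rewrite -size_poly_gt0.
    by case: (size e) => // m _; case: (k) => [|[|l]] // _; rewrite addSn /= addnC.
  move=> x y dxy.
  have [|dx] := boolP (d %| x); first by left; apply: tdvd.
  right; apply: tdvd; rewrite -(@Gauss_dvdpr _ y x).
    by case: dxy => e ->; rewrite dvdp_mull.
  rewrite coprimep_def; apply/eqP; apply: contrapT => /eqP sg.
  have g0 : gcdp d x != 0 by rewrite gcdp_eq0 negb_and dn0.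
  have gk : (k <= size (gcdp d x))%N.
    apply: kmin; apply/asboolP; exists (gcdp d x); split=> //.
      by move: g0 sg; rewrite -size_poly_gt0; case: (size _) => [|[]].
    by apply: dvdp_trans da; exact: dvdp_gcdl.
  move/negP: dx; apply; have := dvdp_gcdr d x.
  have /eqp_dvdl-> // : gcdp d x %= d.
  rewrite -dvdp_size_eqp ?dvdp_gcdl // eqn_leq dvdp_leq ?dvdp_gcdl //=.
  by rewrite sd.
have [e aE] := tdvd _ da.
have e0 : e != 0 by apply: contraNneq a0 => E; rewrite aE E mul0r.
have [|n fe] := IH e _ e0.
  apply: leq_trans saN; rewrite aE size_mul // sd.
  by case: (k) k1 => [|[|l]] // _; rewrite !addnS /= ltnS leq_addr.
exists (n + 1)%N; rewrite aE; apply: factors_mul => //; exact: factors_prime.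
Qed.

(** For a prime of positive degree, a Bezout relation [u * p + v * c = r] with a nonzero constant
    [r] shows that [c] cannot vanish at a root of [p] lying over a point where [r] does not
    vanish. *)
Lemma geometric_poly : geometric evX.
Proof.
have [pit UF nss] := geoA.
split.
- move=> p p0; have [|q qp] := pit (lead_coef p); first by rewrite lead_coef_eq0.
  have [x px] := ex_nonroot (map_ev_neq0 qp).
  by exists (q, x).
- exact: factorial_poly.
move=> p c pP pc; have [p0 p1 pM] := pP.
have [sp|sp] := leqP (size p) 1.
  have /size1_polyC pE := sp; rewrite pE in pP pc *.
  have [i ci] := nrdvd_polyC pc.
  have [q [qp qc]] := nss _ _ ((rprime_polyC _).1 pP) ci.
  have [x cx] := ex_nonroot (map_ev_neq0 qc).
  by exists (q, x); rewrite !evXE /= map_polyC hornerC.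
have /Bezout_coprimepP[[u v] /=] := rprime_coprimep pP sp pc.
rewrite -size_poly_eq1 => /size_poly1P[r r0 E].
(* The factor [lead_coef p] preserves the degree of [p] under specialization, so that a root
   exists. *)
have [|q] := pit (r * lead_coef p); first by rewrite mulf_neq0 // lead_coef_eq0.
rewrite rmorphM mulf_eq0 negb_or => /andP[qr ql].
have /closed_rootP[x /rootP px] : size (map_poly (ev q) p) != 1%N.
  by rewrite size_map_poly_id0 // neq_ltn sp orbT.
exists (q, x); split=> //.
have := congr1 (evX (q, x)) E; rewrite rmorphD !rmorphM !evXE /= px mulr0 add0r map_polyC hornerC => Ev.
by apply: contraNneq qr => cx; rewrite -Ev; move: cx; rewrite /horner_eval => ->; rewrite mulr0.
Qed.

End Step.
End Geometric.

Section Balanced.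
Variable A : idomainType.
Hypothesis UF : factorial_ring A.
Implicit Types p x y : A.

(* p divides x and y with the same multiplicity *)
Definition balanced p x y := exists e x' y',
  [/\ x = p ^+ e * x', y = p ^+ e * y', ~ rdvd p x' & ~ rdvd p y'].

Lemma expr_cofactor_uniq p e f x y : rprime p -> ~ rdvd p x -> ~ rdvd p y ->
  p ^+ e * x = p ^+ f * y -> e = f /\ x = y.
Proof.
move=> [p0 _ _] px py E.
have main e' f' x' y' : ~ rdvd p x' -> p ^+ e' * x' = p ^+ f' * y' -> (f' <= e')%N.
  move=> px' E'; rewrite leqNgt; apply/negP => ef; apply: px'.
  exists (p ^+ (f' - e').-1 * y'); apply: (mulfI (expf_neq0 e' p0)).
  by rewrite E' -[in LHS](subnKC (ltnW ef)) -(prednK (n := (f' - e')%N)) ?subn_gt0 // exprD exprS; ring.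
have ef : e = f by apply/eqP; rewrite eqn_leq (main _ _ _ _ px E) (main _ _ _ _ py (esym E)).
by subst f; split=> //; exact: (mulfI (expf_neq0 e p0)).
Qed.

(** Multiplicities at [p] add up in a product and [u], [v] contribute none, so x / y and x' / y'
    have the same order along [p]. *)
Lemma balanced_transfer p x y x' y' u v : rprime p -> x' != 0 -> y' != 0 ->
  ~ rdvd p u -> ~ rdvd p v -> u * (y * x') = v * (x * y') ->
  balanced p x' y' -> x != 0 -> y != 0 -> balanced p x y.
Proof.
move=> pP x'0 y'0 pu pv E [e [a [b [x'E y'E pa pb]]]] x0 y0.
have [p0 p1 pM] := pP.
have [f [c [xE pc]]] := valuation UF pP x0; have [g [d [yE pd]]] := valuation UF pP y0.
have nM s t : ~ rdvd p s -> ~ rdvd p t -> ~ rdvd p (s * t) by move=> ps pt /pM[].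
suff [fg _] : (e + g)%N = (e + f)%N /\ u * (d * a) = v * (c * b).
  by exists f, c, d; split=> //; rewrite yE; congr (_ ^+ _ * _); apply/eqP; rewrite -(eqn_add2l e) fg.
apply: (expr_cofactor_uniq pP).
- by apply: (nM) => //; exact: nM.
- by apply: (nM) => //; exact: nM.
have : u * (p ^+ g * d * (p ^+ e * a)) = v * (p ^+ f * c * (p ^+ e * b)).
  by rewrite -xE -yE -x'E -y'E.
by rewrite !exprD => E'; transitivity (u * (p ^+ g * d * (p ^+ e * a))); [ring | rewrite E'; ring].
Qed.

Lemma balanced_cancel p q x y : rprime p -> rprime q ->
  balanced p (q * x) (q * y) -> x != 0 -> y != 0 -> balanced p x y.
Proof.
move=> pP qP B x0 y0; have [q0 _ _] := qP; have [_ p1 _] := pP.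
apply: (balanced_transfer (u := 1) (v := 1) pP _ _ _ _ _ B) => //.
- by rewrite mulf_neq0.
- by rewrite mulf_neq0.
by ring.
Qed.

(** Induction on the number of prime factors of [x]: a prime of [P] dividing numerator or
    denominator divides both, by balance, and can be cancelled. *)
Lemma reduce_fraction (P : A -> Prop) x y :
  (forall p, P p -> rprime p) -> (forall p, P p -> balanced p x y) -> x != 0 -> y != 0 ->
  exists x' y', [/\ x * y' = y * x', x' != 0, y' != 0,
     forall p, P p -> ~ rdvd p x' & forall p, P p -> ~ rdvd p y'].
Proof.
move=> Pp; have [n] : exists n, factors n x \/ x = 0.
  by have [->|/UF[n fx]] := eqVneq x 0; [exists 0%N; right | exists n; left].
elim: n x y => [|n IH] x y fx B x0 y0.
  exists x, y; split=> //; rewrite 1?mulrC //.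
    move=> p Pp' [d xE]; case: fx => [fx|xx]; last by rewrite xx eqxx in x0.
    by rewrite xE mulrC in fx x0; have [] := factors_div (Pp _ Pp') x0 fx.
  move=> p Pp' [d yE]; case: fx => [fx|xx]; last by rewrite xx eqxx in x0.
  have [e [a [b [xE yE' pa pb]]]] := B _ Pp'.
  case: e xE yE' => [|e] xE yE'.
    by apply: pb; exists d; rewrite -yE yE' expr0 mul1r.
  by rewrite xE exprS -mulrA in fx x0; have [] := factors_div (Pp _ Pp') x0 fx.
have [[p Pp' [d xE]]|] := pselect (exists2 p, P p & rdvd p x); last first.
  move=> H; exists x, y; split=> //; rewrite 1?mulrC //.
    by move=> p Pp' px; apply: H; exists p.
  move=> p Pp' [d yE]; have [e [a [b [xE yE' pa pb]]]] := B _ Pp'.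
  case: e xE yE' => [|e] xE yE'.
    by apply: pb; exists d; rewrite -yE yE' expr0 mul1r.
  by apply: H; exists p => //; exists (p ^+ e * a); rewrite xE exprS; ring.
have [e [a [b [xE' yE pa pb]]]] := B _ Pp'.
case: e xE' yE => [|e] xE' yE.
  by case: pa; exists d; rewrite -xE xE' expr0 mul1r.
have pP := Pp _ Pp'; have [p0 _ _] := pP.
have xp : x = p * (p ^+ e * a) by rewrite xE' exprS; ring.
have yp : y = p * (p ^+ e * b) by rewrite yE exprS; ring.
have x1 : p ^+ e * a != 0 by apply: contraNneq x0 => E; rewrite xp E mulr0.
have y1 : p ^+ e * b != 0 by apply: contraNneq y0 => E; rewrite yp E mulr0.
have [||x' [y' [E x'0 y'0 H1 H2]]] := IH (p ^+ e * a) (p ^+ e * b) _ _ x1 y1.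
- left; case: fx => [fx|xx]; last by rewrite xx eqxx in x0.
  by rewrite xp in fx x0; have [m [<-]] := factors_div pP x0 fx.
- by move=> q Pq; apply: (balanced_cancel (Pp _ Pq) pP _ x1 y1); rewrite -xp -yp; exact: B.
by exists x', y'; split=> //; rewrite xp yp -[LHS]mulrA E mulrA.
Qed.

End Balanced.

(** * Triviality of line bundle cocycles over geometric rings *)

Section Picard.
Variables (K : closedFieldType) (A : idomainType) (T : Type).
Variable ev : T -> {rmorphism A -> K}.
Hypothesis geoA : geometric ev.
Variables (J : Type) (U : J -> T -> Prop) (g : J -> J -> T -> K).

Definition regular_at (D : T -> Prop) (f : T -> K) q :=
  exists a P Q : A, ev q a != 0 /\
    forall q', D q' -> ev q' a != 0 -> ev q' Q != 0 /\ f q' = ev q' P / ev q' Q.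

Hypothesis U_open : forall i q, U i q ->
  exists a, ev q a != 0 /\ forall q', ev q' a != 0 -> U i q'.
Hypothesis g_reg : forall i j q, U i q -> U j q ->
  regular_at (fun q' => U i q' /\ U j q') (g i j) q.
Hypothesis g_neq0 : forall i j q, U i q -> U j q -> g i j q != 0.
Hypothesis g_cocycle : forall i j k q, U i q -> U j q -> U k q ->
  g i k q = g i j q * g j k q.

Let pit a : a != 0 -> exists q, ev q a != 0. Proof. by case: geoA => H _ _; exact: H. Qed.
Let UF : factorial_ring A. Proof. by case: geoA. Qed.
Let nss p c : rprime p -> ~ rdvd p c -> exists q, ev q p = 0 /\ ev q c != 0.
Proof. by case: geoA => _ _ H; exact: H. Qed.

Lemma dense_eq b x y : b != 0 -> (forall q, ev q b != 0 -> ev q x = ev q y) -> x = y.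
Proof.
move=> b0 H; apply/eqP; rewrite -subr_eq0; apply/negPn/negP => xy.
have [|q] := pit (a := b * (x - y)); first by rewrite mulf_neq0.
by rewrite rmorphM rmorphB mulf_eq0 negb_or => /andP[qb]; rewrite H // subrr eqxx.
Qed.

Lemma ev_neq0 q a : ev q a != 0 -> a != 0.
Proof. by apply: contraNneq => ->; rewrite rmorph0. Qed.

Section Base.
Variables (i0 : J) (a0 : A).
Hypothesis a0_neq0 : a0 != 0.
Hypothesis a0_U : forall q, ev q a0 != 0 -> U i0 q.

(* A fraction expressing the section of index i0 in the trivialisation i. *)
Definition represents i (AB : A * A) := [/\ AB.1 != 0, AB.2 != 0 &
  forall q, U i q -> U i0 q -> g i i0 q * ev q AB.2 = ev q AB.1].

(** The fractions describing [g i i0] near different points agree where both are defined together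
    with the trivialisations. That set contains a nonempty principal open set, so they are one
    element of the fraction field. *)
Lemma ex_represents i q0 : U i q0 -> exists AB, represents i AB.
Proof.
move=> Ui; have [a [aq aU]] := U_open Ui.
have [|q] := pit (a := a * a0); first by rewrite mulf_neq0 // (ev_neq0 aq).
rewrite rmorphM mulf_eq0 negb_or => /andP[qa qa0].
have Uiq := aU _ qa; have Ui0q := a0_U qa0.
have [b [P [Q [qb H]]]] := g_reg Uiq Ui0q.
have [qQ gE] := H _ (conj Uiq Ui0q) qb.
have qP : ev q P != 0.
  by have := g_neq0 Uiq Ui0q; rewrite gE; apply: contraNneq => ->; rewrite mul0r.
exists (P, Q); split; rewrite /= ?(ev_neq0 qP) ?(ev_neq0 qQ) //.
move=> q' Uiq' Ui0q'.
have [b' [P' [Q' [qb' H']]]] := g_reg Uiq' Ui0q'.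
have [qQ' gE'] := H' _ (conj Uiq' Ui0q') qb'.
suff E : P * Q' = P' * Q.
  by apply: (mulIf qQ'); rewrite gE' -rmorphM E rmorphM mulrAC divfK.
apply: (dense_eq (b := a * a0 * b * b')).
  by rewrite !mulf_neq0 // ?(ev_neq0 qb) ?(ev_neq0 qb') ?(ev_neq0 qa).
move=> r; rewrite !rmorphM !mulf_eq0 !negb_or => /andP[/andP[/andP[ra ra0] rb] rb'].
have D := conj (aU _ ra) (a0_U ra0).
have [rQ rE] := H _ D rb; have [rQ' rE'] := H' _ D rb'.
by apply/eqP; rewrite -eqr_div // -rE -rE'.
Qed.

Lemma represents_trans i j AB CD q : represents i AB -> represents j CD ->
  U i q -> U j q -> exists P Q, [/\ ev q P != 0, ev q Q != 0,
   g i j q = ev q P / ev q Q & P * (AB.2 * CD.1) = Q * (AB.1 * CD.2)].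
Proof.
move=> [A0 B0 rAB] [C0 D0 rCD] Ui Uj.
have [b [P [Q [qb H]]]] := g_reg Ui Uj.
have [qQ gE] := H _ (conj Ui Uj) qb.
have qP : ev q P != 0.
  by have := g_neq0 Ui Uj; rewrite gE; apply: contraNneq => ->; rewrite mul0r.
exists P, Q; split=> //.
have [a [qa aU]] := U_open Ui; have [c [qc cU]] := U_open Uj.
apply: (dense_eq (b := a * c * a0 * b)).
  by rewrite !mulf_neq0 // ?(ev_neq0 qb) ?(ev_neq0 qc) ?(ev_neq0 qa).
move=> r; rewrite !rmorphM !mulf_eq0 !negb_or => /andP[/andP[/andP[/aU Uir /cU Ujr] /a0_U U0r] rb].
have [rQ rE] := H _ (conj Uir Ujr) rb.
rewrite -(rAB _ Uir U0r) -(rCD _ Ujr U0r) (g_cocycle Uir Ujr U0r) rE.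
by field.
Qed.

Definition meets i p := rprime p /\ exists q, U i q /\ ev q p = 0.

Lemma meets_nrdvd p q (P : A) : ev q p = 0 -> ev q P != 0 -> ~ rdvd p P.
Proof. by move=> qp qP [d E]; move: qP; rewrite E rmorphM qp mulr0 eqxx. Qed.

(** A prime hypersurface is irreducible: two nonempty open subsets of it intersect, by the weak
    Nullstellensatz applied to the product of their equations. *)
Lemma meets_both i j p : meets i p -> meets j p -> exists q, [/\ U i q, U j q & ev q p = 0].
Proof.
move=> [pP [q [Uiq qp]]] [_ [r [Ujr rp]]].
have [a [qa aU]] := U_open Uiq; have [b [rb bU]] := U_open Ujr.
have [_ _ pM] := pP.
have [|s [sp]] := nss (c := a * b) pP.
  by case/pM; [exact: (meets_nrdvd qp qa) | exact: (meets_nrdvd rp rb)].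
rewrite rmorphM mulf_eq0 negb_or => /andP[/aU ? /bU ?].
by exists s.
Qed.

(** Along the hypersurface [p], the section of index [i0] divided by [H.1 / H.2] has neither zero
    nor pole, as seen in every trivialisation that meets the hypersurface. *)
Definition adjusted (H : A * A) p := forall i AB, represents i AB -> meets i p ->
  balanced p (AB.1 * H.2) (AB.2 * H.1).

Lemma adjusted_transfer H p i AB : H.1 != 0 -> H.2 != 0 -> represents i AB -> meets i p ->
  balanced p (AB.1 * H.2) (AB.2 * H.1) -> adjusted H p.
Proof.
move=> H1 H2 rAB mi B j CD rCD mj.
have [q [Uj Ui qp]] := meets_both mj mi.
have [P [Q [qP qQ _ E]]] := represents_trans rCD rAB Uj Ui.
have [A0 B0 _] := rAB; have [C0 D0 _] := rCD; have [pP _] := mi.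
apply: (balanced_transfer UF (u := P) (v := Q) pP _ _ _ _ _ B);
  rewrite ?mulf_neq0 //.
- exact: (meets_nrdvd qp qP).
- exact: (meets_nrdvd qp qQ).
by transitivity (P * (CD.2 * AB.1) * (H.1 * H.2)); [ring | rewrite E; ring].
Qed.

Lemma adjusted_mul H p c : rprime p -> ~ rdvd p c -> H.1 != 0 -> H.2 != 0 -> c != 0 ->
  adjusted H p -> adjusted (H.1 * c, H.2) p /\ adjusted (H.1, H.2 * c) p.
Proof.
move=> pP pc H1 H2 c0 gH; have [_ p1 _] := pP.
split=> i AB rAB mi; have [A0 B0 _] := rAB.
  apply: (balanced_transfer UF (u := 1) (v := c) pP _ _ _ _ _ (gH _ _ rAB mi));
    rewrite /= ?mulf_neq0 //; ring.
apply: (balanced_transfer UF (u := c) (v := 1) pP _ _ _ _ _ (gH _ _ rAB mi));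
  rewrite /= ?mulf_neq0 //; ring.
Qed.

Lemma adjusted_assoc H p r : rprime p -> rprime r -> rdvd p r -> adjusted H r -> adjusted H p.
Proof.
move=> pP rP pr gs i AB rAB mi; have [w w1 rE] := rprime_assoc pP rP pr.
have mr : meets i r.
  by case: mi => _ [q [Uq qp]]; split=> //; exists q; rewrite rE rmorphM qp mulr0.
have [e [x [y [xE yE rx ry]]]] := gs _ _ rAB mr.
have nr z : ~ rdvd r z -> ~ rdvd p (w ^+ e * z).
  have [_ p1 pM] := pP; move=> rz; case/pM => [pw|[d dE]].
    case: p1; apply: rdvd_trans w1; have [e0|e0] := posnP e.
      by rewrite e0 expr0 in pw; apply: rdvd_trans pw _; exists w; rewrite mulr1.
    exact: (rprime_expM pP (rdvd_refl p) pw).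
  apply: rz; case: w1 => v vE; exists (d * v); rewrite rE dE.
  by transitivity (d * (v * w) * p); [rewrite -vE; ring | ring].
exists e, (w ^+ e * x), (w ^+ e * y).
split; rewrite ?xE ?yE ?rE ?exprMn; [ring | ring | exact: nr | exact: nr].
Qed.

(** The section of index [i0] is a frame wherever [a0] does not vanish, so its divisor is supported
    on the finitely many primes of [a0]. A fraction with the same divisor is assembled one prime at
    a time. *)
Lemma ex_adjusted : exists H : A * A, [/\ H.1 != 0, H.2 != 0 & forall p, rprime p -> adjusted H p].
Proof.
have [n [u [s [u1 sP _ a0E]]]] := UF a0_neq0.
suff : forall t : seq A, (forall p, p \in t -> rprime p) ->
    exists H : A * A, [/\ H.1 != 0, H.2 != 0, forall p, p \in t -> adjusted H p &
      forall p, rprime p -> (forall r, r \in t -> ~ rdvd p r) -> adjusted H p \/ rdvd p a0].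
  move/(_ s sP) => [H [H1 H2 gs gn]]; exists H; split=> // p pP i AB rAB mi.
  have [[r rs pr]|np] := pselect (exists2 r, r \in s & rdvd p r).
    exact: (adjusted_assoc pP (sP _ rs) pr (gs _ rs) rAB mi).
  have [|gH|pa] := gn _ pP; [by move=> r rs pr; apply: np; exists r|exact: (gH i AB)|].
  rewrite a0E in pa; have [_ p1 pM] := pP.
  case/pM: pa => [pu|/(rprime_prod pP)[r rs pr]]; last by case: np; exists r.
  by case: p1; apply: rdvd_trans u1.
elim=> [|p t IH] tP.
  (* If [p] does not divide [a0], its hypersurface has a point in [U i0], where the section is
     represented by the fraction 1. *)
  exists (1, 1); split; rewrite ?oner_neq0 // => p pP _.
  have [|pa] := pselect (rdvd p a0); [by right|left].
  have [q [qp qa]] := nss pP pa.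
  have r0 : represents i0 (1, 1).
    split; rewrite /= ?oner_neq0 // => r Ur _; rewrite rmorph1 mulr1.
    have := g_cocycle Ur Ur Ur; rewrite -{1}[g _ _ _]mulr1 => /mulfI-> //.
    exact: g_neq0.
  apply: (adjusted_transfer _ _ r0); rewrite ?oner_neq0 //.
    by split=> //; exists q; split=> //; exact: a0_U.
  exists 0%N, 1, 1; rewrite expr0 !mulr1; split=> //; by case: pP.
have [|H [H1 H2 gt gn]] := IH; first by move=> r rt; apply: tP; rewrite in_cons rt orbT.
have pP : rprime p by apply: tP; rewrite mem_head.
(* A prime occurring repeatedly, up to units, has already been treated and must not be corrected
   twice. *)
have [[r rt pr]|np] := pselect (exists2 r, r \in t & rdvd p r).
  exists H; split=> //.
    move=> r'; rewrite in_cons => /orP[/eqP->|/gt] // i AB rAB mi.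
    have rP : rprime r by apply: tP; rewrite in_cons rt orbT.
    exact: (adjusted_assoc pP rP pr (gt _ rt) rAB mi).
  by move=> r' r'P H'; apply: gn => // r'' r''t; apply: H'; rewrite in_cons r''t orbT.
have [[i [AB [rAB mi]]]|nm] := pselect (exists i AB, represents i AB /\ meets i p); last first.
  exists H; split=> //.
    move=> r; rewrite in_cons => /orP[/eqP->|/gt] // i AB rAB mi.
    by case: nm; exists i, AB.
  by move=> r' r'P H'; apply: gn => // r'' r''t; apply: H'; rewrite in_cons r''t orbT.
have [A0 B0 _] := rAB; have [p0 p1 pM] := pP.
(* Multiplying [H] by [p ^+ e / p ^+ f] gives both sides the multiplicity [e + f] and changes
   nothing at primes not dividing [p]. *)
have [e [x [xE px]]] := valuation UF pP (mulf_neq0 A0 H2).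
have [f [y [yE py]]] := valuation UF pP (mulf_neq0 B0 H1).
have pe k : p ^+ k != 0 by rewrite expf_neq0.
have key r : rprime r -> ~ rdvd r p -> adjusted H r -> adjusted (H.1 * p ^+ e, H.2 * p ^+ f) r.
  move=> rP rp gH; have rpk k : ~ rdvd r (p ^+ k).
    by move/(rprime_expM rP (rdvd_refl r)).
  have [g1 _] := adjusted_mul rP (rpk e) H1 H2 (pe e) gH.
  by have [_] := adjusted_mul rP (rpk f) (mulf_neq0 H1 (pe e) : (H.1 * p ^+ e, H.2).1 != 0) H2 (pe f) g1.
have gp : adjusted (H.1 * p ^+ e, H.2 * p ^+ f) p.
  apply: (adjusted_transfer _ _ rAB mi); rewrite /= ?mulf_neq0 //.
  exists (e + f)%N, x, y; split=> //; rewrite mulrA ?xE ?yE exprD; ring.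
exists (H.1 * p ^+ e, H.2 * p ^+ f); split; rewrite ?mulf_neq0 //.
  move=> r; rewrite in_cons => /orP[/eqP->|rt] //.
  have rP : rprime r by apply: tP; rewrite in_cons rt orbT.
  apply: key => //; last exact: gt.
  move=> rp; have [w [v vw] pE] := rprime_assoc rP pP rp.
  by apply: np; exists r => //; exists v; rewrite pE mulrA -vw mul1r.
move=> r rP H'; have [|gr|] := gn r rP; [|left|by right].
  by move=> r' r't; apply: H'; rewrite in_cons r't orbT.
by apply: key => //; apply: H'; rewrite mem_head.
Qed.

End Base.

(** The section divided by [H] is expressed in each trivialisation by a fraction balanced at every
    prime meeting [U i]. Once reduced, its numerator and denominator only have prime factors without
    zeros on [U i], so they vanish nowhere there, and [g i j] is the quotient of the two
    expressions. *)
Lemma picard_trivial : exists P Q : J -> A,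
  (forall i q, U i q -> ev q (P i) != 0 /\ ev q (Q i) != 0) /\
  (forall i j q, U i q -> U j q ->
     g i j q = (ev q (P i) / ev q (Q i)) / (ev q (P j) / ev q (Q j))).
Proof.
have [[i0 [q0 U0]]|nU] := pselect (exists i q, U i q); last first.
  by exists (fun _ => 1), (fun _ => 1); split=> [i q Uq|i j q Uq]; case: nU; exists i, q.
have [a0 [qa0 a0U]] := U_open U0.
have a00 := ev_neq0 qa0.
have [H [H1 H2 gH]] := ex_adjusted a00 a0U.
have main i : exists PQ : A * A, forall q0, U i q0 -> exists AB, [/\ represents i0 i AB,
    AB.1 * H.2 * PQ.2 = AB.2 * H.1 * PQ.1 &
    forall q, U i q -> ev q PQ.1 != 0 /\ ev q PQ.2 != 0].
  have [[q Uq]|nU] := pselect (exists q, U i q); last by exists (1, 1) => q Uq; case: nU; exists q.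
  have [AB rAB] := ex_represents a00 a0U Uq.
  have [A0 B0 _] := rAB.
  have [||||x [y [E x0 y0 xP yP]]] := @reduce_fraction _ UF (meets i) (AB.1 * H.2) (AB.2 * H.1).
  - by move=> p [].
  - by move=> p mp; apply: (gH p _ i AB) => //; case: mp.
  - by rewrite mulf_neq0.
  - by rewrite mulf_neq0.
  exists (x, y) => _ _; exists AB; split=> // r Ur.
  have nz w : w != 0 -> (forall p, meets i p -> ~ rdvd p w) -> ev r w != 0.
    move=> w0 wP; have [n [u [s [[v uv] sP _ wE]]]] := UF w0.
    rewrite wE rmorphM mulf_neq0 //.
      by apply: contraTneq (oner_neq0 K) => u0; rewrite -(rmorph1 (ev r)) uv rmorphM u0 mulr0 eqxx.
    rewrite rmorph_prod; elim: s sP wE => [|p s IHs] sP wE; first by rewrite big_nil oner_neq0.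
    rewrite big_cons; apply: mulf_neq0.
      apply/eqP => rp; apply: (wP p).
        by split; [apply: sP; rewrite mem_head | exists r].
      by exists (u * \prod_(q <- s) q); rewrite wE big_cons; ring.
    have sP' p' : p' \in s -> rprime p' by move=> H'; apply: sP; rewrite in_cons H' orbT.
    have [] // := pselect (\prod_(i1 <- s) ev r i1 != 0).
    move=> nz; exfalso; apply: nz; rewrite big_seq; apply: (big_ind (fun t => t != 0)).
    - exact: oner_neq0.
    - exact: mulf_neq0.
    move=> p' p's; apply/eqP => rp; apply: (wP p').
      by split; [exact: sP' | exists r].
    by exists (u * p * \prod_(q <- rem p' s) q); rewrite wE big_cons (perm_big _ (perm_to_rem p's)) big_cons /=; ring.
  by split; apply: nz.
have [PQ PQE] := choice main.
exists (fun i => (PQ i).1), (fun i => (PQ i).2); split.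
  by move=> i q Uq; have [AB [_ _ H']] := PQE i q Uq; exact: H'.
move=> i j q Ui Uj.
have [AB [rAB E1 N1]] := PQE i q Ui; have [CD [rCD E2 N2]] := PQE j q Uj.
have [P [Q [qP qQ -> E]]] := represents_trans a00 a0U rAB rCD Ui Uj.
have [[n1 n2] [n3 n4]] := (N1 _ Ui, N2 _ Uj).
have [[A0 B0 _] [C0 D0 _]] := (rAB, rCD).
have : P * ((PQ i).2 * (PQ j).1) = Q * ((PQ i).1 * (PQ j).2).
  apply: (mulfI (mulf_neq0 (mulf_neq0 A0 H2) (mulf_neq0 D0 H1))).
  transitivity (P * (AB.1 * H.2 * (PQ i).2) * ((PQ j).1 * (CD.2 * H.1))); first by ring.
  rewrite E1 [(PQ j).1 * _]mulrC -E2.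
  transitivity (P * (AB.2 * CD.1) * (H.1 * H.2 * (PQ i).1 * (PQ j).2)); first by ring.
  by rewrite E; ring.
move/(congr1 (ev q)); rewrite !rmorphM /= => E'.
apply/eqP; rewrite invf_div mulf_div eqr_div ?mulf_neq0 //.
by rewrite E' mulrC.
Qed.

End Picard.

(** * Linear functionals on the tensor product *)

Section Determinants.
Variables (A : comNzRingType) (n : nat).
Implicit Types (M N : 'M[A]_n) (r i : 'I_n).

Definition set_row M N r : 'M[A]_n := \matrix_(k, i) (if k == r then N k i else M k i).

Lemma det_set_row M N r : \det (set_row M N r) = \sum_i N r i * cofactor M r i.
Proof.
rewrite (expand_det_row _ r); apply: eq_bigr => i _.
rewrite mxE eqxx; congr (_ * _); rewrite /cofactor; congr (_ * \det _).
by apply/matrixP => k l; rewrite !mxE eq_sym (negPf (neq_lift _ _)).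
Qed.

Lemma det_set_row_sum (I : finType) M (c : I -> A) (Y : I -> 'M[A]_n) N r :
  (forall i, N r i = \sum_k c k * Y k r i) ->
  \det (set_row M N r) = \sum_k c k * \det (set_row M (Y k) r).
Proof.
move=> H; rewrite det_set_row.
under eq_bigr do rewrite H mulr_suml.
rewrite exchange_big; apply: eq_bigr => k _; rewrite det_set_row mulr_sumr.
by apply: eq_bigr => i _; rewrite mulrA.
Qed.

(** Infinitesimal scaling of the columns: the expansions along the replaced rows regroup into
    expansions of [\det M] along its columns. *)
Lemma sum_det_mul_diag M (d : 'I_n -> A) :
  \sum_r \det (set_row M (\matrix_(k, i) (M k i * d i)) r) = (\sum_i d i) * \det M.
Proof.
under eq_bigr do rewrite det_set_row.
rewrite exchange_big mulr_suml; apply: eq_bigr => i _.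
rewrite (expand_det_col _ i) mulr_sumr; apply: eq_bigr => r _.
by rewrite mxE mulrAC mulrA mulrC mulrA mulrAC.
Qed.

Variable D : A -> A.
Hypothesis D_sum : forall (I : finType) (F : I -> A), D (\sum_i F i) = \sum_i D (F i).
Hypothesis D_mul : forall x y, D (x * y) = D x * y + x * D y.

Lemma deriv_prod (I : finType) (F : I -> A) :
  D (\prod_i F i) = \sum_r \prod_i (if i == r then D (F i) else F i).
Proof.
have D1 : D 1 = 0.
  by have /eqP := D_mul 1 1; rewrite !mulr1 mul1r -[X in X == _]addr0 (inj_eq (addrI _)) eq_sym => /eqP.
have main (s : seq I) : uniq s ->
    D (\prod_(i <- s) F i) = \sum_(r <- s) \prod_(i <- s) (if i == r then D (F i) else F i).
  elim: s => [|j s IH] /=; first by rewrite !big_nil D1.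
  case/andP=> js us; rewrite !big_cons D_mul IH // eqxx.
  congr (_ + _).
    congr (_ * _); apply: eq_big_seq => i si.
    by case: eqP js => // <-; rewrite si.
  rewrite mulr_sumr; apply: eq_big_seq => r sr; rewrite big_cons.
  by case: eqP js => // ->; rewrite sr.
by rewrite main ?index_enum_uniq.
Qed.

Lemma deriv_det M : D (\det M) = \sum_r \det (set_row M (map_mx D M) r).
Proof.
have D1 : D 1 = 0.
  by have /eqP := D_mul 1 1; rewrite !mulr1 mul1r -[X in X == _]addr0 (inj_eq (addrI _)) eq_sym => /eqP.
have D0 : D 0 = 0.
  have := D_sum (fun i : 'I_0 => 0); rewrite !big_ord0 //.
have DN x : D (- x) = - D x.
  have /(congr1 (fun t => t - D x)) : D (- x) + D x = 0.
    by have := D_sum (fun i : 'I_2 => if i == 0 then - x else x); rewrite !big_ord_recl !big_ord0 /= !addr0 addNr D0.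
  by rewrite addrK add0r.
have Ds (s : bool) x : D ((-1) ^+ s * x) = (-1) ^+ s * D x.
  by case: s; rewrite ?expr1 ?expr0 ?mulN1r ?mul1r.
rewrite /determinant D_sum exchange_big /=; apply: eq_bigr => s _.
rewrite Ds deriv_prod mulr_sumr; apply: eq_bigr => r _; congr (_ * _).
by apply: eq_bigr => i _; rewrite !mxE.
Qed.

End Determinants.

Lemma det_mul_rows (A : comNzRingType) (n : nat) (I : finType)
    (c : 'I_n -> I -> A) (Y : I -> 'I_n -> A) :
  \det (\matrix_(r, i) \sum_k c r k * Y k i : 'M_n) =
  \sum_(f : {ffun 'I_n -> I}) (\prod_r c r (f r)) * \det (\matrix_(r, i) Y (f r) i : 'M_n).
Proof.
rewrite /determinant.
under [RHS]eq_bigr do rewrite mulr_sumr.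
rewrite exchange_big; apply: eq_bigr => s _.
under eq_bigr do rewrite mxE.
rewrite bigA_distr_bigA mulr_sumr; apply: eq_bigr => f _.
rewrite big_split /= mulrCA; congr (_ * (_ * _)).
by apply: eq_bigr => r _; rewrite mxE.
Qed.

(* In the coordinate y of the vectors exp (y e) u_0 of a d-dimensional
   irreducible module, a traceless matrix x acts by the differential operator
   dcoef x * d/dy + (d - 1) * dweight x. *)
Section DifferentialOperators.
Variables (K : fieldType) (n : nat).
Implicit Type x : 'M[K]_2.

Definition dcoef x (i : 'I_n) : {mpoly K[n]} :=
  (x 0 1)%:MP + (x 0 0 *+ 2)%:MP * 'X_i - (x 1 0)%:MP * 'X_i ^+ 2.

Definition dweight x (i : 'I_n) : {mpoly K[n]} :=
  (x 1 0)%:MP * 'X_i - (x 0 0)%:MP.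

End DifferentialOperators.

(* Linear functionals on the tensor product of evaluation modules are encoded by
   polynomials in the coordinates y_i of the vectors (x) exp (y_i e) u_0. *)

Section TensorFunctional.
Variables (R : realType) (n : nat) (a : 'I_n -> nat) (z : 'I_n -> R[i]).
Notation C := R[i].
Implicit Types (G : {mpoly C[n]}) (u : tensor R a) (J : multi_index a) (x : 'M[C]_2).

Definition mindex_mnm J : 'X_{1..n} := [multinom nat_of_ord (J i) | i < n].

(** Since e^k u_0 = u_k, a functional with generating polynomial [G] takes the value J! times the
    coefficient of y^J on the basis tensor u_J; this explains the factorials. *)
Definition pairing G u : C :=
  \sum_(J : multi_index a) (\prod_i ((J i)`!)%:R) * G@_(mindex_mnm J) * u J.

Definition vf x k G : {mpoly C[n]} :=
  \sum_i (z i ^+ k) *: (dcoef x i * G^`M(i) + (a i).-1%:R *: (dweight x i * G)).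

Lemma mcoeff_mulXi G i m :
  ('X_i * G)@_m = if m i == 0%N then 0 else G@_(m - U_(i))%MM.
Proof.
rewrite mulrC; case: ifP => [/eqP mi|/negbT mi].
  apply/eqP/negPn/negP; rewrite -mcoeff_msupp (perm_mem (msuppMX G U_(i)%MM)).
  by case/mapP=> k _ E; move: mi; rewrite E mnmDE mnm1E eqxx.
by rewrite -[X in _@_X = _](@submK _ U_(i)%MM m) ?lep1mP // addmC mcoeffMX.
Qed.

Lemma mcoeff_euler G i m : ('X_i * G^`M(i))@_m = (m i)%:R * G@_m.
Proof.
rewrite mcoeff_mulXi; case: eqP => [->|/eqP mi]; first by rewrite mul0r.
rewrite mcoeff_deriv submK ?lep1mP // mnmBE mnm1E eqxx subn1 prednK ?lt0n //.
by rewrite mulr_natl.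
Qed.

Definition set_mnm (m : 'X_{1..n}) i l : 'X_{1..n} :=
  [multinom if j == i then l else m j | j < n].

Lemma sum_mindex_one (f : 'X_{1..n} -> C) i J' (l : nat) :
  \sum_(J : multi_index a | [forall j, (j != i) ==> (J' j == J j)])
     (nat_of_ord (J i) == l)%:R * f (mindex_mnm J) =
  if (l < a i)%N then f (set_mnm (mindex_mnm J') i l) else 0.
Proof.
case: ltnP => [la|al]; last first.
  apply: big1 => J _; case: eqP => [E|]; rewrite ?mul0r //.
  by have := ltn_ord (J i); rewrite E ltnNge al.
pose J1 : multi_index a := [ffun j => dfwith J' (Ordinal la) j].
have J1i : J1 i = Ordinal la by rewrite ffunE dfwith_in.
have J1j j : j != i -> J1 j = J' j by move=> ji; rewrite ffunE dfwith_out // eq_sym.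
rewrite (bigD1 J1) /=; last by apply/forallP => j; apply/implyP => /J1j->.
rewrite J1i eqxx mul1r big1 ?addr0.
  congr f; apply/mnmP => j; rewrite !mnmE; case: eqP => [->|/eqP /J1j->] //.
  by rewrite J1i.
move=> J /andP[/forallP H JJ1]; case: eqP => [E|]; rewrite ?mul0r //.
case/eqP: JJ1; apply/ffunP => j; have [->|ji] := eqVneq j i.
  by rewrite J1i; apply: val_inj.
by rewrite J1j //; have := H j; rewrite ji => /eqP.
Qed.

Definition mnm_fact (m : 'X_{1..n}) : C := \prod_i ((m i)`!)%:R.

Lemma mnm_fact_addU m i : mnm_fact (m + U_(i)) = (m i).+1%:R * mnm_fact m.
Proof.
rewrite /mnm_fact (bigD1 i) //= [in RHS](bigD1 i) //= mnmDE mnm1E eqxx addn1 factS.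
rewrite natrM !mulrA; congr (_ * _); apply: eq_bigr => j ji.
by rewrite mnmDE mnm1E eq_sym (negPf ji) addn0.
Qed.

(** The bound on degrees accounts for e killing the top vector u_(a_i - 1): the differential
    operator would produce there the coefficient of y_i ^ a_i, which must be zero. *)
Lemma pairing_act G x k u :
  (forall m i, G@_m != 0 -> (m i < a i)%N) ->
  pairing G (tensor_act z x k u) = pairing (vf x k G) u.
Proof.
move=> Gdeg; rewrite /pairing.
transitivity (\sum_(J' : multi_index a) \sum_i z i ^+ k *
   (\sum_(J : multi_index a | [forall j, (j != i) ==> (J' j == J j)])
      (\prod_i ((J i)`!)%:R) * G@_(mindex_mnm J) * sl2_irr (a i) x (J i) (J' i)) * u J').
  under eq_bigr do rewrite ffunE mulr_sumr.
  rewrite exchange_big [RHS]exchange_big /=; apply: eq_bigr => i _.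
  under eq_bigr do rewrite mulrA mulr_sumr.
  rewrite (exchange_big_dep predT) //=; apply: eq_bigr => J' _.
  rewrite mulr_sumr mulr_suml; apply: eq_big => [J|J _]; last by ring.
  done.
apply: eq_bigr => J' _; rewrite /vf raddf_sum /= mulr_sumr mulr_suml.
apply: eq_bigr => i _; rewrite mcoeffZ; congr (_ * _); rewrite mulrCA; congr (_ * _).
set m := mindex_mnm J'; have mi : m i = J' i by rewrite mnmE.
have mlt : (m i < a i)%N by rewrite mi.
have -> : \prod_i0 ((J' i0)`!)%:R = mnm_fact m by apply: eq_bigr => j _; rewrite mnmE.
have Jf J : \prod_i0 ((J i0)`!)%:R = mnm_fact (mindex_mnm J).
  by apply: eq_bigr => j _; rewrite mnmE.
pose Sl l := \sum_(J : multi_index a | [forall j, (j != i) ==> (J' j == J j)])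
  (nat_of_ord (J i) == l)%:R * (mnm_fact (mindex_mnm J) * G@_(mindex_mnm J)).
have SlE l : Sl l = if (l < a i)%N then mnm_fact (set_mnm m i l) * G@_(set_mnm m i l) else 0.
  exact: (sum_mindex_one (fun m' => mnm_fact m' * G@_m') i J' l).
(* The three terms come from e, h and f, which link the index in the slot [i] to its successor,
   itself and its predecessor. *)
transitivity (x 0 1 * Sl (m i).+1 + x 0 0 * ((m i).*2%:R - (a i).-1%:R) * Sl (m i)
  + x 1 0 * (m i * (a i - m i))%:R * (if m i == 0%N then 0 else Sl (m i).-1)).
  have Jh J : (J i == J' i) = (nat_of_ord (J i) == m i) by rewrite mi.
  rewrite /Sl; have [m0|m0] := eqVneq (m i) 0%N.
    rewrite mulr0 addr0 !mulr_sumr -big_split; apply: eq_bigr => J _ /=.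
    rewrite /sl2_irr !mxE Jf Jh -mi m0 /= mulr0 mulr0 addr0.
    by case: (nat_of_ord (J i) =P 0%N) => [->|_] /=; rewrite ?mulr1n ?mulr0n; ring.
  rewrite !mulr_sumr -!big_split; apply: eq_bigr => J _ /=.
  rewrite /sl2_irr !mxE Jf Jh -!mi.
  have -> : (m i == (J i).+1) = (nat_of_ord (J i) == (m i).-1).
    by rewrite -[X in X == _](prednK (n := m i)) ?lt0n // eqSS eq_sym.
  case: (nat_of_ord (J i) =P m i) => [->|_] /=; rewrite ?mulr1n ?mulr0n; ring.
move: Sl SlE => Sl SlE.
have set0' : set_mnm m i (m i) = m.
  by apply/mnmP => j; rewrite !mnmE; case: eqP => [->|].
have set1' : set_mnm m i (m i).+1 = (m + U_(i))%MM.
  apply/mnmP => j; rewrite mnmDE mnm1E !mnmE eq_sym.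
  by case: eqP => [->|]; rewrite ?addn1 ?addn0.
have S1 : Sl (m i).+1 = mnm_fact m * ((m i).+1%:R * G@_(m + U_(i))).
  rewrite SlE set1' mnm_fact_addU; case: ifP => [_|/negbT ml]; first by ring.
  have -> : G@_(m + U_(i)) = 0; last by rewrite !mulr0.
  apply/eqP; apply: contraNT ml => /(Gdeg _ i).
  by rewrite mnmDE mnm1E eqxx addn1.
have S0 : Sl (m i) = mnm_fact m * G@_m by rewrite SlE mlt set0'.
rewrite S1 S0 /dcoef /dweight.
set d := G^`M(i).
have -> : ((x 0 1)%:MP_[n] + (x 0 0 *+ 2)%:MP_[n] * 'X_i - (x 1 0)%:MP_[n] * 'X_i ^+ 2) * d
    + (a i).-1%:R *: (((x 1 0)%:MP_[n] * 'X_i - (x 0 0)%:MP_[n]) * G)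
  = (x 0 1)%:MP_[n] * d + (x 0 0 *+ 2)%:MP_[n] * ('X_i * d) - (x 1 0)%:MP_[n] * ('X_i * ('X_i * d))
    + ((a i).-1%:R)%:MP_[n] * ((x 1 0)%:MP_[n] * ('X_i * G) - (x 0 0)%:MP_[n] * G).
  by rewrite -mul_mpolyC; ring.
have e2 : ('X_i * d)@_m = (m i)%:R * G@_m by rewrite mcoeff_euler.
have e3 : ('X_i * ('X_i * d))@_m = if m i == 0%N then 0 else ((m - U_(i))%MM i)%:R * G@_(m - U_(i)).
  by rewrite mcoeff_mulXi mcoeff_euler.
rewrite mcoeffD mcoeffB mcoeffD !mcoeffCM mcoeffB !mcoeffCM mcoeff_deriv e2 e3 (mcoeff_mulXi G).
have aE : (a i).-1%:R = (a i)%:R - 1 :> C.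
  by rewrite -subn1 natrB // (leq_trans _ mlt).
rewrite aE; case: eqP => [m0|/eqP m0].
  rewrite -muln2 m0 /=; ring.
have setp : set_mnm m i (m i).-1 = (m - U_(i))%MM.
  apply/mnmP => j; rewrite mnmBE mnm1E !mnmE eq_sym.
  by case: eqP => [->|]; rewrite ?subn1 ?subn0.
have mE : mnm_fact m = (m i)%:R * mnm_fact (m - U_(i)).
  rewrite -[X in mnm_fact X = _](@submK _ U_(i)%MM m) ?lep1mP // mnm_fact_addU mnmBE mnm1E eqxx subn1.
  by rewrite prednK ?lt0n.
have ml : ((m i).-1 < a i)%N by exact: leq_ltn_trans (leq_pred _) mlt.
have -> : Sl (m i).-1 = mnm_fact (m - U_(i)) * G@_(m - U_(i)).
  by rewrite SlE ml setp.
rewrite mE mnmBE mnm1E eqxx -muln2 !natrM natrB ?(ltnW mlt) // natrB ?lt0n //.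
have -> : G@_(m + U_(i)) *+ (m i).+1 = (m i).+1%:R * G@_(m + U_(i)) by rewrite mulr_natl.
have -> : (true : nat)%:R = 1 :> C by [].
ring.
Qed.

End TensorFunctional.

(** * Multiplication by t in Newton bases *)

Section Nodes.
Variables (K : fieldType) (n : nat) (z : 'I_n -> K) (m : nat).
Hypothesis z_inj : injective z.
Implicit Types (s i : 'I_n) (k : nat).

(* Multiplication by t ^ k in the Newton basis (t - z_m) ... (t - z_(s-1)) of
   C[t] / prod_(m <= i < n) (t - z_i). *)
Definition mult_t s i : K :=
  (if (m <= i)%N then z i *+ (s == i) + (s == i.+1 :> nat)%:R else 0).
Fixpoint mult_tn k s i : K :=
  if k is k'.+1 then \sum_j mult_t s j * mult_tn k' j i
  else ((m <= i)%N && (s == i))%:R.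

(* The change of basis from the idempotents, normalised to be unitriangular. *)
Definition newton s i : K :=
  if (i <= s)%N then
    if (m <= i)%N then \prod_(l < n | (i < l <= s)%N) (z i - z l)^-1 else (s == i)%:R
  else 0.

Lemma newton_diag i : newton i i = 1.
Proof.
rewrite /newton leqnn eqxx; case: ifP => // _; apply: big_pred0 => l.
by rewrite ltnNge; case: leqP.
Qed.

Lemma newtonS s i (s' : 'I_n) : (m <= i)%N -> (i < s)%N -> s = s'.+1 :> nat ->
  newton s' i = (z i - z s) * newton s i.
Proof.
move=> mi lt sE; have i_s' : (i <= s')%N by rewrite -ltnS -sE.
rewrite /newton mi i_s' (ltnW lt) [in RHS](bigD1 s) /= ?lt ?leqnn //.
rewrite mulrA divff ?mul1r; last first.
  by rewrite subr_eq0; apply: contraTneq lt => /z_inj ->; rewrite ltnn.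
apply: eq_bigl => l; rewrite sE.
have -> : (l != s) = (l != s'.+1 :> nat) by rewrite -sE.
by lia.
Qed.

(** The columns of [newton] are eigenvectors of multiplication by t, being multiples of the
    idempotents at the nodes. In coordinates this is the recursion [newtonS] between consecutive
    rows. *)
Lemma mult_t_newton s i :
  \sum_j mult_t s j * newton j i = newton s i * (if (m <= i)%N then z i else 0).
Proof.
have [mi|im] := leqP m i; last first.
  rewrite mulr0; apply: big1 => j _; rewrite /mult_t; case: ifP => mj; last by rewrite mul0r.
  rewrite /newton; case: ifP => ij; rewrite ?mulr0 // leqNgt im /=.
  have -> : (j == i) = false by apply/eqP => E; move: mj im; rewrite E leqNgt => /negP.
  by rewrite mulr0.
have diag : \sum_(j < n | j == s) mult_t s j * newton j i = z s * newton s i.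
  rewrite big_pred1_eq /mult_t eqxx.
  have -> : (s == s.+1 :> nat) = false by apply/eqP; lia.
  rewrite addr0 mulr1n; case: leqP => // sm.
  by rewrite mul0r /newton leqNgt (leq_trans sm mi) mulr0.
rewrite (bigID (fun j => j == s)) /= {}diag.
have [s0|s0] := posnP s.
  rewrite big1 ?addr0 => [|j js]; last first.
    rewrite /mult_t [s == j]eq_sym (negPf js) s0 mulr0n add0r; case: ifP => //; by rewrite mul0r.
  have [->|si] := eqVneq s i; first by rewrite mulrC.
  have -> : newton s i = 0; last by rewrite mulr0 mul0r.
  rewrite /newton s0 leqn0; case: eqP => // i0.
  by case/eqP: si; apply: val_inj; rewrite /= s0 i0.
have s1n : (s.-1 < n)%N by rewrite (leq_ltn_trans (leq_pred _)).
rewrite (bigD1 (Ordinal s1n)) /=; last by apply/eqP => /(congr1 val) /=; lia.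
rewrite big1 ?addr0 => [|j /andP[js js1]]; last first.
  rewrite /mult_t [s == j]eq_sym (negPf js) mulr0n add0r.
  have -> : (s == j.+1 :> nat) = false.
    by apply/eqP => E; case/eqP: js1; apply: val_inj; rewrite /= E.
  by case: ifP; rewrite mul0r.
rewrite /mult_t /= prednK // eqxx.
have -> : (s == Ordinal s1n) = false by apply/eqP => /(congr1 val) /=; lia.
rewrite mulr0n add0r.
have [lt|gt] := ltnP i s.
  have -> : (m <= s.-1)%N by rewrite (leq_trans mi) // -ltnS prednK.
  by rewrite (@newtonS s i (Ordinal s1n)) //= ?prednK //; ring.
have -> : newton (Ordinal s1n) i = 0.
  by rewrite /newton /= leqNgt prednK // gt.
rewrite mulr0 addr0; have [/val_inj->|si] := eqVneq (s : nat) i; first by rewrite mulrC.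
have -> : newton s i = 0; last by rewrite mulr0 mul0r.
by rewrite /newton leqNgt ltn_neqAle si gt.
Qed.

Lemma mult_tn_newton k s i :
  \sum_j mult_tn k s j * newton j i = newton s i * (if (m <= i)%N then z i ^+ k else 0).
Proof.
elim: k s => [|k IH] s /=.
  rewrite (bigD1 s) //= big1 ?addr0 => [|j js]; last by rewrite [s == j]eq_sym (negPf js) andbF mul0r.
  rewrite eqxx andbT expr0 mulrC /newton.
  case: (leqP i s) => [is'|]; last by rewrite !mul0r.
  case: (leqP m i) => mi; first by rewrite (leq_trans mi is').
  by rewrite mulr0; case: eqP => [->|]; rewrite ?mul0r // leqNgt mi mulr0.
under eq_bigr do rewrite mulr_suml.
rewrite exchange_big /=.
under eq_bigr do (under eq_bigr do rewrite -mulrA; rewrite -mulr_sumr IH mulrA).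
rewrite -mulr_suml mult_t_newton -mulrA; congr (_ * _).
by case: ifP; rewrite ?mulr0 // exprS.
Qed.

Lemma mult_t_supp s i : mult_t s i != 0 -> (m <= i)%N /\ (s = i \/ s = i.+1 :> nat).
Proof.
rewrite /mult_t; case: ifP; rewrite ?eqxx // => _ H; split=> //.
have [->|si] := eqVneq s i; first by left.
right; apply/eqP; move: H; rewrite (negPf si) mulr0n add0r.
by case: (s == i.+1 :> nat); rewrite ?eqxx.
Qed.

Lemma mult_tn_supp k s i : mult_tn k s i != 0 -> [/\ (m <= i)%N, (i <= s)%N & (s <= i + k)%N].
Proof.
elim: k s => [|k IH] s /=.
  by case: andP => [[mi /eqP->]|_]; rewrite ?eqxx // addn0 leqnn.
move=> H; have [|/existsNP[j /eqP Hj]] := pselect (forall j, mult_t s j * mult_tn k j i = 0).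
  by move=> E; rewrite big1 ?eqxx in H.
move: Hj; rewrite mulf_eq0 negb_or => /andP[/mult_t_supp[_ Hs] /IH[mi ij jk]].
by split=> //; case: Hs => [->//|->]; lia.
Qed.

(** The extreme diagonal of multiplication by t^k does not see the nodes. It alone survives in the
    associated graded space, where it becomes the shift by k. *)
Lemma mult_tn_top k s i : (m <= i)%N -> s = (i + k)%N :> nat -> mult_tn k s i = 1.
Proof.
move=> mi; elim: k s => [|k IH] s /=.
  by rewrite addn0 mi => /val_inj->; rewrite eqxx.
rewrite addnS => sE; have lt : (i + k < n)%N by rewrite -ltnS -sE ltnS ltnW.
rewrite (bigD1 (Ordinal lt)) //= big1 ?addr0 => [|j js].
  rewrite IH // mulr1 /mult_t /= (leq_trans mi (leq_addr _ _)) sE eqxx.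
  have -> : (s == Ordinal lt) = false by apply/eqP => /(congr1 val) /=; lia.
  by rewrite mulr0n add0r.
apply/eqP; apply: contraTT isT; rewrite mulf_eq0 negb_or => /andP[/mult_t_supp[_ Hs] /mult_tn_supp[_ ij jk]].
case: Hs => [E|E]; first by move: jk; rewrite -E sE; lia.
by case/eqP: js; apply: val_inj => /=; lia.
Qed.

End Nodes.

(* The block b occupies the indices i >= st b, where 1 + #{b | st b <= i} is the
   dimension a_i.  To it belong 2n x n matrices, whose rows (true, r), (false, r)
   are the coordinates with respect to e t^r, f t^r in C^2 (x) C[t]/t^n; an
   element I of idx selects n rows for each block. *)

Section Blocks.
Variables (n s : nat) (st : 'I_s -> nat).

Definition row_idx : finType := (bool * 'I_n)%type.
Definition idx : finType := {ffun 'I_s * 'I_n -> row_idx}.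
Definition upd (I : idx) p q : idx := [ffun p' => if p' == p then q else I p'].

Section Minors.
Variable A : comNzRingType.
Implicit Types (Y : 'I_s -> row_idx -> 'I_n -> A) (I : idx).

Definition minor Y I b : 'M[A]_n := \matrix_(r, i) Y b (I (b, r)) i.
Definition minors Y I : A := \prod_b \det (minor Y I b).

Lemma minors_upd Y I b r (c : row_idx -> A) (N : 'M[A]_n) :
  (forall i, N r i = \sum_q c q * Y b q i) ->
  \det (set_row (minor Y I b) N r) * \prod_(b' | b' != b) \det (minor Y I b') =
  \sum_q c q * minors Y (upd I (b, r) q).
Proof.
move=> NE; rewrite (det_set_row_sum (minor Y I b) (c := c) (Y := fun q => \matrix_(_, i) Y b q i)); last first.
  by move=> i; rewrite NE; apply: eq_bigr => q _; rewrite mxE.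
rewrite mulr_suml; apply: eq_bigr => q _; rewrite -mulrA; congr (_ * _).
rewrite /minors [in RHS](bigD1 b) //=; congr (_ * _).
  congr (\det _); apply/matrixP => k i; rewrite !mxE ffunE xpair_eqE eqxx /=.
  by case: ifP.
apply: eq_bigr => b' bb'; congr (\det _); apply/matrixP => k i; rewrite !mxE ffunE.
by rewrite xpair_eqE (negPf bb').
Qed.

End Minors.

Section Generic.
Variables (K : fieldType) (z : 'I_n -> K).
Hypothesis z_inj : injective z.

Definition bit (e : bool) : 'I_2 := if e then 0 else 1.

(** Column [i] is the vector f + X_i e at the node z_i, written in the Newton basis of the block, if
    [st b <= i], and f t^i otherwise. *)
Definition gen_row (b : 'I_s) (q : row_idx) (i : 'I_n) : {mpoly K[n]} :=
  (newton z (st b) q.2 i)%:MP *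
    (if q.1 then (if (st b <= i)%N then 'X_i else 0) else 1).

Definition gen_minors := minors gen_row.

Definition act_coef (x : 'M[K]_2) k b (q q' : row_idx) : K :=
  x (bit q.1) (bit q'.1) * mult_tn z (st b) k q.2 q'.2.

(** As a_i - 1 counts the blocks with [st b <= i], the weight term of the operator is distributed
    over the blocks. Each factor then carries the operator of the two-dimensional module on every
    active column, and the Leibniz rule on determinants makes it a row operation. *)
Lemma vf_gen_minors (a : 'I_n -> nat) (x : 'M[K]_2) k (I : idx) :
  (forall i, (a i).-1 = (\sum_b (st b <= i))%N) -> x 1 1 = - x 0 0 ->
  \sum_i (z i ^+ k) *: (dcoef x i * (gen_minors I)^`M(i) + (a i).-1%:R *: (dweight x i * gen_minors I))
  = \sum_b \sum_r \sum_q (act_coef x k b (I (b, r)) q) *: gen_minors (upd I (b, r) q).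
Proof.
move=> aE x11.
pose D (G : {mpoly K[n]}) := \sum_i (z i ^+ k) *: (dcoef x i * G^`M(i)).
have D_sum (J : finType) (F : J -> {mpoly K[n]}) : D (\sum_j F j) = \sum_j D (F j).
  rewrite /D [RHS]exchange_big; apply: eq_bigr => i _.
  by rewrite raddf_sum mulr_sumr scaler_sumr.
have D_mul u v : D (u * v) = D u * v + u * D v.
  rewrite /D mulr_suml mulr_sumr -big_split; apply: eq_bigr => i _.
  by rewrite mderivM /= -!mul_mpolyC; ring.
pose w b (i : 'I_n) : {mpoly K[n]} := if (st b <= i)%N then (z i ^+ k) *: dweight x i else 0.
have -> : \sum_i (z i ^+ k) *: (dcoef x i * (gen_minors I)^`M(i) + (a i).-1%:R *: (dweight x i * gen_minors I))
   = D (gen_minors I) + (\sum_b \sum_i w b i) * gen_minors I.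
  rewrite /D exchange_big mulr_suml -big_split; apply: eq_bigr => i _ /=.
  rewrite scalerDr; congr (_ + _).
  have -> : \sum_b w b i = (a i).-1%:R *: ((z i ^+ k) *: dweight x i).
    rewrite aE natr_sum scaler_suml; apply: eq_bigr => b _; rewrite /w.
    by case: ifP; rewrite ?scale1r ?scale0r.
  by rewrite -!mul_mpolyC; ring.
rewrite /gen_minors /minors deriv_prod //.
have prodE b : \prod_i (if i == b then D (\det (minor gen_row I i)) else \det (minor gen_row I i))
    = D (\det (minor gen_row I b)) * \prod_(i | i != b) \det (minor gen_row I i).
  rewrite (bigD1 b) //= eqxx; congr (_ * _); apply: eq_bigr => i /negPf->//.
rewrite (eq_bigr _ (fun b _ => prodE b)).
rewrite mulr_suml -big_split; apply: eq_bigr => b _ /=.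
rewrite [X in _ + _ * X](bigD1 b) //= mulrA -mulrDl (deriv_det D_sum D_mul).
rewrite -(sum_det_mul_diag (minor gen_row I b) (w b)) -big_split mulr_suml.
apply: eq_bigr => r _ /=.
set M := minor gen_row I b.
pose N : 'M[{mpoly K[n]}]_n := \matrix_(r, i) (D (M r i) + M r i * w b i).
have -> : \det (set_row M (map_mx D M) r) + \det (set_row M (\matrix_(k0, i) (M k0 i * w b i)) r) =
   \det (set_row M N r).
  rewrite !det_set_row -big_split; apply: eq_bigr => i _ /=.
  by rewrite -mulrDl !mxE.
(* Applied to the entries (X_i, 1) of an active column, the quadratic terms cancel and the matrix
   [x] acting on (X_i, 1) remains; the factor z_i^k becomes multiplication by t^k through the
   eigenvector property. *)
have rowE i : N r i = \sum_q (act_coef x k b (I (b, r)) q)%:MP * gen_row b q i.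
  rewrite /N !mxE; case: (I (b, r)) => e t; rewrite /act_coef /=.
  rewrite -(pair_bigA _ (fun e' t' => (x (bit e) (bit e') * mult_tn z (st b) k t t')%:MP * gen_row b (e', t') i)) /=.
  have inner e' : \sum_t' (x (bit e) (bit e') * mult_tn z (st b) k t t')%:MP * gen_row b (e', t') i =
     (x (bit e) (bit e') * (newton z (st b) t i * (if (st b <= i)%N then z i ^+ k else 0)))%:MP *
      (if e' then (if (st b <= i)%N then 'X_i else 0) else 1).
    rewrite -(mult_tn_newton (st b) z_inj) mulr_sumr raddf_sum mulr_suml.
    by apply: eq_bigr => t' _; rewrite /gen_row /= !mpolyCM; ring.
  rewrite big_bool !inner /=.
  have DX (G : {mpoly K[n]}) : (forall j, j != i -> G^`M(j) = 0) -> D G = (z i ^+ k) *: (dcoef x i * G^`M(i)).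
    move=> H; rewrite /D (bigD1 i) //= big1 ?addr0 // => j ji.
    by rewrite H // mulr0 scaler0.
  rewrite /w /gen_row /=; have [sti|sti] := leqP (st b) i; last first.
    rewrite !mulr0 !mpolyC0 !mul0r !addr0 DX.
      by case: (e); rewrite ?mulr0 ?mulr1 ?mderiv0 ?mderivC ?mulr0 ?scaler0.
    by move=> j _; case: (e); rewrite ?mulr0 ?mulr1 ?mderiv0 ?mderivC.
  rewrite DX; last first.
    move=> j ji; case: (e); rewrite ?mulr1 ?mderivC // mderiv_mulC mderivX mnm1E.
    by rewrite eq_sym (negPf ji) scale0r mulr0.
  case: (e); rewrite /bit /= ?mulr1.
    have dX : ('X_i : {mpoly K[n]})^`M(i) = 1.
      rewrite mderivX mnm1E eqxx scale1r -mpolyX0; congr 'X_[_].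
      by apply/mnmP => j; rewrite mnmBE subnn mnm0E.
    rewrite mderiv_mulC dX /dcoef /dweight.
    by rewrite -!mul_mpolyC !mpolyCM; ring.
  rewrite mderivC mulr0 scaler0 add0r /dweight x11 -!mul_mpolyC !mpolyCM mpolyCN; ring.
rewrite (minors_upd I rowE); apply: eq_bigr => q _.
by rewrite mul_mpolyC.
Qed.

End Generic.
End Blocks.

Section Degrees.
Variables (K : fieldType) (n : nat).
Implicit Types (G H : {mpoly K[n]}) (i : 'I_n) (d e : nat).

Definition deg_le i d G := forall m, G@_m != 0 -> (m i <= d)%N.

Lemma deg_le_sum (J : finType) (F : J -> {mpoly K[n]}) i d :
  (forall j, deg_le i d (F j)) -> deg_le i d (\sum_j F j).
Proof.
move=> H m; rewrite raddf_sum /= => Hm.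
have [|/existsNP[j /eqP]] := pselect (forall j, (F j)@_m = 0); last exact: H.
by move=> E; rewrite big1 ?eqxx in Hm.
Qed.

Lemma deg_leM i d e G H : deg_le i d G -> deg_le i e H -> deg_le i (d + e) (G * H).
Proof.
move=> Gd He m; rewrite -mcoeff_msupp => /msuppM_le /allpairsP[[m1 m2] /= [h1 h2 ->]].
by rewrite mnmDE leq_add // ?Gd ?He // -mcoeff_msupp.
Qed.

Lemma deg_le_prod (J : finType) (F : J -> {mpoly K[n]}) (d : J -> nat) i :
  (forall j, deg_le i (d j) (F j)) -> deg_le i (\sum_j d j)%N (\prod_j F j).
Proof.
move=> H; apply: (big_ind2 (fun G e => deg_le i e G)) => //.
  by move=> m; rewrite mcoeff1; case: (m =P 0%MM) => [->|_]; rewrite ?mnm0E ?eqxx.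
by move=> *; exact: deg_leM.
Qed.

Lemma deg_leC i d c : deg_le i d c%:MP.
Proof. by move=> m; rewrite mcoeffC; case: (m =P 0%MM) => [->|_]; rewrite ?mnm0E // mulr0 eqxx. Qed.

End Degrees.

Section VectorFacts.
Variable K : fieldType.

Lemma set_span_mem (V : vectType K) (S : set V) (W : {vspace V}) u :
  (forall v, S v -> v \in W) -> u \in set_span S -> u \in W.
Proof. by move=> H; move: u; apply/subvP; exact: set_span_least. Qed.

Lemma big_nonzero (A : nmodType) (J : finType) (F : J -> A) :
  \sum_j F j != 0 -> exists j, F j != 0.
Proof.
move=> H; apply: contrapT => E; case/eqP: H; apply: big1 => j _.
by apply/eqP; apply: contrapT => /negP Fj; apply: E; exists j.
Qed.

End VectorFacts.

Section Fusion.
Variables (R : realType) (n s : nat) (st : 'I_s -> nat) (a : 'I_n -> nat) (z : 'I_n -> R[i]).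
Hypothesis z_inj : injective z.
Hypothesis aE : forall i, a i = ((\sum_b (st b <= i))%N).+1.
Notation C := R[i].
Notation idx := (idx n s).
Implicit Types (I : idx) (x : 'M[C]_2) (k : nat) (u : tensor R a).

(** In one block X_i occurs in a single column, and only if [st b <= i]. The total is a_i - 1,
    exactly what [pairing_act] requires. *)
Lemma gen_minors_deg I (i : 'I_n) : deg_le i (\sum_b (st b <= i))%N (gen_minors st z I).
Proof.
apply: deg_le_prod => b; apply: deg_le_sum => /= sg; move: sg => sg; set p : 'S_n := sg.
rewrite -[X in deg_le _ X]add0n; apply: deg_leM.
  rewrite -[(-1) ^+ _]/((-1) ^+ _ : {mpoly C[n]}) -mpolyC1 -mpolyCN -rmorphXn /=.
  exact: deg_leC.
have -> : ((st b <= i) = \sum_r ((p r == i) && (st b <= i)) :> nat)%N.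
  rewrite (bigD1 ((p^-1)%g i)) //= permKV eqxx /= big1 ?addn0 // => r ri.
  by case: eqP => // E; case/eqP: ri; rewrite -E permK.
apply: deg_le_prod => r; rewrite mxE /gen_row; case: (I (b, r)) => e t /=.
case: e; last by rewrite mulr1; exact: deg_leC.
have [sb|_] := leqP (st b) (p r); last by rewrite mulr0 -mpolyC0; exact: deg_leC.
move=> m; rewrite mcoeffCM mcoeffX; case: (U_(p r)%MM =P m) => [<- _|_]; last by rewrite mulr0 eqxx.
rewrite mnm1E; case: eqP => // E; by rewrite -E sb.
Qed.

Definition minor_form I u : C := pairing (gen_minors st z I) u.

Lemma LI_is_linear I : linear (minor_form I : tensor R a -> C^o).
Proof.
move=> c u v; rewrite /minor_form /pairing scaler_sumr -big_split; apply: eq_bigr => J _.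
by rewrite !ffunE /= mulrDr; congr (_ + _); rewrite /GRing.scale /=; ring.
Qed.
HB.instance Definition _ I := GRing.isLinear.Build C (tensor R a) C^o _ (minor_form I) (LI_is_linear I).

Lemma tensor_act_is_linear x k : linear (tensor_act (a := a) z x k).
Proof.
move=> c u v; apply/ffunP => J; rewrite !ffunE /GRing.scale /= mulr_sumr -big_split.
apply: eq_bigr => i _ /=; rewrite mulrCA -mulrDr; congr (_ * _).
rewrite mulr_sumr -big_split; apply: eq_bigr => J' _ /=.
by rewrite !ffunE /GRing.scale /=; ring.
Qed.
HB.instance Definition _ x k := GRing.isLinear.Build C (tensor R a) (tensor R a) _
  (tensor_act (a := a) z x k) (tensor_act_is_linear x k).

Lemma LI_act I x k u : x 1 1 = - x 0 0 ->
  minor_form I (tensor_act z x k u) =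
  \sum_b \sum_r \sum_q act_coef st z x k b (I (b, r)) q * minor_form (upd I (b, r) q) u.
Proof.
move=> x11.
have Gdeg m i : (gen_minors st z I)@_m != 0 -> (m i < a i)%N.
  by rewrite aE ltnS; apply: gen_minors_deg.
have E := @pairing_act R n a z (gen_minors st z I) x k u Gdeg.
transitivity (pairing (vf a z x k (gen_minors st z I)) u); first exact: E.
rewrite /minor_form; clear E.
have aE' i : (a i).-1 = (\sum_b (st b <= i))%N by rewrite aE.
have := vf_gen_minors z_inj k I aE' x11; rewrite /vf => ->.
have pairing_sum (J : finType) (F : J -> {mpoly C[n]}) : pairing (\sum_j F j) u = \sum_j pairing (F j) u.
  rewrite /pairing exchange_big; apply: eq_bigr => J' _.
  by rewrite raddf_sum mulr_sumr mulr_suml.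
rewrite pairing_sum; apply: eq_bigr => b _; rewrite pairing_sum; apply: eq_bigr => r _.
rewrite pairing_sum; apply: eq_bigr => q _; rewrite /pairing mulr_sumr.
by apply: eq_bigr => J _; rewrite mcoeffZ; ring.
Qed.

Definition low_row (b : 'I_s) (q : row_idx n) (i : 'I_n) : C := (~~ q.1 && (q.2 == i))%:R.

(** Pairing with the lowest vector extracts the constant term, that is, sets every X_i to 0. The
    remaining matrix of rows of f differs from [low_row] by the unitriangular matrix [newton], of
    determinant 1. *)
Lemma LI_low I : minor_form I (tensor_low R a) = minors low_row I.
Proof.
rewrite /minor_form /pairing.
have a0 i : (0 < a i)%N by rewrite aE.
pose J0 : multi_index a := [ffun i => Ordinal (a0 i)].
have J0E (J : multi_index a) : tensor_low R a J = (J == J0)%:R.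
  rewrite ffunE; congr (nat_of_bool _)%:R; apply/forallP/eqP => [H|-> i]; last by rewrite ffunE.
  by apply/ffunP => i; apply: val_inj; rewrite ffunE; apply/eqP/H.
rewrite (bigD1 J0) //= [X in _ + X]big1 ?addr0 => [|J JJ0]; last by rewrite J0E (negPf JJ0) mulr0.
rewrite J0E eqxx mulr1 big1 ?mul1r => [|i _]; last by rewrite ffunE.
have -> : mindex_mnm J0 = 0%MM by apply/mnmP => i; rewrite mnm0E mnmE ffunE.
rewrite /gen_minors /minors rmorph_prod; apply: eq_bigr => b _ /=.
rewrite -det_map_mx /=.
set N : 'M[C]_n := \matrix_(r, i) newton z (st b) r i.
have N1 : \det N = 1.
  rewrite det_trig; last first.
    by apply/is_trig_mxP => i j ij; rewrite mxE /newton leqNgt ij.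
  by apply: big1 => i _; rewrite mxE newton_diag.
rewrite -[RHS]mulr1 -N1 -det_mulmx; congr (\det _); apply/matrixP => r i; rewrite !mxE.
under eq_bigr do rewrite !mxE.
rewrite /gen_row /low_row; case: (I (b, r)) => e t /=.
case: e => /=.
  rewrite big1 => [|j _]; last by rewrite mul0r.
  by case: ifP => _; rewrite ?mulr0 ?mcoeff0 // mcoeffCM mcoeffX; case: (U_(i)%MM =P 0%MM) => [/(congr1 (fun m : 'X_{1..n} => m i))|_]; rewrite ?mnm1E ?mnm0E ?eqxx ?mulr0.
rewrite (bigD1 t) //= eqxx mul1r big1 ?addr0 => [|j jt].
  by rewrite mulr1 mcoeffC eqxx mulr1.
by rewrite eq_sym (negPf jt) mul0r.
Qed.

End Fusion.

Section Combinatorics.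

Lemma sum_le_prod_succ (c : nat -> nat) n : (forall i, (0 < c i)%N) ->
  (\sum_(i < n) c i <= \prod_(i < n) (c i).+1)%N.
Proof.
move=> c0; elim: n => [|n IH]; first by rewrite !big_ord0.
rewrite !big_ord_recr /= mulnS leq_add //; apply: leq_pmull.
by apply: prodn_gt0 => i.
Qed.

(** With c_i = a_i - 1, this keeps the degrees reached by nonzero minors within the range up to \dim
    V allotted to [graded]. *)
Lemma sum_weight_le_prod (c : nat -> nat) n : (forall i, (0 < c i)%N) ->
  (\sum_(i < n) (n.-1 - i) * c i <= \prod_(i < n) (c i).+1)%N.
Proof.
move=> c0; elim: n => [|n IH]; first by rewrite !big_ord0.
rewrite !big_ord_recr /= subnn mul0n addn0 mulnS.
have -> : (\sum_(i < n) (n - i) * c i = \sum_(i < n) (n.-1 - i) * c i + \sum_(i < n) c i)%N.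
  rewrite -big_split; apply: eq_bigr => i _ /=.
  by have := ltn_ord i; case: (n) i => [[]//|m] i; rewrite /= ltnS => im; rewrite subSn // mulSn addnC.
rewrite leq_add // (leq_trans (sum_le_prod_succ n c0)) // leq_pmulr //.
Qed.

End Combinatorics.

(** * Functionals on the fusion product *)

Section Fusion.
Variables (R : realType) (n s : nat) (st : 'I_s -> nat) (a : 'I_n -> nat) (z : 'I_n -> R[i]).
Hypothesis z_inj : injective z.
Hypothesis aE : forall i, a i = ((\sum_b (st b <= i))%N).+1.
Hypothesis st0 : exists b, st b = 0%N.
Notation C := R[i].
Notation idx := (idx n s).
Notation V := (tensor R a).
Notation dimV := (\dim {:V}).
Notation LI := (minor_form st z).
Implicit Types (I : idx) (x : 'M[C]_2) (k m : nat) (u : V).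

Definition wt I : nat := \sum_p (I p).2.
Definition wt0 : nat := \sum_(p : 'I_s * 'I_n) p.2.

Lemma sum_pairE (A B : finType) (f : A * B -> nat) : (\sum_p f p = \sum_b \sum_r f (b, r))%N.
Proof. by rewrite pair_bigA; apply: eq_bigr => -[]. Qed.

Lemma wt_upd I p q : (wt (upd I p q) + (I p).2 = wt I + q.2)%N.
Proof.
rewrite /wt (bigD1 p) //= [in RHS](bigD1 p) //= ffunE eqxx.
have -> : (\sum_(p' | p' != p) (upd I p q p').2 = \sum_(p' | p' != p) (I p').2)%N.
  by apply: eq_bigr => p' /negPf pp'; rewrite ffunE pp'.
by rewrite addnAC [RHS]addnAC [(q.2 + (I p).2)%N]addnC.
Qed.

Lemma wt_minors_low I : minors (@low_row R n s) I != 0 -> wt I = wt0.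
Proof.
rewrite /minors => /prodf_neq0 H.
have main b : exists p : 'S_n, forall r, (I (b, r)).2 = p r.
  have := H b isT; rewrite /determinant => /big_nonzero[/= sg].
  rewrite mulf_eq0 negb_or => /andP[_ /prodf_neq0 nz]; exists sg => r.
  by have := nz r isT; rewrite mxE /low_row; case: ((I (b, r)).2 =P sg r) => [->|_] //; rewrite andbF eqxx.
have [p pE] := choice main.
rewrite /wt /wt0 !sum_pairE.
apply: eq_bigr => b _ /=; rewrite [RHS](reindex_inj (@perm_inj _ (p b))) /=.
by apply: eq_bigr => r _; rewrite pE.
Qed.

Lemma dim_tensor : dimV = (\prod_i a i)%N.
Proof.
rewrite dimvf.
have -> : dim V = (#|multi_index a| * 1)%N by [].
rewrite muln1 card_dep_ffun.
have -> : [seq #|'I_(a x)| | x : 'I_n] = [seq a x | x : 'I_n].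
  by apply: eq_map => i; rewrite card_ord.
by rewrite foldrE big_map big_enum.
Qed.

(** In a nonzero term of a determinant, a row placed in column i < st b has exponent at most i, and
    any other row at most n - 1. Summing the excesses n - 1 - i over the active columns gives the
    bound. *)
Lemma wt_gen_minors I : gen_minors st z I != 0 -> (wt I <= wt0 + dimV)%N.
Proof.
rewrite /gen_minors /minors => /prodf_neq0 H.
have main b : exists p : 'S_n, forall r, ((I (b, r)).2 <= p r + (st b <= p r) * (n.-1 - p r))%N.
  have := H b isT; rewrite /determinant => /big_nonzero[/= sg].
  rewrite mulf_eq0 negb_or => /andP[_ /prodf_neq0 nz]; exists sg => r.
  have := nz r isT; rewrite mxE /gen_row.
  have [sb|sb] := leqP (st b) (sg r).
    move=> _; rewrite /= mul1n; have := ltn_ord (I (b, r)).2; have := ltn_ord (sg r).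
    by move: (nat_of_ord (sg r)) (nat_of_ord (I (b, r)).2) => t1 t2; lia.
  rewrite /newton leqNgt [(st b <= _)%N]leqNgt sb /= addn0.
  have [lt|ge] := ltnP (I (b, r)).2 (sg r); first by rewrite ltnW.
  by case: ((I (b, r)).2 =P sg r) => [->|_]; rewrite ?mpolyC0 ?mul0r ?eqxx // leqnn.
have [p pE] := choice main.
rewrite /wt /wt0 !sum_pairE /=.
apply: (@leq_trans (\sum_(b < s) \sum_(r < n) (p b r + (st b <= p b r) * (n.-1 - p b r)))).
  by apply: leq_sum => b _; apply: leq_sum => r _.
have -> : (\sum_(b < s) \sum_(r < n) (p b r + (st b <= p b r) * (n.-1 - p b r)) =
   \sum_(b < s) \sum_(r < n) r + \sum_(b < s) \sum_(r < n) (st b <= r) * (n.-1 - r))%N.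
  rewrite -big_split; apply: eq_bigr => b _ /=.
  by rewrite -big_split /= [RHS](reindex_inj (@perm_inj _ (p b))).
rewrite leq_add2l exchange_big dim_tensor.
pose c i := (\sum_b (st b <= i))%N.
have c0 i : (0 < c i)%N by case: st0 => b sb; rewrite /c (bigD1 b) //= sb.
rewrite (eq_bigr (fun i : 'I_n => (n.-1 - i) * c i)%N); last first.
  by move=> i _; rewrite /c big_distrr /=; apply: eq_bigr => b _; rewrite mulnC.
by rewrite [X in (_ <= X)%N](eq_bigr (fun i : 'I_n => (c i).+1)) ?sum_weight_le_prod.
Qed.

Lemma act_coef_supp x k b q q' : act_coef st z x k b q q' != 0 ->
  [/\ (st b <= q'.2)%N, (q'.2 <= q.2)%N & (q.2 <= q'.2 + k)%N].
Proof. by rewrite /act_coef mulf_eq0 negb_or => /andP[_ /mult_tn_supp]. Qed.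

Lemma tr_mx2 x : \tr x = 0 -> x 1 1 = - x 0 0.
Proof. by rewrite /mxtrace !big_ord_recl big_ord0 addr0 => /eqP; rewrite addrC addr_eq0 => /eqP <-; congr (x _ _); apply: val_inj. Qed.

Lemma LI_word w I : (forall xk, xk \in w -> \tr xk.1 = 0) -> LI I (word_act a z w) != 0 ->
  (wt0 <= wt I <= wt0 + sumn [seq xk.2 | xk <- w])%N.
Proof.
elim: w I => [|[x k] w IH] I wP.
  by rewrite /= LI_low // => /wt_minors_low->; rewrite addn0 leqnn.
have trx : \tr x = 0 by apply: (wP (x, k)); rewrite mem_head.
rewrite [word_act _ _ _]/= (LI_act z_inj aE _ _ _ (tr_mx2 trx)).
case/big_nonzero=> b /big_nonzero[r] /big_nonzero[q].
rewrite mulf_eq0 negb_or => /andP[/act_coef_supp[_ h1 h2] nz].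
have wP' xk : xk \in w -> \tr xk.1 = 0 by move=> h; apply: wP; rewrite in_cons h orbT.
have /andP[g1 g2] := IH _ wP' nz; rewrite [sumn _]/=.
move: g1 g2 (wt_upd I (b, r) q) h1 h2; move: (wt (upd _ _ _)) (wt I) (sumn _) => U W S1; lia.
Qed.

Lemma LI_fil m I u : u \in fil a z m -> LI I u != 0 -> (wt0 <= wt I <= wt0 + m)%N.
Proof.
move=> um; apply: contraTT => nw; rewrite negbK.
have -> : (LI I u == 0) = (u \in lker (linfun (LI I : V -> C^o))) by rewrite memv_ker lfunE.
apply: (set_span_mem _ um) => _ [w [wP wm ->]]; rewrite memv_ker lfunE /=.
apply: contraNT nw => /(LI_word wP) /andP[-> h] /=; by rewrite (leq_trans h) // leq_add2l.
Qed.

Lemma fil_mono m m' : (m <= m')%N -> (fil a z m <= fil a z m')%VS.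
Proof.
move=> mm; apply: set_span_least => _ [w [wP wm ->]]; apply: set_span_ub.
by exists w; split=> //; exact: leq_trans wm mm.
Qed.

Lemma fil_act x k m u : \tr x = 0 -> u \in fil a z m -> tensor_act z x k u \in fil a z (m + k).
Proof.
move=> trx um.
have -> : tensor_act z x k u = linfun (tensor_act (a := a) z x k) u by rewrite lfunE.
rewrite memv_preim; apply: (set_span_mem _ um) => _ [w [wP wm ->]].
rewrite -memv_preim lfunE /=; apply: set_span_ub; exists ((x, k) :: w); split=> //=.
  by move=> xk; rewrite in_cons => /orP[/eqP->|/wP].
by rewrite addnC leq_add2r.
Qed.

Lemma fil_low : tensor_low R a \in fil a z 0.
Proof. by apply: set_span_ub; exists [::]. Qed.

Definition fil_pred m : {vspace V} := if m is m'.+1 then fil a z m' else 0%VS.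

Lemma symbolE m u : symbol a z m u = u - projv (fil_pred m) u.
Proof. by rewrite /symbol add_lfunE opp_lfunE id_lfunE. Qed.

Lemma fil_pred_sub m : (fil_pred m <= fil a z m)%VS.
Proof. by case: m => [|m] /=; [exact: sub0v | exact: fil_mono]. Qed.

Lemma symbol_fil m u : u \in fil a z m -> symbol a z m u \in fil a z m.
Proof.
move=> um; rewrite symbolE rpredB //.
exact: (subvP (fil_pred_sub m)) (memv_proj _ _).
Qed.

(** A functional of weight [wt0 + m] vanishes on V^(m-1), so it factors through the quotient in
    degree m. *)
Lemma LI_symbol m I u : wt I = (wt0 + m)%N -> LI I (symbol a z m u) = LI I u.
Proof.
move=> wI; rewrite symbolE [LHS]linearB /=.
suff /eqP-> : LI I (projv (fil_pred m) u) == 0 by rewrite subr0.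
apply: contraTT isT; case: m wI => [|m] wI.
  have : projv (fil_pred 0) u \in 0%VS := memv_proj _ _.
  by rewrite memv0 => /eqP->; rewrite [LI I 0]linear0 eqxx.
move/(LI_fil (memv_proj (fil a z m) u)); lia.
Qed.

Lemma grP (v : graded R a) : reflect (forall m : 'I_(dimV).+1, v m \in (symbol a z m @: fil a z m)%VS) (v \in gr a z).
Proof.
apply: (iffP idP) => [vg m|H]; last exact: set_span_ub.
pose f (v : graded R a) : V := v m.
have f_lin : linear f by move=> c v1 v2; rewrite /f !ffunE.
pose fL : {linear graded R a -> V} := HB.pack f (GRing.isLinear.Build C (graded R a) V _ f f_lin).
have -> : v m = linfun fL v by rewrite lfunE.
rewrite memv_preim; apply: (set_span_mem _ vg) => w /(_ m) wm.
by rewrite -memv_preim lfunE.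
Qed.

Lemma gr_fil (v : graded R a) (m : 'I_(dimV).+1) : v \in gr a z -> v m \in fil a z m.
Proof. by move/grP/(_ m)/memv_imgP=> [w wm ->]; exact: symbol_fil. Qed.

Definition comp (u : fusion a z) d : V := if (d <= dimV)%N then vsval u (inord d) else 0.

Lemma comp_fil (u : fusion a z) d : comp u d \in fil a z d.
Proof.
rewrite /comp; case: leqP => dV; last exact: mem0v.
by have := gr_fil (inord d) (subvsP u); rewrite inordK.
Qed.

Lemma gr_low : [ffun m : 'I_(dimV).+1 => if m == 0%N :> nat then tensor_low R a else 0] \in gr a z.
Proof.
apply/grP => m; rewrite ffunE; case: eqP => [->|_]; last exact: mem0v.
apply/memv_imgP; exists (tensor_low R a); first exact: fil_low.
rewrite symbolE /=; have : projv 0%VS (tensor_low R a) \in 0%VS := memv_proj _ _.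
by rewrite memv0 => /eqP->; rewrite subr0.
Qed.

Definition fusion_act_fun x k (u : fusion a z) : fusion a z := vsproj (gr a z)
  [ffun m : 'I_(dimV).+1 => if (k <= m)%N
       then symbol a z m (tensor_act z x k (vsval u (inord (m - k)))) else 0].

Lemma fusion_act_is_linear x k : linear (fusion_act_fun x k).
Proof.
move=> c u v; rewrite /fusion_act_fun -linearP; congr vsproj; apply/ffunP => m.
rewrite !ffunE; case: ifP => _; last by rewrite scaler0 addr0.
have E (u1 v1 : V) : symbol a z m (tensor_act z x k (c *: u1 + v1)) =
    c *: symbol a z m (tensor_act z x k u1) + symbol a z m (tensor_act z x k v1).
  by rewrite (@tensor_act_is_linear R n a z x k c) linearP.
exact: (E (vsval u (inord (m - k))) (vsval v (inord (m - k)))).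
Qed.

Lemma fusion_actE x k (u : fusion a z) : fusion_act a z x k u = fusion_act_fun x k u.
Proof.
pose fL : {linear fusion a z -> fusion a z} := HB.pack (fusion_act_fun x k)
  (GRing.isLinear.Build C (fusion a z) (fusion a z) _ (fusion_act_fun x k) (fusion_act_is_linear x k)).
exact: (lfunE fL).
Qed.

Lemma comp_act x k (u : fusion a z) d : \tr x = 0 ->
  comp (fusion_act a z x k u) d =
  if (d <= dimV)%N && (k <= d)%N then symbol a z d (tensor_act z x k (comp u (d - k))) else 0.
Proof.
move=> trx; rewrite /comp; case: leqP => //= dV.
rewrite fusion_actE vsprojK; last first.
  apply/grP => m; rewrite ffunE; case: leqP => km; last exact: mem0v.
  apply: memv_img; rewrite -[X in fil a z X](subnK km); apply: fil_act => //.
  by have := gr_fil (inord (m - k)) (subvsP u); rewrite inordK // ltnS (leq_trans (leq_subr _ _)) // -ltnS.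
by rewrite ffunE inordK //; case: ifP => // kd; rewrite (leq_trans (leq_subr _ _)).
Qed.

Definition ell I (u : fusion a z) : C :=
  if (wt0 <= wt I)%N then LI I (comp u (wt I - wt0)) else 0.

Lemma ell_is_linear I : linear (ell I : fusion a z -> C^o).
Proof.
move=> c u v; rewrite /ell; case: ifP => _; last by rewrite scaler0 addr0.
rewrite -linearP; congr LI; rewrite /comp; case: ifP => _; last by rewrite scaler0 addr0.
by rewrite linearP !ffunE.
Qed.
HB.instance Definition _ I := GRing.isLinear.Build C (fusion a z) C^o _ (ell I) (ell_is_linear I).

Lemma ell_low I : ell I (fusion_low a z) = minors (@low_row R n s) I.
Proof.
have vlow : vsval (fusion_low a z) = [ffun m : 'I_(dimV).+1 => if m == 0%N :> nat then tensor_low R a else 0].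
  by rewrite /fusion_low vsprojK //; exact: gr_low.
have [w0|w0] := eqVneq (wt I) wt0.
  by rewrite /ell w0 leqnn subnn /comp leq0n vlow ffunE inordK // LI_low.
transitivity (0 : C); last by apply/esym/eqP; apply: contraNT w0 => /wt_minors_low->.
rewrite /ell; case: leqP => // w1; rewrite /comp; case: leqP => w2; last by rewrite [LI I 0]linear0.
rewrite vlow ffunE inordK //; case: eqP => [E|_]; last by rewrite [LI I 0]linear0.
by case/eqP: w0; lia.
Qed.

Definition shift_coef x k (b : 'I_s) (q q' : row_idx n) : C :=
  x (bit q.1) (bit q'.1) * ((st b <= q'.2)%N && (q.2 == q'.2 + k :> nat)%N)%:R.

(** The action of t^k lowers the weight by at most k, while functionals of weight above
    [wt0 + d - k] vanish on V^(d-k). Hence only the terms lowering the weight by exactly k survive,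
    and by [mult_tn_top] their coefficients are independent of the nodes. *)
Lemma ell_act I x k (u : fusion a z) : \tr x = 0 ->
  ell I (fusion_act a z x k u) =
  \sum_b \sum_r \sum_q shift_coef x k b (I (b, r)) q * ell (upd I (b, r) q) u.
Proof.
move=> trx.
have small : (wt I < wt0 + k)%N -> \sum_b \sum_r \sum_q shift_coef x k b (I (b, r)) q * ell (upd I (b, r) q) u = 0.
  move=> wk; apply: big1 => b _; apply: big1 => r _; apply: big1 => q _.
  rewrite /shift_coef; case: andP => [[_ /eqP E]|_]; last by rewrite mulr0 mul0r.
  rewrite /ell; have := wt_upd I (b, r) q; rewrite E => H.
  by case: leqP => // ?; first lia; rewrite mulr0.
have [wk|kw] := ltnP (wt I) (wt0 + k).
  rewrite small // /ell; case: leqP => // w0; rewrite comp_act //.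
  by case: andP => [[_ h]|_]; [lia | rewrite [LI I 0]linear0].
have w0 : (wt0 <= wt I)%N by lia.
pose d := (wt I - wt0)%N; have kd : (k <= d)%N by rewrite /d; lia.
pose w := comp u (d - k).
transitivity (LI I (tensor_act z x k w)).
  rewrite /ell w0 comp_act // -/d kd andbT -/w; case: leqP => dV.
    by rewrite LI_symbol // /d subnKC.
  (* Degrees above \dim V, cut off in [graded], lose nothing: the minor is then the zero
     polynomial. *)
  rewrite [LI I 0]linear0; have -> : gen_minors st z I = 0 -> 0 = LI I (tensor_act z x k w).
  - by move=> E; rewrite /minor_form E /pairing; apply/esym/big1 => J _; rewrite mcoeff0 mulr0 mul0r.
  - by [].
  by apply/eqP; apply: contraTT dV => /wt_gen_minors; rewrite -leqNgt /d; lia.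
rewrite (LI_act z_inj aE _ _ _ (tr_mx2 trx)).
apply: eq_bigr => b _; apply: eq_bigr => r _; apply: eq_bigr => q _.
rewrite /shift_coef; have wu := wt_upd I (b, r) q.
have [/andP[sb /eqP E]|nE] := boolP ((st b <= q.2)%N && ((I (b, r)).2 == q.2 + k :> nat)%N).
  rewrite /act_coef mult_tn_top // /ell; have -> : (wt0 <= wt (upd I (b, r) q))%N by lia.
  by rewrite /w /d; congr (_ * LI _ (comp _ _)); lia.
rewrite mulr0 mul0r; apply/eqP; apply: contraNT nE; rewrite mulf_eq0 negb_or.
move=> /andP[/act_coef_supp[h1 h2 h3] /(LI_fil (comp_fil _ _)) /andP[g1 g2]].
rewrite h1 /=; apply/eqP; move: wu g1 g2 h2 h3 kw; rewrite /d.
by move: (wt (upd _ _ _)) (wt I) wt0 (nat_of_ord (I (b, r)).2) (nat_of_ord q.2) => U W w1 t1 t2; lia.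
Qed.

End Fusion.

(** * Enough functionals on the fusion product *)

(** At least \dim V independent functionals span the dual space; the matrix of their values on a
    basis is square and invertible. *)
Lemma joint_kernel0 (K : fieldType) (V : vectType K) (L : Type) (l : L -> {linear V -> K^o})
    (J : finType) (t : J -> L) : (\dim {:V} <= #|J|)%N ->
  (forall c : J -> K, (forall u, \sum_j c j * l (t j) u = 0) -> forall j, c j = 0) ->
  forall u, (forall i, l i u = 0) -> u = 0.
Proof.
move=> dV indep u lu.
pose A : 'M[K]_(\dim {:V}, #|J|) := \matrix_(k, j) l (t (enum_val j)) (vbasis {:V})`_k.
have coordE (v : V) : v = \sum_k coord (vbasis {:V}) k v *: (vbasis {:V})`_k.
  exact: coord_vbasis (memvf v).
have free_AT : row_free A^T.
  apply: inj_row_free => c cA.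
  have H j : c 0 (enum_rank j) = 0.
    apply: (indep (fun j => c 0 (enum_rank j))) => v.
    rewrite (coordE v) (eq_bigr (fun j => \sum_k coord (vbasis {:V}) k v * (c 0 (enum_rank j) * l (t j) (vbasis {:V})`_k))).
      rewrite exchange_big big1 // => k _ /=; rewrite -mulr_sumr.
      have := congr1 (fun M : 'rV_(\dim {:V}) => M 0 k) cA; rewrite !mxE => E.
      rewrite [X in _ * X](_ : _ = 0) ?mulr0 // -[RHS]E.
      rewrite [RHS](reindex (@enum_rank J)); last exact/onW_bij/enum_rank_bij.
      by apply: eq_bigr => i _; rewrite !mxE enum_rankK.
    move=> i _; rewrite linear_sum mulr_sumr; apply: eq_bigr => k _.
    by rewrite linearZ /=; rewrite /GRing.scale /= mulrCA.
  by apply/rowP => j; rewrite -(enum_valK j) H mxE.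
have rA : row_free A.
  rewrite /row_free eqn_leq rank_leq_row /= (leq_trans dV) //.
  by move: free_AT; rewrite /row_free mxrank_tr => /eqP->.
have : (\row_k coord (vbasis {:V}) k u) *m A = 0.
  apply/rowP => j; rewrite !mxE -[RHS](lu (t (enum_val j))) [in RHS](coordE u) linear_sum.
  by apply: eq_bigr => k _; rewrite !mxE linearZ.
move/eqP; rewrite -[X in _ == X](mul0mx _ A) (inj_eq (row_free_inj rA)) => /eqP E.
rewrite (coordE u) big1 // => k _.
by have := congr1 (fun M : 'rV_(\dim {:V}) => M 0 k) E; rewrite !mxE => ->; rewrite scale0r.
Qed.

Section Independence.
Variables (n s : nat).
Notation idx := (idx n s).
Implicit Types (st : 'I_s -> nat) (I : idx).

Section Rows.
Variable A : comNzRingType.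
Implicit Types p q : nat -> A.

(** With p and q the coefficient sequences of the e and f components of g f, column [i] is t^i g f
    if [st b <= i] and t^i f otherwise, truncated at t^n. *)
Definition frame_row st p q b (k : row_idx n) (i : 'I_n) : A :=
  if (st b <= i)%N then (if (i <= k.2)%N then (if k.1 then p else q) (k.2 - i)%N else 0)
  else (~~ k.1 && (k.2 == i))%:R.

Definition one_seq (j : nat) : A := (j == 0%N)%:R.
Definition scons x p (j : nat) : A := if j is j'.+1 then p j' else x.
End Rows.

Lemma minors_map (A B : comNzRingType) (f : {rmorphism A -> B}) (Y : 'I_s -> row_idx n -> 'I_n -> A) I :
  minors (fun b k i => f (Y b k i)) I = f (minors Y I).
Proof.
rewrite rmorph_prod; apply: eq_bigr => b _; rewrite -det_map_mx; congr (\det _).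
by apply/matrixP => r i; rewrite !mxE.
Qed.

Lemma eq_minors (A : comNzRingType) (Y Y' : 'I_s -> row_idx n -> 'I_n -> A) I :
  (forall b r i, Y b (I (b, r)) i = Y' b (I (b, r)) i) -> minors Y I = minors Y' I.
Proof.
by move=> H; apply: eq_bigr => b _; congr (\det _); apply/matrixP => r i; rewrite !mxE H.
Qed.

Lemma one_rowE (A : comNzRingType) st (p : nat -> A) b (k : row_idx n) (i : 'I_n) : frame_row st p (one_seq A) b k i =
  if k.1 then (if (st b <= i <= k.2)%N then p (k.2 - i)%N else 0) else (k.2 == i)%:R.
Proof.
rewrite /frame_row; case: leqP => si /=; last by case: k => -[].
case: leqP => ik /=; first by case: k.1 => //; rewrite /one_seq subn_eq0 -val_eqE eqn_leq /= ik andbT.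
by case: k.1 => //; rewrite -val_eqE /= ltn_eqF.
Qed.

End Independence.

Section Count.
Variables (m s : nat).
Notation n := m.+1.
Notation idx := (idx n s).
Implicit Types (st : 'I_s -> nat) (I : idx).
Variable K : closedFieldType.
Implicit Type p : nat -> K.
Notation F st p I := (minors (frame_row st p (one_seq K)) I).

Definition above_starts st I := forall b (r : 'I_n),
  if (r < st b)%N then I (b, r) = (false, r) else (st b <= (I (b, r)).2)%N.

Definition start_incr st q b := if b == q then (st b).+1 else st b.
Definition start_incr_all st b := if (st b < n)%N then (st b).+1 else st b.

(** The row e t^(st q) of the block [q] has a single nonzero entry, the constant term of p;
    exchanging f t^(st q) for it multiplies the minor by that term. *)
Definition extend_e st q I : idx :=
  [ffun k => if k == (q, inord (st q)) then (true, inord (st q)) else I k].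
(** Undoes a division of p by t: the rows of e keep their exponents, those of f lose one, and the
    vacated slot receives f t^(n-1), which meets the last column. *)
Definition extend_f st I : idx := [ffun k : 'I_s * 'I_n =>
  if (k.2 < st k.1)%N then I k
  else if k.2 == st k.1 :> nat then (false, ord_max)
  else if (I k).1 then I k else (false, inord (I k).2.-1)].

Lemma det_scaled_row (A : comNzRingType) (d : nat) (M N : 'M[A]_d) r0 x :
  (forall i, N r0 i = (r0 == i)%:R) -> (forall i, M r0 i = x * (r0 == i)%:R) ->
  (forall r i, r != r0 -> i != r0 -> M r i = N r i) -> \det M = x * \det N.
Proof.
move=> HN HM E; rewrite (expand_det_row M r0) (expand_det_row N r0) mulr_sumr.
apply: eq_bigr => i _; rewrite HN HM mulrA; have [<-|ne] := eqVneq r0 i; last by rewrite !(mulr0, mul0r).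
rewrite /cofactor !mulrA; congr (_ * \det _); apply/matrixP => k l; rewrite !mxE.
by apply: E; rewrite eq_sym neq_lift.
Qed.

Lemma F_extend_e st q I p : (st q < n)%N -> above_starts (start_incr st q) I ->
  F st p (extend_e st q I) = p 0%N * F (start_incr st q) p I.
Proof.
move=> sq gI; rewrite /minors (bigD1 q) //= [in RHS](bigD1 q) //= mulrA.
congr (_ * _); last first.
  apply: eq_bigr => b bq; congr (\det _); apply/matrixP => r i.
  by rewrite !mxE ffunE xpair_eqE (negPf bq) !one_rowE /start_incr (negPf bq).
pose r0 : 'I_n := inord (st q); have r0E : r0 = st q :> nat by rewrite inordK.
have gq r := gI q r; rewrite /start_incr eqxx in gq.
apply: (@det_scaled_row _ _ _ _ r0) => [i|i|r i rr ir]; rewrite !mxE ?ffunE ?eqxx one_rowE /start_incr ?eqxx.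
- by have := gq r0; rewrite r0E ltnSn => ->.
- rewrite -/r0 /= r0E -eqn_leq -val_eqE /= r0E; case: eqP => [<-|_]; last by rewrite mulr0.
  by rewrite subnn mulr1.
rewrite xpair_eqE eqxx -/r0 /= (negPf rr) one_rowE eqxx; case: (I (q, r)).1 => //.
by rewrite (ltn_neqAle (st q)) -r0E eq_sym val_eqE ir.
Qed.

Lemma above_starts_extend_e st q I : (st q < n)%N -> above_starts (start_incr st q) I -> above_starts st (extend_e st q I).
Proof.
move=> sq gI b r; have := gI b r; rewrite ffunE xpair_eqE /start_incr.
have [->|bq] := eqVneq b q => //=; rewrite -val_eqE /= inordK //.
by rewrite ltnS; case: (ltngtP (r : nat) (st q)) => [lt|lt|rE] //=; [exact: ltnW | rewrite inordK].
Qed.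

Lemma above_starts_extend_f st I : above_starts (start_incr_all st) I -> above_starts st (extend_f st I).
Proof.
move=> gI b r; have := gI b r; rewrite ffunE /start_incr_all /=.
have [rs|rs] := ltnP r (st b).
  by have -> : (r < if (st b < n)%N then (st b).+1 else st b)%N by case: ifP => _; rewrite ?ltnS ?(ltnW rs).
have sn : (st b < n)%N by apply: leq_ltn_trans rs _.
have [E|ne] := eqVneq (r : nat) (st b); first by rewrite /= -ltnS.
rewrite sn ltnS leqNgt ltn_neqAle eq_sym ne rs /= => h; case: ifP => _; first exact: ltnW.
by have := ltn_ord (I (b, r)).2; move: h; move: (I (b, r)).2 => t h tm; rewrite /= inordK; lia.
Qed.

Definition rot_from (t : nat) (i : 'I_n) : 'I_n :=
  if (i < t)%N then i else if (i == m :> nat) then inord t else inord i.+1.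

Lemma rot_from_inj t : injective (rot_from t).
Proof.
move=> i j /(congr1 val) /=; rewrite /rot_from; have := ltn_ord i; have := ltn_ord j.
move=> hj hi H; apply: val_inj => /=; move: H.
case: ltnP => h1; case: ltnP => h2 //; do 2?[case: eqP => ?]; rewrite ?inordK //; lia.
Qed.

(** Replacing p by t p moves the entries of the e rows to the neighbouring column. The two matrices
    agree after a cyclic rotation of the columns from [st b] on, whence the sign [w], which depends
    on [st] alone. *)
Lemma F_extend_f st : exists2 w : K, w != 0 & forall I p, above_starts (start_incr_all st) I ->
  F st (scons 0 p) (extend_f st I) = w * F (start_incr_all st) p I.
Proof.
pose sg b : 'S_n := if (st b < n)%N then perm (@rot_from_inj (st b)) else 1%g.
exists (\prod_b (-1) ^+ (sg b)^-1%g); first by apply/prodf_neq0 => b _; rewrite signr_eq0.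
move=> I p gI; rewrite /minors -big_split; apply: eq_bigr => b _ /=.
rewrite -det_perm mulrC -det_mulmx -col_permE.
congr (\det _); apply/matrixP => r i; have gr := gI b r.
rewrite !mxE !one_rowE ffunE /start_incr_all /sg /=.
have [sn|sn] := ltnP (st b) n; last first.
  have lt (k : 'I_n) : (k < st b)%N := leq_trans (ltn_ord k) sn.
  by rewrite perm1 lt leqNgt lt.
have im := ltn_ord i; have rm := ltn_ord r.
rewrite permE /rot_from; rewrite /start_incr_all sn in gr.
have [rs|rs] := ltnP r (st b).
  move: gr; rewrite ltnS (ltnW rs) => -> /=; rewrite -!val_eqE; case: ltnP => // si.
  by case: ifP => [/eqP iE|/eqP ne]; rewrite /= inordK; do ?lia; congr (nat_of_bool _)%:R; lia.
have [rE|rE] := eqVneq (r : nat) (st b).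
  move: gr; rewrite rE leqnn => -> /=; rewrite -!val_eqE /=; case: ltnP => // si.
    by rewrite rE [LHS](_ : _ = 0); first rewrite [RHS](_ : _ = 0) //; case: eqP => //; lia.
  by case: ifP => [/eqP iE|/eqP ne]; rewrite /= inordK; do ?lia; congr (nat_of_bool _)%:R; lia.
move: gr; have -> : (r < (st b).+1)%N = false by lia.
case: (I (b, r)) => -[] t /= gt; have tm := ltn_ord t.
  case: (ltnP i (st b)) => si.
    by do 2?[case: andP => [[]|] //]; lia.
  case: eqP => [iE|ne]; rewrite inordK; do ?lia.
    have -> : (st b < st b)%N = false by lia.
    case: andP => [[_ it]|] //.
    have -> : (t - i)%N = 0%N by lia.
    by [].
  rewrite ltnS si /=; case: (ltngtP i t) => [lt|//|->]; last by rewrite subnn.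
  by rewrite subnS; have -> : (t - i)%N = (t - i).-1.+1 by lia.
rewrite -!val_eqE /= inordK; last lia.
case: (ltnP i (st b)) => si; first by do 2?[case: eqP => //]; lia.
by case: (eqP (x := i : nat)) => [iE|ne]; rewrite /= inordK; do ?lia; do 2?[case: eqP => //]; lia.
Qed.

Lemma polynomial_F st p I : exists P : {poly K}, forall x, F st (scons x p) I = P.[x].
Proof.
exists (minors (frame_row st (scons 'X (polyC \o p)) (one_seq _)) I) => x.
rewrite -[RHS]/(horner_eval x _) -minors_map; apply: eq_minors => b r i.
rewrite !one_rowE; case: ifP => _; last by case: eqP; rewrite ?rmorph1 ?rmorph0.
case: ifP => _; last by rewrite rmorph0.
by case: (_ - _)%N => [|k] /=; rewrite /horner_eval ?hornerX ?hornerC.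
Qed.

(** With c_i the number of starts up to i, raising all starts shifts the c_i and drops the last
    factor c_m + 1, while raising only [st q] lowers one factor by 1. By maximality of [st q], that
    factor also equals c_m + 1, so the products add up. *)
Lemma start_count st q : (st q < n)%N -> (forall b, (st b < n)%N -> (st b <= st q)%N) ->
  (\prod_(i < n) (\sum_b (start_incr_all st b <= i)).+1 +
   \prod_(i < n) (\sum_b (start_incr st q b <= i)).+1 = \prod_(i < n) (\sum_b (st b <= i)).+1)%N.
Proof.
move=> sq qmax; pose c i := (\sum_b (st b <= i))%N.
have c1 i : (st q <= i < n)%N -> c i = c m.
  move=> /andP[si im]; apply: eq_bigr => b _; congr nat_of_bool.
  by have := qmax b; case: (ltnP (st b) n) => [h /(_ isT)|h _]; lia.
pose r0 : 'I_n := inord (st q); have r0E : r0 = st q :> nat by rewrite inordK.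
have E1 : (\prod_(i < n) (\sum_b (start_incr_all st b <= i)).+1 = \prod_(i < m) (c i).+1)%N.
  rewrite big_ord_recl /= big1 ?mul1n => [|b _]; last by rewrite /start_incr_all; case: ifP => //; case: (st b).
  apply: eq_bigr => i _; congr _.+1; apply: eq_bigr => b _; congr nat_of_bool.
  by rewrite /bump leq0n add1n /start_incr_all; have := ltn_ord i; case: (ltnP (st b) n) => h im; rewrite ?ltnS //; move: (nat_of_ord i) (st b) h im => i' t h im; lia.
have E2 : (\prod_(i < n) (\sum_b (start_incr st q b <= i)).+1 = c m * \prod_(i < n | i != r0) (c i).+1)%N.
  rewrite (bigD1 r0) //=; congr (_ * _)%N.
    rewrite -(c1 (st q)) ?leqnn ?sq // -r0E /c [RHS](bigD1 q) //= (bigD1 q) //= /start_incr eqxx r0E ltnn leqnn.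
    by rewrite add1n; congr _.+1; apply: eq_bigr => b /negPf->.
  apply: eq_bigr => i ir; congr _.+1; rewrite /c [RHS](bigD1 q) //= (bigD1 q) //= /start_incr eqxx.
  rewrite (ltn_neqAle (st q)) -r0E eq_sym val_eqE ir; congr (_ + _)%N.
  by apply: eq_bigr => b /negPf->.
have E3 : (\prod_(i < n) (c i).+1 = (c m).+1 * \prod_(i < m) (c i).+1)%N.
  by rewrite big_ord_recr mulnC.
have E4 : (\prod_(i < n | i != r0) (c i).+1 = \prod_(i < m) (c i).+1)%N.
  have E5 : (\prod_(i < n) (c i).+1 = (c r0).+1 * \prod_(i < n | i != r0) (c i).+1)%N by exact: bigD1.
  by apply/eqP; rewrite -(eqn_pmul2l (ltn0Sn (c m))) -E3 E5 c1 // r0E leqnn sq.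
by rewrite E1 E2 E3 E4 mulSn.
Qed.

(** The minors, as functions of p, are filtered by divisibility by the constant term p_0. Modulo p_0
    they give minors for all starts raised; the multiples of p_0 give minors for one start raised.
    Independent families for these two cases lift to one whose size is the sum. *)
Lemma independent_family st : exists (J : finType) (t : J -> idx),
  [/\ #|J| = (\prod_(i < n) (\sum_b (st b <= i)).+1)%N, forall j, above_starts st (t j) &
      forall c : J -> K, (forall p, \sum_j c j * F st p (t j) = 0) -> forall j, c j = 0].
Proof.
have [N] := ubnP (\sum_b (n - st b))%N; elim: N st => // N IH st; rewrite ltnS => stN.
have [[q0 sq0]|nst] := pselect (exists b, (st b < n)%N); last first.
  have stn b : (n <= st b)%N by rewrite leqNgt; apply/negP => h; apply: nst; exists b.
  have lt b (r : 'I_n) : (r < st b)%N := leq_trans (ltn_ord r) (stn b).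
  exists unit, (fun _ => [ffun k => (false, k.2)]); split.
  - rewrite card_unit big1 // => i _; rewrite big1 // => b _; by rewrite leqNgt lt.
  - by move=> _ b r; rewrite ffunE lt.
  move=> c /(_ (one_seq K)); rewrite (big_pred1 tt) => [|[]//].
  rewrite /minors big1 ?mulr1 => [c0 []//|b _].
  rewrite -[RHS](det1 K n); congr (\det _); apply/matrixP => r i; rewrite !mxE one_rowE ffunE //=.
(* The count of the two smaller families is right only for a maximal start below n. *)
have [q sq qmax] := @arg_maxnP _ q0 (fun b => st b < n)%N st sq0.
have stlt st' : (forall b, st b <= st' b)%N -> (st q < st' q)%N -> (\sum_b (n - st' b) < N)%N.
  move=> le lt; apply: leq_trans stN; rewrite (bigD1 q) // [X in (_ < X)%N](bigD1 q) //=.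
  by rewrite -addSn leq_add //; [lia | apply: leq_sum => b _; apply: leq_sub2l].
have [|J1 [t1 [card1 good1 ind1]]] := IH (start_incr_all st).
  by apply: stlt => [b|]; rewrite /start_incr_all ?sq //; case: ifP.
have [|J2 [t2 [card2 good2 ind2]]] := IH (start_incr st q).
  by apply: stlt => [b|]; rewrite /start_incr ?eqxx //; case: ifP.
have [w w0 wE] := F_extend_f st.
exists (J1 + J2)%type, (fun j => match j with inl j => extend_f st (t1 j) | inr j => extend_e st q (t2 j) end).
split.
- by rewrite card_sum card1 card2 start_count.
- by move=> [j|j]; [exact: above_starts_extend_f | exact: above_starts_extend_e].
move=> c H'.
have H p : \sum_j c (inl j) * F st p (extend_f st (t1 j)) + \sum_j c (inr j) * F st p (extend_e st q (t2 j)) = 0.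
  by rewrite -[RHS](H' p) big_sumType.
(* Setting p_0 = 0 kills the second family and turns the first into independent functions, up to the
   nonzero factor [w]. *)
have c1 j : c (inl j) = 0.
  apply: (ind1 (fun j => c (inl j))) => p; have := H (scons 0 p).
  rewrite [X in _ + X]big1 => [|j' _]; last by rewrite F_extend_e //= mul0r mulr0.
  under eq_bigr do rewrite wE // mulrCA.
  by rewrite -mulr_sumr addr0 => /eqP; rewrite mulf_eq0 (negPf w0) => /eqP.
move=> [j|j] //; apply: (ind2 (fun j => c (inr j))) => p.
have [P PE] := choice (fun j => polynomial_F (start_incr st q) (p \o succn) (t2 j)).
pose Q := \sum_j c (inr j) *: P j.
have QE x : Q.[x] = \sum_j c (inr j) * F (start_incr st q) (scons x (p \o succn)) (t2 j).
  by rewrite horner_sum; apply: eq_bigr => j' _; rewrite hornerZ PE.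
(* The remaining relation is p_0 times a polynomial in p_0. The factor p_0 is cancelled in the
   polynomial ring, so that the value p_0 = 0 is covered too. *)
have XQ x : ('X * Q).[x] = 0.
  rewrite hornerM hornerX QE mulr_sumr -[RHS](H (scons x (p \o succn))).
  rewrite [X in X + _]big1 ?add0r => [|j' _]; last by rewrite c1 mul0r.
  by apply: eq_bigr => j' _; rewrite F_extend_e // mulrCA.
have Q0 : Q = 0.
  apply/eqP; apply: contraT => Q0; have /closed_nonrootP[x] : 'X * Q != 0.
    by rewrite mulf_neq0 ?polyX_eq0.
  by rewrite /root XQ eqxx.
have pE : p = scons (p 0%N) (p \o succn) by apply: funext => -[].
by rewrite pE -QE Q0 horner0.
Qed.

End Count.

(** * Exponentials of sums of square-zero matrices acting in different tensor slots *)

Section Tensors.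
Variables P Q : finType.
Notation ix := {ffun P -> Q}.
Definition fupd (I : ix) p q : ix := [ffun p' => if p' == p then q else I p'].

Section Comm.
Variable A : comNzRingType.
Implicit Types (g h : P -> Q -> Q -> A) (F : ix -> A) (I : ix).

Definition tens g F I : A := \sum_(I' : ix) (\prod_p g p (I p) (I' p)) * F I'.

Lemma tens_mul g h F I :
  tens g (tens h F) I = tens (fun p k l => \sum_q g p k q * h p q l) F I.
Proof.
rewrite /tens; under eq_bigr do rewrite mulr_sumr.
rewrite exchange_big; apply: eq_bigr => I' _ /=.
rewrite bigA_distr_bigA mulr_suml; apply: eq_bigr => J _.
by rewrite big_split mulrA.
Qed.

Lemma eq_tens g h F F' I : (forall p k l, g p k l = h p k l) -> (forall J, F J = F' J) ->
  tens g F I = tens h F' I.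
Proof.
move=> gh FF; apply: eq_bigr => I' _; rewrite FF; congr (_ * _).
by apply: eq_bigr => p _.
Qed.

Lemma tens_fupd g F I p (c : Q -> A) :
  \sum_q c q * tens g F (fupd I p q) =
  \sum_(I' : ix) (\sum_q c q * g p q (I' p)) * (\prod_(p' | p' != p) g p' (I p') (I' p')) * F I'.
Proof.
under eq_bigr do rewrite mulr_sumr; rewrite exchange_big; apply: eq_bigr => I' _ /=.
rewrite !mulr_suml; apply: eq_bigr => q _; rewrite !mulrA (bigD1 p) //= ffunE eqxx !mulrA.
congr (_ * _ * _); apply: eq_bigr => p' /negPf pp'; by rewrite ffunE pp'.
Qed.
End Comm.

Section Exponential.
Variable K : fieldType.
Hypothesis K0 : [pchar K] =i pred0.
Variable C : P -> Q -> Q -> K.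
Hypothesis CC : forall p k l, \sum_q C p k q * C p q l = 0.
Variable F : nat -> ix -> K.
Hypothesis FS : forall j I, F j.+1 I = \sum_p \sum_q C p (I p) q * F j (fupd I p q).

Let g p k l : {poly K} := (k == l)%:R + C p k l *: 'X.
Let Phi := tens g (fun I => (F 0 I)%:P).

(** Because C^2 = 0, the derivative C of 1 + C X equals C (1 + C X). Thus [Phi] solves the
    differential equation whose coefficient recursion is [FS]. *)
Lemma exp_poly_deriv I : (Phi I)^`() = \sum_p \sum_q C p (I p) q *: Phi (fupd I p q).
Proof.
have -> : (Phi I)^`() = \sum_(I' : ix) (\prod_p g p (I p) (I' p))^`() * (F 0 I')%:P.
  rewrite /Phi /tens raddf_sum; apply: eq_bigr => I' _.
  by rewrite [LHS]derivM derivC mulr0 addr0.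
have dprod I' : (\prod_p g p (I p) (I' p))^`() =
    \sum_p (C p (I p) (I' p))%:P * \prod_(p' | p' != p) g p' (I p') (I' p').
  rewrite (@deriv_prod _ (fun f : {poly K} => f^`())) => [|f f']; last exact: derivM.
  apply: eq_bigr => p _; rewrite (bigD1 p) //= eqxx.
  rewrite /g derivD derivZ derivX -[_%:R^`()]/((_%:R : {poly K})^`()) -polyC_natr derivC add0r -mul_polyC mulr1; congr (_ * _).
  by apply: eq_bigr => p' /negPf->.
under eq_bigr do rewrite dprod mulr_suml.
rewrite exchange_big; apply: eq_bigr => p _ /=.
under [RHS]eq_bigr do rewrite -mul_polyC.
rewrite (tens_fupd g _ I p (fun q => (C p (I p) q)%:P)).
apply: eq_bigr => I' _; congr (_ * _ * _).
under eq_bigr do rewrite /g mulrDr.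
rewrite big_split /= (bigD1 (I' p)) //= eqxx mulr1 big1 ?addr0; last first.
  by move=> q /negPf->; rewrite mulr0.
rewrite [X in _ + X](_ : _ = 0) ?addr0 //.
under eq_bigr do rewrite -mul_polyC mulrA -polyCM.
by rewrite -mulr_suml -rmorph_sum /= CC polyC0 mul0r.
Qed.

Lemma coef_exp_poly j I : (j`!)%:R * (Phi I)`_j = F j I.
Proof.
elim: j I => [|j IH] I.
  rewrite mul1r -horner_coef0 /Phi /tens horner_sum (bigD1 I) //= [X in _ + X]big1 => [|I' II'].
    rewrite addr0 hornerM hornerC horner_prod big1 ?mul1r // => p _.
    by rewrite /g eqxx hornerD hornerZ hornerX mulr0 addr0 hornerC.
  have [p pI] : exists p, I p != I' p.
    apply/existsP; apply: contraR II'; rewrite negb_exists => /forallP H.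
    by apply/eqP/ffunP => p; have := H p; rewrite negbK => /eqP.
  rewrite hornerM horner_prod (bigD1 p) //= /g (negPf pI) hornerD hornerZ hornerX mulr0.
  by rewrite addr0 horner0 !mul0r.
rewrite factS mulnC natrM -mulrA (mulr_natl _ j.+1) -coef_deriv exp_poly_deriv FS.
rewrite coef_sum mulr_sumr; apply: eq_bigr => p _.
rewrite coef_sum mulr_sumr; apply: eq_bigr => q _.
by rewrite coefZ mulrCA IH.
Qed.

Lemma size_exp_poly I : (size (Phi I) <= #|P|.+1)%N.
Proof.
apply: (leq_trans (size_sum _ _ _)); apply/bigmax_leqP => I' _.
rewrite mulrC mul_polyC (leq_trans (size_scale_leq _ _)) //.
apply: (leq_trans (size_prod_leq _ _)).
have H : (\sum_p size (g p (I p) (I' p)) <= \sum_(p : P) 2)%N.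
  apply: leq_sum => p _; rewrite /g -polyC_natr addrC -[_ *: 'X]mul_polyC.
  by rewrite mul_polyC (leq_trans (size_polyD _ _)) // geq_max
    (leq_trans (size_scale_leq _ _)) ?size_polyX // (leq_trans (size_polyC_leq1 _)).
move: H; rewrite sum_nat_const => H.
by rewrite leq_subLR (leq_trans (n := (#|P| * 2).+1)) // ?ltnS // muln2 -addnn addnS.
Qed.

Lemma exp_nilpotent j I : (#|P| < j)%N -> F j I = 0.
Proof.
by move=> jP; rewrite -coef_exp_poly (leq_sizeP _ _ (size_exp_poly I)) ?mulr0.
Qed.

Lemma tens_exp N I : (#|P| <= N)%N ->
  \sum_(j < N.+1) (j`!)%:R^-1 * F j I = tens (fun p k l => (k == l)%:R + C p k l) (F 0) I.
Proof.
move=> PN; have fact0 j : (j`!)%:R != 0 :> K.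
  by rewrite ((pcharf0P K).1 K0) -lt0n fact_gt0.
transitivity (Phi I).[1].
  rewrite (horner_coef_wide _ (leq_trans (size_exp_poly I) (_ : _ <= N.+1)%N)) ?ltnS //.
  by apply: eq_bigr => j _; rewrite expr1n mulr1 -coef_exp_poly mulKf.
rewrite /Phi /tens horner_sum; apply: eq_bigr => I' _.
rewrite hornerM hornerC horner_prod; congr (_ * _); apply: eq_bigr => p _.
by rewrite /g hornerD hornerZ hornerX mulr1 -polyC_natr hornerC.
Qed.
End Exponential.
End Tensors.

Lemma tens_minors n s (A : comNzRingType) (g : 'I_s -> row_idx n -> row_idx n -> A)
    (Y : 'I_s -> row_idx n -> 'I_n -> A) I :
  tens (fun p => g p.1) (minors Y) I = minors (fun b k i => \sum_q g b k q * Y b q i) I.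
Proof.
rewrite /minors.
under [RHS]eq_bigr => b _.
  rewrite [X in \det X](_ : _ = \matrix_(r, i) \sum_q g b (I (b, r)) q * Y b q i); last first.
    by apply/matrixP => r i; rewrite !mxE.
  rewrite (det_mul_rows (fun r q => g b (I (b, r)) q) (Y b)).
  over.
rewrite bigA_distr_bigA /=.
pose h (I' : idx n s) : {ffun 'I_s -> {ffun 'I_n -> row_idx n}} := [ffun b => [ffun r => I' (b, r)]].
have hK : bijective h.
  exists (fun f : {ffun 'I_s -> {ffun 'I_n -> row_idx n}} => [ffun p : 'I_s * 'I_n => f p.1 p.2]) => [I'|f]; first by apply/ffunP => -[b r]; rewrite !ffunE.
  by apply/ffunP => b; apply/ffunP => r; rewrite !ffunE.
rewrite (reindex h) /=; last exact: onW_bij.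
apply: eq_bigr => I' _; rewrite big_split /=; congr (_ * _).
  rewrite (eq_bigr (fun p => g p.1 (I (p.1, p.2)) (I' (p.1, p.2)))) => [|[]//].
  rewrite -(pair_bigA _ (fun b r => g b (I (b, r)) (I' (b, r)))) /=.
  by apply: eq_bigr => b _; apply: eq_bigr => r _; rewrite !ffunE.
apply: eq_bigr => b _; congr (\det _); apply/matrixP => r i; by rewrite !mxE !ffunE.
Qed.

Section Nilpotent.
Variables (K : fieldType) (V : vectType K) (N : 'End(V)).

Lemma iter_comp_lfunE k u : iter k (comp_lfun N) \1%VF u = iter k N u.
Proof. by elim: k => [|k IH]; rewrite /= ?id_lfunE // comp_lfunE IH. Qed.

(** The images of the powers decrease strictly until they vanish, since a repeated image would stay
    constant. This validates the truncation in [nilp_exp]. *)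
Lemma nilpotent_dim m : (forall u, iter m N u = 0) -> forall k u, (\dim {:V} <= k)%N -> iter k N u = 0.
Proof.
move=> Nm; pose W j := (iter j (comp_lfun N) \1%VF @: {:V})%VS.
have WS j : W j.+1 = (N @: W j)%VS by rewrite /W /= limg_comp.
have Wmono j : (W j.+1 <= W j)%VS.
  by elim: j => [|j IH]; [rewrite /W /= lim1g subvf | rewrite WS [X in (_ <= X)%VS]WS limgS].
have Wdim j : (\dim (W j) <= \dim {:V} - j)%N.
  elim: j => [|j IH]; first by rewrite subn0 dimvS ?subvf.
  have [W0|W0] := eqVneq (W j) 0%VS; first by rewrite WS W0 limg0 dimv0.
  suff : (\dim (W j.+1) < \dim (W j))%N by move: IH; rewrite -dimv_eq0 in W0; lia.
  rewrite ltnNge; apply: contra W0 => le; have E : W j.+1 = W j by apply/eqP; rewrite eqEdim le Wmono.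
  have Ek k : W (j + k)%N = W j by elim: k => [|k IHk]; rewrite ?addn0 // addnS WS IHk -WS.
  rewrite -(Ek m) -subv0; apply/subvP => _ /memv_imgP[u _ ->]; rewrite iter_comp_lfunE.
  have iter0 i : iter i N 0 = 0 by elim: i => //= i ->; rewrite linear0.
  by rewrite memv0 iterD Nm iter0.
move=> k u dk; have := memv_img (iter k (comp_lfun N) \1%VF) (memvf u); rewrite -/(W k).
have := Wdim k; rewrite (eqP (_ : (_ - _ == 0)%N)) ?subn_eq0 // leqn0 dimv_eq0 => /eqP->.
by rewrite memv0 iter_comp_lfunE => /eqP.
Qed.
End Nilpotent.

Section Fusion.
Variables (R : realType) (m s : nat).
Notation n := m.+1.
Variables (st : 'I_s -> nat) (a : 'I_n -> nat) (z : 'I_n -> R[i]).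
Hypothesis z_inj : injective z.
Hypothesis aE : forall i, a i = ((\sum_b (st b <= i))%N).+1.
Hypothesis st0 : exists b, st b = 0%N.
Notation C := R[i].
Notation idx := (idx n s).
Notation V := (tensor R a).
Notation M := (fusion a z).
Notation ell := (ell st (a := a) (z := z)).
Implicit Types (I : idx) (x : 'M[C]_2) (u : M) (p : nat -> C).

(** Adding up the components is an injection into V. Going down from the top degree, if the sum is 0
    and the components above m vanish, the component m lies in V^(m-1) and also in the image of
    [symbol], which meets V^(m-1) in 0. *)
Lemma dim_fusion : (\dim {:M} <= \prod_(i < n) (\sum_b (st b <= i)).+1)%N.
Proof.
have -> : (\prod_(i < n) (\sum_b (st b <= i)).+1 = \dim {:V})%N.
  by rewrite (dim_tensor R) //; apply: eq_bigr.
pose f (u : M) : V := \sum_m0 vsval u m0.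
have f_lin : linear f.
  by move=> c u v; rewrite /f scaler_sumr -big_split; apply: eq_bigr => m0 _; rewrite linearP !ffunE.
pose fL : {linear M -> V} := HB.pack f (GRing.isLinear.Build C M V _ f f_lin).
have ker0 : lker (linfun fL) == 0%VS.
  apply/lker0P => u v; rewrite !lfunE => E; apply/eqP; rewrite -subr_eq0; apply/eqP.
  have {E} : f (u - v) = 0 by rewrite -[LHS]/(fL (u - v)) linearB E subrr.
  move: (u - v) => {u v} u fu.
  have main e (m0 : 'I_(\dim {:V}).+1) : (\dim {:V} < m0 + e)%N -> vsval u m0 = 0.
    elim: e m0 => [|e IH] m0; first by rewrite addn0 ltnNge -ltnS ltn_ord.
    move=> hm; have zero (m1 : 'I_(\dim {:V}).+1) : (m0 < m1)%N -> vsval u m1 = 0.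
      by move=> lt; apply: IH; rewrite (leq_trans hm) // addnS -addSn leq_add2r.
    have um0 : vsval u m0 \in fil_pred a z m0.
      have : vsval u m0 = - \sum_(m1 | m1 != m0) vsval u m1.
        by apply/eqP; rewrite -addr_eq0; apply/eqP; move: fu; rewrite /f (bigD1 m0).
      move=> ->; rewrite memvN; apply: memv_suml => m1 ne.
      case: (ltngtP m1 m0) => [lt|gt|E]; last by case/eqP: ne; apply: val_inj.
        have := gr_fil m1 (subvsP u); apply: (subvP _ (vsval u m1)).
        by move: lt; case: (nat_of_ord m0) => //= k lt; apply: fil_mono.
      by rewrite zero ?mem0v.
    have /memv_imgP[w _ E] := (grP z _ (subvsP u)) m0.
    rewrite -(projv_id um0) E symbolE linearB.
    by rewrite [X in _ - X](projv_proj (fil_pred a z m0) w) subrr.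
  apply: val_inj => /=; apply/ffunP => m0; rewrite ffunE; by apply: (main (\dim {:V}).+1); rewrite addnS ltnS leq_addl.
by rewrite -(@limg_dim_eq _ _ _ (linfun fL) {:M}) ?dimvS ?subvf // (eqP ker0) capv0.
Qed.

Definition Xact x p : 'End(M) := \sum_(k < n) p k *: fusion_act a z x k.

Definition act_mx x p (b : 'I_s) (k q : row_idx n) : C :=
  x (bit k.1) (bit q.1) * (if (st b <= q.2 <= k.2)%N then p (k.2 - q.2)%N else 0).

Lemma ell_Xact x p I u : \tr x = 0 ->
  ell I (Xact x p u) = \sum_k \sum_q act_mx x p k.1 (I k) q * ell (fupd I k q) u.
Proof.
move=> trx; rewrite /Xact sum_lfunE linear_sum /=.
rewrite (eq_bigr (fun k : 'I_n => \sum_b \sum_r \sum_q p k * (shift_coef st x k b (I (b, r)) q * ell (upd I (b, r) q) u))); last first.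
  move=> k _; rewrite scale_lfunE linearZ /= ell_act // /GRing.scale /= mulr_sumr; apply: eq_bigr => b _.
  by rewrite mulr_sumr; apply: eq_bigr => r _; rewrite mulr_sumr.
rewrite exchange_big /=.
rewrite (eq_bigr (fun k => \sum_q act_mx x p k.1 (I (k.1, k.2)) q * ell (fupd I (k.1, k.2) q) u)) => [|[]//].
rewrite -(pair_bigA _ (fun b r => \sum_q act_mx x p b (I (b, r)) q * ell (fupd I (b, r) q) u)) /=.
apply: eq_bigr => b _; rewrite exchange_big; apply: eq_bigr => r _; rewrite exchange_big.
apply: eq_bigr => q _ /=; rewrite /shift_coef /act_mx.
case: (I (b, r)) => e t /=; case: leqP => sq /=; last first.
  rewrite [in RHS]mulr0 [in RHS]mul0r big1 // => k _; by rewrite [X in _ * (X * _)]mulr0 mul0r mulr0.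
case: leqP => qt /=; last first.
  rewrite [in RHS]mulr0 [in RHS]mul0r big1 // => k _; case: eqP => [E|_]; last by rewrite [X in _ * (X * _)]mulr0 mul0r mulr0.
  by move: qt; rewrite E ltnNge leq_addr.
have tq : (t - q.2 < n)%N by rewrite (leq_ltn_trans (leq_subr _ _)).
rewrite (bigD1 (Ordinal tq)) //= subnKC // eqxx mulr1 big1 ?addr0.
  by rewrite mulrCA mulrA.
move=> k kE; case: eqP => [E|_]; last by rewrite [X in _ * (X * _)]mulr0 mul0r mulr0.
by case/eqP: kE; apply: val_inj => /=; rewrite E addKn.
Qed.

Lemma act_mx_sqr x p b k l : x *m x = 0 -> \sum_q act_mx x p b k q * act_mx x p b q l = 0.
Proof.
move=> xx; have xxE i j : x i 0 * x 0 j + x i 1 * x 1 j = 0.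
  have := congr1 (fun A : 'M_2 => A i j) xx; rewrite !mxE !big_ord_recl big_ord0 addr0 => <-.
  by congr (_ + x _ _ * x _ _); apply: val_inj.
pose c t := (if (st b <= t <= k.2)%N then p (k.2 - t)%N else 0) * (if (st b <= l.2 <= t)%N then p (t - l.2)%N else 0).
rewrite (eq_bigr (fun q : row_idx n => x (bit k.1) (bit q.1) * x (bit q.1) (bit l.1) * c q.2)).
  rewrite -(pair_bigA _ (fun e (t : 'I_n) => x (bit k.1) (bit e) * x (bit e) (bit l.1) * c t)) /=.
  by rewrite big_bool /= -!mulr_sumr -mulrDl xxE mul0r.
by move=> q _; rewrite /act_mx /c mulrACA.
Qed.

(** The matrix of g on the part of C^2 (x) C[t]/t^n with exponents at least [st b], extended by the
    identity on the lower exponents. *)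
Definition gmat (g : 'I_2 -> 'I_2 -> nat -> C) (b : 'I_s) (k q : row_idx n) : C :=
  if (st b <= q.2)%N then (if (q.2 <= k.2)%N then g (bit k.1) (bit q.1) (k.2 - q.2)%N else 0)
  else (k == q)%:R.

Definition elem_seq x p (i j : 'I_2) (t : nat) : C := ((i == j) && (t == 0%N))%:R + x i j * p t.

Lemma gmat_elem x p b k q : (k == q)%:R + act_mx x p b k q = gmat (elem_seq x p) b k q.
Proof.
rewrite /gmat /act_mx /elem_seq; case: leqP => sq /=; last by rewrite mulr0 addr0.
have bitE : (bit k.1 == bit q.1) = (k.1 == q.1) by case: k.1; case: q.1.
case: k q sq bitE => e t [e' t'] /= sq bitE; rewrite xpair_eqE bitE.
case: leqP => tt; last by rewrite mulr0 addr0 -(inj_eq val_inj) /= ltn_eqF // andbF.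
by rewrite -val_eqE /= subn_eq0 eqn_leq tt andbT.
Qed.

Lemma char0C : [pchar C] =i pred0.
Proof. exact: Num.Theory.pchar_num. Qed.

Lemma ell_iter_exp x p N I u : \tr x = 0 -> x *m x = 0 -> (#|{: 'I_s * 'I_n}| <= N)%N ->
  \sum_(j < N.+1) (j`!)%:R^-1 * ell I (iter j (Xact x p) u) =
  tens (fun k => gmat (elem_seq x p) k.1) (fun J => ell J u) I.
Proof.
move=> trx xx hN.
rewrite (@tens_exp _ _ C char0C (fun k : 'I_s * 'I_n => act_mx x p k.1) (fun k : 'I_s * 'I_n => fun i j => act_mx_sqr p k.1 i j xx)
  (fun j I => ell I (iter j (Xact x p) u))) //.
  by apply: eq_tens => // k i j; rewrite gmat_elem.
by move=> j J; rewrite /= ell_Xact.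
Qed.

Lemma ell_iter_nil x p I u j : \tr x = 0 -> x *m x = 0 -> (#|{: 'I_s * 'I_n}| < j)%N ->
  ell I (iter j (Xact x p) u) = 0.
Proof.
move=> trx xx hj.
apply: (exp_nilpotent (fun k : 'I_s * 'I_n => fun i j => act_mx_sqr p k.1 i j xx) (F := fun j I => ell I (iter j (Xact x p) u))) => //.
by move=> i J; rewrite /= ell_Xact.
Qed.

Lemma gmat_low g I : tens (fun k => gmat g k.1) (fun J => ell J (fusion_low a z)) I =
  minors (frame_row st (g 0 1) (g 1 1)) I.
Proof.
transitivity (tens (fun k => gmat g k.1) (minors (@low_row R n s)) I).
  by apply: eq_tens => // J; rewrite ell_low.
rewrite (tens_minors (gmat g)); apply: eq_minors => b r i.
rewrite (bigD1 (false, i)) //= big1 ?addr0 => [|[e t]].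
  rewrite /low_row eqxx mulr1 /gmat /frame_row /=; by case: (I (b, r)) => -[] t.
by rewrite /low_row xpair_eqE; case: e => [_|/negPf /= ->]; rewrite mulr0.
Qed.

Lemma sl2_e_nil : \tr (sl2_e R) = 0 /\ sl2_e R *m sl2_e R = 0.
Proof.
split; last by rewrite mul_delta_mx_0.
by rewrite /mxtrace !big_ord_recl big_ord0 !mxE /= !addr0.
Qed.

Lemma sl2_f_nil : \tr (sl2_f R) = 0 /\ sl2_f R *m sl2_f R = 0.
Proof.
split; last by rewrite mul_delta_mx_0.
by rewrite /mxtrace !big_ord_recl big_ord0 !mxE /= !addr0.
Qed.

(** A linear relation between functionals of the independent family, evaluated at the vectors exp(e
    (x) p) v for all p, is a relation between the minors as functions of p, hence trivial. The
    family is as large as the bound on the dimension. *)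
Lemma ell_inj u : (forall I, ell I u = 0) -> u = 0.
Proof.
have [J [t [cardJ goodJ indJ]]] := independent_family m [the closedFieldType of C] st.
apply: (@joint_kernel0 _ M idx (fun I => [the {linear M -> C^o} of ell I]) J t).
  by rewrite cardJ dim_fusion.
move=> c Hc; apply: indJ => p; have [tre ee] := sl2_e_nil.
pose N := #|{: 'I_s * 'I_n}|.
(* A truncated series stands for the exponential: nilpotency of the operator on the fusion product
   is only deduced from the present lemma. On the functionals, [N] terms suffice because each slot
   contributes degree at most 1. *)
rewrite -[RHS](Hc (\sum_(j < N.+1) (j`!)%:R^-1 *: iter j (Xact (sl2_e R) p) (fusion_low a z))).
apply: eq_bigr => j _; congr (_ * _); rewrite linear_sum /=.
rewrite (eq_bigr (fun k : 'I_N.+1 => (k`!)%:R^-1 * ell (t j) (iter k (Xact (sl2_e R) p) (fusion_low a z)))); last first.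
  by move=> k _; rewrite linearZ.
rewrite ell_iter_exp // gmat_low; apply: eq_minors => b r i.
rewrite /frame_row; case: leqP => // _; case: leqP => // _; case: (_.1);
 rewrite /elem_seq /sl2_e !mxE /= ?mul1r ?add0r //.
by rewrite mul0r addr0.
Qed.

(** The truncation at \dim M in [nilp_exp] and the one at the number of slots are compared at their
    maximum. The operator is nilpotent because all functionals vanish on its high powers. *)
Lemma ell_exp x p I u : \tr x = 0 -> x *m x = 0 ->
  ell I (nilp_exp (Xact x p) u) = tens (fun k => gmat (elem_seq x p) k.1) (fun J => ell J u) I.
Proof.
move=> trx xx; pose N := maxn #|{: 'I_s * 'I_n}| (\dim {:M}).
rewrite -(@ell_iter_exp x p N) ?leq_maxl // /nilp_exp sum_lfunE linear_sum /=.
rewrite (eq_bigr (fun k : 'I_(\dim {:M}).+1 => (k`!)%:R^-1 * ell I (iter k (Xact x p) u))); last first.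
  by move=> k _; rewrite scale_lfunE iter_comp_lfunE linearZ.
rewrite (big_ord_widen N.+1 (fun k => (k`!)%:R^-1 * ell I (iter k (Xact x p) u))) ?ltnS ?leq_maxr //.
rewrite big_mkcond; apply: eq_bigr => k _; case: ltnP => // dk.
rewrite (@nilpotent_dim _ _ _ #|{: 'I_s * 'I_n}|.+1) ?linear0 ?mulr0 //; last exact: ltnW.
by move=> w; apply: ell_inj => J; rewrite ell_iter_nil.
Qed.

End Fusion.

(** * Elementary matrices and SL_2 over truncated polynomials *)

Definition elem01 (A : comNzRingType) (p : A) : 'M[A]_2 := 1%:M + p *: delta_mx 0 1.
Definition elem10 (A : comNzRingType) (p : A) : 'M[A]_2 := 1%:M + p *: delta_mx 1 0.

Lemma det2 (A : comNzRingType) (g : 'M[A]_2) : \det g = g 0 0 * g 1 1 - g 0 1 * g 1 0.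
Proof.
rewrite (expand_det_row _ 0) big_ord_recl big_ord1 /cofactor !det_mx11 !mxE /=.
have E1 : lift ord0 ord0 = 1 :> 'I_2 by apply: val_inj.
have E0 : lift (1 : 'I_2) ord0 = 0 by apply: val_inj.
by rewrite !E1 !E0 /=; ring.
Qed.

Lemma eq_mx2 (A : Type) (g h : 'M[A]_2) :
  g 0 0 = h 0 0 -> g 0 1 = h 0 1 -> g 1 0 = h 1 0 -> g 1 1 = h 1 1 -> g = h.
Proof.
move=> h00 h01 h10 h11; apply/matrixP => i j.
have dich (k : 'I_2) : k = 0 \/ k = 1.
  by case: k => -[|[|//]] ?; [left | right]; apply: val_inj.
by case: (dich i) => ->; case: (dich j) => ->.
Qed.

Lemma mulmx2E (A : comNzRingType) (g h : 'M[A]_2) i j : (g *m h) i j = g i 0 * h 0 j + g i 1 * h 1 j.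
Proof.
by rewrite mxE big_ord_recl big_ord1; congr (_ + g _ _ * h _ _); apply: val_inj.
Qed.

Lemma det_elem01 (A : comNzRingType) (p : A) : \det (elem01 p) = 1.
Proof. by rewrite det2 !mxE /=; ring. Qed.

Lemma det_elem10 (A : comNzRingType) (p : A) : \det (elem10 p) = 1.
Proof. by rewrite det2 !mxE /=; ring. Qed.

Lemma sl2_factor (A : comNzRingType) (g : 'M[A]_2) w : \det g = 1 -> g 1 0 * w = 1 ->
  exists x y, g = elem01 x *m (elem10 (g 1 0) *m (elem01 y *m 1%:M)).
Proof.
rewrite det2 => dg cw.
pose x := (g 0 0 - 1) * w; pose y := g 0 1 - x * g 1 1; exists x, y.
have xc : x * g 1 0 = g 0 0 - 1 by rewrite /x -mulrA [w * _]mulrC cw mulr1.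
have cy : g 1 0 * y + 1 = g 1 1.
  have -> : g 1 0 * y + 1 = g 1 0 * g 0 1 - (x * g 1 0) * g 1 1 + 1 by rewrite /y; ring.
  by rewrite xc -{2}dg; ring.
rewrite mulmx1; apply: eq_mx2; rewrite !(mulmx2E, mxE) /=.
- have -> : g 0 0 = x * g 1 0 + 1 by rewrite xc; ring.
  by ring.
- have -> : g 0 1 = y + x * g 1 1 by rewrite /y; ring.
  by rewrite -cy; ring.
- by ring.
- by rewrite -{1}cy; ring.
Qed.

Lemma elem10K (A : comNzRingType) (p : A) (g : 'M[A]_2) : elem10 (- p) *m (elem10 p *m g) = g.
Proof. by apply: eq_mx2; rewrite !(mulmx2E, mxE) /=; ring. Qed.

Lemma elem10_row1 (A : comNzRingType) (p : A) (g : 'M[A]_2) : (elem10 p *m g) 1 0 = p * g 0 0 + g 1 0.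
Proof. by rewrite !(mulmx2E, mxE) /=; ring. Qed.

Section TruncatedPolynomials.
Variables (K : fieldType) (m : nat).
Notation n := m.+1.
Notation Rn := {poly %/ ('X^n : {poly K})}.
Implicit Types p q : Rn.
Notation cf p t := ((p : {poly K})`_t).

Lemma size_mk_monicXn : (size (mk_monic ('X^n : {poly K}))).-1 = n.
Proof. by rewrite mk_monic_Xn size_polyXn. Qed.

Lemma coef_Rn_large p t : (n <= t)%N -> cf p t = 0.
Proof. by move=> nt; apply: big_coef_npoly; rewrite size_mk_monicXn. Qed.

Lemma coef_in_qpoly (f : {poly K}) t : (t < n)%N -> cf (in_qpoly 'X^n f) t = f`_t.
Proof.
by move=> tn; rewrite /= mk_monic_Xn -Pdiv.RingMonic.take_poly_rmodp coef_take_poly tn.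
Qed.

Lemma coef_RnM p q t : (t < n)%N -> cf (p * q) t = \sum_(u < t.+1) cf p u * cf q (t - u)%N.
Proof. by move=> tn; rewrite [LHS]coef_in_qpoly // coefM. Qed.

Lemma coef_Rn0M p q : cf (p * q) 0 = cf p 0 * cf q 0.
Proof. by rewrite coef_RnM // big_ord_recl big_ord0 addr0. Qed.

Lemma coef_Rn1 t : cf (1 : Rn) t = (t == 0%N)%:R.
Proof. by rewrite /= coefC; case: t. Qed.

Lemma eq_Rn p q : (forall t, (t < n)%N -> cf p t = cf q t) -> p = q.
Proof.
move=> H; apply/npolyP => t; have [/H//|nt] := ltnP t n.
by rewrite !coef_Rn_large.
Qed.

Lemma Rn_nilpotent p : cf p 0 = 0 -> p ^+ n = 0.
Proof.
move=> p0; have main k t : (t < k)%N -> (t < n)%N -> cf (p ^+ k) t = 0.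
  elim: k t => // k IH t tk tn; rewrite [p ^+ k.+1]exprS coef_RnM // big1 // => -[[|u] /= ut] _.
    by rewrite p0 mul0r.
  by rewrite IH ?mulr0 //; lia.
by apply: eq_Rn => t tn; rewrite main //= coef0.
Qed.

Lemma Rn_unit p : cf p 0 != 0 -> exists q, p * q = 1.
Proof.
move=> p0; pose x : Rn := 1 - (cf p 0)^-1 *: p.
have x0 : cf x 0 = 0 by rewrite /x /= coefB coefC coefZ mulVf // subrr.
have := subrX1 x n; rewrite Rn_nilpotent // sub0r => /eqP; rewrite eqr_oppLR.
have -> : x - 1 = - ((cf p 0)^-1 *: p) by rewrite /x addrC addKr.
rewrite mulNr opprK -scalerAl scalerAr => /eqP E.
by exists ((cf p 0)^-1 *: (\sum_(i < n) x ^+ i)).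
Qed.

(** Generation by elementary matrices over a local ring. If the lower left entry is a unit, three
    factors suffice; otherwise the determinant forces the upper left entry to be a unit, and adding
    the first row to the second reduces to that case. *)
Lemma sl2_ind (P : 'M[Rn]_2 -> Prop) : P 1%:M ->
  (forall p g, \det g = 1 -> P g -> P (elem01 p *m g)) ->
  (forall p g, \det g = 1 -> P g -> P (elem10 p *m g)) ->
  forall g, \det g = 1 -> P g.
Proof.
move=> P1 P01 P10.
have unit_case (g : 'M[Rn]_2) : \det g = 1 -> cf (g 1 0) 0 != 0 -> P g.
  move=> dg /Rn_unit[w cw]; have [x [y ->]] := sl2_factor dg cw.
  apply: (P01); last apply: (P10); last apply: (P01) => //.
  - by rewrite det_mulmx det_elem10 mulmx1 det_elem01 mulr1.
  - by rewrite mulmx1 det_elem01.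
  - by rewrite det1.
move=> g dg; have [c0|] := eqVneq (cf (g 1 0) 0) 0; last exact: unit_case.
rewrite -(elem10K 1 g).
have dg' : \det (elem10 1 *m g) = 1 by rewrite det_mulmx det_elem10 dg mulr1.
apply: (P10) => //; apply: unit_case => //.
rewrite elem10_row1 mul1r coefD c0 addr0.
move: dg; rewrite det2 => /(congr1 (fun p : Rn => cf p 0)); rewrite coef_Rn1 coefB !coef_Rn0M c0 mulr0 subr0.
by move=> E; apply: contra_eq_neq E => ->; rewrite mul0r eq_sym oner_eq0.
Qed.

End TruncatedPolynomials.

(** * The representation of SL_2 and the orbit of the lowest vector *)

Section Representation.
Variables (R : realType) (m s : nat).
Notation n := m.+1.
Variables (st : 'I_s -> nat) (a : 'I_n -> nat) (z : 'I_n -> R[i]).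
Hypothesis z_inj : injective z.
Hypothesis aE : forall i, a i = ((\sum_b (st b <= i))%N).+1.
Hypothesis st0 : exists b, st b = 0%N.
Notation C := R[i].
Notation idx := (idx n s).
Notation M := (fusion a z).
Notation ell := (ell st (a := a) (z := z)).
Notation Rn := {poly %/ ('X^n : {poly C})}.
Implicit Types (I : idx) (u : M) (g h : 'M[Rn]_2) (p q : nat -> C).

Definition gseq g (i j : 'I_2) (t : nat) : C := (g i j : {poly C})`_t.
Notation gtens g := (tens (fun k : 'I_s * 'I_n => gmat st (gseq g) k.1)).

Lemma eq_gmat (g h : 'I_2 -> 'I_2 -> nat -> C) b (k q : row_idx n) :
  (forall i j t, (t < n)%N -> g i j t = h i j t) -> gmat st g b k q = gmat st h b k q.
Proof.
move=> gh; rewrite /gmat; case: ifP => // _; case: ifP => // _.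
by rewrite gh // (leq_ltn_trans (leq_subr _ _)).
Qed.

Lemma gmat_mul g h b (k l : row_idx n) :
  \sum_q gmat st (gseq g) b k q * gmat st (gseq h) b q l = gmat st (gseq (g *m h)) b k l.
Proof.
rewrite {3}/gmat; case: leqP => [sl|ls]; last first.
  rewrite (bigD1 l) //= [X in _ + X]big1 ?addr0 => [|q ql]; last first.
    by rewrite [X in _ * X]/gmat leqNgt ls (negPf ql) mulr0.
  by rewrite /gmat leqNgt ls eqxx mulr1.
pose c (e : bool) t := (if (t <= k.2)%N then gseq g (bit k.1) (bit e) (k.2 - t) else 0) *
  (if (l.2 <= t)%N then gseq h (bit e) (bit l.1) (t - l.2) else 0).
rewrite (eq_bigr (fun q : row_idx n => c q.1 q.2)); last first.
  move=> q _; rewrite /c /gmat sl; case: leqP => sq //.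
  by rewrite [(l.2 <= q.2)%N]leqNgt (leq_trans sq sl) !mulr0.
rewrite -(pair_bigA _ (fun e (t : 'I_n) => c e t)) /= big_bool /= -big_split /=.
have kn := ltn_ord k.2.
case: leqP => [lk|kl]; last first.
  apply: big1 => t _; rewrite /c; case: leqP => h1; case: leqP => h2; rewrite ?mulr0 ?mul0r ?addr0 //.
  by move: kl; rewrite ltnNge (leq_trans h2 h1).
have E : gseq (g *m h) (bit k.1) (bit l.1) (k.2 - l.2) =
    \sum_(v < (k.2 - l.2).+1) \sum_(e : bool) gseq g (bit k.1) (bit e) v * gseq h (bit e) (bit l.1) (k.2 - l.2 - v).
  have tn : (k.2 - l.2 < n)%N by rewrite (leq_ltn_trans (leq_subr _ _)).
  rewrite /gseq mulmx2E coefD !coef_RnM // -big_split; apply: eq_bigr => v _.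
  by rewrite big_bool.
rewrite {}E.
pose F t := c true t + c false t.
rewrite -(big_mkord xpredT F) (big_cat_nat (n := l.2)) //=; last by rewrite ltnW.
rewrite [X in X + _]big1_seq ?add0r => [|t]; last first.
  by rewrite mem_index_iota /= => tl; rewrite /F /c [(l.2 <= t)%N]leqNgt tl !mulr0 addr0.
rewrite (big_cat_nat (n := k.2.+1)) //=; last by rewrite leqW.
rewrite [X in _ + X]big1_seq ?addr0 => [|t]; last first.
  by rewrite mem_index_iota /= => /andP[kt _]; rewrite /F /c [(t <= k.2)%N]leqNgt kt !mul0r addr0.
rewrite -{1}[nat_of_ord l.2]add0n big_addn subSn // big_rev_mkord subn0.
apply: eq_bigr => v _; rewrite big_bool /F /c; have := ltn_ord v; rewrite ltnS => vk.
have [e1 e2 e3 e4 e5] : [/\ ((k.2 - l.2).+1 - v.+1 + l.2 = k.2 - v)%N, (k.2 - v <= k.2)%N,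
    (l.2 <= k.2 - v)%N, (k.2 - (k.2 - v) = v)%N & (k.2 - v - l.2 = k.2 - l.2 - v)%N].
  by move: lk vk; move: (nat_of_ord k.2) (nat_of_ord l.2) (nat_of_ord v) => x y w; split; lia.
by rewrite e1 e2 e3 e4 e5.
Qed.

Lemma gtens_mul g h (F : idx -> C) I : gtens g (gtens h F) I = gtens (g *m h) F I.
Proof. by rewrite tens_mul; apply: eq_tens => // k i j; exact: gmat_mul. Qed.

Lemma gtens1 (F : idx -> C) I : gtens (1%:M) F I = F I.
Proof.
rewrite /tens (bigD1 I) //= [X in _ + X]big1 ?addr0 => [|J JI].
  rewrite big1 ?mul1r // => k _; rewrite /gmat /gseq !mxE !eqxx leqnn subnn.
  by case: ifP => // _; rewrite coef_Rn1.
have [k kI] : exists k, I k != J k.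
  apply/existsP; apply: contraR JI; rewrite negb_exists => /forallP H.
  by apply/eqP/ffunP => k; have := H k; rewrite negbK => /eqP.
rewrite (bigD1 k) //= [X in X * _ * _](_ : _ = 0) ?mul0r //.
rewrite /gmat /gseq mxE (negPf kI); case: ifP => // _; case: leqP => // le.
move: kI; case: (I k) (J k) le => [e t] [e' t'] /=; rewrite xpair_eqE -val_eqE /=.
case: (e =P e') => [-> /= ne le|ne _ _].
  by rewrite eqxx coef_Rn1 subn_eq0 leqNgt ltn_neqAle eq_sym ne le.
have -> : (bit e == bit e') = false by case: e e' ne => -[].
by rewrite coef0.
Qed.

Lemma gseq_elem01 (p : Rn) i j t : gseq (elem01 p) i j t = elem_seq (sl2_e R) (fun k => (p : {poly C})`_k) i j t.
Proof.
rewrite /gseq /elem01 /elem_seq /sl2_e !mxE coefD; congr (_ + _).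
  by case: (i == j) => /=; rewrite ?coef_Rn1 ?coef0.
case: (_ && _); first by rewrite mulr1 mul1r.
by rewrite mul0r; have -> : p * (false%:R : Rn) = 0 := mulr0 p; rewrite coef0.
Qed.

Lemma gseq_elem10 (p : Rn) i j t : gseq (elem10 p) i j t = elem_seq (sl2_f R) (fun k => (p : {poly C})`_k) i j t.
Proof.
rewrite /gseq /elem10 /elem_seq /sl2_f !mxE coefD; congr (_ + _).
  by case: (i == j) => /=; rewrite ?coef_Rn1 ?coef0.
case: (_ && _); first by rewrite mulr1 mul1r.
by rewrite mul0r; have -> : p * (false%:R : Rn) = 0 := mulr0 p; rewrite coef0.
Qed.

Lemma ell_exp01 (p : Rn) I u :
  ell I (nilp_exp (\sum_(k < n) (p : {poly C})`_k *: fusion_act a z (sl2_e R) k) u) = gtens (elem01 p) (fun J => ell J u) I.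
Proof.
have [tr0 sq0] := sl2_e_nil R; rewrite (ell_exp z_inj aE st0 (fun k => (p : {poly C})`_k) I u tr0 sq0).
by apply: eq_tens => // k i j; apply: eq_gmat => *; rewrite gseq_elem01.
Qed.

Lemma ell_exp10 (p : Rn) I u :
  ell I (nilp_exp (\sum_(k < n) (p : {poly C})`_k *: fusion_act a z (sl2_f R) k) u) = gtens (elem10 p) (fun J => ell J u) I.
Proof.
have [tr0 sq0] := sl2_f_nil R; rewrite (ell_exp z_inj aE st0 (fun k => (p : {poly C})`_k) I u tr0 sq0).
by apply: eq_tens => // k i j; apply: eq_gmat => *; rewrite gseq_elem10.
Qed.

Lemma eq_ell u v : (forall I, ell I u = ell I v) -> u = v.
Proof.
move=> H; apply/eqP; rewrite -subr_eq0; apply/eqP; apply: (ell_inj z_inj aE st0) => I.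
by rewrite linearB /= H subrr.
Qed.

Definition intertwines (f : 'End(M)) g := forall u I, ell I (f u) = gtens g (fun J => ell J u) I.

Lemma intertwines_comp f f' g h : intertwines f g -> intertwines f' h -> intertwines (f \o f')%VF (g *m h).
Proof.
by move=> fg fh u I; rewrite comp_lfunE fg -gtens_mul; apply: eq_tens => // J; rewrite fh.
Qed.

Lemma intertwines_inj f f' g : intertwines f g -> intertwines f' g -> f = f'.
Proof. by move=> fg fg'; apply/lfunP => u; apply: eq_ell => I; rewrite fg fg'. Qed.

Lemma ex_intertwines g : \det g = 1 -> exists f, intertwines f g.
Proof.
move: g; apply: sl2_ind => [|p g dg [f fg]|p g dg [f fg]].
- by exists \1%VF => u I; rewrite id_lfunE gtens1.
- exists (nilp_exp (\sum_(k < n) (p : {poly C})`_k *: fusion_act a z (sl2_e R) k) \o f)%VF.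
  by apply: intertwines_comp => // u I; exact: ell_exp01.
- exists (nilp_exp (\sum_(k < n) (p : {poly C})`_k *: fusion_act a z (sl2_f R) k) \o f)%VF.
  by apply: intertwines_comp => // u I; exact: ell_exp10.
Qed.

(** No relations of SL_2 have to be checked: the functionals separate points, so the operator
    intertwining a given matrix is unique, and multiplicativity follows from that of the action on
    tensors. *)
Lemma ex_integrates : exists rho, @integrates R n a z rho /\ forall g, \det g = 1 -> intertwines (rho g) g.
Proof.
have H g : exists f, \det g = 1 -> intertwines f g.
  have [dg|dg] := eqVneq (\det g) 1; last by exists 0 => dg1; case/eqP: dg.
  by have [f fg] := ex_intertwines dg; exists f.
have [rho rhoP] := choice H.
exists rho; split=> //; split=> [g h dg dh|p|p].
- apply: (intertwines_inj (g := g *m h)); last by apply: intertwines_comp; exact: rhoP.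
  by apply: rhoP; rewrite det_mulmx dg dh mulr1.
- apply: (intertwines_inj (g := elem01 p)); first by apply: rhoP; exact: det_elem01.
  by move=> u I; exact: ell_exp01.
- apply: (intertwines_inj (g := elem10 p)); first by apply: rhoP; exact: det_elem10.
  by move=> u I; exact: ell_exp10.
Qed.

(** Since [orbit_low] quantifies over [rho], its description requires every integrating [rho] to be
    the expected one; the elementary matrices determine it. *)
Lemma integrates_intertwines rho g : @integrates R n a z rho -> \det g = 1 -> intertwines (rho g) g.
Proof.
move=> [rhoM rho01 rho10]; move: g.
have r01 (p : Rn) : intertwines (rho (elem01 p)) (elem01 p) by rewrite rho01 => u I; exact: ell_exp01.
have r10 (p : Rn) : intertwines (rho (elem10 p)) (elem10 p) by rewrite rho10 => u I; exact: ell_exp10.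
apply: sl2_ind => [|p g dg rg|p g dg rg].
- by have := r01 0; rewrite /elem01 scale0r addr0.
- by rewrite rhoM ?det_elem01 //; exact: intertwines_comp.
- by rewrite rhoM ?det_elem10 //; exact: intertwines_comp.
Qed.

Definition frame_minors p q I := minors (frame_row st p q) I.

Lemma gtens_low g I : gtens g (fun J => ell J (fusion_low a z)) I =
  frame_minors (gseq g 0 1) (gseq g 1 1) I.
Proof. exact: gmat_low. Qed.

Lemma eq_frame_minors p q p' q' I : (forall t, (t < n)%N -> p t = p' t) -> (forall t, (t < n)%N -> q t = q' t) ->
  frame_minors p q I = frame_minors p' q' I.
Proof.
move=> pp qq; apply: eq_minors => b r i; rewrite /frame_row; case: ifP => // _; case: ifP => // _.
have lt : ((I (b, r)).2 - i < n)%N by rewrite (leq_ltn_trans (leq_subr _ _)).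
by case: (_.1); [exact: pp | exact: qq].
Qed.

Lemma sl2_column p q : (p 0%N != 0) || (q 0%N != 0) -> exists g : 'M[Rn]_2, \det g = 1 /\
  (forall t, (t < n)%N -> gseq g 0 1 t = p t /\ gseq g 1 1 t = q t).
Proof.
pose P : Rn := in_qpoly 'X^n (\poly_(t < n) p t); pose Q : Rn := in_qpoly 'X^n (\poly_(t < n) q t).
have PE t : (t < n)%N -> (P : {poly C})`_t = p t by move=> tn; rewrite coef_in_qpoly // coef_poly tn.
have QE t : (t < n)%N -> (Q : {poly C})`_t = q t by move=> tn; rewrite coef_in_qpoly // coef_poly tn.
move=> /orP[p0|q0].
  have [|w Pw] := @Rn_unit _ m P; first by rewrite PE.
  exists (\matrix_(i, j) if i == 0 then (if j == 0 then 0 else P) else (if j == 0 then - w else Q)).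
  split; first by rewrite det2 !mxE /= mul0r sub0r mulrN opprK.
  by move=> t tn; rewrite /gseq !mxE /= PE ?QE.
have [|w Qw] := @Rn_unit _ m Q; first by rewrite QE.
exists (\matrix_(i, j) if i == 0 then (if j == 0 then w else P) else (if j == 0 then 0 else Q)).
split; first by rewrite det2 !mxE /= mulr0 subr0 mulrC.
by move=> t tn; rewrite /gseq !mxE /= PE ?QE.
Qed.

Lemma frame_minors_neq0 p q : (p 0%N != 0) || (q 0%N != 0) -> exists I, frame_minors p q I != 0.
Proof.
move=> pq; pose e := p 0%N != 0.
have x0 : (if e then p else q) 0%N != 0 by move: pq; rewrite /e; case: ifP.
exists [ffun k : 'I_s * 'I_n => if (k.2 < st k.1)%N then (false, k.2) else (e, k.2)].
apply/prodf_neq0 => b _; rewrite det_trig.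
  apply/prodf_neq0 => r _; rewrite !mxE ffunE /=; case: (ltnP r (st b)) => rs.
    by rewrite /frame_row /= leqNgt rs /= eqxx oner_neq0.
  by rewrite /frame_row /= rs leqnn subnn.
apply/is_trig_mxP => r i ri; rewrite !mxE ffunE /=; case: (ltnP r (st b)) => rs.
  rewrite /frame_row /=; case: ifP => _; first by rewrite leqNgt ri.
  by rewrite -(inj_eq val_inj) /= ltn_eqF.
by rewrite /frame_row /= (leq_trans rs (ltnW ri)) leqNgt ri.
Qed.

Lemma frame_vector p q : (p 0%N != 0) || (q 0%N != 0) ->
  exists w : M, w != 0 /\ forall I, ell I w = frame_minors p q I.
Proof.
move=> pq; have [g [dg gE]] := sl2_column pq; have [f fg] := ex_intertwines dg.
have fE I : ell I (f (fusion_low a z)) = frame_minors p q I.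
  by rewrite fg gtens_low; apply: eq_frame_minors => t /gE[].
exists (f (fusion_low a z)); split=> //.
have [I] := frame_minors_neq0 pq; apply: contraNneq => w0.
by rewrite -fE w0 linear0.
Qed.

(** Only the second column (p, q) of g matters, being g f. The columns that occur are those with a
    unit entry, and each can be completed to a matrix of determinant 1. *)
Lemma orbit_lowP (x : proj M) : orbit_low x <->
  exists p q, (p 0%N != 0) || (q 0%N != 0) /\ exists w : M,
    val x = <[w]>%VS /\ forall I, ell I w = frame_minors p q I.
Proof.
split=> [[rho [g [rhoP dg xE]]]|[p [q [pq [w [xE wE]]]]]].
  exists (gseq g 0 1), (gseq g 1 1); split.
    rewrite -negb_and; apply/negP => /andP[/eqP p0 /eqP q0].
    move: dg; rewrite det2 => /(congr1 (fun p : Rn => (p : {poly C})`_0)).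
    rewrite coef_Rn1 coefB !coef_Rn0M -/(gseq g 1 1 0) -/(gseq g 0 1 0) p0 q0 mulr0 mul0r subr0.
    by move/esym/eqP; rewrite oner_eq0.
  exists (rho g (fusion_low a z)); split=> // I.
  by rewrite (integrates_intertwines rhoP dg) gtens_low.
have [g [dg gE]] := sl2_column pq; have [rho [rhoP rhoE]] := ex_integrates.
exists rho, g; split=> //; rewrite xE; congr <[_]>%VS; apply: eq_ell => I.
by rewrite wE rhoE // gtens_low; apply: eq_frame_minors => t /gE[].
Qed.

Lemma curve_vector k c : (k < n)%N -> forall I,
  ell I (nilp_exp (c *: fusion_act a z (sl2_e R) k) (fusion_low a z)) =
  frame_minors (fun t => if t == k then c else 0) (one_seq C) I.
Proof.
move=> kn I; have [tr0 sq0] := sl2_e_nil R.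
have -> : c *: fusion_act a z (sl2_e R) k = Xact a z (sl2_e R) (fun t => if t == k then c else 0).
  rewrite /Xact (bigD1 (Ordinal kn)) //= eqxx big1 ?addr0 // => t tk.
  by rewrite ifN ?scale0r //; apply: contra tk => /eqP E; apply/eqP/val_inj.
rewrite (ell_exp z_inj aE st0 _ I _ tr0 sq0) gmat_low.
apply: eq_frame_minors => t tn; rewrite /elem_seq /sl2_e !mxE /= ?mul1r ?add0r //.
  by rewrite mul0r addr0.
exact: aE.
Qed.

End Representation.

(** * Regular functions in homogeneous coordinates *)

Section Homogeneous.
Variables (K : fieldType) (M : vectType K).
Notation crd i u := (coord (vbasis {:M}) i u).
Implicit Types (f g : M -> K) (d e : nat).

Definition hpoly d f := exists2 P : {mpoly K[\dim {:M}]}, P \is d.-homog & forall u, f u = P.@[fun i => crd i u].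

Lemma eq_hpoly d f g : f =1 g -> hpoly d f -> hpoly d g.
Proof. by move=> fg [P hP PE]; exists P => // u; rewrite -fg. Qed.

Lemma hpolyD d f g : hpoly d f -> hpoly d g -> hpoly d (fun u => f u + g u).
Proof.
by move=> [P hP PE] [Q hQ QE]; exists (P + Q) => [|u]; [exact: rpredD | rewrite mevalD PE QE].
Qed.

Lemma hpoly0 d : hpoly d (fun=> 0).
Proof. by exists 0 => [|u]; [exact: rpred0 | rewrite meval0]. Qed.

Lemma hpolyC c : hpoly 0 (fun=> c).
Proof.
exists c%:MP => [|u]; last by rewrite mevalC.
by rewrite -[c%:MP]mulr1 mul_mpolyC rpredZ // dhomog1.
Qed.

Lemma hpolyM d e f g : hpoly d f -> hpoly e g -> hpoly (d + e) (fun u => f u * g u).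
Proof.
by move=> [P hP PE] [Q hQ QE]; exists (P * Q) => [|u]; [exact: dhomogM | rewrite mevalM PE QE].
Qed.

Lemma hpolyZ d c f : hpoly d f -> hpoly d (fun u => c * f u).
Proof. exact: (hpolyM (hpolyC c)). Qed.

Lemma hpolyN d f : hpoly d f -> hpoly d (fun u => - f u).
Proof. by move/(hpolyZ (-1)); apply: eq_hpoly => u; rewrite mulN1r. Qed.

Lemma hpolyB d f g : hpoly d f -> hpoly d g -> hpoly d (fun u => f u - g u).
Proof. by move=> hf hg; apply: hpolyD => //; exact: hpolyN. Qed.

Lemma hpolyX d k f : hpoly d f -> hpoly (d * k) (fun u => f u ^+ k).
Proof.
move=> hf; elim: k => [|k IH]; first by rewrite muln0; apply: hpolyC.
by rewrite mulnS; apply: eq_hpoly (hpolyM hf IH) => u; rewrite exprS.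
Qed.

Lemma hpoly_sum (I : Type) (r : seq I) (Q : pred I) d (F : I -> M -> K) :
  (forall i, Q i -> hpoly d (F i)) -> hpoly d (fun u => \sum_(i <- r | Q i) F i u).
Proof.
move=> H; elim: r => [|i r IH]; first by apply: eq_hpoly (hpoly0 d) => u; rewrite big_nil.
have [Qi|nQ] := boolP (Q i); last by apply: eq_hpoly IH => u; rewrite big_cons (negPf nQ).
by apply: eq_hpoly (hpolyD (H i Qi) IH) => u; rewrite big_cons Qi.
Qed.

Lemma hpoly_prod (I : Type) (r : seq I) (d : I -> nat) (F : I -> M -> K) :
  (forall i, hpoly (d i) (F i)) -> hpoly (\sum_(i <- r) d i) (fun u => \prod_(i <- r) F i u).
Proof.
move=> H; elim: r => [|i r IH].
  by rewrite big_nil; apply: eq_hpoly (hpolyC 1) => u; rewrite big_nil.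
by rewrite big_cons; apply: eq_hpoly (hpolyM (H i) IH) => u; rewrite big_cons.
Qed.

Lemma hpoly_coord i : hpoly 1 (fun u => crd i u).
Proof. by exists 'X_i => [|u]; rewrite ?mevalXU // dhomogX; apply/eqP/mdeg1. Qed.

Lemma hpoly_linear (l : {linear M -> K^o}) : hpoly 1 l.
Proof.
have H : hpoly 1 (fun u => \sum_(i < \dim {:M}) (l (vbasis {:M})`_i : K) * crd i u).
  by apply: hpoly_sum => i _; apply: hpolyZ; exact: hpoly_coord.
case: H => P hP PE; exists P => // u; rewrite -PE [u in LHS](coord_vbasis (memvf u)) linear_sum.
by apply: eq_bigr => i _; rewrite linearZ mulrC.
Qed.

Lemma hpoly_scale d f c u : hpoly d f -> f (c *: u) = c ^+ d * f u.
Proof.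
move=> [P hP PE]; rewrite !PE !mevalE mulr_sumr; apply: eq_big_seq => m mP.
rewrite mulrCA; congr (_ * _); have dE : mdeg m = d by move: hP => /dhomogP; exact.
rewrite -dE mdegE -prodrXr -big_split; apply: eq_bigr => i _ /=.
by rewrite linearZ exprMn.
Qed.

Lemma peval_hpoly d (P : {mpoly K[\dim {:M}]}) : P \is d.-homog ->
  exists2 f, hpoly d f & forall x, peval P x = f (vpick (val x)).
Proof. by move=> hP; exists (fun u => P.@[fun i => crd i u]) => //; exists P. Qed.

End Homogeneous.

Definition hmap (K : fieldType) (N M : vectType K) d (F : N -> M) :=
  forall i, hpoly d (fun u => coord (vbasis {:M}) i (F u)).

Lemma hpoly_comp (K : fieldType) (N M : vectType K) d e (F : N -> M) (f : M -> K) :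
  hpoly e f -> hmap d F -> hpoly (d * e) (f \o F).
Proof.
(* The test of membership keeps the fact that [m] lies in the support, which is where its degree is
   known to be [e]. *)
move=> [P hP PE] hF; apply: (@eq_hpoly _ _ _ (fun u => \sum_(m <- msupp P) (if m \in msupp P then P@_m * \prod_i coord (vbasis {:M}) i (F u) ^+ m i else 0))).
  by move=> u; rewrite /= PE mevalE [LHS]big_seq [RHS]big_seq; apply: eq_bigr => m ->.
apply: hpoly_sum => m _; have [mP|_] := boolP (m \in msupp P); last exact: hpoly0.
apply: hpolyZ; have dE : mdeg m = e by move: hP => /dhomogP; exact.
by rewrite -dE mdegE big_distrr; apply: hpoly_prod => i; apply: hpolyX; exact: hF.
Qed.

Lemma hmap_sum (K : fieldType) (N M : vectType K) (I : Type) (r : seq I) d (F : I -> N -> K) (w : I -> M) :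
  (forall i, hpoly d (F i)) -> hmap d (fun u => \sum_(i <- r) F i u *: w i).
Proof.
move=> hF i; apply: (@eq_hpoly _ _ _ (fun u => \sum_(j <- r) coord (vbasis {:M}) i (w j) * F j u)).
  by move=> u; rewrite linear_sum; apply: eq_bigr => j _; rewrite linearZ mulrC.
by apply: hpoly_sum => j _; apply: hpolyZ.
Qed.

Section Points.
Variables (K : fieldType) (M : vectType K).
Implicit Types (x y : proj M) (u w : M) (X U : set (proj M)).

Definition rep x : M := vpick (val x).
(** The point [x0] is a default value, taken when [w] is zero. *)
Definition pt (x0 : proj M) w : proj M := insubd x0 <[w]>%VS.

Lemma rep_neq0 x : rep x != 0.
Proof. by rewrite /rep vpick0 -dimv_eq0 (eqP (valP x)). Qed.

Lemma val_rep x : val x = <[rep x]>%VS.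
Proof.
apply/esym/eqP; rewrite eqEdim -memvE memv_pick dim_vline rep_neq0.
by rewrite (eqP (valP x)).
Qed.

Lemma val_pt x0 w : w != 0 -> val (pt x0 w) = <[w]>%VS.
Proof. by move=> w0; rewrite val_insubd dim_vline w0. Qed.

Lemma eq_vline u w : u != 0 -> w != 0 -> (<[u]> = <[w]>)%VS -> exists2 c, c != 0 & u = c *: w.
Proof.
move=> u0 w0 E; have : u \in <[w]>%VS by rewrite -E memv_line.
move=> /vlineP[c uE]; exists c => //; apply: contraNneq u0 => c0; by rewrite uE c0 scale0r.
Qed.

Lemma vline_scale c w : c != 0 -> (<[c *: w]> = <[w]>)%VS.
Proof.
move=> c0; apply/eqP; rewrite eqEsubv -!memvE memvZ ?memv_line //=.
by rewrite -[X in X \in _](scalerK c0) memvZ ?memv_line.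
Qed.

Lemma rep_scale x w : w != 0 -> val x = <[w]>%VS -> exists2 c, c != 0 & rep x = c *: w.
Proof. by move=> w0 xw; apply: eq_vline; rewrite ?rep_neq0 // -val_rep. Qed.

Lemma pt_scale x0 c w : c != 0 -> pt x0 (c *: w) = pt x0 w.
Proof. by move=> c0; rewrite /pt vline_scale. Qed.

Lemma pt_rep x0 x : pt x0 (rep x) = x.
Proof. by apply: val_inj; rewrite val_pt ?rep_neq0 // -val_rep. Qed.

Lemma pt_inj x0 u w : u != 0 -> w != 0 -> pt x0 u = pt x0 w -> exists2 c, c != 0 & u = c *: w.
Proof. by move=> u0 w0 E; apply: eq_vline => //; rewrite -(val_pt x0 u0) E val_pt. Qed.

Lemma rep_pt x0 w : w != 0 -> exists2 c, c != 0 & rep (pt x0 w) = c *: w.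
Proof. by move=> w0; apply: rep_scale => //; rewrite val_pt. Qed.

Lemma hpoly_rep0 d f x w : hpoly d f -> w != 0 -> val x = <[w]>%VS -> (f (rep x) == 0) = (f w == 0).
Proof.
move=> hf w0 /(rep_scale w0)[c c0 ->]; rewrite (hpoly_scale _ _ hf) mulf_eq0.
by rewrite expf_eq0 (negPf c0) andbF.
Qed.

Lemma hpoly_ratio d f g x w : hpoly d f -> hpoly d g -> w != 0 -> val x = <[w]>%VS ->
  f (rep x) / g (rep x) = f w / g w.
Proof.
move=> hf hg w0 /(rep_scale w0)[c c0 ->]; rewrite (hpoly_scale _ _ hf) (hpoly_scale _ _ hg).
by rewrite -mulf_div divff ?mul1r // expf_neq0.
Qed.

Lemma zopenP U : zopen U <-> forall x, U x -> exists d f,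
  [/\ hpoly d f, f (rep x) != 0 & forall y, f (rep y) != 0 -> U y].
Proof.
split=> [[S [Sh SE]] x Ux|H].
  have : ~ (forall P, S P -> peval P x = 0).
    by move=> HS; have : (~` U)%classic x by rewrite SE.
  move/existsNP => [P /not_implyP[SP /eqP Px]].
  have [d hP] := Sh P SP; have [f hf fE] := peval_hpoly hP.
  exists d, f; split=> // [|y fy]; first by rewrite -fE.
  apply: contrapT => nU; have : (~` U)%classic y by [].
  by rewrite SE => /(_ P SP) /eqP; rewrite fE (negPf fy).
exists [set P | (exists d, P \is d.-homog) /\ forall y, peval P y != 0 -> U y]%classic; split=> [P []//|].
apply/seteqP; split=> x /=.
  by move=> nU P [_ PU]; apply/eqP; apply: contra_notT nU => /PU.
move=> HS Ux; have [d [f [[P hP PE] fx fU]]] := H x Ux.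
have : peval P x = 0.
  apply: HS; split; first by exists d.
  by move=> y; rewrite /peval -PE; exact: fU.
by rewrite /peval -PE => E; rewrite -/(rep x) E eqxx in fx.
Qed.

Lemma zopenI U U' : zopen U -> zopen U' -> zopen (U `&` U')%classic.
Proof.
move=> /zopenP Uo /zopenP Uo'; apply/zopenP => x [/Uo[d [f [hf fx fU]]] /Uo'[e [g [hg gx gU]]]].
exists (d + e)%N, (fun u => f u * g u); split; [exact: hpolyM | by rewrite mulf_neq0 |].
by move=> y; rewrite mulf_eq0 negb_or => /andP[/fU ? /gU ?].
Qed.

Lemma zopen_hpoly d f : hpoly d f -> zopen [set x | f (rep x) != 0]%classic.
Proof. by move=> hf; apply/zopenP => x /= fx; exists d, f. Qed.

Lemma zclosure_hpoly X d f : hpoly d f -> (forall x, X x -> f (rep x) = 0) ->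
  forall x, zclosure X x -> f (rep x) = 0.
Proof.
move=> [P hP PE] fX x /(_ [set x | peval P x = 0]%classic); rewrite /= /peval -PE; apply; split.
  exists [set P]%classic; split=> [_ ->|]; first by exists d.
  by apply/seteqP; split=> y /= => [Py _ -> //|]; exact.
by move=> y /fX; rewrite /= PE.
Qed.

Lemma in_zclosure X x : (forall d f, hpoly d f -> (forall y, X y -> f (rep y) = 0) -> f (rep x) = 0) ->
  zclosure X x.
Proof.
move=> H Z [[S [Sh ->]] XS] P SP; have [d hP] := Sh P SP; have [f hf fE] := peval_hpoly hP.
by rewrite fE; apply: (H d) => // y Xy; rewrite -fE; exact: (XS y Xy).
Qed.

Lemma regular_onP X (f : proj M -> K) : regular_on X f <->
  forall x, X x -> exists e o d p q, [/\ hpoly e o, o (rep x) != 0, hpoly d p, hpoly d q &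
    forall y, X y -> o (rep y) != 0 -> q (rep y) != 0 /\ f y = p (rep y) / q (rep y)].
Proof.
split=> H x Xx.
  have [U [d [P [Q [Uo Ux hP hQ E]]]]] := H x Xx.
  have [e [o [ho ox oU]]] := (zopenP U).1 Uo x Ux.
  have [p hp pE] := peval_hpoly hP; have [q hq qE] := peval_hpoly hQ.
  exists e, o, d, p, q; split=> // y Xy oy.
  by have := E y Xy (oU y oy); rewrite pE qE.
have [e [o [d [p [q [ho ox [P hP PE] [Q hQ QE] E]]]]]] := H x Xx.
exists [set x | o (rep x) != 0]%classic, d, P, Q; split=> //; first exact: (zopen_hpoly ho).
by move=> y Xy oy; have := E y Xy oy; rewrite PE QE.
Qed.

Lemma regular_on_sub X Y (f : proj M -> K) : (Y `<=` X)%classic -> regular_on X f -> regular_on Y f.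
Proof.
move=> YX /regular_onP H; apply/regular_onP => x /YX/H[e [o [d [p [q [ho ox hp hq E]]]]]].
by exists e, o, d, p, q; split=> // y /YX; exact: E.
Qed.

Lemma regular_ratio X d f g : hpoly d f -> hpoly d g -> (forall x, X x -> g (rep x) != 0) ->
  regular_on X (fun x => f (rep x) / g (rep x)).
Proof.
move=> hf hg g0; apply/regular_onP => x Xx; exists 0%N, (fun=> 1), d, f, g.
by split=> //; [exact: hpolyC | exact: oner_neq0 | move=> y Xy _; split; first exact: g0].
Qed.

End Points.

Section RegularMaps.
Variables (K : fieldType) (N M : vectType K).
Variables (Y : set (proj N)) (X : set (proj M)) (phi : proj N -> proj M).

Lemma hmap_regular_map : (forall y, Y y -> X (phi y)) ->
  (forall y, Y y -> exists e o d (F : N -> M), [/\ hpoly e o, o (rep y) != 0, hmap d F &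
     forall y', Y y' -> o (rep y') != 0 -> F (rep y') != 0 /\ val (phi y') = <[F (rep y')]>%VS]) ->
  regular_map Y X phi.
Proof.
move=> YX loc; split=> // [U Uo|U f Uo fr].
  exists [set y | exists e o d (F : N -> M) d' g, [/\ hpoly e o, hmap d F, hpoly d' g, o (rep y) != 0 /\ g (F (rep y)) != 0 &
     forall y', Y y' -> o (rep y') != 0 -> g (F (rep y')) != 0 -> U (phi y')]]%classic.
    apply/zopenP => y /= [e [o [d [F [d' [g [ho hF hg [oy gy] H]]]]]]].
    exists (e + d * d')%N, (fun u => o u * g (F u)); split; first exact: hpolyM ho (hpoly_comp hg hF).
      by rewrite mulf_neq0.
    move=> y'; rewrite mulf_eq0 negb_or => /andP[oy' gy'].
    by exists e, o, d, F, d', g.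
  move=> y Yy; split=> [[e [o [d [F [d' [g [_ _ _ [oy gy] H]]]]]]]|Uy]; first exact: H.
  have [e [o [d [F [ho oy hF E]]]]] := loc y Yy.
  have [d' [g [hg gy gU]]] := (zopenP U).1 Uo _ Uy.
  exists e, o, d, F, d', g; split=> //.
    by split=> //; have [F0 pE] := E y Yy oy; rewrite -(hpoly_rep0 hg F0 pE).
  move=> y' Yy' oy' gy'; apply: gU; have [F0 pE] := E y' Yy' oy'.
  by rewrite (hpoly_rep0 hg F0 pE).
apply/regular_onP => y [Yy Uy].
have [e [o [d [F [ho oy hF E]]]]] := loc y Yy.
have [e' [o' [d' [p [q [ho' oy' hp hq E']]]]]] := (regular_onP _ _).1 fr (phi y) (conj (YX y Yy) Uy).
exists (e + d * e')%N, (fun u => o u * o' (F u)), (d * d')%N, (p \o F), (q \o F).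
split; first exact: hpolyM ho (hpoly_comp ho' hF).
- rewrite mulf_neq0 //; have [F0 pE] := E y Yy oy.
  by rewrite -(hpoly_rep0 ho' F0 pE).
- exact: hpoly_comp.
- exact: hpoly_comp.
move=> y' [Yy' Uy']; rewrite mulf_eq0 negb_or => /andP[oy1 oy2].
have [F0 pE] := E y' Yy' oy1.
have [|q0 fE] := E' (phi y') (conj (YX y' Yy') Uy'); first by rewrite (hpoly_rep0 ho' F0 pE).
by rewrite /= -(hpoly_rep0 hq F0 pE) q0 fE (hpoly_ratio hp hq F0 pE).
Qed.

End RegularMaps.

(** * Polynomial and regular functions on parameter spaces *)

Section PolynomialFunctions.
Variables (K : closedFieldType) (A : idomainType) (T : Type) (ev : T -> {rmorphism A -> K}).
Implicit Types f g : T -> K.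

Definition pol f := exists a, forall t, ev t a = f t.

Lemma eq_pol f g : f =1 g -> pol f -> pol g.
Proof. by move=> fg [a aE]; exists a => t; rewrite aE fg. Qed.

Lemma polD f g : pol f -> pol g -> pol (fun t => f t + g t).
Proof. by move=> [a aE] [b bE]; exists (a + b) => t; rewrite rmorphD aE bE. Qed.

Lemma polM f g : pol f -> pol g -> pol (fun t => f t * g t).
Proof. by move=> [a aE] [b bE]; exists (a * b) => t; rewrite rmorphM aE bE. Qed.

Lemma polN f : pol f -> pol (fun t => - f t).
Proof. by move=> [a aE]; exists (- a) => t; rewrite rmorphN aE. Qed.

Lemma pol0 : pol (fun=> 0).
Proof. by exists 0 => t; rewrite rmorph0. Qed.

Lemma pol1 : pol (fun=> 1).
Proof. by exists 1 => t; rewrite rmorph1. Qed.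

Lemma polX f k : pol f -> pol (fun t => f t ^+ k).
Proof. by move=> [a aE]; exists (a ^+ k) => t; rewrite rmorphXn aE. Qed.

Lemma pol_sum (I : Type) (r : seq I) (Q : pred I) (F : I -> T -> K) :
  (forall i, Q i -> pol (F i)) -> pol (fun t => \sum_(i <- r | Q i) F i t).
Proof.
move=> H; elim: r => [|i r IH]; first by apply: eq_pol pol0 => t; rewrite big_nil.
have [Qi|nQ] := boolP (Q i); last by apply: eq_pol IH => t; rewrite big_cons (negPf nQ).
by apply: eq_pol (polD (H i Qi) IH) => t; rewrite big_cons Qi.
Qed.

Lemma pol_prod (I : Type) (r : seq I) (Q : pred I) (F : I -> T -> K) :
  (forall i, Q i -> pol (F i)) -> pol (fun t => \prod_(i <- r | Q i) F i t).
Proof.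
move=> H; elim: r => [|i r IH]; first by apply: eq_pol pol1 => t; rewrite big_nil.
have [Qi|nQ] := boolP (Q i); last by apply: eq_pol IH => t; rewrite big_cons (negPf nQ).
by apply: eq_pol (polM (H i Qi) IH) => t; rewrite big_cons Qi.
Qed.

Lemma pol_det n (F : T -> 'M[K]_n) : (forall i j, pol (fun t => F t i j)) -> pol (fun t => \det (F t)).
Proof.
move=> H; have Hf : forall i, exists a : 'I_n -> A, forall j t, ev t (a j) = F t i j.
  by move=> i; have [b bE] := choice (H i); exists b.
have [a aE] := choice Hf.
exists (\det (\matrix_(i, j) a i j)) => t; rewrite -det_map_mx; congr (\det _).
by apply/matrixP => i j; rewrite !mxE.
Qed.

Definition reg (D : T -> Prop) f := forall t, D t -> regular_at ev D f t.

Lemma regP D f : reg D f <-> forall t, D t -> exists o p q, [/\ pol o, pol p, pol q, o t != 0 &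
  forall t', D t' -> o t' != 0 -> q t' != 0 /\ f t' = p t' / q t'].
Proof.
split=> H t Dt.
  have [a [P [Q [at0 E]]]] := H t Dt; exists (fun t => ev t a), (fun t => ev t P), (fun t => ev t Q).
  by split=> //; [exists a | exists P | exists Q].
have [o [p [q [[a aE] [P PE] [Q QE] ot E]]]] := H t Dt.
by exists a, P, Q; rewrite aE; split=> // t' Dt'; rewrite aE PE QE; exact: E.
Qed.

Lemma pol_reg D f : pol f -> reg D f.
Proof.
move=> pf; apply/regP => t Dt; exists (fun=> 1), f, (fun=> 1); split=> //; try exact: pol1.
  exact: oner_neq0.
by move=> t' _ _; rewrite oner_neq0 divr1.
Qed.

Lemma reg_sub D D' f : (forall t, D' t -> D t) -> reg D f -> reg D' f.
Proof.
move=> DD /regP H; apply/regP => t Dt; have [o [p [q [ho hp hq ot E]]]] := H t (DD t Dt).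
by exists o, p, q; split=> // t' Dt'; exact: E (DD t' Dt').
Qed.

Lemma eq_reg D f g : (forall t, D t -> f t = g t) -> reg D f -> reg D g.
Proof.
move=> fg /regP H; apply/regP => t Dt; have [o [p [q [ho hp hq ot E]]]] := H t Dt.
by exists o, p, q; split=> // t' Dt' ot'; rewrite -fg //; exact: E.
Qed.

Lemma regM D f g : reg D f -> reg D g -> reg D (fun t => f t * g t).
Proof.
move=> /regP Hf /regP Hg; apply/regP => t Dt.
have [o [p [q [ho hp hq ot E]]]] := Hf t Dt; have [o' [p' [q' [ho' hp' hq' ot' E']]]] := Hg t Dt.
exists (fun t => o t * o' t), (fun t => p t * p' t), (fun t => q t * q' t).
split; try exact: polM; first by rewrite mulf_neq0.
move=> t' Dt'; rewrite mulf_eq0 negb_or => /andP[ot1 ot2].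
have [q0 ->] := E t' Dt' ot1; have [q'0 ->] := E' t' Dt' ot2.
by rewrite mulf_neq0 // mulf_div.
Qed.

Lemma regV D f : (forall t, D t -> f t != 0) -> reg D f -> reg D (fun t => (f t)^-1).
Proof.
move=> f0 /regP Hf; apply/regP => t Dt; have [o [p [q [ho hp hq ot E]]]] := Hf t Dt.
exists o, q, p; split=> // t' Dt' ot'; have [q0 fE] := E t' Dt' ot'.
rewrite fE invf_div; split=> //; have := f0 t' Dt'; rewrite fE mulf_eq0 negb_or.
by case/andP.
Qed.

Lemma reg_div D f g : (forall t, D t -> g t != 0) -> reg D f -> reg D g -> reg D (fun t => f t / g t).
Proof. by move=> g0 rf rg; apply: regM => //; exact: regV. Qed.

Lemma reg_local D f : (forall t, D t -> exists a D', [/\ pol a, a t != 0, D' t,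
   forall t', D t' -> a t' != 0 -> D' t' & reg D' f]) -> reg D f.
Proof.
move=> H; apply/regP => t Dt; have [a [D' [pa at0 Dt' DD /regP rf]]] := H t Dt.
have [o [p [q [ho hp hq ot E]]]] := rf t Dt'.
exists (fun t => a t * o t), p, q; split=> //; [exact: polM | by rewrite mulf_neq0 |].
by move=> t' Dt''; rewrite mulf_eq0 negb_or => /andP[a' o']; apply: E => //; exact: DD.
Qed.

Definition has_const := forall c, pol (fun=> c).

Section VectorValued.
Variables (M : vectType K).
Definition pmap (F : T -> M) := forall i, pol (fun t => coord (vbasis {:M}) i (F t)).

Lemma pol_hpoly d (f : M -> K) (F : T -> M) : has_const -> hpoly d f -> pmap F -> pol (fun t => f (F t)).
Proof.
move=> cst [P hP PE] hF.
apply: (@eq_pol (fun t => \sum_(m <- msupp P) P@_m * \prod_i coord (vbasis {:M}) i (F t) ^+ m i)).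
  by move=> t; rewrite PE mevalE.
apply: pol_sum => m _; apply: polM; first exact: cst.
by apply: pol_prod => i _; apply: polX.
Qed.
End VectorValued.
End PolynomialFunctions.

Section Substitution.
Variables (K : closedFieldType) (A A' : idomainType) (T T' : Type).
Variables (ev : T -> {rmorphism A -> K}) (ev' : T' -> {rmorphism A' -> K}).

Definition polmap (phi : T' -> T) := forall f, pol ev f -> pol ev' (f \o phi).

Lemma reg_comp phi D D' f : polmap phi -> (forall t, D' t -> D (phi t)) -> reg ev D f -> reg ev' D' (f \o phi).
Proof.
move=> pphi DD /regP H; apply/regP => t Dt; have [o [p [q [ho hp hq ot E]]]] := H _ (DD t Dt).
exists (o \o phi), (p \o phi), (q \o phi); split=> //; try exact: pphi.
by move=> t' Dt'; exact: E (DD t' Dt').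
Qed.

Lemma pmap_comp (M : vectType K) phi (F : T -> M) : polmap phi -> pmap ev F -> pmap ev' (F \o phi).
Proof. by move=> pphi pF i; exact: (pphi _ (pF i)). Qed.
End Substitution.

Section AffineSpace.
Variable K : closedFieldType.

Fixpoint aff_ring d : idomainType := if d is d'.+1 then {poly (aff_ring d')} else K.

(** Points are infinite sequences of which only the first [d] entries are read: one type of points
    serves every dimension, and [geometric_poly] can be iterated. *)
Fixpoint aff_ev d (v : nat -> K) : {rmorphism aff_ring d -> K} :=
  match d return {rmorphism aff_ring d -> K} with
  | 0 => idfun
  | d'.+1 => evX (aff_ev d') (v, v d')
  end.

Lemma eq_aff_ev d v v' : (forall k, (k < d)%N -> v k = v' k) -> aff_ev d v =1 aff_ev d v'.
Proof.
elim: d => // d IH vv a; rewrite /= /horner_eval vv //; congr (_.[_]).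
by apply/polyP => i; rewrite !coef_map; apply: IH => k kd; apply: vv; exact: ltnW.
Qed.

Lemma geometric_reparam (A : idomainType) (T T' : Type) (ev : T -> {rmorphism A -> K}) (ev' : T' -> {rmorphism A -> K}) :
  (forall t, exists t', ev' t' =1 ev t) -> geometric ev -> geometric ev'.
Proof.
move=> sur [pit UF nss]; split=> // [a /pit[t ta]|p c pP pc].
  by have [t' E] := sur t; exists t'; rewrite E.
have [t [tp tc]] := nss p c pP pc; have [t' E] := sur t; by exists t'; rewrite !E.
Qed.

Lemma geometric_aff d : geometric (aff_ev d).
Proof.
elim: d => [|d IH].
  apply: geometric_reparam (geometric_base K) => _; by exists (fun=> 0).
apply: geometric_reparam (geometric_poly IH) => -[v x].
exists (fun k => if k == d then x else v k) => a /=; rewrite /horner_eval eqxx; congr (_.[_]).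
by apply/polyP => i; rewrite !coef_map; apply: eq_aff_ev => k kd; rewrite ltn_eqF.
Qed.

Lemma aff_const d c : pol (aff_ev d) (fun=> c).
Proof.
elim: d => [|d [a aE]]; first by exists c.
by exists a%:P => v; rewrite /= /horner_eval map_polyC hornerC; exact: aE.
Qed.

Lemma aff_coord d k : (k < d)%N -> pol (aff_ev d) (fun v => v k).
Proof.
elim: d => // d IH; rewrite ltnS leq_eqVlt => /orP[/eqP->|/IH[a aE]].
  by exists 'X => v; rewrite /= /horner_eval map_polyX hornerX.
by exists a%:P => v; rewrite /= /horner_eval map_polyC hornerC; exact: aE.
Qed.

Lemma aff_subst d (A : idomainType) (T : Type) (ev : T -> {rmorphism A -> K}) (c : T -> nat -> K) :
  has_const ev -> (forall k, (k < d)%N -> pol ev (fun t => c t k)) -> polmap (aff_ev d) ev c.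
Proof.
move=> cst; elim: d => [|d IH] pc f [a aE]; apply: (eq_pol (fun t => aE (c t))); first exact: cst.
rewrite /= in a aE *.
apply: (@eq_pol _ _ _ _ (fun t => \sum_(i < size a) aff_ev d (c t) a`_i * c t d ^+ i)).
  move=> t; rewrite /horner_eval (horner_coef_wide _ (size_poly _ _)).
  by apply: eq_bigr => i _; rewrite coef_map.
apply: pol_sum => i _; apply: polM; last by apply: polX; exact: pc.
by apply: (IH (fun k kd => pc k (ltnW kd)) (fun v => aff_ev d v a`_i)); exists a`_i.
Qed.

Definition line_ev (x : K) : {rmorphism {poly K} -> K} := horner_eval x.

Lemma line_const : has_const line_ev.
Proof. by move=> c; exists c%:P => x; rewrite /= /horner_eval hornerC. Qed.

Lemma line_id : pol line_ev id.
Proof. by exists 'X => x; rewrite /= /horner_eval hornerX. Qed.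

Lemma poly_eq0 (P : {poly K}) (c : {poly K}) : c != 0 -> (forall x, c.[x] != 0 -> P.[x] = 0) -> P = 0.
Proof.
move=> c0 H; apply/eqP; apply: contraT => P0.
have /closed_nonrootP[x] : c * P != 0 by rewrite mulf_neq0.
by rewrite /root hornerM mulf_eq0 negb_or => /andP[/H->]; rewrite eqxx.
Qed.

(** A fraction describing the function near one point is reduced to lowest terms p / q. At any other
    point the local fraction has nonzero denominator, so a zero of q would be a zero of p, against
    coprimality. Hence q has no root and is constant. *)
Lemma reg_line f : reg line_ev (fun=> True) f -> pol line_ev f.
Proof.
move=> rf.
have [a [P [Q [a0 E]]]] := rf 0 I.
have a00 : a != 0 by apply: contraNneq a0 => ->; rewrite rmorph0.
have /closed_nonrootP[x0 ax0] := a00.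
have Q0 : Q != 0 by apply: contraNneq (E x0 I ax0).1 => ->; rewrite rmorph0.
pose g := gcdp P Q; have g0 : g != 0 by rewrite gcdp_eq0 negb_and Q0 orbT.
have PE : P = P %/ g * g by rewrite divpK ?dvdp_gcdl.
have QE : Q = Q %/ g * g by rewrite divpK ?dvdp_gcdr.
pose p := P %/ g; pose q := Q %/ g.
have pq : coprimep p q by rewrite /p /q /g coprimep_div_gcd // Q0 orbT.
have main x : q.[x] != 0 /\ f x = p.[x] / q.[x].
  have [b [P' [Q' [bx E']]]] := rf x I.
  have b0 : b != 0 by apply: contraNneq bx => ->; rewrite rmorph0.
  have pqE : p * Q' = P' * q.
    apply/eqP; rewrite -subr_eq0; apply/eqP; apply: (@poly_eq0 _ (a * b * g)); first by rewrite !mulf_neq0.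
    move=> y; rewrite !hornerM !mulf_eq0 !negb_or => /andP[/andP[ay b_y] gy].
    have [Qy fy] := E y I ay; have [Q'y fy'] := E' y I b_y.
    apply/eqP; rewrite hornerD hornerN !hornerM subr_eq0; apply/eqP.
    apply: (mulfI gy); have : P.[y] * Q'.[y] = P'.[y] * Q.[y].
      by apply/eqP; rewrite -eqr_div //; apply/eqP; rewrite -[LHS]fy.
    by rewrite PE QE !hornerM -/p -/q => H; rewrite mulrCA mulrA H; ring.
  have [Q'x fx] := E' x I bx.
  have Hx : p.[x] * Q'.[x] = P'.[x] * q.[x] by rewrite -!hornerM pqE.
  have qx : q.[x] != 0.
    apply/negP => /eqP qx0; have : root p x.
      by move/eqP: Hx; rewrite qx0 mulr0 mulf_eq0 (negPf Q'x) orbF.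
    by move/(coprimep_root pq); rewrite qx0 eqxx.
  by split=> //; rewrite fx; apply/eqP; rewrite eqr_div // Hx.
have sq : size q == 1%N.
  apply: contraT => /closed_rootP[x]; by rewrite /root (negPf (main x).1).
have /size_poly1P[c c0 qE] := sq.
exists (c^-1 *: p) => x; rewrite /= /horner_eval hornerZ (main x).2 qE hornerC mulrC //.
Qed.

Lemma unit_line f : reg line_ev (fun=> True) f -> (forall t, f t != 0) -> forall t t', f t = f t'.
Proof.
move=> rf f0; have [P PE] := reg_line rf.
have sP : size P == 1%N.
  by apply: contraT => /closed_rootP[x /eqP px]; have := f0 x; rewrite -PE /= /horner_eval px eqxx.
have /size_poly1P[c _ PC] := sP.
by move=> t t'; rewrite -!PE PC /= /horner_eval !hornerC.
Qed.

End AffineSpace.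

(** * Sections of line bundles along polynomial families *)

Section Sections.
Variables (K : closedFieldType) (M : vectType K) (X : set (proj M)) (E : cocycle M) (x0 : proj M).
Hypothesis hE : is_line_bundle X E.
Notation J := (lb_index E).
Notation pt := (pt x0).

Section Space.
Variables (A : idomainType) (T : Type) (ev : T -> {rmorphism A -> K}).
Hypothesis cst : has_const ev.
Implicit Types (D : T -> Prop) (F : T -> M) (S : J -> T -> K).

Definition into (Y : set (proj M)) D F := forall t, D t -> F t != 0 /\ Y (pt (F t)).

Lemma pol_open D F (U : set (proj M)) t : pmap ev F -> (forall t, D t -> F t != 0) -> zopen U -> D t -> U (pt (F t)) ->
  exists a, [/\ pol ev a, a t != 0 & forall t', D t' -> a t' != 0 -> U (pt (F t'))].
Proof.
move=> pF F0 /zopenP Uo Dt /Uo[d [f [hf ft fU]]].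
exists (fun t => f (F t)); split; first exact: pol_hpoly hf pF.
  by rewrite -(hpoly_rep0 hf (F0 t Dt) (val_pt x0 (F0 t Dt))).
move=> t' Dt' ft'; apply: fU.
by rewrite (hpoly_rep0 hf (F0 t' Dt') (val_pt x0 (F0 t' Dt'))).
Qed.

Lemma reg_pullback D F (Y : set (proj M)) f : pmap ev F -> into Y D F -> regular_on Y f ->
  reg ev D (fun t => f (pt (F t))).
Proof.
move=> pF FY /regular_onP rf; apply/regP => t Dt; have [F0 Yt] := FY t Dt.
have [e [o [d [p [q [ho ox hp hq H]]]]]] := rf _ Yt.
exists (fun t => o (F t)), (fun t => p (F t)), (fun t => q (F t)).
split; [exact: pol_hpoly ho pF | exact: pol_hpoly hp pF | exact: pol_hpoly hq pF | |].
  by rewrite -(hpoly_rep0 ho F0 (val_pt x0 F0)).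
move=> t' Dt' ot'; have [F0' Yt'] := FY t' Dt'; have vE := val_pt x0 F0'.
have [|q0 ->] := H _ Yt'; first by rewrite (hpoly_rep0 ho F0' vE).
by rewrite -(hpoly_rep0 hq F0' vE) q0 (hpoly_ratio hp hq F0' vE).
Qed.

(* the functions S i are the expressions of a nowhere vanishing section of the
   pullback of E along F, in the trivialisations i *)
Definition sect D F S := [/\ forall i, reg ev (fun t => D t /\ lb_open i (pt (F t))) (S i),
  forall i t, D t -> lb_open i (pt (F t)) -> S i t != 0 &
  forall i j t, D t -> lb_open i (pt (F t)) -> lb_open j (pt (F t)) ->
    S i t = lb_trans i j (pt (F t)) * S j t].

Lemma sect_congr D F F' S : (forall t, D t -> pt (F t) = pt (F' t)) -> sect D F S -> sect D F' S.
Proof.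
move=> FF [rS S0 SC]; split=> [i|i t Dt|i j t Dt].
- by apply: reg_sub (rS i) => t [Dt]; rewrite FF.
- by rewrite -FF //; exact: S0.
- by rewrite -FF //; exact: SC.
Qed.

Lemma ex_sect D F : geometric ev -> pmap ev F -> into X D F ->
  (forall t, D t -> exists a, [/\ pol ev a, a t != 0 & forall t', a t' != 0 -> D t']) ->
  exists S, sect D F S.
Proof.
move=> geo pF FX Do; have [Eo Ec Er En Em] := hE.
have F0 t : D t -> F t != 0 by case/FX.
pose U (i : J) t := D t /\ lb_open i (pt (F t)).
have U_open i t : U i t -> exists a, ev t a != 0 /\ forall t', ev t' a != 0 -> U i t'.
  move=> [Dt Ut]; have [oD [[a aE] at0 aD]] := Do t Dt.
  have [oU [[b bE] bt bU]] := pol_open pF F0 (Eo i) Dt Ut.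
  exists (a * b); rewrite rmorphM mulf_neq0 ?aE ?bE //; split=> // t'.
  rewrite rmorphM mulf_eq0 negb_or aE bE => /andP[at' bt'].
  by split; [exact: aD | apply: bU => //; exact: aD].
have g_reg i j t : U i t -> U j t -> regular_at ev (fun t' => U i t' /\ U j t') (fun t => lb_trans i j (pt (F t))) t.
  move=> Ui Uj; have : reg ev (fun t => U i t /\ U j t) (fun t => lb_trans i j (pt (F t))).
    apply: reg_pullback pF _ (Er i j) => t' [[Dt' Ui'] [_ Uj']]; split; first exact: F0.
    by split=> //; split=> //; have [] := FX t' Dt'.
  by apply.
have g0 i j t : U i t -> U j t -> lb_trans i j (pt (F t)) != 0.
  by move=> [Dt Ui] [_ Uj]; apply: En => //; have [] := FX t Dt.
have gc i j k t : U i t -> U j t -> U k t ->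
    lb_trans i k (pt (F t)) = lb_trans i j (pt (F t)) * lb_trans j k (pt (F t)).
  by move=> [Dt Ui] [_ Uj] [_ Uk]; apply: Em => //; have [] := FX t Dt.
have [P [Q [PQ0 gE]]] := picard_trivial geo U_open g_reg g0 gc.
exists (fun i t => ev t (P i) / ev t (Q i)); split=> [i|i t Dt Ut|i j t Dt Ui Uj].
- apply: reg_div; [by move=> t /PQ0[] | |]; apply: pol_reg; by [exists (P i) | exists (Q i)].
- have [P0 Q0] := PQ0 i t (conj Dt Ut); by rewrite mulf_neq0 ?invr_eq0.
- have [P0 Q0] := PQ0 j t (conj Dt Uj).
  by rewrite (gE i j t) // mulfVK // mulf_neq0 ?invr_eq0.
Qed.

End Space.

Lemma sect_comp (A A' : idomainType) (T T' : Type) (ev : T -> {rmorphism A -> K})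
    (ev' : T' -> {rmorphism A' -> K}) (phi : T' -> T) D D' F S :
  polmap ev ev' phi -> (forall t, D' t -> D (phi t)) -> sect ev D F S ->
  sect ev' D' (F \o phi) (fun i => S i \o phi).
Proof.
move=> pphi DD [rS S0 SC]; split=> [i|i t Dt|i j t Dt].
- by apply: reg_comp pphi _ (rS i) => t [/DD].
- by apply: S0; exact: DD.
- by apply: SC; exact: DD.
Qed.

(** The quotient of two frames does not depend on the trivialisation; it is a regular function
    without zeros on the affine line, hence constant. *)
Lemma sect_line F S S' : pmap (@line_ev K) F -> into X (fun=> True) F ->
  sect (@line_ev K) (fun=> True) F S -> sect (@line_ev K) (fun=> True) F S' ->
  exists2 c, c != 0 & forall i t, lb_open i (pt (F t)) -> S i t = c * S' i t.
Proof.
move=> pF FX [rS S0 SC] [rS' S0' SC']; have [Eo Ec _ En _] := hE.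
have F0 t : True -> F t != 0 by move=> _; have [] := FX t I.
have XF t : X (pt (F t)) by have [] := FX t I.
have [idx idxP] := choice (fun t => Ec _ (XF t)).
pose h t := S (idx t) t / S' (idx t) t.
have hP i t : lb_open i (pt (F t)) -> S i t = h t * S' i t.
  move=> Ui; rewrite (SC _ _ _ I Ui (idxP t)) (SC' _ _ _ I Ui (idxP t)) /h mulrCA mulfVK //.
  exact: S0'.
have rh : reg (@line_ev K) (fun=> True) h.
  apply: reg_local => t _; have [a [pa at0 aU]] := pol_open (@line_const K) pF F0 (Eo (idx t)) I (idxP t).
  exists a, (fun t' => True /\ lb_open (idx t) (pt (F t'))); split=> //.
    by move=> t' _ at'; split=> //; exact: aU.
  apply: (@eq_reg _ _ _ _ _ (fun t' => S (idx t) t' / S' (idx t) t')).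
    by move=> t' [_ Ut']; rewrite (hP _ _ Ut') mulfK // S0'.
  by apply: reg_div (rS _) (rS' _) => t' [_]; exact: S0'.
have h0 t : h t != 0 by rewrite mulf_neq0 ?invr_eq0 // ?S0 ?S0'.
by exists (h 0) => // i t /hP ->; rewrite (unit_line rh h0 t 0).
Qed.

End Sections.

Section Plane.
Variable K : closedFieldType.

Definition row2 (a b : K) : 'rV[K]_2 := \row_j (if j == 0 then a else b).

Lemma row2_0 a b : row2 a b 0 0 = a. Proof. by rewrite mxE. Qed.
Lemma row2_1 a b : row2 a b 0 1 = b. Proof. by rewrite mxE. Qed.
Lemma row2E (v : 'rV[K]_2) : v = row2 (v 0 0) (v 0 1).
Proof.
apply/rowP => j; rewrite mxE; case: j => -[|[|//]] hj /=.
  by congr (v _ _); apply: val_inj.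
by congr (v _ _); apply: val_inj.
Qed.

Lemma row2_eq0 (v : 'rV[K]_2) : (v == 0) = (v 0 0 == 0) && (v 0 1 == 0).
Proof.
apply/eqP/andP => [->|[/eqP v0 /eqP v1]]; first by rewrite !mxE eqxx.
by rewrite (row2E v) v0 v1; apply/rowP => j; rewrite !mxE if_same.
Qed.

Definition plane_coords (v : 'rV[K]_2) (k : nat) : K := if k == 0%N then v 0 0 else v 0 1.
Definition plane_ev (v : 'rV[K]_2) : {rmorphism aff_ring K 2 -> K} := aff_ev 2 (plane_coords v).

Lemma geometric_plane : geometric plane_ev.
Proof.
apply: geometric_reparam (geometric_aff K 2) => t; exists (row2 (t 0%N) (t 1%N)).
move=> x; apply: eq_aff_ev => -[|[|k]] // _; rewrite /plane_coords /=; [exact: row2_0 | exact: row2_1].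
Qed.

Lemma plane_const : has_const plane_ev.
Proof. by move=> c; have [a aE] := aff_const 2 c; exists a => t; exact: aE. Qed.

Lemma plane_coord (j : 'I_2) : pol plane_ev (fun v => v 0 j).
Proof.
case: j => -[|[|//]] hj.
  have [a aE] := @aff_coord K 2 0 isT; exists a => t; rewrite aE /plane_coords /=.
  by congr (t _ _); apply: val_inj.
have [a aE] := @aff_coord K 2 1 isT; exists a => t; rewrite aE /plane_coords /=.
by congr (t _ _); apply: val_inj.
Qed.

Lemma plane_linear (l : {linear 'rV[K]_2 -> K^o}) : pol plane_ev l.
Proof.
have H : pol plane_ev (fun v : 'rV[K]_2 => \sum_j v 0 j * (l (delta_mx 0 j) : K)).
  by apply: pol_sum => j _; apply: polM; [exact: plane_coord | exact: plane_const].
case: H => x xE; exists x => v; rewrite xE [v in RHS]row_sum_delta linear_sum.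
by apply: eq_bigr => j _; rewrite linearZ.
Qed.

Lemma plane_subst (A : idomainType) (T : Type) (ev : T -> {rmorphism A -> K}) (c : T -> 'rV[K]_2) :
  has_const ev -> pol ev (fun t => c t 0 0) -> pol ev (fun t => c t 0 1) -> polmap plane_ev ev c.
Proof.
move=> cst p0 p1 f [a aE].
have H := @aff_subst K 2 A T ev (fun t => plane_coords (c t)) cst.
apply: (eq_pol (fun t => aE (c t))); apply: (H _ (fun v => aff_ev 2 v a)); last by exists a.
by move=> -[|[|//]] _; rewrite /plane_coords.
Qed.

Lemma hmap_pmap (M : vectType K) d (F : 'rV[K]_2 -> M) : hmap d F -> pmap plane_ev F.
Proof.
move=> hF i; apply: (pol_hpoly (F := id) plane_const (hF i)) => k; exact: plane_linear.
Qed.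

Lemma plane_line (u w : 'rV[K]_2) : polmap plane_ev (@line_ev K) (fun t => u + t *: w).
Proof.
apply: plane_subst; first exact: line_const.
  apply: (@eq_pol _ _ _ _ (fun t => u 0 0 + t * w 0 0)) => [t|]; first by rewrite !mxE.
  by apply: polD; [exact: line_const | apply: polM; [exact: line_id | exact: line_const]].
apply: (@eq_pol _ _ _ _ (fun t => u 0 1 + t * w 0 1)) => [t|]; first by rewrite !mxE.
by apply: polD; [exact: line_const | apply: polM; [exact: line_id | exact: line_const]].
Qed.

Lemma plane_scale c : polmap plane_ev plane_ev (fun z => c *: z).
Proof.
apply: plane_subst; first exact: plane_const.
  apply: (@eq_pol _ _ _ _ (fun z : 'rV[K]_2 => c * z 0 0)) => [t|]; first by rewrite !mxE.
  by apply: polM; [exact: plane_const | exact: plane_coord].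
apply: (@eq_pol _ _ _ _ (fun z : 'rV[K]_2 => c * z 0 1)) => [t|]; first by rewrite !mxE.
by apply: polM; [exact: plane_const | exact: plane_coord].
Qed.

Lemma plane_neq0_open (t : 'rV[K]_2) : t != 0 ->
  exists a, [/\ pol plane_ev a, a t != 0 & forall t', a t' != 0 -> t' != 0].
Proof.
rewrite row2_eq0 negb_and => /orP[t0|t1].
  exists (fun v => v 0 0); split=> // [|v]; first exact: plane_coord.
  by apply: contraNneq => ->; rewrite mxE.
exists (fun v => v 0 1); split=> // [|v]; first exact: plane_coord.
by apply: contraNneq => ->; rewrite mxE.
Qed.

Lemma only_root (P : {poly K}) a : P != 0 -> (forall x, P.[x] = 0 -> x = a) ->
  exists2 c, c != 0 & exists k, P = c *: ('X - a%:P) ^+ k.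
Proof.
move=> P0 H; have [r rE] := closed_field_poly_normal P.
exists (lead_coef P); first by rewrite lead_coef_eq0.
exists (size r); rewrite {1}rE; congr (_ *: _).
rewrite (eq_big_seq (fun=> 'X - a%:P)) => [|z zr].
  by rewrite big_const_seq count_predT iter_mulr_1.
congr ('X - _%:P); apply: H; apply/eqP; rewrite -/(root P z) rE rootZ ?lead_coef_eq0 //.
by rewrite root_prod_XsubC.
Qed.

End Plane.

Lemma hmap_scale (K : fieldType) (N M : vectType K) d (F : N -> M) c u : hmap d F -> F (c *: u) = c ^+ d *: F u.
Proof.
move=> hF; rewrite [LHS](coord_vbasis (memvf _)) [F u in RHS](coord_vbasis (memvf _)) scaler_sumr.
by apply: eq_bigr => i _; rewrite (hpoly_scale _ _ (hF i)) scalerA.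
Qed.

Lemma hpoly_rV (K : fieldType) n (j : 'I_n) : hpoly 1 (fun v : 'rV[K]_n => v 0 j).
Proof.
pose l (v : 'rV[K]_n) : K^o := v 0 j.
have l_lin : linear l by move=> c u v; rewrite /l !mxE.
exact: (hpoly_linear (HB.pack l (GRing.isLinear.Build K 'rV[K]_n K^o _ l l_lin))).
Qed.

(** Injectivity makes 0 the only root of f and 1 the only root of f - f(1). So f = a t^k and f -
    f(1) = b (t - 1)^l. *)
Lemma pol_inj_linear (K : closedFieldType) (f : K -> K) : [pchar K] =i pred0 ->
  pol (@line_ev K) f -> f 0 = 0 -> (forall t t', f t = f t' -> t = t') -> exists2 c, c != 0 & forall t, f t = c * t.
Proof.
move=> K0 [F FE'] f0 f_inj.
have FE t : F.[t] = f t by rewrite -FE'.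
have F0 : F != 0.
  apply/negP => /eqP F0; have := f_inj 0 1; rewrite -!FE F0 !horner0 => /(_ (erefl _)) /esym/eqP.
  by rewrite oner_eq0.
have [|a a0 [k FkE]] := only_root F0 (a := 0).
  by move=> x; rewrite FE => fx; apply: f_inj; rewrite fx f0.
have ft t : f t = a * t ^+ k by rewrite -FE FkE hornerZ horner_exp !hornerE subr0.
have k0 : k != 0%N by apply/negP => /eqP k0; move/eqP: f0; rewrite ft k0 mulr1 (negPf a0).
have G0 : F - (f 1)%:P != 0.
  apply/negP; rewrite subr_eq0 => /eqP FC; have := f_inj 0 1.
  by rewrite -!FE FC !hornerC => /(_ (erefl _)) /esym/eqP; rewrite oner_eq0.
have [|b b0 [l GE]] := only_root G0 (a := 1).
  by move=> x; rewrite !hornerE FE => /eqP; rewrite subr_eq0 => /eqP /f_inj.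
(* The derivative at 1 is a k, nonzero in characteristic 0, whereas that of (t - 1)^l vanishes at 1
   unless l = 1. *)
have l1 : l = 1%N.
  have := congr1 (fun P : {poly K} => P^`().[1]) GE.
  rewrite derivB derivC subr0 FkE !derivZ !deriv_exp !derivXsubC !mul1r !hornerZ !hornerMn !horner_exp !hornerE subr0 subrr expr1n.
  case: l {GE} => [|[|l]] //; rewrite ?mulr0n ?expr0n /= ?mul0rn mulr0 => /eqP.
    by rewrite mulf_eq0 (negPf a0) ((pcharf0P K).1 K0) (negPf k0).
  by rewrite mulf_eq0 (negPf a0) ((pcharf0P K).1 K0) (negPf k0).
have G t : a * t ^+ k - a = b * (t - 1).
  have := congr1 (fun P : {poly K} => P.[t]) GE; rewrite l1 expr1 !hornerE FE !ft expr1n mulr1.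
  by move=> ->.
have ab : a = b by have := G 0; rewrite expr0n (negPf k0) mulr0 !sub0r mulrN1 => /oppr_inj.
exists a => // t; rewrite ft; apply: (addIr (- a)); rewrite G -ab; ring.
Qed.

Lemma vline_rep0 (K : closedFieldType) (y : proj 'rV[K]_2) : rep y 0 0 != 0 ->
  (<[rep y]> = <[(row2 1 (rep y 0 1 / rep y 0 0))%R]>)%VS.
Proof.
move=> y0; rewrite -[RHS](vline_scale _ y0); congr <[_]>%VS.
rewrite {1}(row2E (rep y)); apply/rowP => j; rewrite !mxE; case: ifP => _; first by rewrite mulr1.
by rewrite mulrC mulfVK.
Qed.

(** * The degree of a line bundle on a curve as a weight under scaling *)

Section Degree.
Variables (K : closedFieldType) (M : vectType K) (X : set (proj M)) (E : cocycle M) (x0 : proj M).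
Hypothesis K0 : [pchar K] =i pred0.
Hypothesis hE : is_line_bundle X E.
Variables (C : set (proj M)) (phi : proj 'rV[K]_2 -> proj M) (d : int).
Hypothesis phi_iso : variety_iso [set: proj 'rV[K]_2]%classic C phi.
Hypothesis E_iso : lb_iso [set: proj 'rV[K]_2]%classic (lb_pullback phi E) (O_P1 K d).
Variables (D0 : nat) (gam : 'rV[K]_2 -> M).
Notation V := 'rV[K]_2.
Notation J := (lb_index E).
Notation pt := (pt x0).
Hypothesis gam_hmap : hmap D0 gam.
Hypothesis gam_neq0 : forall z, z != 0 -> gam z != 0.
Hypothesis gam_X : forall z, z != 0 -> X (pt (gam z)).
Hypothesis gam_C : forall z, z != 0 -> C (pt (gam z)).
Hypothesis gam_sur : forall x, C x -> exists2 z, z != 0 & x = pt (gam z).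
Hypothesis gam_inj : forall z z', z != 0 -> z' != 0 -> pt (gam z) = pt (gam z') -> exists c, z = c *: z'.

Lemma pt_gam_scale c z : c != 0 -> pt (gam (c *: z)) = pt (gam z).
Proof. by move=> c0; rewrite (hmap_scale _ _ gam_hmap) pt_scale // expf_neq0. Qed.

Fact dim_point0 : \dim <[row2 1 0 : V]>%VS == 1%N.
Proof. by rewrite dim_vline row2_eq0 row2_0 oner_eq0. Qed.
Fact dim_point1 : \dim <[row2 0 1 : V]>%VS == 1%N.
Proof. by rewrite dim_vline row2_eq0 row2_1 oner_eq0 andbF. Qed.
Definition point0 : proj V := exist _ <[row2 1 0 : V]>%VS dim_point0.
Definition point1 : proj V := exist _ <[row2 0 1 : V]>%VS dim_point1.

Lemma point0P (y : proj V) : (y = point0) <-> rep y 0 1 = 0.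
Proof.
split=> [->|y1].
  have [|c c0 ->] := @rep_scale _ _ point0 (row2 1 0) _ (erefl _); first by rewrite row2_eq0 row2_0 oner_eq0.
  by rewrite mxE row2_1 mulr0.
apply: val_inj; rewrite /= val_rep (row2E (rep y)) y1.
have y0 : rep y 0 0 != 0 by have := rep_neq0 y; rewrite row2_eq0 y1 eqxx andbT.
rewrite -[RHS](vline_scale _ y0); congr <[_]>%VS; apply/rowP => j; rewrite !mxE.
by case: ifP; rewrite ?mulr1 ?mulr0.
Qed.

Lemma point1P (y : proj V) : (y = point1) <-> rep y 0 0 = 0.
Proof.
split=> [->|y0].
  have [|c c0 ->] := @rep_scale _ _ point1 (row2 0 1) _ (erefl _); first by rewrite row2_eq0 row2_1 oner_eq0 andbF.
  by rewrite mxE row2_0 mulr0.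
apply: val_inj; rewrite /= val_rep (row2E (rep y)) y0.
have y1 : rep y 0 1 != 0 by have := rep_neq0 y; rewrite row2_eq0 y0 eqxx.
rewrite -[RHS](vline_scale _ y1); congr <[_]>%VS; apply/rowP => j; rewrite !mxE.
by case: ifP; rewrite ?mulr1 ?mulr0.
Qed.

(** On two lines of the plane, each missing one of two points of the curve, S is a constant multiple
    of the standard local frame of O(d). The lines meet in the same points of the curve up to
    scaling of z, and the transition function of O(d) there yields the factor l^-d. *)
Lemma section_homogeneous S : sect (E := E) x0 (@plane_ev K) (fun z => z != 0) gam S ->
  forall i z l, z != 0 -> l != 0 -> lb_open i (pt (gam z)) -> S i (l *: z) = l ^ (- d) * S i z.
Proof.
move=> hS.
have [[phiC _ phi_reg] [psi [[_ psi_open psi_reg] psiK phiK]]] := phi_iso.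
have [_ phi_open _] := phi_iso.1.
have [h [h_reg h0 h_coc]] := E_iso.
have [Eo Ec Er En Em] := hE.
(* The isomorphism with P^1 is arbitrary, so it need not match the parametrisation [gam]. The basis
   [u0], [u1] of the plane is chosen to lie over the points 0 and infinity of P^1. *)
pose alpha z := psi (pt (gam z)).
have alphaK z : z != 0 -> phi (alpha z) = pt (gam z) by move=> z0; rewrite /alpha phiK //; exact: gam_C.
have [u0 u00 u0E] : exists2 u, u != 0 & alpha u = point0.
  have [u u0 uE] := gam_sur (phiC point0 I); exists u => //; by rewrite /alpha -uE psiK.
have [u1 u10 u1E] : exists2 u, u != 0 & alpha u = point1.
  have [u u0' uE] := gam_sur (phiC point1 I); exists u => //; by rewrite /alpha -uE psiK.
have alpha_inj z z' : z != 0 -> z' != 0 -> alpha z = alpha z' -> exists c, z = c *: z'.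
  by move=> z0 z'0 zz; apply: gam_inj => //; rewrite -!alphaK // zz.
have pt01 : point0 <> point1.
  move/point1P/eqP; have := rep_neq0 point0; rewrite row2_eq0.
  by have -> := (point0P point0).1 (erefl _); rewrite eqxx andbT => /negPf->.
have indep a b : a *: u0 + b *: u1 = 0 -> a = 0 /\ b = 0.
  move=> ab0; have [a0|a0] := eqVneq a 0.
    by split=> //; move/eqP: ab0; rewrite a0 scale0r add0r scaler_eq0 (negPf u10) orbF => /eqP.
  exfalso; apply: pt01; rewrite -u0E -u1E /alpha; congr psi.
  have E0 : u0 = (- (a^-1 * b)) *: u1.
    by move/eqP: ab0; rewrite addr_eq0 => /eqP E0; rewrite scaleNr -scalerA -scalerN -E0 scalerK.
  rewrite {1}E0 pt_gam_scale // oppr_eq0; apply: contraNneq u00 => b0.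
  by rewrite E0 b0 oppr0 scale0r.
have span z : exists a b, z = a *: u0 + b *: u1.
  pose B : 'M[K]_2 := \matrix_(i, j) (if i == 0 then u0 else u1) 0 j.
  have BE (v : V) : v *m B = v 0 0 *: u0 + v 0 1 *: u1.
    apply/rowP => j; rewrite !mxE big_ord_recl big_ord1 !mxE /=.
    by congr (_ + v _ _ * _); apply: val_inj.
  have Bu : B \in unitmx.
    rewrite -row_free_unit; apply: inj_row_free => v; rewrite BE => /indep[v0 v1].
    by rewrite (row2E v) v0 v1; apply/rowP => j; rewrite !mxE if_same.
  exists ((z *m invmx B) 0 0), ((z *m invmx B) 0 1); by rewrite -BE mulmxKV.
have cover z : z != 0 -> exists i : J, lb_open i (pt (gam z)) by move=> z0; apply: Ec; exact: gam_X.
have lineA t : u0 + t *: u1 != 0.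
  by apply/negP => /eqP; rewrite -[u0]scale1r => /indep[/eqP]; rewrite oner_eq0.
have lineB t : u1 + t *: u0 != 0.
  by apply/negP => /eqP; rewrite addrC -[u1]scale1r => /indep[_ /eqP]; rewrite oner_eq0.
have lineA0 t : rep (alpha (u0 + t *: u1)) 0 0 != 0.
  apply/negP => /eqP/point1P; rewrite -u1E => /(alpha_inj _ _ (lineA t) u10)[c cE].
  have : 1 *: u0 + (t - c) *: u1 = 0 by rewrite scale1r scalerBl addrA cE subrr.
  by case/indep => /eqP; rewrite oner_eq0.
have lineB1 t : rep (alpha (u1 + t *: u0)) 0 1 != 0.
  apply/negP => /eqP/point0P; rewrite -u0E => /(alpha_inj _ _ (lineB t) u00)[c cE].
  have : (t - c) *: u0 + 1 *: u1 = 0 by rewrite scale1r scalerBl addrAC [_ + u1]addrC cE subrr.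
  by case/indep => _ /eqP; rewrite oner_eq0.
pose f t := rep (alpha (u0 + t *: u1)) 0 1 / rep (alpha (u0 + t *: u1)) 0 0.
(* The affine coordinate of P^1 along the line is polynomial, injective and zero at t = 0: with
   respect to [u0], [u1] the two parametrisations differ by a diagonal matrix. *)
have [c c0 fE] : exists2 c, c != 0 & forall t, f t = c * t.
  have pf : pol (@line_ev K) f.
    apply: reg_line.
    pose W := [set y : proj V | rep y 0 0 != 0]%classic.
    have Wo : zopen W by exact: (zopen_hpoly (@hpoly_rV K 2 0)).
    have rW : regular_on ([set: proj V] `&` W)%classic (fun y : proj V => rep y 0 1 / rep y 0 0).
      by apply: (regular_ratio (@hpoly_rV K 2 1) (@hpoly_rV K 2 0)) => y [].
    have pml : pmap (@line_ev K) (gam \o (fun t => u0 + t *: u1)).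
      by apply: pmap_comp (plane_line u0 u1) _; exact: hmap_pmap gam_hmap.
    apply: (reg_pullback (@line_const K) pml _ (psi_reg W _ Wo rW)) => t _.
    by split; [exact: gam_neq0 | split; [exact: gam_C | exact: lineA0]].
  have f0 : f 0 = 0 by rewrite /f scale0r addr0 u0E (point0P point0).1 // mul0r.
  have f_inj t t' : f t = f t' -> t = t'.
    move=> ff; have : alpha (u0 + t *: u1) = alpha (u0 + t' *: u1).
      apply: val_inj; rewrite /= !val_rep.
      by rewrite !vline_rep0 // -/(f t) ff.
    move/(alpha_inj _ _ (lineA t) (lineA t'))=> [b bE].
    have : (1 - b) *: u0 + (t - b * t') *: u1 = 0.
      apply/eqP; rewrite !scalerBl scale1r addrACA -opprD -scalerA -scalerDr -bE subrr //.
    by case/indep => /eqP; rewrite subr_eq0 => /eqP <- /eqP; rewrite mul1r subr_eq0 => /eqP.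
  exact: pol_inj_linear K0 pf f0 f_inj.
have pull (i : J) z : z != 0 -> lb_open i (pt (gam z)) -> lb_open (c := lb_pullback phi E) i (alpha z).
  by move=> z0; rewrite /= alphaK.
have pull_trans (i i' : J) z : z != 0 ->
    lb_trans (c := lb_pullback phi E) i i' (alpha z) = lb_trans i i' (pt (gam z)).
  by move=> z0; rewrite /= alphaK.
have O_trans1 (j : 'I_2) (y : proj V) : rep y 0 j != 0 -> lb_trans (c := O_P1 K d) j j y = 1.
  by move=> yj; rewrite /= divff // exp1rz.
(* comparison of S with the standard section along a line avoiding a point *)
have line_cmp (j : 'I_2) (u w : V) : (forall t, u + t *: w != 0) ->
    (forall t, rep (alpha (u + t *: w)) 0 j != 0) ->
    exists2 c, c != 0 & forall (i : J) t, lb_open i (pt (gam (u + t *: w))) ->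
      S i (u + t *: w) = c * (h j i (alpha (u + t *: w)))^-1.
  move=> l0 lj.
  have pl := plane_line u w.
  have lX : into x0 X (fun=> True) (gam \o (fun t => u + t *: w)) by move=> t _; split; [exact: gam_neq0 | exact: gam_X].
  have pml : pmap (@line_ev K) (gam \o (fun t => u + t *: w)) by apply: pmap_comp pl _; exact: hmap_pmap gam_hmap.
  have s1 : sect (E := E) x0 (@line_ev K) (fun=> True) (gam \o (fun t => u + t *: w)) (fun i => S i \o (fun t => u + t *: w)).
    by apply: (sect_comp pl _ hS).
  have s2 : sect (E := E) x0 (@line_ev K) (fun=> True) (gam \o (fun t => u + t *: w)) (fun i t => (h j i (alpha (u + t *: w)))^-1).
    have hn0 i t : lb_open i (pt (gam (u + t *: w))) -> h j i (alpha (u + t *: w)) != 0.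
      by move=> Ui; apply: (h0 j i _ I (lj t)); exact: pull.
    split=> [i|i t _ Ui|i i' t _ Ui Ui'].
    - apply: regV => [t [_]|]; first exact: hn0.
      have [U' Uo' UE'] := phi_open _ (Eo i).
      pose W := ([set y : proj V | rep y 0 j != 0] `&` U')%classic.
      have Wo : zopen W by apply: zopenI => //; exact: (zopen_hpoly (@hpoly_rV K 2 j)).
      have rW : regular_on ([set: proj V] `&` W)%classic (h j i).
        by apply: regular_on_sub (h_reg j i) => y [_ [yj /(UE' y I) Uy]].
      apply: (reg_pullback (@line_const K) pml _ (psi_reg W _ Wo rW)) => t [_ Ut].
      split; first exact: gam_neq0.
      split; first exact: gam_C.
      by split; [exact: lj | apply/(UE' _ I); rewrite /= -/(alpha _) alphaK].
    - by rewrite invr_eq0; exact: hn0.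
    have Hc := h_coc j j i i' (alpha (u + t *: w)) I (lj t) (lj t) (pull i _ (l0 t) Ui) (pull i' _ (l0 t) Ui').
    rewrite (pull_trans i i' _ (l0 t)) O_trans1 // mul1r in Hc; rewrite -Hc.
    by rewrite invfM mulrCA divff ?mulr1 //; apply: En => //; exact: gam_X.
  have [e e0 eE] := sect_line hE pml lX s1 s2; exists e => // i t Ui; exact: eE.
have [cA cA0 cmpA] := line_cmp 0 u0 u1 lineA lineA0.
have [cB cB0 cmpB] := line_cmp 1 u1 u0 lineB lineB1.
have swap t : t != 0 -> u0 + t *: u1 = t *: (u1 + t^-1 *: u0).
  by move=> t0; rewrite scalerDr scalerA divff // scale1r addrC.
(* The points of the two lines are proportional with ratio t, and the frames [h 0] and [h 1] differ
   by (c t)^d. *)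
have AB (i : J) t : t != 0 -> lb_open i (pt (gam (u0 + t *: u1))) ->
    S i (u0 + t *: u1) = cA / cB * c ^ (- d) * t ^ (- d) * S i (u1 + t^-1 *: u0).
  move=> t0 Ui; have aE : alpha (u0 + t *: u1) = alpha (u1 + t^-1 *: u0).
    by rewrite /alpha swap // pt_gam_scale.
  have Ui' : lb_open i (pt (gam (u1 + t^-1 *: u0))) by rewrite -(pt_gam_scale _ t0) -swap.
  rewrite cmpA // cmpB //.
  have y1 : rep (alpha (u0 + t *: u1)) 0 1 != 0 by rewrite aE lineB1.
  have Hc := h_coc 0 1 i i (alpha (u0 + t *: u1)) I (lineA0 t) y1 (pull i _ (lineA t) Ui) (pull i _ (lineA t) Ui).
  have gE : lb_trans i i (pt (gam (u0 + t *: u1))) = 1.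
    have Xp := gam_X (lineA t); have g0 := En i i _ Xp Ui Ui.
    by apply: (mulfI g0); rewrite -Em // mulr1.
  rewrite pull_trans // gE mulr1 in Hc.
  have -> : h 0 i (alpha (u0 + t *: u1)) = (c * t) ^ d * h 1 i (alpha (u0 + t *: u1)).
    by rewrite Hc -fE.
  rewrite aE; have h1 : h 1 i (alpha (u1 + t^-1 *: u0)) != 0.
    by rewrite -aE; apply: (h0 1 i _ I y1); exact: pull.
  by rewrite expfzMl !invfM !invr_expz; field; rewrite cB0 h1.
(* Along a line avoiding the origin, z -> S(l z) and S are frames of the same pullback, so their
   ratio is constant; it suffices to know it at one point of the line. *)
have cst (u w : V) l : (forall t, u + t *: w != 0) -> l != 0 -> exists2 b, b != 0 &
    forall (i : J) t, lb_open i (pt (gam (u + t *: w))) -> S i (l *: (u + t *: w)) = b * S i (u + t *: w).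
  move=> uw l0; have pl := plane_line u w.
  have lX : into x0 X (fun=> True) (gam \o (fun t => u + t *: w)) by move=> t _; split; [exact: gam_neq0 | exact: gam_X].
  have pml : pmap (@line_ev K) (gam \o (fun t => u + t *: w)) by apply: pmap_comp pl _; exact: hmap_pmap gam_hmap.
  have s1 : sect (E := E) x0 (@line_ev K) (fun=> True) (gam \o (fun t => u + t *: w)) (fun i => S i \o (fun t => u + t *: w)).
    by apply: (sect_comp pl _ hS).
  have s0 := sect_comp (plane_scale l) (D' := fun z => z != 0) _ hS.
  have {}s0 := sect_comp pl (D' := fun=> True) _ (s0 _).
  have s2 : sect (E := E) x0 (@line_ev K) (fun=> True) (gam \o (fun t => u + t *: w)) (fun i => S i \o (fun z => l *: z) \o (fun t => u + t *: w)).
    apply: sect_congr (s0 _ _) => [t _|t _|z z0] //=; first by rewrite pt_gam_scale.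
    by rewrite scaler_eq0 negb_or l0.
  by have [b b0 bE] := sect_line hE pml lX s2 s1; exists b => // i t Ui; exact: bE.
(* At t = 1 both lines pass through [u0 + u1], which normalises the constant. *)
have AB1 : cA / cB * c ^ (- d) = 1.
  have [i Ui] := cover _ (lineA 1); have := AB i 1 (oner_neq0 _) Ui.
  rewrite exp1rz mulr1 invr1 [u1 + _]addrC !scale1r => E1.
  have S1 : S i (u0 + u1) != 0 by case: hS => _ S0 _; rewrite -[u1]scale1r S0.
  by apply: (mulIf S1); rewrite -E1 mul1r.
have step1 i l t : l != 0 -> lb_open i (pt (gam (u1 + t *: u0))) ->
    S i (l *: (u1 + t *: u0)) = l ^ (- d) * S i (u1 + t *: u0).
  move=> l0 Ui; have [b b0 bE] := cst u1 u0 l lineB l0.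
  have [k Uk] := cover _ (lineA l); have := AB k l l0 Uk; rewrite AB1 mul1r swap // => E1.
  have Uk' : lb_open k (pt (gam (u1 + l^-1 *: u0))) by rewrite -(pt_gam_scale _ l0) -swap.
  have S1 : S k (u1 + l^-1 *: u0) != 0 by case: hS => _ S0 _; rewrite S0.
  by rewrite bE //; congr (_ * _); apply: (mulIf S1); rewrite -E1 bE.
have step2 i l a b : l != 0 -> b != 0 -> lb_open i (pt (gam (a *: u0 + b *: u1))) ->
    S i (l *: (a *: u0 + b *: u1)) = l ^ (- d) * S i (a *: u0 + b *: u1).
  move=> l0 b0; have -> : a *: u0 + b *: u1 = b *: (u1 + (a / b) *: u0).
    by rewrite scalerDr scalerA mulrCA divff // mulr1 addrC.
  rewrite pt_gam_scale // => Ui; rewrite scalerA !step1 ?mulf_neq0 // mulrA; congr (_ * _).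
  by rewrite expfzMl.
move=> i z l z0 l0 Ui; have [a [b zE]] := span z.
have [b0|b0] := eqVneq b 0; last by rewrite zE step2 // -zE.
have a0 : a != 0 by apply: contraNneq z0 => a0; rewrite zE a0 b0 !scale0r addr0.
have zl t : z + t *: u1 != 0.
  by apply/negP => /eqP; rewrite zE b0 scale0r addr0 => /indep[/eqP]; rewrite (negPf a0).
have [e e0 eE] := cst z u1 l zl l0.
(* A multiple of [u0] is joined to a vector with nonzero component along [u1], where the factor is
   already known. *)
have [k Uk] := cover _ (zl 1).
have E1 := eE k 1 Uk; have zuE : z + 1 *: u1 = a *: u0 + 1 *: u1 by rewrite zE b0 scale0r addr0.
have S1 : S k (z + 1 *: u1) != 0 by case: hS => _ S0 _; rewrite S0.
have eE' : e = l ^ (- d).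
  by apply: (mulIf S1); rewrite -E1 zuE step2 ?oner_neq0 // -zuE.
by have := eE i 0; rewrite scale0r addr0 -eE' => ->.
Qed.

End Degree.

Section Density.
Variables (K : closedFieldType) (A : idomainType) (T : Type) (ev : T -> {rmorphism A -> K}).
Hypothesis pit : forall a, a != 0 -> exists t, ev t a != 0.

Lemma pol_dense_gen (o f : T -> K) : pol ev o -> pol ev f -> (exists t, o t != 0) ->
  (forall t, o t != 0 -> f t = 0) -> forall t, f t = 0.
Proof.
move=> [a aE] [b bE] [t0 ot0] fo t.
have a0 : a != 0 by apply: contraNneq ot0 => a0; rewrite -aE a0 rmorph0.
suff b0 : b = 0 by rewrite -bE b0 rmorph0.
apply/eqP; apply: contraT => b0; have [|t1] := pit (a := a * b); first by rewrite mulf_neq0.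
by rewrite rmorphM mulf_eq0 negb_or aE bE => /andP[/fo->]; rewrite eqxx.
Qed.

(** A homogeneous equation of X pulls back to a polynomial vanishing on a dense set of parameters,
    hence everywhere. This places degenerate members of a family in the closure of the orbit. *)
Lemma dense_zclosure (M : vectType K) (x0 : proj M) (X : set (proj M)) (o : T -> K) (F : T -> M) :
  has_const ev -> pmap ev F -> pol ev o -> (exists t, o t != 0) ->
  (forall t, o t != 0 -> F t != 0 /\ X (pt x0 (F t))) -> forall t, F t != 0 -> zclosure X (pt x0 (F t)).
Proof.
move=> cst pF po eo FX t F0; apply: in_zclosure => d f hf fX.
apply/eqP; rewrite (hpoly_rep0 hf F0 (val_pt x0 F0)); apply/eqP.
apply: (@pol_dense_gen o (fun t => f (F t))) => //; first exact: pol_hpoly hf pF.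
move=> t' /FX[F0' /fX /eqP]; by rewrite (hpoly_rep0 hf F0' (val_pt x0 F0')) => /eqP.
Qed.

End Density.

(** * Rational normal curves are isomorphic to P^1 *)

Section RationalNormalCurve.
Variables (K : closedFieldType) (M : vectType K) (x0 : proj M).
Variables (D : nat) (w : nat -> M) (lam : nat -> {linear M -> K^o}).
Notation V := 'rV[K]_2.
Notation pt0 := (pt x0).
Definition rnc (z : V) : M := \sum_(j < D.+1) (z 0 0 ^+ (D - j) * z 0 1 ^+ j) *: w j.
Hypothesis D0 : (0 < D)%N.
Hypothesis lamE : forall j z, (j <= D)%N -> lam j (rnc z) = z 0 0 ^+ (D - j) * z 0 1 ^+ j.

Lemma rnc_hmap : hmap D rnc.
Proof.
apply: hmap_sum => j; have jD : (j <= D)%N by rewrite -ltnS.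
have := hpolyM (hpolyX (D - j) (@hpoly_rV K 2 0)) (hpolyX j (@hpoly_rV K 2 1)).
by rewrite !mul1n subnK.
Qed.

Lemma rnc_neq0 z : z != 0 -> rnc z != 0.
Proof.
rewrite row2_eq0 negb_and => /orP[z0|z1].
  apply: contraNneq z0 => r0; have := @lamE 0 z (leq0n _).
  by rewrite r0 linear0 subn0 mulr1 => /esym/eqP; rewrite expf_eq0 => /andP[].
apply: contraNneq z1 => r0; have := @lamE D z (leqnn _).
by rewrite r0 linear0 subnn mul1r => /esym/eqP; rewrite expf_eq0 => /andP[].
Qed.

Definition rnc_affine : set (proj M) := [set x | exists c, val x = <[rnc (row2 1 c)]>%VS]%classic.
Notation C := (zclosure rnc_affine).

Lemma rnc_mem z : z != 0 -> C (pt0 (rnc z)).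
Proof.
have pit a : a != 0 -> exists t, @plane_ev K t a != 0 by case: (geometric_plane K) => H _ _; exact: H.
move=> z0; apply: (dense_zclosure pit (plane_const (K := K)) (o := fun z => z 0 0)) => //.
- exact: hmap_pmap rnc_hmap.
- exact: plane_coord.
- by exists (row2 1 0); rewrite row2_0 oner_neq0.
- move=> t t0; have tn : t != 0 by rewrite row2_eq0 negb_and t0.
  split; first exact: rnc_neq0.
  exists (t 0 1 / t 0 0); rewrite val_pt ?rnc_neq0 //.
  have {1}-> : t = t 0 0 *: row2 1 (t 0 1 / t 0 0).
    rewrite {1}(row2E t); apply/rowP => j; rewrite !mxE; case: ifP => _; first by rewrite mulr1.
    by rewrite mulrC mulfVK.
  by rewrite (hmap_scale _ _ rnc_hmap) vline_scale // expf_neq0.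
- exact: rnc_neq0.
Qed.

Lemma rnc_vanish d f : hpoly d f -> (forall c, f (rnc (row2 1 c)) = 0) -> forall x, C x -> f (rep x) = 0.
Proof.
move=> hf fc; apply: (zclosure_hpoly hf) => x [c xc]; apply/eqP.
have n0 : rnc (row2 1 c) != 0 by rewrite rnc_neq0 // row2_eq0 row2_0 oner_eq0.
by rewrite (hpoly_rep0 hf n0 xc) fc.
Qed.

Lemma rnc_quadric x i j : C x -> (i < D)%N -> (j < D)%N ->
  lam i (rep x) * lam j.+1 (rep x) = lam i.+1 (rep x) * lam j (rep x).
Proof.
move=> Cx iD jD; apply/eqP; rewrite -subr_eq0; apply/eqP.
have hl k := hpoly_linear (lam k).
apply: (rnc_vanish (hpolyB (hpolyM (hl i) (hl j.+1)) (hpolyM (hl i.+1) (hl j)))) Cx => c.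
by rewrite !lamE ?(ltnW iD) ?(ltnW jD) // !row2_0 !row2_1 !expr1n !mul1r -!exprD addSnnS subrr.
Qed.

Lemma rnc_span x : C x -> rep x = \sum_(j < D.+1) (lam j (rep x) : K) *: w j.
Proof.
move=> Cx; rewrite [LHS](coord_vbasis (memvf _)) [RHS](coord_vbasis (memvf _)); apply: eq_bigr => i _.
congr (_ *: _); apply/eqP; rewrite -subr_eq0; apply/eqP.
have h : hmap 1 (fun u => \sum_(j < D.+1) (lam j u : K) *: w j) by apply: hmap_sum => j; exact: hpoly_linear.
apply: (rnc_vanish (hpolyB (hpoly_coord i) (h i))) Cx => c.
apply/eqP; rewrite subr_eq0; apply/eqP; congr (coord _ _ _).
by apply: eq_bigr => j _; rewrite lamE // -ltnS.
Qed.

(** A point of the closure lies in the span of the [w j] and satisfies the quadrics. If its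
    coordinate 0 is nonzero, they make the coordinates a geometric progression; otherwise they force
    all but the last to vanish, which is the point at infinity. *)
Lemma rnc_sur x : C x -> exists2 z, z != 0 & x = pt0 (rnc z).
Proof.
move=> Cx; have [l0|l0] := eqVneq (lam 0%N (rep x)) 0.
  have lj j : (j < D)%N -> lam j (rep x) = 0.
    elim: j => // j IH jD; have := rnc_quadric Cx (ltnW jD) jD.
    by rewrite IH ?(ltnW jD) // mul0r => /esym/eqP; rewrite -expr2 expf_eq0 => /andP[_ /eqP].
  have E : rep x = (lam D (rep x) : K) *: w D.
    rewrite {1}(rnc_span Cx) big_ord_recr /= big1 ?add0r // => j _; by rewrite lj ?scale0r.
  have lD : (lam D (rep x) : K) != 0.
    by apply: contraNneq (rep_neq0 x) => lD; rewrite E lD scale0r.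
  exists (row2 0 1); first by rewrite row2_eq0 row2_1 oner_eq0 andbF.
  rewrite -[LHS](pt_rep x0) E pt_scale //; congr pt0.
  rewrite /rnc big_ord_recr /= big1 ?add0r => [|j _].
    by rewrite row2_0 row2_1 subnn expr1n mulr1 scale1r.
  by rewrite row2_0 expr0n subn_eq0 leqNgt ltn_ord /= mul0r scale0r.
pose c : K := lam 1%N (rep x) / lam 0%N (rep x).
have lj j : (j <= D)%N -> lam j (rep x) = lam 0%N (rep x) * c ^+ j.
  elim: j => [|j IH] jD; first by rewrite mulr1.
  apply: (mulfI l0); rewrite (rnc_quadric Cx D0 jD) IH ?(ltnW jD) // exprS /c; field.
  exact: l0.
exists (row2 1 c); first by rewrite row2_eq0 row2_0 oner_eq0.
rewrite -[LHS](pt_rep x0) {1}(rnc_span Cx) -[RHS](pt_scale _ _ l0) /rnc scaler_sumr; congr pt0.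
by apply: eq_bigr => j _; rewrite lj; [rewrite scalerA row2_0 row2_1 expr1n mul1r | rewrite -ltnS].
Qed.

Lemma rnc_inj z z' : z != 0 -> z' != 0 -> pt0 (rnc z) = pt0 (rnc z') -> exists c, z = c *: z'.
Proof.
move=> z0 z'0 /(pt_inj (rnc_neq0 z0) (rnc_neq0 z'0))[c c0 E].
have L j : (j <= D)%N -> z 0 0 ^+ (D - j) * z 0 1 ^+ j = c * (z' 0 0 ^+ (D - j) * z' 0 1 ^+ j).
  by move=> jD; rewrite -!lamE // E linearZ.
have := L 0%N (leq0n _); have := L 1%N D0; rewrite subn0 !expr0 !expr1 !mulr1 => L1 L0.
have [a0|a0] := eqVneq (z' 0 0) 0.
  have b0 : z' 0 1 != 0 by move: z'0; rewrite row2_eq0 a0 eqxx.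
  have z00 : z 0 0 = 0.
    by move/eqP: L0; rewrite a0 expr0n -leqn0 leqNgt D0 mulr0 expf_eq0 => /andP[_ /eqP].
  exists (z 0 1 / z' 0 1); rewrite [LHS]row2E z00; apply/rowP => j; rewrite [in RHS](row2E z') a0 !mxE.
  by case: ifP => _; rewrite ?mulr0 // divfK.
have z00 : z 0 0 != 0.
  by apply: contraNneq (expf_neq0 D a0) => z00; move/esym/eqP: L0; rewrite z00 expr0n -leqn0 leqNgt D0 mulf_eq0 (negPf c0).
exists (z 0 0 / z' 0 0); rewrite [LHS]row2E; apply/rowP => j; rewrite [in RHS](row2E z') !mxE.
case: ifP => _; first by rewrite divfK.
have DE : D = (D - 1).+1 by rewrite subn1 prednK.
apply: (mulfI (expf_neq0 (D - 1) z00)); rewrite L1.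
have -> : z 0 0 ^+ (D - 1) * (z 0 0 / z' 0 0 * z' 0 1) = z 0 0 ^+ D / z' 0 0 * z' 0 1.
  by rewrite {2}DE exprS; ring.
rewrite L0 {2}DE exprS; field.
exact: a0.
Qed.

Definition rnc_map (y : proj V) : proj M := pt0 (rnc (rep y)).

(** Two consecutive coordinates of the curve are proportional to (z_0, z_1). The charts k = 0 and k
    = D - 1 together define the inverse map. *)
Definition rnc_chart (k : nat) (u : M) : V := \sum_(j < 2) (lam (k + j)%N u : K) *: delta_mx 0 j.

Lemma rnc_chartE k z : (k < D)%N -> rnc_chart k (rnc z) = (z 0 0 ^+ (D - k.+1) * z 0 1 ^+ k) *: z.
Proof.
move=> kD; set c := _ * _; rewrite [in RHS](row_sum_delta z) scaler_sumr; apply: eq_bigr => -[j hj] _.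
rewrite scalerA /= lamE; last by case: j hj => [|[|//]] _; rewrite ?addn0 ?addn1 // ltnW.
rewrite /c; congr (_ *: _); case: j hj => [|[|//]] hj.
  have -> : z 0 (Ordinal hj) = z 0 0 by congr (z _ _); apply: val_inj.
  rewrite addn0; have -> : (D - k = (D - k.+1).+1)%N by rewrite subnSK.
  by rewrite exprSr; ring.
have -> : z 0 (Ordinal hj) = z 0 1 by congr (z _ _); apply: val_inj.
by rewrite addn1 [z 0 1 ^+ k.+1]exprSr mulrA.
Qed.

Lemma rnc_chart_hmap k : hmap 1 (rnc_chart k).
Proof. by apply: hmap_sum => j; exact: hpoly_linear. Qed.

Variable y0 : proj V.
Definition rnc_inv (x : proj M) : proj V :=
  if (lam 0%N (rep x) : K) != 0 then pt y0 (rnc_chart 0 (rep x))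
  else pt y0 (rnc_chart D.-1 (rep x)).

Lemma rnc_inv_local x z : z != 0 -> x = pt0 (rnc z) -> rnc_inv x = pt y0 z /\
  ((lam 0%N (rep x) : K) != 0 -> rnc_chart 0 (rep x) != 0 /\ val (rnc_inv x) = <[rnc_chart 0 (rep x)]>%VS) /\
  ((lam D (rep x) : K) != 0 -> rnc_chart D.-1 (rep x) != 0 /\ val (rnc_inv x) = <[rnc_chart D.-1 (rep x)]>%VS).
Proof.
move=> zn0 xE; have [c c0 rE] := rep_pt x0 (rnc_neq0 zn0); rewrite -xE in rE.
have l0E : (lam 0%N (rep x) : K) = c * z 0 0 ^+ D by rewrite rE linearZ /= lamE // subn0 mulr1.
have lDE : (lam D (rep x) : K) = c * z 0 1 ^+ D by rewrite rE linearZ /= lamE // subnn mul1r.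
have ch0 : rnc_chart 0 (rep x) = (c * z 0 0 ^+ D.-1) *: z.
  by rewrite rE (hmap_scale _ _ (rnc_chart_hmap 0)) rnc_chartE // subn1 mulr1 expr1 scalerA.
have chD : rnc_chart D.-1 (rep x) = (c * z 0 1 ^+ D.-1) *: z.
  by rewrite rE (hmap_scale _ _ (rnc_chart_hmap _)) rnc_chartE ?prednK // subnn mul1r expr1 scalerA.
have e0 : (lam 0%N (rep x) : K) != 0 -> c * z 0 0 ^+ D.-1 != 0.
  by rewrite l0E mulf_eq0 negb_or c0 expf_eq0 D0 /= => z00; rewrite mulf_neq0 // expf_neq0.
have eD : (lam D (rep x) : K) != 0 -> c * z 0 1 ^+ D.-1 != 0.
  by rewrite lDE mulf_eq0 negb_or c0 expf_eq0 D0 /= => z00; rewrite mulf_neq0 // expf_neq0.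
have invE : rnc_inv x = pt y0 z.
  rewrite /rnc_inv; case: ifP => [/e0 h|/negbT]; first by rewrite ch0 pt_scale.
  rewrite negbK => l0; rewrite chD pt_scale // eD //.
  have z00 : z 0 0 = 0 by move: l0; rewrite l0E mulf_eq0 (negPf c0) expf_eq0 D0 => /eqP.
  by move: zn0; rewrite lDE row2_eq0 z00 eqxx /= => z1; rewrite mulf_neq0 // expf_neq0.
split=> //; rewrite invE val_pt //; split=> [/e0 h|/eD h].
  by rewrite ch0 scaler_eq0 negb_or h zn0 vline_scale.
by rewrite chD scaler_eq0 negb_or h zn0 vline_scale.
Qed.

Lemma rnc_iso : variety_iso [set: proj V]%classic C rnc_map.
Proof.
split.
  apply: hmap_regular_map => [y _|y _]; first by apply: rnc_mem; exact: rep_neq0.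
  exists 0%N, (fun=> 1), D, rnc; split; [exact: hpolyC | exact: oner_neq0 | exact: rnc_hmap |].
  by move=> y' _ _; rewrite rnc_neq0 ?rep_neq0 // val_pt // rnc_neq0 ?rep_neq0.
exists rnc_inv; split.
- apply: hmap_regular_map => // x Cx; have [z zn0 xE] := rnc_sur Cx.
  have [l0|l0] := boolP ((lam 0%N (rep x) : K) != 0).
    exists 1%N, (lam 0%N), 1%N, (rnc_chart 0); split=> //; [exact: hpoly_linear | exact: rnc_chart_hmap |].
    move=> x' Cx' l0'; have [z' z'n0 x'E] := rnc_sur Cx'.
    by have [_ [H _]] := rnc_inv_local z'n0 x'E; exact: H.
  exists 1%N, (lam D), 1%N, (rnc_chart D.-1); split=> //; [exact: hpoly_linear | | exact: rnc_chart_hmap |].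
    move: l0; rewrite negbK; have [c c0] := rep_pt x0 (rnc_neq0 zn0); rewrite -xE => ->.
    rewrite !linearZ !lamE // subn0 subnn mulr1 mul1r !mulf_eq0 !negb_or c0 (negPf c0) /= expf_eq0 D0 => /eqP z00.
    by rewrite expf_neq0 //; move: zn0; rewrite row2_eq0 z00 eqxx.
  move=> x' Cx' l0'; have [z' z'n0 x'E] := rnc_sur Cx'.
  by have [_ [_ H]] := rnc_inv_local z'n0 x'E; exact: H.
- move=> y _; have [-> _] := rnc_inv_local (rep_neq0 y) (erefl (pt0 (rnc (rep y)))).
  exact: pt_rep.
move=> x Cx; have [z zn0 xE] := rnc_sur Cx.
have [-> _] := rnc_inv_local zn0 xE; rewrite /rnc_map xE.
have [c c0 ->] := rep_pt y0 zn0.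
by rewrite (hmap_scale _ _ rnc_hmap) pt_scale // expf_neq0.
Qed.

End RationalNormalCurve.

(** A change of basis of the column spaces multiplies all minors by the same factor. Every
    comparison of points of sh given by different matrices goes through this. *)
Lemma minors_mulr (A : comNzRingType) n s (Y Y' : 'I_s -> row_idx n -> 'I_n -> A) (W : 'I_s -> 'M[A]_n) I :
  (forall b k i, Y b k i = \sum_j Y' b k j * W b j i) -> minors Y I = (\prod_b \det (W b)) * minors Y' I.
Proof.
move=> YE; rewrite mulrC /minors -big_split; apply: eq_bigr => b _ /=.
rewrite -det_mulmx; congr (\det _); apply/matrixP => r i; rewrite !mxE YE.
by apply: eq_bigr => j _; rewrite mxE.
Qed.

Lemma minors_scale (A : comNzRingType) n s (Y Y' : 'I_s -> row_idx n -> 'I_n -> A) (c : 'I_s -> 'I_n -> A) I :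
  (forall b k i, Y b k i = c b i * Y' b k i) -> minors Y I = (\prod_b \prod_i c b i) * minors Y' I.
Proof.
move=> YE; rewrite (@minors_mulr _ _ _ Y Y' (fun b => diag_mx (\row_i c b i))).
  by congr (_ * _); apply: eq_bigr => b _; rewrite det_diag; apply: eq_bigr => i _; rewrite mxE.
move=> b k i; rewrite YE (bigD1 i) //= big1 ?addr0 => [|j ji]; first by rewrite !mxE eqxx mulrC.
by rewrite !mxE (negPf ji) mulr0.
Qed.

(** * Polynomial families in sh and the curves C_k *)

Section Fusion.
Variables (R : realType) (m s : nat).
Notation n := m.+1.
Variables (st : 'I_s -> nat) (a : 'I_n -> nat) (z : 'I_n -> R[i]).
Hypothesis z_inj : injective z.
Hypothesis aE : forall i, a i = ((\sum_b (st b <= i))%N).+1.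
Hypothesis st0 : exists b, st b = 0%N.
Notation K := R[i].
Notation idx := (idx n s).
Notation M := (fusion a z).
Notation ell := (ell st (a := a) (z := z)).
Variable x0 : proj M.
Notation pt := (pt x0).
Implicit Types (I : idx) (u : M) (p q : nat -> K).

Lemma ex_recover : exists w : idx -> M, forall u, u = \sum_I ell I u *: w I.
Proof.
pose f (u : M) : {ffun idx -> K^o} := [ffun I => ell I u].
have f_lin : linear f by move=> c u v; apply/ffunP => I; rewrite !ffunE linearP.
pose fL : {linear M -> {ffun idx -> K^o}} := HB.pack f (GRing.isLinear.Build K M {ffun idx -> K^o} _ f f_lin).
have ker0 : lker (linfun fL) == 0%VS.
  apply/lker0P => u v; rewrite !lfunE => E; apply: (eq_ell z_inj aE st0) => I.
  by have := congr1 (fun g : {ffun idx -> K^o} => g I) E; rewrite !ffunE.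
exists (fun I => (linfun fL)^-1%VF [ffun J => (J == I)%:R]) => u.
rewrite -{1}(lker0_lfunK ker0 u) lfunE /=.
have -> : f u = \sum_I ell I u *: [ffun J => (J == I)%:R].
  apply/ffunP => J.
  have tE I : (ell I u *: [ffun J => (J == I)%:R] : {ffun idx -> K^o}) J = ell I u * (J == I)%:R.
    by rewrite ffunE [X in _ *: X]ffunE.
  rewrite sum_ffunE ffunE (eq_bigr _ (fun I _ => tE I)) (bigD1 J) //= eqxx mulr1 big1 ?addr0 // => I IJ.
  by rewrite eq_sym (negPf IJ) mulr0.
by rewrite linear_sum; apply: eq_bigr => I _; rewrite linearZ.
Qed.

Definition rec_basis : idx -> M := sval (cid ex_recover).
(** A linear left inverse of u -> ([ell I u]). On values [F] outside its image the result has no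
    meaning, so for families one proves by density that [F] lies in the image. *)
Definition recover (F : idx -> K) : M := \sum_I F I *: rec_basis I.

Lemma recover_ell u : recover (fun I => ell I u) = u.
Proof. by rewrite /recover -(svalP (cid ex_recover) u). Qed.

Lemma eq_recover F F' : F =1 F' -> recover F = recover F'.
Proof. by move=> FF; apply: eq_bigr => I _; rewrite FF. Qed.

Lemma recoverZ c F : recover (fun I => c * F I) = c *: recover F.
Proof. by rewrite /recover scaler_sumr; apply: eq_bigr => I _; rewrite scalerA. Qed.

Definition frame p q : M := recover (frame_minors st p q).

Lemma frameP p q : (p 0%N != 0) || (q 0%N != 0) ->
  [/\ forall I, ell I (frame p q) = frame_minors st p q I, frame p q != 0 & orbit_low (pt (frame p q))].
Proof.
move=> pq; have [w [w0 wE]] := frame_vector z_inj aE st0 pq.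
have fE : frame p q = w by rewrite -(recover_ell w); apply: eq_recover => I; rewrite wE.
rewrite fE; split=> //; apply/(orbit_lowP z_inj aE st0).
by exists p, q; split=> //; exists w; split=> //; rewrite val_pt.
Qed.

Section Family.
Variables (A : idomainType) (T : Type) (ev : T -> {rmorphism A -> K}).
Hypothesis cst : has_const ev.
Hypothesis pit : forall c, c != 0 -> exists t, ev t c != 0.
Variables (F : T -> idx -> K) (o : T -> K).
Hypothesis F_pol : forall I, pol ev (fun t => F t I).
Hypothesis o_pol : pol ev o.
Hypothesis o_neq0 : exists t, o t != 0.
Hypothesis F_frame : forall t, o t != 0 -> exists p q c,
  [/\ (p 0%N != 0) || (q 0%N != 0), c != 0 & forall I, F t I = c * frame_minors st p q I].

Lemma recover_pmap : pmap ev (fun t => recover (F t)).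
Proof.
move=> i; apply: (@eq_pol _ _ _ _ (fun t => \sum_I F t I * coord (vbasis {:M}) i (rec_basis I))).
  by move=> t; rewrite linear_sum; apply: eq_bigr => I _; rewrite linearZ.
by apply: pol_sum => I _; apply: polM.
Qed.

Lemma family_frame t : o t != 0 -> exists p q c, [/\ (p 0%N != 0) || (q 0%N != 0), c != 0 & recover (F t) = c *: frame p q].
Proof.
move=> /F_frame[p [q [c [pq c0 FE]]]]; exists p, q, c; split=> //.
by rewrite -recoverZ; exact: eq_recover.
Qed.

(** A polynomial identity in the parameters, true on the dense set where the family consists of
    multiples of orbit vectors. *)
Lemma family_ell t I : ell I (recover (F t)) = F t I.
Proof.
apply/eqP; rewrite -subr_eq0; apply/eqP.
apply: (pol_dense_gen pit (f := fun t => ell I (recover (F t)) - F t I) o_pol) => //.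
  apply: polD; last by apply: polN.
  exact: pol_hpoly cst (hpoly_linear _) recover_pmap.
move=> {}t ot; have [p [q [c [pq c0 FE]]]] := F_frame ot; have [fE _ _] := frameP pq.
have -> : recover (F t) = c *: frame p q by rewrite -recoverZ; exact: eq_recover.
by rewrite linearZ /= fE FE /GRing.scale /= subrr.
Qed.

Lemma family_neq0 t I : F t I != 0 -> recover (F t) != 0.
Proof. by apply: contraNneq => r0; rewrite -family_ell r0 linear0. Qed.

Lemma family_sh t : recover (F t) != 0 -> sh a z (pt (recover (F t))).
Proof.
apply: (dense_zclosure pit cst recover_pmap o_pol o_neq0) => t1 ot.
have [p [q [c [pq c0 ->]]]] := family_frame ot; have [_ f0 fo] := frameP pq.
by rewrite scaler_eq0 negb_or c0 f0 pt_scale.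
Qed.

End Family.

Section Curve.
Variable k : nat.
Hypothesis kn : (k < n)%N.

Definition slot (b : 'I_s) (i : nat) : bool := (st b <= i)%N && (i + k < n)%N.
(** The frame of exp(c e_k) v homogenised in c = x_1 / x_0: column [i] is x_0 f t^i + x_1 e t^(i+k).
    Where the e part is zero, outside [slot], the column f t^i is left unscaled, so that it does not
    vanish at x_0 = 0. *)
Definition curve_row (x : 'rV[K]_2) (b : 'I_s) (t : row_idx n) (i : 'I_n) : K :=
  if slot b i then (if t.1 then (t.2 == i + k :> nat)%N%:R * x 0 1 else (t.2 == i)%:R * x 0 0)
  else (~~ t.1 && (t.2 == i))%:R.
Definition curve_minors x I : K := minors (curve_row x) I.
Definition curve_deg : nat := \sum_b \sum_(i < n) slot b i.
Definition e_rows I : nat := \sum_b \sum_(i < n) (I (b, i)).1.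

Lemma curve_deg_gt0 : (0 < curve_deg)%N.
Proof.
have [b sb] := st0; rewrite /curve_deg (bigD1 b) //= (bigD1 (ord0 : 'I_n)) //=.
by rewrite /slot sb add0n kn.
Qed.

Definition block_deg (b : 'I_s) : nat := \sum_(i < n) slot b i.
Definition block_e_rows I (b : 'I_s) : nat := \sum_(i < n) (I (b, i)).1.
Definition curve_det (x : 'rV[K]_2) I (b : 'I_s) : K := \det (minor (curve_row x) I b).

(** In each nonzero term every row of e contributes x_1, and every slot filled by a row of f
    contributes x_0. The exponents depend only on the number of e rows, so the determinant is a
    multiple of one monomial. *)
Lemma curve_det_monomial x I b :
  curve_det x I b = curve_det (row2 1 1) I b *
    (x 0 0 ^+ (block_deg b - block_e_rows I b) * x 0 1 ^+ block_e_rows I b) /\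
  (curve_det (row2 1 1) I b != 0 -> (block_e_rows I b <= block_deg b)%N).
Proof.
have term (sg : 'S_n) : \prod_r minor (curve_row x) I b r (sg r) =
    (\prod_r minor (curve_row (row2 1 1)) I b r (sg r)) * (x 0 0 ^+ (block_deg b - block_e_rows I b) * x 0 1 ^+ block_e_rows I b) /\
    ((\prod_r minor (curve_row (row2 1 1)) I b r (sg r)) != 0 -> (block_e_rows I b <= block_deg b)%N).
  have DbE : block_deg b = (\sum_r slot b (sg r))%N by rewrite /block_deg (reindex_inj (@perm_inj _ sg)).
  have [/prodf_neq0 nz|] := boolP (\prod_r minor (curve_row (row2 1 1)) I b r (sg r) != 0); last first.
    rewrite negbK => /eqP p0; rewrite p0 mul0r; split=> //.
    move/eqP: p0; rewrite prodf_seq_eq0 => /hasP[r _]; rewrite !mxE /curve_row row2_0 row2_1 !mulr1 => /andP[_ /eqP r0].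
    rewrite (bigD1 r) //= mxE /curve_row; move: r0; case: ifP => _; last by move->; rewrite mul0r.
    by case: ifP => _ ->; rewrite !mul0r.
  have er r : ((I (b, r)).1 <= slot b (sg r))%N.
    have := nz r isT; rewrite mxE /curve_row; case: ifP => //; case: (I (b, r)) => -[] t //= _.
    by rewrite eqxx.
  have ED : (block_e_rows I b <= block_deg b)%N by rewrite DbE; apply: leq_sum => r _.
  split=> //.
  have -> : (block_deg b - block_e_rows I b = \sum_r (slot b (sg r) - (I (b, r)).1))%N by rewrite DbE /block_e_rows sumnB.
  rewrite /block_e_rows -!prodrXr -!big_split; apply: eq_bigr => r _ /=.
  have := er r; rewrite !mxE /curve_row row2_0 row2_1; case: ifP => _; case: (I (b, r)) => -[] t //= _.
  - by rewrite subnn mul1r mulr1 expr1.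
  - by rewrite subn0 mulr1 expr1 mulr1.
  - by rewrite !mulr1.
split.
  rewrite /curve_det /determinant mulr_suml; apply: eq_bigr => sg _; rewrite (term sg).1.
  exact: mulrA.
rewrite /curve_det /determinant => /big_nonzero[/= sg]; rewrite mulf_eq0 negb_or => /andP[_].
exact: (term sg).2.
Qed.

Lemma curve_minors_facts x I :
  curve_minors x I = curve_minors (row2 1 1) I * (x 0 0 ^+ (curve_deg - e_rows I) * x 0 1 ^+ e_rows I) /\
  (curve_minors (row2 1 1) I != 0 -> (e_rows I <= curve_deg)%N).
Proof.
rewrite /curve_minors /minors.
have [/prodf_neq0 nz|] := boolP (\prod_b \det (minor (curve_row (row2 1 1)) I b) != 0); last first.
  rewrite negbK => /eqP p0; rewrite p0 mul0r; split=> //.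
  move/eqP: p0; rewrite prodf_seq_eq0 => /hasP[b _] /andP[_ /eqP b0].
  by rewrite (bigD1 b) //= [X in X * _](curve_det_monomial x I b).1 /curve_det b0 !mul0r.
split; last by move=> _; apply: leq_sum => b _; exact: (curve_det_monomial x I b).2 (nz b isT).
have -> : (curve_deg - e_rows I = \sum_b (block_deg b - block_e_rows I b))%N.
  by rewrite sumnB // => b _; exact: (curve_det_monomial x I b).2 (nz b isT).
by rewrite /e_rows -!prodrXr -!big_split; apply: eq_bigr => b _; exact: (curve_det_monomial x I b).1.
Qed.

Lemma curve_minors_monomial x I :
  curve_minors x I = curve_minors (row2 1 1) I * (x 0 0 ^+ (curve_deg - e_rows I) * x 0 1 ^+ e_rows I).
Proof. exact: (curve_minors_facts x I).1. Qed.

Lemma curve_frameE (x : 'rV[K]_2) I : x 0 0 != 0 ->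
  curve_minors x I = (\prod_(b < s) \prod_(i < n) (if slot b i then x 0 0 else 1)) *
    frame_minors st (fun t => if t == k then x 0 1 / x 0 0 else 0) (one_seq K) I.
Proof.
move=> x00; apply: minors_scale => b [e t] i; rewrite /curve_row /frame_row /slot /=.
case: (leqP (st b) i) => sb /=; last by rewrite mul1r.
have tn := ltn_ord t.
case: (ltnP (i + k) n) => ik; case: e => /=.
- case: leqP => it; last by rewrite mulr0 ltn_eqF ?mul0r // (leq_trans it) // leq_addr.
  have -> : (t - i == k)%N = (t == i + k :> nat)%N by apply/eqP/eqP => ?; lia.
  by case: eqP => _; rewrite ?mul0r ?mulr0 // mul1r mulrC divfK.
- rewrite -val_eqE /= /one_seq; case: leqP => it; last by rewrite ltn_eqF // mul0r mulr0.
  by rewrite subn_eq0 eqn_leq it andbT mulrC.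
- rewrite mul1r; case: leqP => it //; case: eqP => // E; lia.
rewrite mul1r -val_eqE /= /one_seq; case: leqP => it; last by rewrite ltn_eqF.
by rewrite subn_eq0 eqn_leq it andbT.
Qed.

Lemma curve_frame (x : 'rV[K]_2) : x 0 0 != 0 -> exists p q c, [/\ (p 0%N != 0) || (q 0%N != 0), c != 0 &
  forall I, curve_minors x I = c * frame_minors st p q I].
Proof.
move=> x00; exists (fun t => if t == k then x 0 1 / x 0 0 else 0), (one_seq K).
exists (\prod_(b < s) \prod_(i < n) (if slot b i then x 0 0 else 1)); split.
- by rewrite oner_neq0 orbT.
- by apply/prodf_neq0 => b _; apply/prodf_neq0 => i _; case: ifP => // _; exact: oner_neq0.
by move=> I; exact: curve_frameE.
Qed.

Lemma curve_minors_pol I : pol (@plane_ev K) (fun x => curve_minors x I).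
Proof.
apply: (@eq_pol _ _ _ _ (fun x : 'rV[K]_2 => curve_minors (row2 1 1) I * (x 0 0 ^+ (curve_deg - e_rows I) * x 0 1 ^+ e_rows I))).
  by move=> x; rewrite [RHS]curve_minors_monomial.
apply: polM; first exact: plane_const.
apply: polM; apply: polX; exact: plane_coord.
Qed.

Let pit2 : forall c, c != 0 -> exists t, @plane_ev K t c != 0.
Proof. by case: (geometric_plane K) => H _ _; exact: H. Qed.

Definition curve_vec (x : 'rV[K]_2) : M := recover (curve_minors x).

Lemma curve_ell x I : ell I (curve_vec x) = curve_minors x I.
Proof.
apply: (family_ell (plane_const (K := K)) pit2 curve_minors_pol (plane_coord K 0) _ curve_frame).
by exists (row2 1 0); rewrite row2_0 oner_neq0.
Qed.

(** Selects the e row in the slots of [A] and the f row elsewhere. The matrix is triangular and the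
    minor is a monomial with coefficient 1, so every monomial of degree [curve_deg] is read off by
    some functional. *)
Definition curve_idx (A : {set 'I_s * 'I_n}) : idx :=
  [ffun p => if p \in A then (true, inord (p.2 + k)) else (false, p.2)].

Lemma curve_minors_idx (A : {set 'I_s * 'I_n}) x : (forall p : 'I_s * 'I_n, p \in A -> slot p.1 p.2) ->
  curve_minors x (curve_idx A) = x 0 0 ^+ (curve_deg - #|A|) * x 0 1 ^+ #|A|.
Proof.
move=> AS.
have eA : e_rows (curve_idx A) = #|A|.
  rewrite -sum1_card big_mkcond /e_rows sum_pairE.
  by apply: eq_bigr => b _; apply: eq_bigr => i _; rewrite ffunE; case: ifP.
rewrite curve_minors_monomial eA [X in X * _](_ : _ = 1) ?mul1r //.
apply: big1 => b _; rewrite det_trig.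
  apply: big1 => r _; rewrite !mxE ffunE /curve_row row2_0 row2_1 !mulr1.
  case: (boolP ((b, r) \in A)) => [/AS/= sr|_] /=; first by rewrite sr inordK ?eqxx //; case/andP: sr.
  by rewrite eqxx if_same.
apply/is_trig_mxP => r i ri; rewrite !mxE ffunE /curve_row row2_0 row2_1 !mulr1.
have nri : (r == i) = false by rewrite -val_eqE /= ltn_eqF.
case: (boolP ((b, r) \in A)) => [/AS/= sr|_] /=; last by rewrite nri if_same.
have rk : (r + k < n)%N by case/andP: sr.
by rewrite inordK // eqn_add2r; case: ifP => // _; rewrite ltn_eqF.
Qed.

Lemma ex_slots j : (j <= curve_deg)%N -> exists A : {set 'I_s * 'I_n}, (forall p : 'I_s * 'I_n, p \in A -> slot p.1 p.2) /\ #|A| = j.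
Proof.
move=> jD; pose S := [set p : 'I_s * 'I_n | slot p.1 p.2].
have cS : #|S| = curve_deg.
  rewrite -sum1_card big_mkcond sum_pairE; apply: eq_bigr => b _; apply: eq_bigr => i _.
  by rewrite inE; case: ifP.
exists [set p in take j (enum S)]; split.
  by move=> p; rewrite inE => /mem_take; rewrite mem_enum inE.
rewrite cardsE; have /card_uniqP -> : uniq (take j (enum S)) by rewrite take_uniq // enum_uniq.
by rewrite size_takel // -cardE cS.
Qed.

Definition curve_lam_idx (j : nat) : idx :=
  if pselect (j <= curve_deg)%N is left h then curve_idx (sval (cid (ex_slots h))) else [ffun p => (false, p.2)].

Lemma curve_lam x j : (j <= curve_deg)%N -> ell (curve_lam_idx j) (curve_vec x) = x 0 0 ^+ (curve_deg - j) * x 0 1 ^+ j.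
Proof.
move=> jD; rewrite curve_ell /curve_lam_idx; case: pselect => // h.
case: cid => A [AS cA] /=; by rewrite curve_minors_idx // cA.
Qed.

Definition curve_w (j : nat) : M := \sum_(I | e_rows I == j) curve_minors (row2 1 1) I *: rec_basis I.

Lemma curve_vecE x : curve_vec x = rnc curve_deg curve_w x.
Proof.
rewrite /curve_vec /recover /rnc.
pose f I := (x 0 0 ^+ (curve_deg - e_rows I) * x 0 1 ^+ e_rows I) *: (curve_minors (row2 1 1) I *: rec_basis I).
have fE I : curve_minors x I *: rec_basis I = f I by rewrite curve_minors_monomial mulrC /f scalerA.
rewrite (eq_bigr f) // => {fE}.
have big0 I : (curve_deg < e_rows I)%N -> curve_minors (row2 1 1) I = 0.
  by move=> DI; apply/eqP; apply: contraTT DI => /(curve_minors_facts 0 I).2; rewrite -leqNgt.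
rewrite (bigID (fun I => (e_rows I <= curve_deg)%N)) /= [X in _ + X]big1 ?addr0 => [|I]; last first.
  by rewrite -ltnNge => /big0 E; rewrite /f E scale0r scaler0.
rewrite (partition_big (fun I => inord (e_rows I) : 'I_curve_deg.+1) xpredT) //=.
apply: eq_bigr => j _; rewrite /curve_w scaler_sumr; apply: eq_big => [I|I /andP[le /eqP <-]].
  apply/andP/eqP => [[le /eqP <-]|E]; first by rewrite inordK.
  by split; [rewrite E -ltnS | rewrite E inord_val].
by rewrite /f inordK.
Qed.

Lemma curve_lamE j x : (j <= curve_deg)%N ->
  ell (curve_lam_idx j) (rnc curve_deg curve_w x) = x 0 0 ^+ (curve_deg - j) * x 0 1 ^+ j.
Proof. by move=> jD; rewrite -curve_vecE curve_lam. Qed.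

Notation curve_forms := (fun j => [the {linear M -> K^o} of ell (curve_lam_idx j)]).

Lemma curve_vec_neq0 x : x != 0 -> curve_vec x != 0.
Proof. rewrite curve_vecE; exact: (rnc_neq0 (lam := curve_forms) curve_lamE). Qed.

Lemma curve_sh x : x != 0 -> sh a z (pt (curve_vec x)).
Proof.
move=> xn; apply: (family_sh (plane_const (K := K)) pit2 curve_minors_pol (plane_coord K 0) _ curve_frame).
  by exists (row2 1 0); rewrite row2_0 oner_neq0.
exact: curve_vec_neq0.
Qed.

Lemma sh_curveE : @sh_curve R n a z k = zclosure (rnc_affine curve_deg curve_w).
Proof.
have E c : nilp_exp (c *: fusion_act a z (sl2_e R) k) (fusion_low a z) = rnc curve_deg curve_w (row2 1 c).
  apply: (eq_ell z_inj aE st0) => I; rewrite (curve_vector z_inj aE st0) // -curve_vecE curve_ell.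
  rewrite curve_frameE row2_0 ?oner_neq0 // row2_1 divr1 big1 ?mul1r // => b _.
  by apply: big1 => i _; rewrite if_same.
by congr zclosure; apply/seteqP; split=> x [c xc]; exists c; [rewrite -E | rewrite E].
Qed.

End Curve.
End Fusion.

(** * Existence of line bundles *)

Section RegularOn.
Variables (K : fieldType) (M : vectType K) (X : set (proj M)).
Implicit Types f g : proj M -> K.

Lemma regular_on1 : regular_on X (fun=> 1).
Proof.
apply/regular_onP => x Xx; exists 0%N, (fun=> 1), 0%N, (fun=> 1), (fun=> 1).
split=> [||||y _ _]; try exact: hpolyC; first exact: oner_neq0.
by rewrite oner_neq0 divr1.
Qed.

Lemma regular_onM f g : regular_on X f -> regular_on X g -> regular_on X (fun x => f x * g x).
Proof.
move=> /regular_onP Hf /regular_onP Hg; apply/regular_onP => x Xx.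
have [e [o [d [p [q [ho ox hp hq H]]]]]] := Hf x Xx.
have [e' [o' [d' [p' [q' [ho' ox' hp' hq' H']]]]]] := Hg x Xx.
exists (e + e')%N, (fun u => o u * o' u), (d + d')%N, (fun u => p u * p' u), (fun u => q u * q' u).
split; try exact: hpolyM; first by rewrite mulf_neq0.
move=> y Xy; rewrite mulf_eq0 negb_or => /andP[oy oy'].
have [q0 ->] := H y Xy oy; have [q0' ->] := H' y Xy oy'.
by rewrite mulf_neq0 // mulf_div.
Qed.

Lemma regular_onV f : (forall x, X x -> f x != 0) -> regular_on X f -> regular_on X (fun x => (f x)^-1).
Proof.
move=> f0 /regular_onP Hf; apply/regular_onP => x Xx.
have [e [o [d [p [q [ho ox hp hq H]]]]]] := Hf x Xx.
exists e, o, d, q, p; split=> // y Xy oy; have [q0 fE] := H y Xy oy.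
rewrite fE invf_div; split=> //; have := f0 y Xy; rewrite fE mulf_eq0 negb_or.
by case/andP.
Qed.

Lemma regular_on_exprz f (k : int) : (forall x, X x -> f x != 0) -> regular_on X f -> regular_on X (fun x => f x ^ k).
Proof.
move=> f0 rf; have nat_case (j : nat) : regular_on X (fun x => f x ^+ j).
  elim: j => [|j IH]; first exact: regular_on1.
  have -> : (fun x => f x ^+ j.+1) = (fun x => f x * f x ^+ j) by apply: funext => x; rewrite exprS.
  exact: regular_onM.
case: k => j; first exact: nat_case.
by apply: regular_onV => [x Xx|]; [rewrite expf_neq0 // f0 | exact: nat_case].
Qed.

Lemma regular_on_prod (I : Type) (r : seq I) (F : I -> proj M -> K) :
  (forall i, regular_on X (F i)) -> regular_on X (fun x => \prod_(i <- r) F i x).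
Proof.
move=> H; elim: r => [|i r IH].
  have -> : (fun x => \prod_(i <- [::]) F i x) = (fun=> 1) by apply: funext => x; rewrite big_nil.
  exact: regular_on1.
have -> : (fun x => \prod_(i <- i :: r) F i x) = (fun x => F i x * \prod_(i <- r) F i x).
  by apply: funext => x; rewrite big_cons.
exact: regular_onM.
Qed.
End RegularOn.

Section Fusion.
Variables (R : realType) (m s : nat).
Notation n := m.+1.
Variables (st : 'I_s -> nat) (a : 'I_n -> nat) (z : 'I_n -> R[i]).
Hypothesis z_inj : injective z.
Hypothesis aE : forall i, a i = ((\sum_b (st b <= i))%N).+1.
Hypothesis st0 : exists b, st b = 0%N.
Notation K := R[i].
Notation idx := (idx n s).
Notation M := (fusion a z).
Notation ell := (ell st (a := a) (z := z)).
Variable x0 : proj M.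
Notation pt := (pt x0).
Implicit Types (I J : idx) (u : M).
Notation SH := (sh a z).

(** The functionals only give products over all blocks. Changing the selection in one block isolates
    the ratio of the minors of that block. *)
Definition mix I J (b : 'I_s) : idx := [ffun p => if p.1 == b then J p else I p].

Lemma minors_mix (A : comNzRingType) (Y : 'I_s -> row_idx n -> 'I_n -> A) I J b :
  minors Y (mix I J b) = \det (minor Y J b) * \prod_(b' | b' != b) \det (minor Y I b').
Proof.
rewrite /minors (bigD1 b) //=; congr (_ * _).
  by congr (\det _); apply/matrixP => r i; rewrite !mxE ffunE eqxx.
apply: eq_bigr => b' /negPf bb'; congr (\det _); apply/matrixP => r i; by rewrite !mxE ffunE bb'.
Qed.

Lemma minors_mix_mul (A : comNzRingType) (Y : 'I_s -> row_idx n -> 'I_n -> A) I J L b :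
  minors Y (mix I L b) * minors Y J = minors Y (mix I J b) * minors Y (mix J L b).
Proof. by rewrite !minors_mix [minors Y J](bigD1 b) //=; ring. Qed.

Lemma mix_id I b : mix I I b = I.
Proof. by apply/ffunP => p; rewrite ffunE if_same. Qed.

(** These Segre relations hold on the orbit because the functionals are products of minors there,
    and they pass to the closure as quadratic equations. *)
Lemma sh_quadric x I J L b : SH x ->
  ell (mix I L b) (rep x) * ell J (rep x) = ell (mix I J b) (rep x) * ell (mix J L b) (rep x).
Proof.
move=> Sx; apply/eqP; rewrite -subr_eq0; apply/eqP.
have hl H := hpoly_linear [the {linear M -> K^o} of ell H].
apply: (zclosure_hpoly (hpolyB (hpolyM (hl (mix I L b)) (hl J)) (hpolyM (hl (mix I J b)) (hl (mix J L b)))) _ Sx).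
move=> y /(orbit_lowP z_inj aE st0)[p [q [pq [w [yE wE]]]]].
have w0 : w != 0 by have := valP y; rewrite yE dim_vline; case: (w != 0).
have [c c0 ->] := rep_scale w0 yE.
rewrite !linearZ /= !wE /frame_minors /GRing.scale /=.
by rewrite !mulrN mulrACA minors_mix_mul [X in _ - X]mulrACA subrr.
Qed.

Lemma mix_neq0 x I J b : SH x -> ell I (rep x) != 0 -> ell J (rep x) != 0 -> ell (mix I J b) (rep x) != 0.
Proof.
move=> Sx I0 J0; have := sh_quadric I J I b Sx; rewrite mix_id => E.
have : ell I (rep x) * ell J (rep x) != 0 by rewrite mulf_neq0.
by rewrite E mulf_eq0 negb_or => /andP[].
Qed.

Variable c : 'I_s -> int.

(** On the orbit the ratio is that of the minors of block [b] for [J] and for [I], the transition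
    function of O(1) in the Plücker coordinates of that block. So this is the product of the powers
    [c b] of these bundles. *)
Definition block_cocycle : cocycle M :=
  @Cocycle K M idx (fun I => [set x | ell I (rep x) != 0]%classic)
    (fun I J x => \prod_b (ell (mix I J b) (rep x) / ell I (rep x)) ^ (c b)).

Lemma block_line_bundle : is_line_bundle SH block_cocycle.
Proof.
have hl H := hpoly_linear [the {linear M -> K^o} of ell H].
split=> [I|x Sx|I J|I J x Sx Ix Jx|I J L x Sx Ix Jx Lx].
- exact: (zopen_hpoly (hl I)).
- apply: contrapT => nex; have /negP := rep_neq0 x; apply; apply/eqP.
  apply: (ell_inj z_inj aE st0) => I; apply/eqP; apply: contrapT => /negP Ix.
  by apply: nex; exists I.
- apply: regular_on_prod => b; apply: regular_on_exprz => [x [[Sx Ix] Jx]|].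
    by rewrite mulf_neq0 ?invr_eq0 // mix_neq0.
  by apply: (regular_ratio (hl _) (hl _)) => x [[]].
- by apply/prodf_neq0 => b _; rewrite expfz_neq0 // mulf_neq0 ?invr_eq0 // mix_neq0.
rewrite -big_split; apply: eq_bigr => b _ /=; rewrite -expfzMl; congr (_ ^ _).
rewrite mulf_div -(sh_quadric I J L b Sx).
by field; rewrite Ix Jx.
Qed.

(** On C_k the minors of block [b] are homogeneous of degree [block_deg b] in (x_0, x_1), so the
    block contributes [c b] times that degree. *)
Lemma block_restricts k : (k < n)%N ->
  restricts_to_O (@sh_curve R n a z k) block_cocycle (\sum_b c b * (block_deg m st k b)%:Z).
Proof.
move=> kn; rewrite (sh_curveE z_inj aE st0 x0 kn).
have lamE := curve_lamE z_inj aE st0 x0 kn.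
have D0 := curve_deg_gt0 st0 kn.
pose forms j := [the {linear M -> K^o} of ell (curve_lam_idx m st k j)].
have y0 : proj 'rV[K]_2 by exact: point0.
exists (rnc_map x0 (curve_deg m st k) (curve_w z_inj aE st0 k)).
split; first exact: (rnc_iso x0 (lam := forms) D0 lamE y0).
pose phi := rnc_map x0 (curve_deg m st k) (curve_w z_inj aE st0 k).
(* The isomorphism compares the minor of each block with the power of x_j of the same degree; the
   quotient does not depend on the chosen representative of y. *)
pose h (j : 'I_2) I (y : proj 'rV[K]_2) : K :=
  \prod_b (curve_det st k (rep y) I b / (rep y 0 j) ^+ block_deg m st k b) ^ (c b).
have phiE y : phi y = pt (curve_vec z_inj aE st0 k (rep y)) by rewrite (curve_vecE z_inj aE st0).
have vec0 y : curve_vec z_inj aE st0 k (rep y) != 0 by apply: (curve_vec_neq0 z_inj aE st0 x0 kn); exact: rep_neq0.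
have ellE y I : (ell I (rep (phi y)) == 0) = (curve_minors st k (rep y) I == 0).
  have hl := hpoly_linear [the {linear M -> K^o} of ell I].
  by rewrite phiE (hpoly_rep0 hl (vec0 y) (val_pt x0 (vec0 y))) /= curve_ell.
have ratioE y I J : ell J (rep (phi y)) / ell I (rep (phi y)) =
    curve_minors st k (rep y) J / curve_minors st k (rep y) I.
  have hl H := hpoly_linear [the {linear M -> K^o} of ell H].
  by rewrite phiE (hpoly_ratio (hl J) (hl I) (vec0 y) (val_pt x0 (vec0 y))) /= !curve_ell.
have det0 y I b : ell I (rep (phi y)) != 0 -> curve_det st k (rep y) I b != 0.
  by rewrite ellE /curve_minors => /prodf_neq0/(_ b isT).
have det_hpoly I b : hpoly (block_deg m st k b) (fun v : 'rV[K]_2 => curve_det (R := R) st k v I b).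
  have [d0|d0] := eqVneq (curve_det (R := R) st k (row2 1 1) I b) 0.
    by apply: eq_hpoly (hpoly0 'rV[K]_2 _) => v; rewrite (curve_det_monomial st k v I b).1 d0 mul0r.
  have le := (curve_det_monomial st k 0 I b).2 d0.
  apply: (@eq_hpoly _ _ _ (fun v : 'rV[K]_2 => curve_det st k (row2 1 1) I b *
    (v 0 0 ^+ (block_deg m st k b - block_e_rows I b) * v 0 1 ^+ block_e_rows I b))).
    by move=> v; rewrite [RHS](curve_det_monomial st k v I b).1.
  apply: hpolyZ; have := hpolyM (hpolyX (block_deg m st k b - block_e_rows I b) (@hpoly_rV K 2 0))
    (hpolyX (block_e_rows I b) (@hpoly_rV K 2 1)).
  by rewrite !mul1n subnK.
exists h; split=> [j I|j I y _ jy Iy|j j' I J y _ jy jy' Iy Jy].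
- apply: regular_on_prod => b; apply: regular_on_exprz => [y [[_ jy] Iy]|].
    by rewrite mulf_neq0 ?invr_eq0 ?expf_neq0 // det0.
  have hj := hpolyX (block_deg m st k b) (@hpoly_rV K 2 j); rewrite mul1n in hj.
  by apply: (regular_ratio (det_hpoly I b) hj) => y [[_ jy] _]; rewrite expf_neq0.
- by apply/prodf_neq0 => b _; rewrite expfz_neq0 // mulf_neq0 ?invr_eq0 ?expf_neq0 // det0.
have transE : lb_trans (c := lb_pullback phi block_cocycle) I J y =
    \prod_b (curve_det st k (rep y) J b / curve_det st k (rep y) I b) ^ (c b).
  apply: eq_bigr => b _; congr (_ ^ _); rewrite ratioE /curve_minors minors_mix.
  rewrite [minors _ I](bigD1 b) //= -mulf_div divff ?mulr1 //.
  by apply/prodf_neq0 => b' _; exact: det0.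
have OE : lb_trans (c := O_P1 K (\sum_b c b * (block_deg m st k b)%:Z)) j j' y =
    \prod_b ((rep y 0 j') ^+ block_deg m st k b / (rep y 0 j) ^+ block_deg m st k b) ^ (c b).
  have t0 : rep y 0 j' / rep y 0 j != 0 by rewrite mulf_neq0 ?invr_eq0.
  transitivity ((rep y 0 (j' : 'I_2) / rep y 0 (j : 'I_2)) ^ (\sum_b c b * (block_deg m st k b)%:Z)); first by [].
  rewrite (big_morph (fun d => (rep y 0 (j' : 'I_2) / rep y 0 (j : 'I_2)) ^ d) (id1 := 1) (op1 := *%R)) => [|d e|]; last by [].
    by apply: eq_bigr => b _; rewrite (mulrC (c b)) -exprz_exp -exprnP expr_div_n.
  exact: expfzDr.
rewrite transE OE /h -!big_split; apply: eq_bigr => b _ /=; rewrite -!expfzMl; congr (_ ^ _).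
by field; rewrite det0 // !expf_neq0.
Qed.

Lemma block_is_O (A : n.-tuple int) :
  (forall l : 'I_n, tnth A l = \sum_(b < s) (if (st b <= l)%N then c b else 0)) -> is_O block_cocycle A.
Proof.
move=> AE k; have -> : \sum_(l < n | (l < n - k)%N) tnth A l = \sum_b c b * (block_deg m st k b)%:Z.
  under eq_bigr do rewrite AE; rewrite exchange_big; apply: eq_bigr => b _ /=.
  rewrite /block_deg (big_morph Posz PoszD (erefl _)) mulr_sumr big_mkcond; apply: eq_bigr => l _.
  have -> : (l < n - k)%N = (l + k < n)%N by rewrite ltn_subRL addnC.
  rewrite /slot.
  by case: (l + k < n)%N; case: (st b <= l)%N; rewrite ?mulr1 ?mulr0.
exact: block_restricts.
Qed.

End Fusion.

(** * Constraints on degrees *)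

Section Spaces.
Variable K : closedFieldType.
Notation V := 'rV[K]_2.

Definition pair_coords (t : V * V) (k : nat) : K :=
  if (k < 2)%N then plane_coords t.1 k else plane_coords t.2 (k - 2).
Definition pair_ev (t : V * V) : {rmorphism aff_ring K 4 -> K} := aff_ev 4 (pair_coords t).
Definition triple_coords (t : V * V * V) (k : nat) : K :=
  if (k < 4)%N then pair_coords t.1 k else plane_coords t.2 (k - 4).
Definition triple_ev (t : V * V * V) : {rmorphism aff_ring K 6 -> K} := aff_ev 6 (triple_coords t).

Lemma pair_const : has_const pair_ev.
Proof. by move=> c; have [a aE] := aff_const 4 c; exists a => t; exact: aE. Qed.
Lemma triple_const : has_const triple_ev.
Proof. by move=> c; have [a aE] := aff_const 6 c; exists a => t; exact: aE. Qed.

Lemma ord2E (j : 'I_2) : j = 0 \/ j = 1.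
Proof. by case: j => -[|[|//]] ?; [left | right]; apply: val_inj. Qed.

Lemma plane_coordsE (v : V) (j : 'I_2) : plane_coords v j = v 0 j.
Proof. by case: (ord2E j) => ->. Qed.

Lemma pair_coord1 (j : 'I_2) : pol pair_ev (fun t => t.1 0 j).
Proof.
have [|a aE] := @aff_coord K 4 j; first exact: leq_trans (ltn_ord j) _.
by exists a => t; rewrite aE /pair_coords ltn_ord plane_coordsE.
Qed.
Lemma pair_coord2 (j : 'I_2) : pol pair_ev (fun t => t.2 0 j).
Proof.
have [|a aE] := @aff_coord K 4 (2 + j); first by rewrite -ltn_subRL.
by exists a => t; rewrite aE /pair_coords ltnNge leq_addr /= addKn plane_coordsE.
Qed.

Lemma triple_coord1 (j : 'I_2) : pol triple_ev (fun t => t.1.1 0 j).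
Proof.
have [|a aE] := @aff_coord K 6 j; first exact: leq_trans (ltn_ord j) _.
exists a => t; rewrite aE /triple_coords (leq_trans (ltn_ord j)) //.
by rewrite /pair_coords ltn_ord plane_coordsE.
Qed.
Lemma triple_coord2 (j : 'I_2) : pol triple_ev (fun t => t.1.2 0 j).
Proof.
have [|a aE] := @aff_coord K 6 (2 + j); first by rewrite -ltn_subRL (leq_trans (ltn_ord j)).
exists a => t; rewrite aE /triple_coords -ltn_subRL ltn_ord.
by rewrite /pair_coords ltnNge leq_addr /= addKn plane_coordsE.
Qed.
Lemma triple_coord3 (j : 'I_2) : pol triple_ev (fun t => t.2 0 j).
Proof.
have [|a aE] := @aff_coord K 6 (4 + j); first by rewrite -ltn_subRL.
by exists a => t; rewrite aE /triple_coords ltnNge leq_addr /= addKn plane_coordsE.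
Qed.

Lemma geometric_triple : geometric triple_ev.
Proof.
apply: geometric_reparam (geometric_aff K 6) => t.
exists (row2 (t 0%N) (t 1%N), row2 (t 2%N) (t 3%N), row2 (t 4%N) (t 5%N)) => x.
apply: eq_aff_ev => -[|[|[|[|[|[|k]]]]]] // _; rewrite /triple_coords /pair_coords /plane_coords /=.
all: first [exact: row2_0 | exact: row2_1].
Qed.

Section Substitution.
Variables (A : idomainType) (T : Type) (ev : T -> {rmorphism A -> K}).
Hypothesis cst : has_const ev.
Definition pol_vec (c : T -> V) := forall j, pol ev (fun t => c t 0 j).

Lemma pair_subst (F G : T -> V) : pol_vec F -> pol_vec G -> polmap pair_ev ev (fun t => (F t, G t)).
Proof.
move=> pF pG f [a aE]; apply: (eq_pol (fun t => aE (F t, G t))).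
apply: (aff_subst (d := 4) (c := fun t => pair_coords (F t, G t)) cst _ (f := fun v => aff_ev 4 v a)); last by exists a.
by move=> -[|[|[|[|k]]]] // _; rewrite /pair_coords /plane_coords /=.
Qed.

Lemma triple_subst (F G z : T -> V) : pol_vec F -> pol_vec G -> pol_vec z ->
  polmap triple_ev ev (fun t => (F t, G t, z t)).
Proof.
move=> pF pG pz f [a aE]; apply: (eq_pol (fun t => aE (F t, G t, z t))).
apply: (aff_subst (d := 6) (c := fun t => triple_coords (F t, G t, z t)) cst _ (f := fun v => aff_ev 6 v a)); last by exists a.
by move=> -[|[|[|[|[|[|k]]]]]] // _; rewrite /triple_coords /pair_coords /plane_coords /=.
Qed.

Lemma pol_vec_const v : pol_vec (fun=> v).
Proof. by move=> j; exact: cst. Qed.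

Lemma pol_vecD F G : pol_vec F -> pol_vec G -> pol_vec (fun t => F t + G t).
Proof. by move=> pF pG j; apply: eq_pol (polD (pF j) (pG j)) => t; rewrite mxE. Qed.

Lemma pol_vecZ f F : pol ev f -> pol_vec F -> pol_vec (fun t => f t *: F t).
Proof. by move=> pf pF j; apply: eq_pol (polM pf (pF j)) => t; rewrite mxE. Qed.

Lemma pol_vec_row2 f g : pol ev f -> pol ev g -> pol_vec (fun t => row2 (f t) (g t)).
Proof.
move=> pf pg j; case: (ord2E j) => ->.
  by apply: eq_pol pf => t; rewrite row2_0.
by apply: eq_pol pg => t; rewrite row2_1.
Qed.
End Substitution.

Definition det_pair (F G : V) : K := F 0 0 * G 0 1 - F 0 1 * G 0 0.

Lemma det_pairDl F G t : det_pair (F + t *: G) G = det_pair F G.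
Proof. by rewrite /det_pair !mxE; ring. Qed.
Lemma det_pairDr F G t : det_pair F (G + t *: F) = det_pair F G.
Proof. by rewrite /det_pair !mxE; ring. Qed.

End Spaces.

Section Frames.
Variables (K : closedFieldType) (M : vectType K) (X : set (proj M)) (E : cocycle M) (x0 : proj M).
Hypothesis hE : is_line_bundle X E.
Notation J := (lb_index E).
Notation pt := (pt x0).
Notation V := 'rV[K]_2.

Lemma sect_at (A : idomainType) (T : Type) (ev : T -> {rmorphism A -> K}) D F (S S' : J -> T -> K) t :
  into x0 X D F -> sect (E := E) x0 ev D F S -> sect (E := E) x0 ev D F S' -> D t ->
  exists2 c, c != 0 & forall i, lb_open i (pt (F t)) -> S i t = c * S' i t.
Proof.
move=> FX [_ S0 SC] [_ S0' SC'] Dt; have [Eo Ec _ _ _] := hE; have [_ Xt] := FX t Dt.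
have [i Ui] := Ec _ Xt; exists (S i t / S' i t); first by rewrite mulf_neq0 ?invr_eq0 ?S0 ?S0'.
move=> j Uj; rewrite (SC _ _ _ Dt Uj Ui) (SC' _ _ _ Dt Uj Ui) mulrCA divfK //; exact: S0'.
Qed.

Lemma sect_line_from F S S' c : pmap (@line_ev K) F -> into x0 X (fun=> True) F ->
  sect (E := E) x0 (@line_ev K) (fun=> True) F S -> sect (E := E) x0 (@line_ev K) (fun=> True) F S' ->
  (forall i, lb_open i (pt (F 0)) -> S i 0 = c * S' i 0) ->
  forall i t, lb_open i (pt (F t)) -> S i t = c * S' i t.
Proof.
move=> pF FX hS hS' H; have [e e0 eE] := sect_line hE pF FX hS hS'.
have [_ Ec _ _ _] := hE; have [_ Xt] := FX 0 I; have [i Ui] := Ec _ Xt.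
have [_ S0' _] := hS'; have S1 := S0' i 0 I Ui.
have -> : c = e by apply: (mulIf S1); rewrite -H // eE.
exact: eE.
Qed.

Definition frames (t : V * V) : Prop := det_pair t.1 t.2 != 0.

Section Invariance.
Variables (F : V * V -> M) (S S' : J -> V * V -> K) (c : K).
Hypothesis pF : pmap (@pair_ev K) F.
Hypothesis FX : into x0 X frames F.
Hypothesis hS : sect (E := E) x0 (@pair_ev K) frames F S.
Hypothesis hS' : sect (E := E) x0 (@pair_ev K) frames F S'.
Definition proportional (t : V * V) := forall i, lb_open i (pt (F t)) -> S i t = c * S' i t.

Lemma proportional_line (phi : K -> V * V) : polmap (@pair_ev K) (@line_ev K) phi -> (forall t, frames (phi t)) ->
  proportional (phi 0) -> forall t, proportional (phi t).
Proof.
move=> pphi fphi H0 t i.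
apply: (sect_line_from (F := F \o phi) (S := fun i => S i \o phi) (S' := fun i => S' i \o phi)).
- exact: pmap_comp pphi pF.
- by move=> t' _; apply: FX.
- by apply: sect_comp pphi _ hS.
- by apply: sect_comp pphi _ hS'.
- exact: H0.
Qed.

Lemma proportional_addl f g t : frames (f, g) -> proportional (f, g) -> proportional (f + t *: g, g).
Proof.
move=> fr H; apply: (@proportional_line (fun t => (f + t *: g, g))).
- apply: pair_subst; first exact: line_const.
    apply: pol_vecD; first by apply: pol_vec_const; exact: line_const.
    by apply: pol_vecZ; [exact: line_id | apply: pol_vec_const; exact: line_const].
  by apply: pol_vec_const; exact: line_const.
- by move=> t'; rewrite /frames /= det_pairDl.
by rewrite scale0r addr0.
Qed.

Lemma proportional_addr f g t : frames (f, g) -> proportional (f, g) -> proportional (f, g + t *: f).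
Proof.
move=> fr H; apply: (@proportional_line (fun t => (f, g + t *: f))).
- apply: pair_subst; first exact: line_const.
    by apply: pol_vec_const; exact: line_const.
  apply: pol_vecD; first by apply: pol_vec_const; exact: line_const.
  by apply: pol_vecZ; [exact: line_id | apply: pol_vec_const; exact: line_const].
- by move=> t'; rewrite /frames /= det_pairDr.
by rewrite scale0r addr0.
Qed.

(** A monomial matrix of determinant 1 is a product of three elementary ones, each applied along a
    line of frames on which the ratio of the two sections is constant. *)
Lemma proportional_rot f g x : x != 0 -> frames (f, g) -> proportional (f, g) ->
  frames (x *: g, - x^-1 *: f) /\ proportional (x *: g, - x^-1 *: f).
Proof.
move=> x0' fr H.
have fr1 : frames (f + x *: g, g) by rewrite /frames /= det_pairDl.
have H1 := proportional_addl (t := x) fr H.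
have g2 : g + (- x^-1) *: (f + x *: g) = - x^-1 *: f.
  by rewrite scalerDr scalerA mulNr mulVf // scaleN1r addrCA subrr addr0.
have fr2 : frames (f + x *: g, - x^-1 *: f) by rewrite /frames /= -g2 det_pairDr.
have H2 := proportional_addr (t := - x^-1) fr1 H1; rewrite g2 in H2.
have f3 : f + x *: g + x *: (- x^-1 *: f) = x *: g.
  by rewrite scalerA mulrN divff // scaleN1r addrAC subrr add0r.
split; first by rewrite /frames /= -f3 det_pairDl.
by have := proportional_addl (t := x) fr2 H2; rewrite f3.
Qed.

(** The diagonal matrix with entries 2 and 1/2 is the product of the rotations for x = 1 and x =
    -2. *)
Lemma proportional_scale f g : (2%:R : K) != 0 -> frames (f, g) -> proportional (f, g) ->
  proportional (2%:R *: f, 2%:R^-1 *: g).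
Proof.
move=> two fr H; have [fr1 H1] := proportional_rot (oner_neq0 K) fr H.
have m2 : - 2%:R != 0 :> K by rewrite oppr_eq0.
have [_] := proportional_rot m2 fr1 H1.
by rewrite !scalerA invr1 mulrNN mulr1 invrN opprK mulr1.
Qed.
End Invariance.
End Frames.

Lemma ex_minor (K : fieldType) n s (Y : 'I_s -> row_idx n -> 'I_n -> K) :
  (forall b (v : 'I_n -> K), (forall k, \sum_i Y b k i * v i = 0) -> forall i, v i = 0) ->
  exists I, minors Y I != 0.
Proof.
move=> Yinj.
pose N b : 'M[K]_(#|row_idx n|, n) := \matrix_(k, i) Y b (enum_val k) i.
have full b : row_full (N b).
  rewrite /row_full -mxrank_tr -/(row_free _); apply: inj_row_free => v vN; apply/rowP => i.
  rewrite [RHS]mxE; apply: (Yinj b (fun i => v 0 i)) => k.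
  have := congr1 (fun M : 'rV_#|row_idx n| => M 0 (enum_rank k)) vN; rewrite !mxE => E; rewrite -[RHS]E.
  by apply: eq_bigr => j _; rewrite !mxE enum_rankK mulrC.
exists [ffun p => enum_val (fullrankfun (full p.1) p.2)].
apply/prodf_neq0 => b _.
have -> : minor Y [ffun p => enum_val (fullrankfun (full p.1) p.2)] b = rowsub (fullrankfun (full b)) (N b).
  by apply/matrixP => r i; rewrite !mxE ffunE.
by rewrite -unitfE -unitmxE -row_full_unit; exact: fullrowsub_full.
Qed.

Lemma sum_shift (A : pzSemiRingType) m (t c : nat) (g : nat -> A) : (t < m.+1)%N ->
  \sum_(i < m.+1) (t == i + c)%N%:R * g i = if (c <= t)%N then g (t - c)%N else 0.
Proof.
move=> tm; case: leqP => ct; last first.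
  by rewrite big1 // => i _; rewrite ltn_eqF ?mul0r // (leq_trans ct) // leq_addl.
have tc : (t - c < m.+1)%N by apply: leq_ltn_trans tm; exact: leq_subr.
rewrite (bigD1 (Ordinal tc)) //= subnK // eqxx mul1r big1 ?addr0 // => i.
rewrite -val_eqE /= => ne; case: eqP => [E|]; last by rewrite mul0r.
by move: ne; rewrite E addnK eqxx.
Qed.

Lemma sum_pick2 (A : pzSemiRingType) n (u v : 'I_n) (x y : A) (g : 'I_n -> A) :
  \sum_j g j * ((j == u)%:R * x + (j == v)%:R * y) = g u * x + g v * y.
Proof.
have pick (w : 'I_n) (e : A) : \sum_j g j * ((j == w)%:R * e) = g w * e.
  rewrite (bigD1 w) //= eqxx mul1r big1 ?addr0 // => j /negPf->.
  by rewrite mul0r mulr0.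
by rewrite -!pick -big_split; apply: eq_bigr => j _; rewrite mulrDr.
Qed.

Section Rows.
Variables (K : closedFieldType) (m s : nat) (st : 'I_s -> nat).
Notation n := m.+1.
Notation V := 'rV[K]_2.
Implicit Types (b : 'I_s) (e : bool) (F G z : V).

Definition side e : 'I_2 := if e then 1 else 0.
Definition shift (j : nat) e : nat := if e then (m - j)%N else 0%N.
Definition coef1 (j : nat) F z b e (i : nat) : K :=
  if (st b <= i <= j)%N then (if (i < j)%N then z 0 0 else 1) * F 0 (side e) else (~~ e)%:R.
Definition coef2 (j : nat) G z b e (i : nat) : K :=
  if (st b <= i < j)%N then z 0 1 * G 0 (side e) else 0.
(* With k = m - j, and F = (F_f, F_e), the column i of the block b is
   z_0 (F_f f_i + F_e e_(i+k)) + z_1 (G_f f_(i+1) + G_e e_(i+1+k)) for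
   st b <= i < j, F_f f_i + F_e e_(i+k) for i = j, and f_i otherwise.  This joins
   the curve of index k, at z = (1, 0), to that of index k + 1, described by z
   when F and G are the standard basis, and, at z = (0, 1), to the same family
   for j - 1, provided that no block starts at j. *)
Definition phi_row (j : nat) (t : V * V * V) b (k : row_idx n) (i : 'I_n) : K :=
  (k.2 == i + shift j k.1 :> nat)%N%:R * coef1 j t.1.1 t.2 b k.1 i +
  (k.2 == i + (shift j k.1).+1 :> nat)%N%:R * coef2 j t.1.2 t.2 b k.1 i.
Definition phi_minors j t I : K := minors (phi_row j t) I.
Definition regular_triple (t : V * V * V) : Prop := det_pair t.1.1 t.1.2 != 0 /\ t.2 != 0.

Lemma coef1_pol j b e i : pol (@triple_ev K) (fun t => coef1 j t.1.1 t.2 b e i).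
Proof.
rewrite /coef1; case: (st b <= i <= j)%N; last exact: triple_const.
apply: polM; last exact: triple_coord1.
by case: (i < j)%N; [exact: triple_coord3 | exact: triple_const].
Qed.

Lemma coef2_pol j b e i : pol (@triple_ev K) (fun t => coef2 j t.1.2 t.2 b e i).
Proof.
rewrite /coef2; case: (st b <= i < j)%N; last exact: triple_const.
by apply: polM; [exact: triple_coord3 | exact: triple_coord2].
Qed.

Lemma phi_minors_pol j I : pol (@triple_ev K) (fun t => phi_minors j t I).
Proof.
apply: pol_prod => b _.
apply: pol_det => r i.
apply: (@eq_pol _ _ _ _ (fun t => phi_row j t b (I (b, r)) i)) => [t|]; first by rewrite mxE.
apply: polD; apply: polM; [exact: triple_const | exact: coef1_pol | exact: triple_const | exact: coef2_pol].
Qed.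

Lemma frame_indep F G x y : det_pair F G != 0 -> (forall e, F 0 (side e) * x + G 0 (side e) * y = 0) -> x = 0 /\ y = 0.
Proof.
move=> FG H; have := H false; have := H true; rewrite /side => H1 H0.
have Ex : det_pair F G * x = 0.
  have -> : det_pair F G * x = G 0 1 * (F 0 0 * x + G 0 0 * y) - G 0 0 * (F 0 1 * x + G 0 1 * y) by rewrite /det_pair; ring.
  by rewrite H0 H1 !mulr0 subrr.
have Ey : det_pair F G * y = 0.
  have -> : det_pair F G * y = F 0 0 * (F 0 1 * x + G 0 1 * y) - F 0 1 * (F 0 0 * x + G 0 0 * y) by rewrite /det_pair; ring.
  by rewrite H0 H1 !mulr0 subrr.
by split; apply/eqP; [move/eqP: Ex | move/eqP: Ey]; rewrite mulf_eq0 (negPf FG).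
Qed.

Lemma phi_row_sum j t b e (w : nat) (v : nat -> K) : (j <= m)%N -> (w < n)%N -> (w + shift j e < n)%N ->
  \sum_i phi_row j t b (e, inord (w + shift j e)) i * v i =
  coef1 j t.1.1 t.2 b e w * v w + (if (0 < w)%N then coef2 j t.1.2 t.2 b e w.-1 * v w.-1 else 0).
Proof.
move=> jm wn we; rewrite /phi_row /= inordK //.
under eq_bigr do rewrite mulrDl -!mulrA.
rewrite big_split /= (sum_shift _ (fun i => coef1 j t.1.1 t.2 b e i * v i)) //.
rewrite (sum_shift _ (fun i => coef2 j t.1.2 t.2 b e i * v i)) // leq_addl addnK.
congr (_ + _); case: w {wn we} => [|w] /=; first by rewrite add0n ltnn.
by rewrite addSn -addnS leq_addl addnK.
Qed.

(** The columns of each block are independent. In a relation v, the e and f rows for position w form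
    a system in F and G, so z_0 v_w (v_w itself if w = j) and z_1 v_(w-1) vanish separately, and one
    of z_0, z_1 is nonzero. *)
Lemma phi_minors_neq0 j t : (j <= m)%N -> regular_triple t -> exists I, phi_minors j t I != 0.
Proof.
move=> jm [FG z0]; apply: ex_minor => b v0 H.
pose v i := v0 (inord i); have vE i : v0 i = v i by rewrite /v inord_val.
have {}H k : \sum_i phi_row j t b k i * v i = 0 by rewrite -[RHS](H k); apply: eq_bigr => i _; rewrite vE.
have out w : (w < n)%N -> ~~ (st b <= w <= j)%N -> v w = 0.
  move=> wn nw; have := H (false, inord (w + shift j false)); rewrite phi_row_sum //= ?addn0 //.
  rewrite /coef1 (negPf nw) mul1r => <-; case: ltnP => w0; last by rewrite addr0.
  rewrite /coef2; case: ifP => [h|_]; last by rewrite mul0r addr0.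
  by exfalso; move: h nw; lia.
have inn w : (st b <= w <= j)%N -> (if (w < j)%N then t.2 0 0 else 1) * v w = 0 /\
    (if (st b < w)%N then t.2 0 1 * v w.-1 else 0) = 0.
  move=> h; have wj : (w <= j)%N by case/andP: h.
  apply: (frame_indep FG) => e.
  have we : (w + shift j e < n)%N by rewrite /shift; case: e; lia.
  have wn : (w < n)%N by lia.
  rewrite -[RHS](H (e, inord (w + shift j e))) phi_row_sum // /coef1 h; congr (_ + _).
    by rewrite mulrA [_ * t.1.1 _ _]mulrC.
  case: (posnP w) => [->|w0]; first by rewrite mulr0.
  rewrite /coef2; have -> : (st b <= w.-1 < j)%N = (st b < w)%N by move: h w0; lia.
  by case: ifP => _; rewrite ?mulr0 ?mul0r // [RHS]mulrAC [RHS]mulrC.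
move=> i; rewrite vE; have [h|] := boolP (st b <= i <= j)%N; last exact: out.
have [H1 _] := inn i h; case: (ltnP i j) H1 => [ij H1|ji]; last by rewrite mul1r.
have h' : (st b <= i.+1 <= j)%N by case/andP: h => h _; rewrite ij (leq_trans h).
have [_] := inn i.+1 h'; have -> : (st b < i.+1)%N by case/andP: h.
move/eqP; rewrite mulf_eq0 => /orP[/eqP z1|/eqP //].
move/eqP: H1; rewrite mulf_eq0 => /orP[/eqP z00|/eqP //].
by move: z0; rewrite row2_eq0 z00 z1 eqxx.
Qed.

(* The power series (x t^k + w t^(k+1)) / (1 + y t), whose truncated multiples by
   t^i span the columns of phi_row at general points. *)
Fixpoint phi_seq (k : nat) (x y w : K) (t : nat) : K :=
  if t is t'.+1 then (t == k)%:R * x + (t' == k)%:R * w - y * phi_seq k x y w t' else (t == k)%:R * x.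

Lemma phi_seq_lt k x y w t : (t < k)%N -> phi_seq k x y w t = 0.
Proof.
elim: t => [|t IH] tk /=; first by rewrite ltn_eqF // mul0r.
by rewrite IH 1?ltnW // !ltn_eqF // 1?ltnW // !mul0r mulr0 addr0 subr0.
Qed.

Lemma phi_seq_eq k x y w : phi_seq k x y w k = x.
Proof.
case: k => [|k] /=; first by rewrite mul1r.
by rewrite eqxx phi_seq_lt // mulr0 subr0 ltn_eqF // mul0r addr0 mul1r.
Qed.

Definition phi_mx j (t : V * V * V) b : 'M[K]_n := \matrix_(l, i)
  ((l == i :> nat)%N%:R * coef1 j t.1.1 t.2 b false i + (l == i.+1 :> nat)%N%:R * coef2 j t.1.2 t.2 b false i).

(** For st b <= i < j, column [i] is z_0 F_f (1 + y t) t^i (f + p e) with p = (x t^k + w t^(k+1)) /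
    (1 + y t). So [phi_mx] is a bidiagonal change of columns, and a general member of the family
    lies in the orbit. *)
Lemma phi_frame j (t : V * V * V) : (j <= m)%N -> t.2 0 0 * t.1.1 0 0 * det_pair t.1.1 t.1.2 != 0 -> exists p q c,
  [/\ (p 0%N != 0) || (q 0%N != 0), c != 0 & forall I, phi_minors j t I = c * minors (frame_row st p q) I].
Proof.
case: t => [[F G] z] /= jm; rewrite !mulf_eq0 !negb_or => /andP[/andP[z0 F0] FG].
pose k := (m - j)%N; pose x := F 0 1 / F 0 0; pose y := (z 0 1 * G 0 0) / (z 0 0 * F 0 0).
pose w := (z 0 1 * G 0 1) / (z 0 0 * F 0 0).
pose p := phi_seq k x y w.
have cE I : phi_minors j (F, G, z) I = (\prod_b \det (phi_mx j (F, G, z) b)) * minors (frame_row st p (one_seq K)) I.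
  apply: minors_mulr => b [e l] i; rewrite /phi_mx /=.
  have -> : \sum_l' frame_row st p (one_seq K) b (e, l) l' * phi_mx j (F, G, z) b l' i =
      frame_row st p (one_seq K) b (e, l) i * coef1 j F z b false i +
      (if (i.+1 < n)%N then frame_row st p (one_seq K) b (e, l) (inord i.+1) * coef2 j G z b false i else 0).
    case: ltnP => i1.
      rewrite -(sum_pick2 i (inord i.+1) _ _ (frame_row st p (one_seq K) b (e, l))).
      by apply: eq_bigr => l' _; rewrite mxE -!val_eqE /= inordK.
    rewrite addr0 (bigD1 i) //= mxE eqxx mul1r (ltn_eqF (ltnSn i)) mul0r addr0 big1 ?addr0 // => l' ne.
    have ln := ltn_ord l'; rewrite mxE val_eqE (negPf ne) mul0r add0r (_ : _ == _ = false) ?mul0r ?mulr0 //.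
    by rewrite ltn_eqF // (leq_trans ln).
  rewrite /phi_row /= /coef1 /coef2 /side.
  have im := ltn_ord i; have lm := ltn_ord l.
  case: (boolP (st b <= i <= j)%N) => h; last first.
    have h2 : (st b <= i < j)%N = false by apply/negP => /andP[h1 /ltnW h2]; rewrite h1 h2 in h.
    rewrite h2 !mulr0 if_same !addr0 mulr1 /frame_row /=.
    case: (leqP (st b) i) => si; last first.
      case: e => /=; first by rewrite mulr0.
      by rewrite addn0 mulr1 -val_eqE.
    have ji : (j < i)%N by rewrite si /= -ltnNge in h.
    case: e => /=.
      rewrite mulr0; case: leqP => // il; rewrite /p phi_seq_lt // /k.
      by move: (nat_of_ord l) (nat_of_ord i) lm il ji => l' i'; lia.
    rewrite addn0 mulr1 /one_seq; case: leqP => il; last by rewrite ltn_eqF.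
    by rewrite subn_eq0 eqn_leq il andbT.
  have [si ij] := andP h; rewrite si /=.
  have f_i : frame_row st p (one_seq K) b (e, l) i = if (i <= l)%N then (if e then p else one_seq K) (l - i)%N else 0.
    by rewrite /frame_row si.
  rewrite f_i; case: (ltnP i j) => ltij; last first.
    have {ltij} ij' : i = j :> nat by apply/eqP; rewrite eqn_leq ij.
    rewrite !mulr0 if_same !addr0 !mul1r ij'; case: e {f_i} => /=; last first.
      rewrite addn0 /one_seq; case: leqP => jl; last by rewrite ltn_eqF.
      by rewrite subn_eq0 eqn_leq jl andbT.
    case: leqP => jl; last by rewrite ltn_eqF ?mul0r // (leq_trans jl) // leq_addr.
    have [->|ne] := eqVneq (l : nat) (j + (m - j))%N.
      by rewrite addKn /p phi_seq_eq mul1r divfK.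
    by rewrite /p phi_seq_lt ?mul0r // /k; move: (nat_of_ord l) lm jl ne => l' lm jl ne; lia.
  have i1 : (i.+1 < n)%N by lia.
  rewrite i1 /frame_row inordK // (leq_trans si) //=.
  have zF : z 0 0 * F 0 0 != 0 by rewrite mulf_neq0.
  case: e {f_i} => /=; last first.
    rewrite addn0 addn1 /one_seq; congr (_ * _ + _ * _).
      by case: leqP => il; [rewrite subn_eq0 eqn_leq il andbT | rewrite ltn_eqF].
    by case: (ltnP i l) => il; [rewrite subn_eq0 eqn_leq il andbT | rewrite ltn_eqF].
  have yE : y * (z 0 0 * F 0 0) = z 0 1 * G 0 0 by rewrite divfK.
  have wE : w * (z 0 0 * F 0 0) = z 0 1 * G 0 1 by rewrite divfK.
  have xE : x * F 0 0 = F 0 1 by rewrite divfK.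
  case: (leqP i l) => il; last first.
    rewrite [X in X * _](_ : _ = 0); last by rewrite ltn_eqF // (leq_trans il) // leq_addr.
    rewrite (ltn_eqF (leq_trans il (leq_addr _ _))).
    by rewrite ltnNge (ltnW il) /= !mul0r.
  move: (subnKC il) => lE; move: (l - i)%N lE => d lE.
  have -> : (i < l)%N = (0 < d)%N by rewrite -lE -addn1 leq_add2l.
  have -> : (l - i.+1 = d.-1)%N by rewrite -lE; lia.
  rewrite -lE eqn_add2l -/k eqn_add2l.
  case: d lE => [|d] lE /=.
    by rewrite mul0r !addr0 -xE [in RHS]mulrACA; ring.
  have pE : p d.+1 = (d.+1 == k)%:R * x + (d == k)%:R * w - y * p d by [].
  rewrite eqSS pE -wE -yE -xE; ring.
exists p, (one_seq K), (\prod_b \det (phi_mx j (F, G, z) b)); split=> //.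
  by rewrite oner_neq0 orbT.
have [||I] := @phi_minors_neq0 j (F, G, z) => //.
  by split=> //=; apply: contraNneq z0 => ->; rewrite mxE.
by rewrite cE mulf_eq0 negb_or => /andP[].
Qed.

Lemma phi_minors_curve j F G I : (j <= m)%N ->
  phi_minors j (F, G, row2 1 0) I = minors (fun b t i => if slot m st (m - j) b i then (if t.1 then (t.2 == i + (m - j) :> nat)%N%:R * F 0 1 else (t.2 == i)%:R * F 0 0) else (~~ t.1 && (t.2 == i))%:R) I.
Proof.
move=> jm; apply: eq_minors => b r i; move: (I (b, r)) => [e l]; rewrite /phi_row /coef1 /coef2 /= row2_0 row2_1 !mul0r !if_same mulr0 addr0 mul1r.
have -> : slot m st (m - j) b i = (st b <= i <= j)%N.
  by rewrite /slot; congr andb; apply/idP/idP; lia.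
rewrite /side /shift -val_eqE; case: (st b <= i <= j)%N; case: e => //=; rewrite ?addn0 ?mulr1 ?mulr0 //.
Qed.

Lemma phi_minors_axes j z I : (j <= m)%N ->
  phi_minors j (row2 1 0, row2 0 1, z) I = minors (fun b t i => if slot m st (m - j).+1 b i then (if t.1 then (t.2 == i + (m - j).+1 :> nat)%N%:R * z 0 1 else (t.2 == i)%:R * z 0 0) else (~~ t.1 && (t.2 == i))%:R) I.
Proof.
move=> jm; apply: eq_minors => b r i; move: (I (b, r)) => [e l]; rewrite /phi_row /coef1 /coef2 /= .
have -> : slot m st (m - j).+1 b i = (st b <= i < j)%N.
  by rewrite /slot; congr andb; apply/idP/idP; lia.
rewrite /side /shift; case: e => /=; rewrite ?row2_0 ?row2_1 ?mulr0 ?mulr1 ?if_same ?mulr0 ?add0r.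
  by case: ifP => _ //; rewrite mulr0.
rewrite addr0 addn0 -val_eqE /=; case: (leqP (st b) i) => //= si; case: (ltngtP i j) => ij //=; by rewrite mulr1.
Qed.

(** At z = (0, 1) the columns j - 1 and j of an active block are combinations of f_j and e_m, with
    coefficients G and F, and can be replaced by e_m and f_j, the columns of the family for j - 1. A
    block starting at j would have only one of these columns active; this is where the hypothesis
    enters. *)
Lemma phi_minors_degenerate j F G : (0 < j <= m)%N -> (forall b, st b != j) ->
  exists c, forall I, phi_minors j (F, G, row2 0 1) I =
    c * phi_minors j.-1 (row2 0 1, row2 (-1) 0, row2 (G 0 1) (- G 0 0)) I.
Proof.
move=> /andP[j0 jm] nj.
have uE : (inord j.-1 : 'I_n) = j.-1 :> nat by rewrite inordK //; lia.
have vE : (inord j : 'I_n) = j :> nat by rewrite inordK.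
move: (inord j.-1 : 'I_n) (inord j : 'I_n) uE vE => u v uE vE.
(* The columns [u] = j - 1 and [v] = j of the new family are e_m and f_j; the entries of [U] are the
   coordinates of the old columns in them. *)
pose U b : 'M[K]_n := \matrix_(l, i) if (st b < j)%N then
  (if i == u then (l == u)%:R * G 0 1 + (l == v)%:R * G 0 0
   else if i == v then (l == u)%:R * F 0 1 + (l == v)%:R * F 0 0 else (l == i)%:R) else (l == i)%:R.
exists (\prod_b \det (U b)) => I'; apply: minors_mulr => b [e l] i.
set Y' := phi_row j.-1 _ b (e, l).
have pick w : \sum_l' Y' l' * (l' == w)%:R = Y' w.
  by rewrite (bigD1 w) //= eqxx mulr1 big1 ?addr0 // => l' /negPf->; rewrite mulr0.
have [bj|jb] := ltnP (st b) j; last first.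
  have {}jb : (j < st b)%N by rewrite ltn_neqAle eq_sym nj.
  rewrite (eq_bigr (fun l' => Y' l' * (l' == i)%:R)) => [|l' _]; last by rewrite mxE ltnNge (ltnW jb).
  rewrite pick /Y' /phi_row /coef1 /coef2 /=.
  have h w : (w <= j)%N -> (st b <= w)%N = false by move=> wj; apply/negP; lia.
  have -> : (st b <= i <= j)%N = false by apply/negP => /andP[h1 h2]; rewrite h in h1.
  have -> : (st b <= i <= j.-1)%N = false by apply/negP => /andP[h1 h2]; rewrite h // in h1; lia.
  have -> : (st b <= i < j)%N = false by apply/negP => /andP[h1 h2]; rewrite h // in h1; lia.
  have -> : (st b <= i < j.-1)%N = false by apply/negP => /andP[h1 h2]; rewrite h // in h1; lia.
  by case: e {Y' pick} => /=; rewrite ?mulr0.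
have im := ltn_ord i; have lm := ltn_ord l.
have Y'u : Y' u = (e && (l == m :> nat))%:R.
  rewrite /Y' /phi_row /coef1 /coef2 /= uE ltnn andbF mulr0 addr0 leqnn andbT.
  have -> : (st b <= j.-1)%N by lia.
  rewrite mul1r /side /shift; case: e {Y' pick} => /=; rewrite ?row2_0 ?row2_1 ?mulr0 // mulr1.
  by have -> : (j.-1 + (m - j.-1) = m)%N by lia.
have Y'v : Y' v = (~~ e && (l == j :> nat))%:R.
  rewrite /Y' /phi_row /coef1 /coef2 /= vE.
  have -> : (j <= j.-1)%N = false by apply/negP; lia.
  have -> : (j < j.-1)%N = false by apply/negP; lia.
  rewrite !andbF mulr0 addr0 /shift; case: e {Y' pick Y'u} => /=; first by rewrite mulr0.
  by rewrite addn0 mulr1.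
have [iu|iu] := eqVneq i u.
  rewrite (eq_bigr (fun l' => Y' l' * ((l' == u)%:R * G 0 1 + (l' == v)%:R * G 0 0))) => [|l' _]; last by rewrite mxE bj iu eqxx.
  rewrite sum_pick2 Y'u Y'v /phi_row /coef1 /coef2 /= iu uE row2_0 row2_1 mul1r.
  have -> : (j.-1 < j)%N by lia.
  have -> : (st b <= j.-1)%N by lia.
  rewrite leq_pred mul0r /= mulr0 add0r /side /shift; case: e {Y' pick Y'u Y'v} => /=.
    by rewrite mul0r addr0; have -> : (j.-1 + (m - j).+1 = m)%N by lia.
  by rewrite mul0r add0r; have -> : (j.-1 + 1 = j)%N by lia.
have [iv|iv] := eqVneq i v.
  rewrite (eq_bigr (fun l' => Y' l' * ((l' == u)%:R * F 0 1 + (l' == v)%:R * F 0 0))) => [|l' _]; last by rewrite mxE bj (negPf iu) iv eqxx.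
  rewrite sum_pick2 Y'u Y'v /phi_row /coef1 /coef2 /= iv vE ltnn andbF mulr0 addr0 leqnn andbT (ltnW bj) mul1r.
  rewrite /side /shift; case: e {Y' pick Y'u Y'v} => /=.
    by rewrite mul0r addr0; have -> : (j + (m - j) = m)%N by lia.
  by rewrite mul0r add0r addn0.
rewrite (eq_bigr (fun l' => Y' l' * (l' == i)%:R)) => [|l' _]; last by rewrite mxE bj (negPf iu) (negPf iv).
rewrite pick /Y' /phi_row /coef1 /coef2 /= !row2_0 !row2_1.
have {}iu : i != j.-1 :> nat by rewrite -uE val_eqE.
have {}iv : i != j :> nat by rewrite -vE val_eqE.
have -> : (i <= j)%N = (i < j.-1)%N by apply/idP/idP; lia.
have -> : (i < j)%N = (i < j.-1)%N by apply/idP/idP; lia.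
have -> : (i <= j.-1)%N = (i < j.-1)%N by apply/idP/idP; lia.
case: (leqP (st b) i) => si; case: ltnP => ij /=; do 1?[by case: e {Y' pick Y'u Y'v} => /=; rewrite ?mulr0].
rewrite mul0r mulr0 add0r mul1r /side /shift; case: e {Y' pick Y'u Y'v} => /=; rewrite ?row2_0 ?row2_1.
  by rewrite mulr1 !mulr0 addr0; have -> : ((m - j).+1 = m - j.-1)%N by lia.
by rewrite mulr0 mulr0 add0r mulrNN mulr1.
Qed.

(** The factor [c1] is for the active columns before j and [c2] for column j, which does not involve
    z and may scale differently. *)
Lemma phi_minors_colscale j (t t' : V * V * V) (c1 c2 : K) :
  (forall b e i, (i < j)%N -> coef1 j t.1.1 t.2 b e i = (if (st b <= i)%N then c1 else 1) * coef1 j t'.1.1 t'.2 b e i) ->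
  (forall b e, coef1 j t.1.1 t.2 b e j = (if (st b <= j)%N then c2 else 1) * coef1 j t'.1.1 t'.2 b e j) ->
  (forall b e i, (i < j)%N -> coef2 j t.1.2 t.2 b e i = (if (st b <= i)%N then c1 else 1) * coef2 j t'.1.2 t'.2 b e i) ->
  exists c, forall I, phi_minors j t I = c * phi_minors j t' I.
Proof.
move=> H1 H2 H3.
pose c b (i : 'I_n) := if (i < j)%N then (if (st b <= i)%N then c1 else 1) else if (i == j :> nat) && (st b <= j)%N then c2 else 1.
exists (\prod_b \prod_i c b i) => I; apply: minors_scale => b [e l] i.
rewrite /phi_row /= /c; case: (ltngtP i j) => ij /=.
- by rewrite H1 // H3 // mulrDr !mulrA [X in X * _ + _]mulrC ![_ * (if _ then c1 else 1)]mulrC.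
- rewrite mul1r /coef1 /coef2 !(leqNgt i) ij !andbF.
  by rewrite (ltnNge i) (ltnW ij) andbF.
rewrite ij H2 /coef2 ltnn !andbF !mulr0 !addr0 mulrCA; by [].
Qed.
End Rows.

Lemma exprz2_inj (K : numFieldType) (d e : int) : (2%:R : K) ^ d = 2%:R ^ e -> d = e.
Proof.
have two : (2%:R : K) != 0 by rewrite pnatr_eq0.
move=> E; apply/eqP; rewrite -subr_eq0; apply/eqP.
have {E} : (2%:R : K) ^ (d - e) = 1 by rewrite expfzDr // E -expfzDr // subrr expr0z.
have nat_case k : (2%:R : K) ^+ k = 1 -> k = 0%N.
  by move=> /eqP; rewrite -natrX (eqr_nat K _ 1); case: k => // k; rewrite -[1%N]/(2 ^ 0)%N eqn_exp2l.
case: (d - e) => k; first by move/nat_case => ->.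
by move=> H; have /eqP : ((2%:R : K) ^+ k.+1)^-1 = 1 := H; rewrite invr_eq1 => /eqP/nat_case.
Qed.

(** * Comparing the degrees on three consecutive curves *)

Section Fusion.
Variables (R : realType) (m s : nat).
Notation n := m.+1.
Variables (st : 'I_s -> nat) (a : 'I_n -> nat) (z : 'I_n -> R[i]).
Hypothesis z_inj : injective z.
Hypothesis aE : forall i, a i = ((\sum_b (st b <= i))%N).+1.
Hypothesis st0 : exists b, st b = 0%N.
Notation K := R[i].
Notation M := (fusion a z).
Notation V := 'rV[K]_2.
Variable x0 : proj M.
Notation pt := (pt x0).
Notation SH := (sh a z).
Notation e1 := (row2 (1 : K) 0).
Notation e2 := (row2 (0 : K) 1).
Notation curve := (curve_vec z_inj aE st0).

Definition phi_vec j (t : V * V * V) : M := recover z_inj aE st0 (phi_minors st j t).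

Let pit : forall c, c != 0 -> exists t, @triple_ev K t c != 0.
Proof. by case: (geometric_triple K) => H _ _; exact: H. Qed.

Lemma det_pair_e : det_pair e1 e2 = 1.
Proof. by rewrite /det_pair !row2_0 !row2_1 mulr1 mulr0 subr0. Qed.

Lemma e1_neq0 : e1 != 0.
Proof. by rewrite row2_eq0 row2_0 oner_eq0. Qed.

Lemma e2_neq0 : e2 != 0.
Proof. by rewrite row2_eq0 row2_1 oner_eq0 andbF. Qed.

Let generic (t : V * V * V) : K := t.2 0 0 * t.1.1 0 0 * det_pair t.1.1 t.1.2.

Lemma det_pair_pol : pol (@triple_ev K) (fun t => det_pair t.1.1 t.1.2).
Proof.
have p1 := @triple_coord1 K; have p2 := @triple_coord2 K.
by apply: polD; [|apply: polN]; apply: polM.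
Qed.

Let generic_pol : pol (@triple_ev K) generic.
Proof.
have p1 := @triple_coord1 K; have p3 := @triple_coord3 K.
by apply: polM det_pair_pol; apply: polM.
Qed.

Let generic_neq0 : exists t, generic t != 0.
Proof. by exists (e1, e2, e1); rewrite /generic /= det_pair_e !row2_0 !mulr1 oner_neq0. Qed.

Lemma phi_pmap j : pmap (@triple_ev K) (phi_vec j).
Proof. by apply: recover_pmap; [exact: triple_const | exact: phi_minors_pol]. Qed.

Lemma phi_neq0 j t : (j <= m)%N -> regular_triple t -> phi_vec j t != 0.
Proof.
move=> jm rt; have [I I0] := @phi_minors_neq0 K m s st j t jm rt.
apply: (family_neq0 z_inj aE st0 x0 (@triple_const K) pit (@phi_minors_pol K m s st j) generic_pol generic_neq0 _ I0).
by move=> t' gt'; have [p [q [c [pq c0 E]]]] := phi_frame st jm gt'; exists p, q, c.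
Qed.

Lemma phi_into j : (j <= m)%N -> into x0 SH (@regular_triple K) (phi_vec j).
Proof.
move=> jm t rt; have v0 := phi_neq0 jm rt; split=> //.
apply: (family_sh (z_inj := z_inj) (aE := aE) (st0 := st0) x0 (@triple_const K) pit (@phi_minors_pol K m s st j) generic_pol generic_neq0 _ v0).
by move=> t' gt'; have [p [q [c [pq c0 E]]]] := phi_frame st jm gt'; exists p, q, c.
Qed.

Lemma regular_triple_open (t : V * V * V) : regular_triple t ->
  exists f, [/\ pol (@triple_ev K) f, f t != 0 & forall t', f t' != 0 -> regular_triple t'].
Proof.
move=> [d0 z0]; have [j zj] : exists j : 'I_2, t.2 0 j != 0.
  by move: z0; rewrite row2_eq0 negb_and => /orP[]; [exists 0 | exists 1].
exists (fun t : V * V * V => det_pair t.1.1 t.1.2 * t.2 0 j); split.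
- by apply: polM; [exact: det_pair_pol | exact: triple_coord3].
- by rewrite mulf_neq0.
move=> t'; rewrite mulf_eq0 negb_or => /andP[d0' z0']; split=> //.
by apply: contraNneq z0' => ->; rewrite mxE.
Qed.

Lemma pt_phi j j' t t' : (j <= m)%N -> regular_triple t ->
  (exists c : K, forall I : idx n s, phi_minors st j t I = c * phi_minors st j' t' I) -> pt (phi_vec j t) = pt (phi_vec j' t').
Proof.
move=> jm rt [c cE]; have E : phi_vec j t = c *: phi_vec j' t'.
  by rewrite /phi_vec -recoverZ; exact: eq_recover.
have c0 : c != 0 by apply: contraNneq (phi_neq0 jm rt) => c0; rewrite E c0 scale0r.
by rewrite E pt_scale.
Qed.

Lemma phi_curve j F G : (j <= m)%N -> phi_vec j (F, G, e1) = curve (m - j) F.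
Proof. by move=> jm; apply: eq_recover => I; rewrite phi_minors_curve. Qed.

Lemma phi_axes j w : (j <= m)%N -> phi_vec j (e1, e2, w) = curve (m - j).+1 w.
Proof. by move=> jm; apply: eq_recover => I; rewrite phi_minors_axes. Qed.

Lemma pt_phi_scale3 j F G (w : V) l : (j <= m)%N -> det_pair F G != 0 -> w != 0 -> l != 0 ->
  pt (phi_vec j (F, G, l *: w)) = pt (phi_vec j (F, G, w)).
Proof.
move=> jm d0 w0 l0; apply: pt_phi => //; first by split=> //=; rewrite scaler_eq0 negb_or l0.
apply: (@phi_minors_colscale _ _ _ _ _ _ _ l 1) => b; [move=> e i ij | move=> e | move=> e i ij]; rewrite /coef1 /coef2 /=.
- by rewrite ij mxE (ltnW ij) andbT; case: (st b <= i)%N; rewrite ?mul1r ?mulrA.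
- by rewrite ltnn; case: (st b <= j)%N; rewrite !mul1r.
by rewrite ij mxE andbT; case: (st b <= i)%N; rewrite ?mul1r ?mulrA.
Qed.

(** The columns before j depend only on z_0 F and z_1 G, so the factors can be moved to z; column j,
    which involves F alone, is rescaled by [l]. *)
Lemma pt_phi_torus j F G (w : V) l : (j <= m)%N -> det_pair F G != 0 -> w != 0 -> l != 0 ->
  pt (phi_vec j (l *: F, l^-1 *: G, w)) = pt (phi_vec j (F, G, row2 (l * w 0 0) (l^-1 * w 0 1))).
Proof.
move=> jm d0 w0 l0; apply: pt_phi => //.
  split=> //=; rewrite /det_pair !mxE.
  have -> : l * F 0 0 * (l^-1 * G 0 1) - l * F 0 1 * (l^-1 * G 0 0) = (l / l) * det_pair F G by rewrite /det_pair; ring.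
  by rewrite divff // mul1r.
apply: (@phi_minors_colscale _ _ _ _ _ _ _ 1 l) => b; [move=> e i ij | move=> e | move=> e i ij]; rewrite /coef1 /coef2 /=.
- by rewrite ij !mxE /= if_same mul1r; case: ifP => _ //; rewrite mulrCA mulrA.
- by rewrite ltnn !mxE leqnn andbT; case: ifP => _; rewrite !mul1r.
by rewrite !mxE /= if_same mul1r; case: ifP => _ //; rewrite mulrCA mulrA.
Qed.

Lemma pt_phi_degenerate j F G : (0 < j <= m)%N -> (forall b, st b != j) -> det_pair F G != 0 ->
  pt (phi_vec j (F, G, e2)) = pt (phi_vec j.-1 (e2, row2 (-1) 0, row2 (G 0 1) (- G 0 0))).
Proof.
move=> jm nj d0; apply: pt_phi; first by case/andP: jm.
  by split=> //; exact: e2_neq0.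
exact: phi_minors_degenerate.
Qed.

Section Bundle.
Variables (E : cocycle M) (A : n.-tuple int).
Hypothesis hE : is_line_bundle SH E.
Hypothesis hO : is_O E A.
Notation J := (lb_index E).
Notation sect := (sect (E := E) x0).

Definition degree k : int := \sum_(l < n | (l < n - k)%N) tnth A l.

Lemma curve_homogeneous k S : (k < n)%N -> sect (@plane_ev K) (fun w => w != 0) (curve k) S ->
  forall i (w : V) l, w != 0 -> l != 0 -> lb_open i (pt (curve k w)) -> S i (l *: w) = l ^ (- degree k) * S i w.
Proof.
move=> kn hS i w l; have [phi [phi_iso E_iso]] := hO (Ordinal kn).
have lamE := curve_lamE z_inj aE st0 x0 kn.
have D0 := curve_deg_gt0 st0 kn.
pose forms j := [the {linear M -> K^o} of ell st (curve_lam_idx m st k j)].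
have cE := sh_curveE z_inj aE st0 x0 kn.
have gE : curve k = rnc (curve_deg m st k) (curve_w z_inj aE st0 k) by apply: funext => u; exact: curve_vecE.
have g_hmap : hmap (curve_deg m st k) (curve k) by rewrite gE; exact: rnc_hmap.
have g0 := curve_vec_neq0 z_inj aE st0 x0 kn.
have gX := curve_sh z_inj aE st0 x0 kn.
have gC (u : V) : u != 0 -> sh_curve (a := a) (z := z) k (pt (curve k u)).
  by move=> u0; rewrite cE gE; exact: (rnc_mem (lam := forms) x0 lamE u0).
have g_sur x : sh_curve (a := a) (z := z) k x -> exists2 u : V, u != 0 & x = pt (curve k u).
  by rewrite cE gE; exact: (rnc_sur (lam := forms) x0 D0 lamE).
have g_inj (u u' : V) : u != 0 -> u' != 0 -> pt (curve k u) = pt (curve k u') -> exists c, u = c *: u'.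
  by rewrite gE; exact: (rnc_inj (lam := forms) D0 lamE).
exact: (section_homogeneous (pchar_num _) hE phi_iso E_iso g_hmap g0 gX gC g_sur g_inj hS).
Qed.

Lemma ex_phi_sect j : (j <= m)%N -> exists S, sect (@triple_ev K) (@regular_triple K) (phi_vec j) S.
Proof.
move=> jm; apply: (ex_sect hE (@triple_const K) (geometric_triple K) (phi_pmap j) (phi_into jm)).
exact: regular_triple_open.
Qed.

Lemma ex_curve_sect k : (k < n)%N -> exists S, sect (@plane_ev K) (fun w => w != 0) (curve k) S.
Proof.
move=> kn; apply: (ex_sect hE (@plane_const K) (geometric_plane K)).
- have -> : curve k = rnc (curve_deg m st k) (curve_w z_inj aE st0 k) by apply: funext => u; exact: curve_vecE.
  by apply: hmap_pmap; exact: rnc_hmap.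
- move=> w w0; split; [exact: (curve_vec_neq0 z_inj aE st0 x0 kn) | exact: (curve_sh z_inj aE st0 x0 kn)].
exact: plane_neq0_open.
Qed.

Lemma axes_subst : polmap (@triple_ev K) (@plane_ev K) (fun w => (e1, e2, w)).
Proof.
apply: triple_subst; first exact: plane_const.
- by apply: pol_vec_const; exact: plane_const.
- by apply: pol_vec_const; exact: plane_const.
exact: plane_coord.
Qed.

Lemma regular_axes (w : V) : w != 0 -> regular_triple (e1, e2, w).
Proof. by split=> //=; rewrite det_pair_e oner_neq0. Qed.

Lemma phi_homogeneous j S : (0 < j <= m)%N -> sect (@triple_ev K) (@regular_triple K) (phi_vec j) S ->
  forall i (w : V) l, w != 0 -> l != 0 -> lb_open i (pt (phi_vec j (e1, e2, w))) ->
  S i (e1, e2, l *: w) = l ^ (- degree (m - j).+1) * S i (e1, e2, w).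
Proof.
move=> /andP[j0 jm] hS i w l w0 l0 Ui.
have hS' : sect (@plane_ev K) (fun w => w != 0) (curve (m - j).+1) (fun i w => S i (e1, e2, w)).
  have := sect_comp axes_subst regular_axes hS; apply: sect_congr => u u0 /=.
  by rewrite phi_axes.
have kn : ((m - j).+1 < n)%N by rewrite ltnS; lia.
have Ui' : lb_open i (pt (curve (m - j).+1 w)) by rewrite -phi_axes.
exact: (curve_homogeneous kn hS' w0 l0 Ui').
Qed.

Lemma plane_line_pol (u w : V) : pol_vec (@line_ev K) (fun t => u + t *: w).
Proof.
apply: pol_vecD; first by apply: pol_vec_const; exact: line_const.
by apply: pol_vecZ; [exact: line_id | apply: pol_vec_const; exact: line_const].
Qed.

Let two : (2%:R : K) != 0.
Proof. by rewrite pnatr_eq0. Qed.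

(* For j = 0 the family is constant along (e1, e2, _), and there is no curve to compare with. *)
Lemma phi_half j S : (j <= m)%N -> sect (@triple_ev K) (@regular_triple K) (phi_vec j) S ->
  forall i, lb_open i (pt (phi_vec j (e1, e2, e1))) ->
  S i (e1, e2, 2%:R^-1 *: e1) = 2%:R ^ degree (m - j).+1 * S i (e1, e2, e1).
Proof.
move=> jm hS i Ui; case: (posnP j) => [j0|j0]; last first.
  rewrite (phi_homogeneous _ hS) ?e1_neq0 ?invr_eq0 ?j0 //.
  by rewrite exprz_inv opprK.
subst j; have -> : degree (m - 0).+1 = 0.
  by rewrite /degree subn0 subnn big_pred0 // => l; rewrite ltn0.
rewrite expr0z mul1r.
have const w : phi_vec 0 (e1, e2, w) = phi_vec 0 (e1, e2, e1).
  rewrite (phi_axes w (leq0n m)) (phi_axes e1 (leq0n m)); apply: eq_recover => I.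
  apply: eq_minors => b r k; have sl : slot m st (m - 0).+1 b k = false.
    by rewrite /slot; apply/negP => /andP[_]; lia.
  by rewrite /curve_row sl.
have step u w : (forall t, u + t *: w != 0) -> S i (e1, e2, u + w) = S i (e1, e2, u).
  move=> uw0.
  pose phi t := (e1, e2, u + t *: w).
  have pphi : polmap (@triple_ev K) (@line_ev K) phi.
    apply: triple_subst; first exact: line_const.
    - by apply: pol_vec_const; exact: line_const.
    - by apply: pol_vec_const; exact: line_const.
    exact: plane_line_pol.
  have regphi t : True -> regular_triple (phi t) by move=> _; exact: regular_axes.
  have s1 := sect_comp pphi regphi hS.
  have pphi0 : polmap (@triple_ev K) (@line_ev K) (fun=> phi 0).
    by apply: triple_subst => [|||]; first exact: line_const; apply: pol_vec_const; exact: line_const.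
  have s2 : sect (@line_ev K) (fun=> True) (phi_vec 0 \o phi) (fun i => S i \o (fun=> phi 0)).
    have := sect_comp (D' := fun=> True) pphi0 (fun _ _ => regphi 0 Logic.I) hS; apply: sect_congr => t _ /=.
    by rewrite /phi const [in RHS]const.
  have pX : pmap (@line_ev K) (phi_vec 0 \o phi) by exact: pmap_comp pphi (phi_pmap 0).
  have iX : into x0 SH (fun=> True) (phi_vec 0 \o phi) by move=> t _; apply: phi_into => //; exact: regphi.
  have U1 : lb_open i (pt (phi_vec 0 (phi 1))) by apply: (eq_ind_r (fun v => lb_open i (pt v)) Ui (const _)).
  have H : S i (phi 1) = 1 * S i (phi 0).
    exact: (sect_line_from hE (c := 1) pX iX s1 s2 (fun k _ => esym (mul1r _)) U1).
  by move: H; rewrite mul1r /phi scale1r scale0r addr0.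
have S2 c : c != 0 -> S i (e1, e2, c *: e1) = S i (e1, e2, e2).
  move=> c0; rewrite -(step (c *: e1) (e2 - c *: e1)); first by rewrite addrCA subrr addr0.
  move=> t; apply/negP => /eqP E0.
  have := congr1 (fun v : V => v 0 1) E0; rewrite !mxE /= mulr0 oppr0 addr0 add0r mulr1 => t0.
  by move: E0; rewrite t0 scale0r addr0 => /eqP; rewrite scaler_eq0 (negPf c0) (negPf e1_neq0).
have i0 : (2%:R : K)^-1 != 0 by rewrite invr_eq0.
by have := S2 1 (oner_neq0 K); rewrite scale1r => ->; exact: S2 i0.
Qed.

Section Step.
Variable j : nat.
Hypothesis j0 : (0 < j <= m)%N.
Hypothesis nj : forall b, st b != j.
Variables S S' : J -> V * V * V -> K.
Hypothesis hS : sect (@triple_ev K) (@regular_triple K) (phi_vec j) S.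
Hypothesis hS' : sect (@triple_ev K) (@regular_triple K) (phi_vec j.-1) S'.

Let jm : (j <= m)%N. Proof. by case/andP: j0. Qed.

Lemma frames_e : frames (e1, e2).
Proof. by rewrite /frames /= det_pair_e oner_neq0. Qed.

Lemma pair_pol1 : pol_vec (@pair_ev K) fst.
Proof. exact: pair_coord1. Qed.
Lemma pair_pol2 : pol_vec (@pair_ev K) snd.
Proof. exact: pair_coord2. Qed.

Lemma third_subst (w : V) : polmap (@triple_ev K) (@pair_ev K) (fun t => (t.1, t.2, w)).
Proof.
apply: triple_subst; [exact: pair_const | exact: pair_pol1 | exact: pair_pol2 |].
by apply: pol_vec_const; exact: pair_const.
Qed.

Lemma regular_third (w : V) : w != 0 -> forall t, frames t -> regular_triple (t.1, t.2, w).
Proof. by move=> w0 t ft; split. Qed.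

Lemma phi_third_pmap l (w : V) : pmap (@pair_ev K) (phi_vec l \o (fun t => (t.1, t.2, w))).
Proof. exact: pmap_comp (third_subst w) (phi_pmap l). Qed.

Lemma phi_third_into l (w : V) : (l <= m)%N -> w != 0 -> into x0 SH (@frames K) (phi_vec l \o (fun t => (t.1, t.2, w))).
Proof. by move=> lm w0 t ft; apply: phi_into => //; exact: regular_third. Qed.

Lemma pt_curve_scale k (w : V) c : (k < n)%N -> c != 0 -> pt (curve k (c *: w)) = pt (curve k w).
Proof.
move=> kn c0; rewrite !curve_vecE (hmap_scale _ _ (rnc_hmap _ _)) pt_scale //.
by rewrite expf_neq0.
Qed.

(** At z = (1, 0) the family depends on F alone and traces C_(m-j). A section [T] along that curve
    serves for comparison; the ratio is unchanged by the scaling of frames, and [T] picks up the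
    degree from F -> 2 F. *)
Lemma step_first i : lb_open i (pt (phi_vec j (e1, e2, e1))) ->
  S i (2%:R *: e1, 2%:R^-1 *: e2, e1) = 2%:R ^ (- degree (m - j)) * S i (e1, e2, e1).
Proof.
move=> Ui; have kn : (m - j < n)%N by rewrite ltnS leq_subr.
have [T hT] := ex_curve_sect kn.
have s1 := sect_comp (third_subst e1) (regular_third e1_neq0) hS.
have p1 : polmap (@plane_ev K) (@pair_ev K) fst.
  by apply: plane_subst; [exact: pair_const | exact: pair_pol1 | exact: pair_pol1].
have s2 : sect (@pair_ev K) (@frames K) (phi_vec j \o (fun t => (t.1, t.2, e1))) (fun i => T i \o fst).
  have := sect_comp (D' := @frames K) p1 _ hT; move=> H.
  apply: sect_congr (H _) => [t _|t ft] /=; first by rewrite phi_curve.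
  by apply: contraNneq ft => t0; rewrite /det_pair t0 !mxE !mul0r subrr.
have [c c0 cE] := sect_at hE (phi_third_into jm e1_neq0) s1 s2 frames_e.
have two' := two; have H : proportional x0 (phi_vec j \o (fun t => (t.1, t.2, e1))) (fun i => S i \o (fun t => (t.1, t.2, e1))) (fun i => T i \o fst) c (e1, e2) by [].
have ptc : pt (curve (m - j) e1) = pt (phi_vec j (e1, e2, e1)) := congr1 pt (esym (phi_curve e1 e2 jm)).
have pt2 : pt (phi_vec j (2%:R *: e1, 2%:R^-1 *: e2, e1)) = pt (phi_vec j (e1, e2, e1)).
  apply: etrans (etrans (pt_curve_scale e1 kn two) ptc).
  exact: (congr1 pt (phi_curve (2%:R *: e1) (2%:R^-1 *: e2) jm)).
have Ui' : lb_open i (pt (curve (m - j) e1)) by rewrite ptc.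
have T2 := curve_homogeneous kn hT e1_neq0 two Ui'.
have := proportional_scale hE (phi_third_pmap j e1) (phi_third_into jm e1_neq0) s1 s2 two frames_e H (i := i).
rewrite /= pt2 => /(_ Ui) ->; rewrite T2 mulrCA; congr (_ * _).
exact/esym/(cE i Ui).
Qed.

Lemma det_e2 : det_pair e2 (row2 (-1) 0) != 0.
Proof. by rewrite /det_pair !row2_0 !row2_1 mul0r sub0r mul1r opprK oner_neq0. Qed.

Lemma det_scaled : det_pair (2%:R *: e1) (2%:R^-1 *: e2) != 0.
Proof. by rewrite /det_pair !mxE /= !mulr0 subr0 !mulr1 divff // oner_neq0. Qed.

(** Halving z multiplies S' at the standard frame by the power of 2 given by [phi_half]; invariance
    of the ratio carries this factor to the rotated frame that occurs in the degeneration. *)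
Lemma step_chi i : lb_open i (pt (phi_vec j.-1 (e2, row2 (-1) 0, e1))) ->
  S' i (e2, row2 (-1) 0, 2%:R^-1 *: e1) = 2%:R ^ degree (m - j).+2 * S' i (e2, row2 (-1) 0, e1).
Proof.
have jm' : (j.-1 <= m)%N by rewrite (leq_trans (leq_pred _)).
have dE : (m - j.-1).+1 = (m - j).+2 by move: j0; lia.
have i0 : (2%:R : K)^-1 != 0 by rewrite invr_eq0.
have h0 : 2%:R^-1 *: e1 != 0 by rewrite scaler_eq0 negb_or i0 e1_neq0.
have s1 := sect_comp (third_subst e1) (regular_third e1_neq0) hS'.
have s2 : sect (@pair_ev K) (@frames K) (phi_vec j.-1 \o (fun t => (t.1, t.2, e1))) (fun i => S' i \o (fun t => (t.1, t.2, 2%:R^-1 *: e1))).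
  have := sect_comp (third_subst _) (regular_third h0) hS'; apply: sect_congr => t ft.
  exact: (pt_phi_scale3 jm' ft e1_neq0 i0).
have H : proportional x0 (phi_vec j.-1 \o (fun t => (t.1, t.2, e1))) (fun i => S' i \o (fun t => (t.1, t.2, 2%:R^-1 *: e1)))
    (fun i => S' i \o (fun t => (t.1, t.2, e1))) (2%:R ^ degree (m - j).+2) (e1, e2).
  by move=> k Uk; rewrite /= (phi_half jm' hS') // dE.
have [_] := proportional_rot hE (phi_third_pmap _ e1) (phi_third_into jm' e1_neq0) s2 s1 (oner_neq0 K) frames_e H.
have -> : 1 *: e2 = e2 by rewrite scale1r.
have -> : - 1^-1 *: e1 = row2 (-1) 0 by rewrite invr1; apply/rowP => k; rewrite !mxE; case: ifP => _; rewrite ?mulr1 ?mulr0.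
by move=> H'; exact: H'.
Qed.

(** At z = (0, 1) the family becomes that for j - 1 with parameter (G_1, - G_0), so the scaling G ->
    G / 2 is read as halving the parameter of S', whose effect is [step_chi]. *)
Lemma step_last i : lb_open i (pt (phi_vec j (e1, e2, e2))) ->
  S i (2%:R *: e1, 2%:R^-1 *: e2, e2) = 2%:R ^ degree (m - j).+2 * S i (e1, e2, e2).
Proof.
move=> Ui; have jm' : (j.-1 <= m)%N by rewrite (leq_trans (leq_pred _)).
have s1 := sect_comp (third_subst e2) (regular_third e2_neq0) hS.
pose psi (t : V * V) := (e2, row2 (-1) 0 : V, row2 (t.2 0 1) (- t.2 0 0)).
have ppsi : polmap (@triple_ev K) (@pair_ev K) psi.
  apply: triple_subst; [exact: pair_const | apply: pol_vec_const; exact: pair_const | apply: pol_vec_const; exact: pair_const |].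
  by apply: pol_vec_row2; [exact: pair_pol2 | apply: polN; exact: pair_pol2].
have rpsi t : frames t -> regular_triple (psi t).
  move=> ft; split=> /=; first exact: det_e2.
  apply: contraNneq ft => /rowP t0; have := t0 0; have := t0 1; rewrite !mxE /= => /eqP; rewrite oppr_eq0 => /eqP t1 t2.
  by rewrite /det_pair t1 t2 !mulr0 subrr.
have s2 : sect (@pair_ev K) (@frames K) (phi_vec j \o (fun t => (t.1, t.2, e2))) (fun i => S' i \o psi).
  have := sect_comp ppsi rpsi hS'; apply: sect_congr => t ft.
  exact/esym/(pt_phi_degenerate j0 nj ft).
have [c c0 cE] := sect_at hE (phi_third_into jm e2_neq0) s1 s2 frames_e.
have H : proportional x0 (phi_vec j \o (fun t => (t.1, t.2, e2))) (fun i => S i \o (fun t => (t.1, t.2, e2))) (fun i => S' i \o psi) c (e1, e2) by [].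
have psi3 : row2 (e2 0 1) (- e2 0 0) = e1 by rewrite row2_0 row2_1 oppr0.
have psi4 : row2 ((2%:R^-1 *: e2) 0 1) (- (2%:R^-1 *: e2) 0 0) = 2%:R^-1 *: e1.
  by apply/rowP => k; rewrite !mxE /=; case: ifP => _; rewrite ?mulr0 ?mulr1 ?oppr0.
have psi1 : psi (e1, e2) = (e2, row2 (-1) 0, e1) := congr1 (fun v => (e2, row2 (-1) 0 : V, v)) psi3.
have psi2 : psi (2%:R *: e1, 2%:R^-1 *: e2) = (e2, row2 (-1) 0, 2%:R^-1 *: e1) := congr1 (fun v => (e2, row2 (-1) 0 : V, v)) psi4.
have d0 : det_pair e1 e2 != 0 by rewrite det_pair_e oner_neq0.
pose rot v := pt (phi_vec j.-1 (e2, row2 (-1) 0, v)).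
have pt1 : pt (phi_vec j (e1, e2, e2)) = rot e1 := etrans (pt_phi_degenerate j0 nj d0) (congr1 rot psi3).
have pt2 : pt (phi_vec j (2%:R *: e1, 2%:R^-1 *: e2, e2)) = rot (2%:R^-1 *: e1) := etrans (pt_phi_degenerate j0 nj det_scaled) (congr1 rot psi4).
have i0 : (2%:R : K)^-1 != 0 by rewrite invr_eq0 two.
have pt3 : rot (2%:R^-1 *: e1) = rot e1 := pt_phi_scale3 jm' det_e2 e1_neq0 i0.
have Ui1 : lb_open i (rot e1) by rewrite -pt1.
have Ui2 : lb_open i (pt (phi_vec j (2%:R *: e1, 2%:R^-1 *: e2, e2))) by rewrite pt2 pt3.
have S2 : S i (2%:R *: e1, 2%:R^-1 *: e2, e2) = c * S' i (psi (2%:R *: e1, 2%:R^-1 *: e2)).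
  exact: (proportional_scale hE (phi_third_pmap j e2) (phi_third_into jm e2_neq0) s1 s2 two frames_e H Ui2).
rewrite S2 psi2 (step_chi Ui1).
rewrite mulrCA; congr (_ * _); rewrite -psi1; exact/esym/(cE i Ui).
Qed.

(** By the torus identity, the line from e1 to e2 for the scaled frame and the line from 2 e1 to e2
    / 2 for the standard frame give the same points. The ratio rho of S along them is constant, and
    its two endpoints are evaluated. *)
Lemma step_degree : degree (m - j) + degree (m - j).+2 = degree (m - j).+1 + degree (m - j).+1.
Proof.
have [_ Ec _ _ _] := hE; have [_ S0 _] := hS.
pose w t := e1 + t *: (e2 - e1); pose w' t := 2%:R *: e1 + t *: (2%:R^-1 *: e2 - 2%:R *: e1).
have w'E t : w' t = row2 (2%:R * w t 0 0) (2%:R^-1 * w t 0 1).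
  by apply/rowP => k; rewrite !mxE /=; case: ifP => _; ring.
have w0 t : w t != 0.
  have w00 : w t 0 0 = 1 - t by rewrite !mxE /=; ring.
  have w01 : w t 0 1 = t by rewrite !mxE /=; ring.
  rewrite row2_eq0 w00 w01; apply/negP => /andP[h1 /eqP t0].
  by move: h1; rewrite t0 subr0 oner_eq0.
have w'0 t : w' t != 0.
  rewrite w'E row2_eq0 row2_0 row2_1 !mulf_eq0 invr_eq0 (negPf two) /=.
  by have := w0 t; rewrite row2_eq0.
have pl u v (f : K -> V) : pol_vec (@line_ev K) f -> polmap (@triple_ev K) (@line_ev K) (fun t => (u, v, f t)).
  move=> pf; apply: triple_subst => //; first exact: line_const.
    by apply: pol_vec_const; exact: line_const.
  by apply: pol_vec_const; exact: line_const.
have q1 := pl (2%:R *: e1) (2%:R^-1 *: e2) w (plane_line_pol _ _).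
have q2 := pl e1 e2 w' (plane_line_pol _ _).
have r1 t : True -> regular_triple (2%:R *: e1, 2%:R^-1 *: e2, w t) := fun _ => conj det_scaled (w0 t).
have r2 t : True -> regular_triple (e1, e2, w' t) := fun _ => regular_axes (w'0 t).
have s1 := sect_comp q1 r1 hS.
have d0 : det_pair e1 e2 != 0 by rewrite det_pair_e oner_neq0.
pose ax v := pt (phi_vec j (e1, e2, v)).
have ptE t : pt (phi_vec j (2%:R *: e1, 2%:R^-1 *: e2, w t)) = ax (w' t) := etrans (pt_phi_torus jm d0 (w0 t) two) (congr1 ax (esym (w'E t))).
have s2 : sect (@line_ev K) (fun=> True) (phi_vec j \o (fun t => (2%:R *: e1, 2%:R^-1 *: e2, w t))) (fun i => S i \o (fun t => (e1, e2, w' t))).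
  have := sect_comp q2 r2 hS; apply: sect_congr => t _; exact/esym/ptE.
have pX := pmap_comp q1 (phi_pmap j).
have iX : into x0 SH (fun=> True) (phi_vec j \o (fun t => (2%:R *: e1, 2%:R^-1 *: e2, w t))).
  by move=> t _; apply: (phi_into jm); exact: r1.
have [rho rho0 rhoE] := sect_line hE pX iX s1 s2.
have w_0 : w 0 = e1 by rewrite /w scale0r addr0.
have w'_0 : w' 0 = 2%:R *: e1 by rewrite /w' scale0r addr0.
have w_1 : w 1 = e2 by rewrite /w scale1r addrCA subrr addr0.
have w'_1 : w' 1 = 2%:R^-1 *: e2 by rewrite /w' scale1r addrCA subrr addr0.
have i0 : (2%:R : K)^-1 != 0 by rewrite invr_eq0 two.
(* The start compares C_k with C_(k+1), the end compares C_(k+2) with C_(k+1), for k = m - j;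
   eliminating rho gives the arithmetic progression. *)
have E0 : (2%:R : K) ^ (- degree (m - j)) = rho * 2%:R ^ (- degree (m - j).+1).
  have [_ Xt] := phi_into jm (regular_axes e1_neq0); have [i Ui] := Ec _ Xt.
  have Ui' : lb_open i (pt (phi_vec j (2%:R *: e1, 2%:R^-1 *: e2, w 0))).
    by rewrite ptE w'_0 /ax (pt_phi_scale3 jm d0 e1_neq0 two).
  have H : S i (2%:R *: e1, 2%:R^-1 *: e2, w 0) = rho * S i (e1, e2, w' 0) := rhoE i 0 Ui'.
  move: H; rewrite w_0 w'_0 (step_first Ui) (phi_homogeneous j0 hS e1_neq0 two Ui) mulrA; apply: mulIf.
  exact: (S0 i _ (regular_axes e1_neq0) Ui).
have E1 : (2%:R : K) ^ degree (m - j).+2 = rho * 2%:R ^ degree (m - j).+1.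
  have [_ Xt] := phi_into jm (regular_axes e2_neq0); have [i Ui] := Ec _ Xt.
  have Ui' : lb_open i (pt (phi_vec j (2%:R *: e1, 2%:R^-1 *: e2, w 1))).
    by rewrite ptE w'_1 /ax (pt_phi_scale3 jm d0 e2_neq0 i0).
  have H : S i (2%:R *: e1, 2%:R^-1 *: e2, w 1) = rho * S i (e1, e2, w' 1) := rhoE i 1 Ui'.
  move: H; rewrite w_1 w'_1 (step_last Ui) (phi_homogeneous j0 hS e2_neq0 i0 Ui) mulrA exprz_inv opprK; apply: mulIf.
  exact: (S0 i _ (regular_axes e2_neq0) Ui).
have tz d : (2%:R : K) ^ d != 0 by rewrite expfz_neq0.
apply: (@exprz2_inj K); rewrite !expfzDr // E1.
have -> : rho = 2%:R ^ degree (m - j).+1 / 2%:R ^ degree (m - j).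
  apply: (mulIf (tz (- degree (m - j).+1))); rewrite -E0 mulrAC -expfzDr // subrr expr0z mul1r.
  by rewrite invr_expz.
by field; exact: tz.
Qed.
End Step.

(** Consecutive degrees differ by one entry of A: with indices from 0, the degree on C_k minus that
    on C_(k+1) is the entry n - k - 1. *)
Lemma line_bundle_eq j : (0 < j <= m)%N -> (forall b, st b != j) -> nth 0 A j.-1 = nth 0 A j.
Proof.
move=> /[dup] j0 /andP[jp jm] nj.
have [S hS] := ex_phi_sect jm; have [S' hS'] := ex_phi_sect (leq_trans (leq_pred j) jm).
have := step_degree j0 nj hS hS'.
have dE k : (k < n)%N -> degree k = degree k.+1 + nth 0 A (n - k.+1).
  move=> kn; rewrite /degree; have kn' : (n - k.+1 < n)%N by rewrite ltn_subrL.
  rewrite (bigD1 (Ordinal kn')) /=; last by rewrite ltn_sub2l.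
  rewrite addrC (tnth_nth 0) /=; congr (_ + _); apply: eq_bigl => l.
  rewrite -val_eqE /=; have := ltn_ord l; move: (nat_of_ord l) => l' ?; apply/andP/idP; lia.
rewrite (dE (m - j)%N) ?ltnS ?leq_subr // (dE (m - j).+1); last by rewrite ltnS; lia.
have -> : (n - (m - j).+1 = j)%N by lia.
have -> : (n - (m - j).+2 = j.-1)%N by lia.
move: (degree _) (nth 0 A j) (nth 0 A j.-1) => d x y; lia.
Qed.

End Bundle.
End Fusion.

(** * Types *)

Definition block_start (t : seq nat) (b : 'I_(size t)) : nat := sumn (take b t).

Lemma block_start0 k t : block_start (ord0 : 'I_(size (k :: t))) = 0%N.
Proof. by rewrite /block_start take0. Qed.

Lemma block_startS k t (b : 'I_(size t)) : block_start (lift ord0 b : 'I_(size (k :: t))) = (k + block_start b)%N.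
Proof. by []. Qed.

Lemma size_blocks T (t : seq nat) (b : seq T) : size b = size t -> size (blocks t b) = sumn t.
Proof.
elim: t b => [|k t IH] [|x b] //= [sb]; rewrite /blocks /= size_cat size_nseq.
by rewrite -(IH b sb).
Qed.

Lemma nth_blocks_cons T x0 k t x (b : seq T) l :
  nth x0 (blocks (k :: t) (x :: b)) l = if (l < k)%N then x else nth x0 (blocks t b) (l - k).
Proof. by rewrite /blocks /= nth_cat size_nseq nth_nseq; case: (l < k)%N. Qed.

Lemma nth_blocks_iota t c l : (l < sumn t)%N ->
  nth 0%N (blocks t (iota c.+1 (size t))) l = (c + \sum_(b < size t) (block_start b <= l))%N.
Proof.
elim: t c l => [|k t IH] c l // lt.
rewrite [iota _ _]/= nth_blocks_cons big_ord_recl block_start0 /=.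
case: ltnP => lk.
  rewrite big1 ?addn0 ?addn1 // => b _; rewrite block_startS leqNgt ltn_addr //.
rewrite IH; last by rewrite ltn_subLR.
rewrite -addn1 -addnA; congr (_ + (_ + _))%N; apply: eq_bigr => b _.
by rewrite block_startS leq_subRL.
Qed.

Lemma nth_blocks_eq (T : eqType) (x0 : T) t (b : seq T) l : all (fun k => 0 < k)%N t -> size b = size t ->
  sorted (fun x y => x != y) b -> (l.+1 < sumn t)%N ->
  nth x0 (blocks t b) l = nth x0 (blocks t b) l.+1 <-> forall c : 'I_(size t), block_start c != l.+1.
Proof.
elim: t b l => [|k t IH] [|x b] l //= /andP[k0 t0] [sb] srt lt.
have starts (Q : nat -> Prop) : (forall c : 'I_(size (k :: t)), Q (block_start c)) <-> Q 0%N /\ forall c : 'I_(size t), Q (k + block_start c)%N.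
  split=> [H|[H0 H] c]; last by case: (unliftP ord0 c) => [c' ->|->]; [exact: H | rewrite block_start0].
  by split=> [|c]; [have := H ord0; rewrite block_start0 | exact: (H (lift ord0 c))].
rewrite !nth_blocks_cons (starts (fun x => x != l.+1)).
case: (ltngtP l.+1 k) => lk.
- split=> // _; split=> // c; by rewrite gtn_eqF // ltn_addr.
- have srt' := path_sorted srt; rewrite subSn // IH //; last first.
    by rewrite -subSn // ltn_subLR // ltnW.
  split=> [H|[_ H] c].
    by split=> // c; move: (H c); rewrite -subSn // -(eqn_add2l k) subnKC // ltnW.
  by rewrite -subSn // -(eqn_add2l k) subnKC // ltnW.
rewrite -lk subnn; split=> [E|[_ H]]; exfalso.
  case: t b {IH starts} sb srt t0 lt E => [|k' t] [|y b] //=; first by rewrite addn0 lk ltnn.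
  by move=> _ /andP[xy _] /andP[k'0 _] _; rewrite nth_blocks_cons k'0 => /eqP; rewrite (negPf xy).
have s0 : (0 < size t)%N by case: t lt {IH starts H sb t0} => //=; rewrite addn0 lk ltnn.
by have := H (Ordinal s0); rewrite /block_start take0 addn0 lk eqxx.
Qed.

Section Types.
Variables (m : nat) (t : seq nat).
Hypothesis ht : is_type m.+1 t.

Let t_pos : all (fun k => 0 < k)%N t. Proof. by case/andP: ht. Qed.
Let t_sum : sumn t = m.+1. Proof. by case/andP: ht => _ /eqP. Qed.

Lemma type_dimsE (l : 'I_m.+1) : type_dims m.+1 t l = (\sum_(b < size t) (block_start b <= l)).+1.
Proof. by rewrite /type_dims nth_blocks_iota ?t_sum. Qed.

Lemma ex_block_start0 : exists b : 'I_(size t), block_start b = 0%N.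
Proof.
have s0 : (0 < size t)%N by case: t t_sum.
by exists (Ordinal s0); rewrite /block_start take0.
Qed.

Lemma block_start_inj : injective (@block_start t).
Proof.
move=> b c; have lt (x y : 'I_(size t)) : (x < y)%N -> (block_start x < block_start y)%N.
  move=> xy; rewrite /block_start -(cat_take_drop x (take y t)) take_takel ?(ltnW xy) // sumn_cat.
  rewrite -[X in (X < _)%N]addn0 ltn_add2l (drop_nth 0%N) ?size_takel ?(ltnW (ltn_ord y)) //.
  by rewrite nth_take //= ltn_addr // (allP t_pos) // mem_nth.
move=> E; apply: val_inj; case: (ltngtP b c) => // /lt; by rewrite E ltnn.
Qed.

Lemma has_type_eq (B : m.+1.-tuple int) l : has_type t B -> (l.+1 < m.+1)%N ->
  nth 0 B l = nth 0 B l.+1 <-> forall b : 'I_(size t), block_start b != l.+1.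
Proof. by move=> [b [sb srt ->]] lm; apply: nth_blocks_eq; rewrite ?t_sum. Qed.

Lemma ex_has_type : exists B : m.+1.-tuple int, has_type t B.
Proof.
pose b := [seq Posz k | k <- iota 0 (size t)].
have sb : size b = size t by rewrite size_map size_iota.
have /eqP sB : size (blocks t b) = m.+1 by rewrite size_blocks.
exists (Tuple sB); exists b; split=> //.
rewrite sorted_map; apply: (@sub_sorted _ ltn); last exact: iota_ltn_sorted.
by move=> x y /= xy; rewrite eqz_nat ltn_eqF.
Qed.

End Types.

(** The type of a tuple determines which consecutive entries agree, so one tuple of type [u] decides
    for all of them; a tuple of type [t] exists, so the universal statement can be instantiated. *)
Lemma type_geP m t u (A : m.+1.-tuple int) : is_type m.+1 t -> is_type m.+1 u -> has_type u A ->
  type_ge m.+1 t u <->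
  forall l, (l.+1 < m.+1)%N -> (forall b : 'I_(size t), block_start b != l.+1) -> nth 0 A l = nth 0 A l.+1.
Proof.
move=> ht hu hA; split=> [ge l lm nl|H B C hB hC l lm].
  have [B hB] := ex_has_type ht; exact: (ge B A hB hA l lm ((has_type_eq ht hB lm).2 nl)).
by move=> /(has_type_eq ht hB lm).1/(H l lm) /(has_type_eq hu hA lm).1/(has_type_eq hu hC lm).2.
Qed.

(* c b is the jump of A at the start of the block b. *)
Lemma sum_jumps m t (A : m.+1.-tuple int) : is_type m.+1 t ->
  (forall l, (l.+1 < m.+1)%N -> (forall b : 'I_(size t), block_start b != l.+1) -> nth 0 A l = nth 0 A l.+1) ->
  exists c : 'I_(size t) -> int, forall l : 'I_m.+1, tnth A l = \sum_(b < size t) (if (block_start b <= l)%N then c b else 0).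
Proof.
move=> ht H; have [b0 b00] := ex_block_start0 ht; have inj := block_start_inj ht.
pose c (b : 'I_(size t)) := if block_start b is k.+1 then nth 0 A k.+1 - nth 0 A k else nth 0 A 0.
exists c => -[l lm]; rewrite (tnth_nth 0) /=; elim: l lm => [|l IH] lm.
  rewrite (bigD1 b0) //= b00 leqnn big1 => [|b bb0]; first by rewrite addr0 /c b00.
  by rewrite leqn0 -b00 (inj_eq inj) (negPf bb0).
pose d (b : 'I_(size t)) := if block_start b == l.+1 then c b else 0.
have -> : \sum_(b < size t) (if (block_start b <= l.+1)%N then c b else 0) = nth 0 A l + \sum_(b < size t) d b.
  rewrite (IH (ltnW lm)) -big_split; apply: eq_bigr => b _ /=; rewrite /d.
  by case: (ltngtP (block_start b) l.+1) => [h|h|->]; rewrite ?ltnn ?add0r //; [rewrite -ltnS h addr0 | rewrite leqNgt ltnW].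
have [[b bl]|nb] := pselect (exists b : 'I_(size t), block_start b = l.+1).
  rewrite (bigD1 b) //= /d bl eqxx big1 => [|b' bb']; last by rewrite -bl (inj_eq inj) (negPf bb').
  by rewrite addr0 /c bl addrCA subrr addr0.
have nb' (b : 'I_(size t)) : block_start b != l.+1 by apply/eqP => bl; apply: nb; exists b.
by rewrite big1 ?addr0 => [|b _]; [rewrite (H l lm nb') | rewrite /d (negPf (nb' b))].
Qed.

Theorem proposition5p1 (R : realType) (n : nat) (hn : (0 < n)%N)
    (z : 'I_n -> R[i]) (hz : injective z)
    (i j : seq nat) (hi : is_type n i) (hj : is_type n j)
    (A : n.-tuple int) (hA : has_type j A) :
  (exists E : cocycle (fusion (type_dims n i) z),
      is_line_bundle (sh (type_dims n i) z) E /\ is_O E A)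
  <-> type_ge n i j.
Proof.
case: n hn z hz hi hj A hA => // m _ z z_inj hi hj A hA.
have aE := type_dimsE hi; have st0 := ex_block_start0 hi.
(* A default point for [pt]: the projective space is inhabited by any point of the orbit, here that
   of the column (1, 1). *)
have [x0 _] : exists x0 : proj (fusion (type_dims m.+1 i) z), True.
  have [|w [w0 _]] := frame_vector z_inj aE st0 (p := one_seq _) (q := one_seq _).
    by rewrite oner_neq0.
  have w1 : \dim <[w]>%VS == 1%N by rewrite dim_vline w0.
  by exists (exist _ <[w]>%VS w1).
rewrite (type_geP hi hj hA); split=> [[E [hE hO]] l lm nl|H].
  exact: (line_bundle_eq z_inj aE st0 x0 hE hO (j := l.+1)).
have [c cE] := sum_jumps hi H.
exists (block_cocycle (@block_start i) (type_dims m.+1 i) z c); split.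
  exact: (block_line_bundle z_inj aE st0).
exact: (block_is_O z_inj aE st0 x0).
Qed.
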